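(* Let $(u_t,v_t)$ be a solution of the symbiotic branching model on $\mathbb{Z}^d$ with parameters $\kappa>0$, $\varrho\in[-1,1]$, transition rates $(a(i,j))_{i,j\in\mathbb{Z}^d}$, and homogeneous initial conditions $u_0=v_0\equiv 1$. Then $(u_t,v_t)$ is intermittent (i.e. $\gamma_2>0$) if and only if $$\kappa\varrho>\frac{1}{\bar G_\infty}.$$ In particular, there is no intermittency for non-positive $\varrho$.
   Context: Symbiotic branching model: fix $d\ge 1$, $\kappa>0$, $\varrho\in[-1,1]$ and rates $(a(i,j))_{i,j\in\mathbb{Z}^d}$ with $0\le a(i,j)<\infty$, $\sum_{j}a(i,j)=1$ for all $i$, and $a(i,j)=a(0,j-i)$. Fix a positive summable function $\omega$ on $\mathbb{Z}^d$ with $\sum_i\omega(i)a(i,j)\le K\omega(j)$ for all $j$ and some finite $K$, and let $E=\{f:\mathbb{Z}^d\to\mathbb{R}_{\ge0}\mid\sum_j f(j)\omega(j)<\infty\}$ (the choice of $\omega$ is immaterial). A solution is a weak solution with almost surely continuous paths in $E\times E$ of $$du(t,i)=\sum_{j}a(i,j)(u(t,j)-u(t,i))\,dt+\sqrt{\kappa u(t,i)v(t,i)}\,dW^1_t(i),$$ $$dv(t,i)=\sum_{j}a(i,j)(v(t,j)-v(t,i))\,dt+\sqrt{\kappa u(t,i)v(t,i)}\,dW^2_t(i),$$ for $i\in\mathbb{Z}^d$, where $W^1(i),W^2(i)$, $i\in\mathbb{Z}^d$, are standard Brownian motions with $\langle W^n(i),W^m(j)\rangle_t=\varrho t$ if $i=j,\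 n\ne m$; $=t$ if $i=j,\ n=m$; $=0$ otherwise. Second Lyapunov exponent: $\gamma_2=\lim_{t\to\infty}\frac1t\log\mathbb{E}[u(t,k)^2]$ (it does not depend on $k$, and is the same with $v$ in place of $u$). The system is called intermittent if $\gamma_2>0$. Symmetrization: let $X^1,X^2$ be independent continuous-time Markov processes on $\mathbb{Z}^d$ with transition rates $(a(i,j))$; $\bar X_t=X^1_t-X^2_t$, with transition probabilities $\bar p_t(i,j)$ (transition rates $a(i,j)+a(j,i)$). $\bar G_\infty=\int_0^\infty\bar p_t(0,0)\,dt\in(0,\infty]$, with the convention $1/\infty=0$. *)

(* Defs.v *)
From HB Require Import structures.
From mathcomp Require Export all_boot all_order all_algebra.
From mathcomp Require Export all_classical all_reals all_analysis.

Set Implicit Arguments.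
Unset Strict Implicit.
Unset Printing Implicit Defensive.

Import Order.TTheory GRing.Theory Num.Theory.
Import numFieldNormedType.Exports.

Local Open Scope classical_set_scope.
Local Open Scope ring_scope.

Definition lattice (d : nat) := 'rV[int]_d.

(* Sum of a real family indexed by the lattice; it is the usual sum whenever
   the family is absolutely summable. *)
Definition lattice_sum (R : realType) (d : nat) (f : lattice d -> R) : R :=
  fine (\esum_(j in setT) (f^\+ j)%:E) - fine (\esum_(j in setT) (f^\- j)%:E).

Record transition_rates (R : realType) (d : nat)
    (a : lattice d -> lattice d -> R) : Prop := {
  rates_ge0 : forall i j, 0 <= a i j;
  rates_sum1 : forall i, (\esum_(j in setT) (a i j)%:E = 1)%E;
  rates_shift : forall i j, a i j = a 0 (j - i) }.

Record reference_weight (R : realType) (d : nat)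
    (a : lattice d -> lattice d -> R) (omega : lattice d -> R) : Prop := {
  weight_gt0 : forall i, 0 < omega i;
  weight_summable : (\esum_(i in setT) (omega i)%:E < +oo)%E;
  weight_rates : exists K : R, forall j,
    (\esum_(i in setT) (omega i * a i j)%:E <= (K * omega j)%:E)%E }.

Definition state_space (R : realType) (d : nat) (omega : lattice d -> R) :
    set (lattice d -> R) :=
  [set f | (forall i, 0 <= f i) /\
           (\esum_(i in setT) (f i * omega i)%:E < +oo)%E].

(* Continuous paths [0, oo) -> E, for the norm of the weighted l^1 space. *)
Definition continuous_path_in (R : realType) (d : nat) (omega : lattice d -> R)
    (x : R -> lattice d -> R) : Prop :=
  forall t : R, 0 <= t -> state_space omega (x t) /\
    (\esum_(j in setT) (`|x s j - x t j| * omega j)%:E)%E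
      @[s --> within [set s : R | 0 <= s] (nbhs t)] --> 0%E.

(* Generator matrix of the Markov process with transition rates a; the
   diagonal entries a i i play no role. *)
Definition q_matrix (R : realType) (d : nat) (a : lattice d -> lattice d -> R)
    (i j : lattice d) : R :=
  if i == j then - fine (\esum_(k in [set k | k != i]) (a i k)%:E) else a i j.

(* p t i j, t >= 0, are the transition probabilities of the continuous-time
   Markov process with transition rates a. *)
Record transition_probabilities (R : realType) (d : nat)
    (a : lattice d -> lattice d -> R)
    (p : R -> lattice d -> lattice d -> R) : Prop := {
  trans_ge0 : forall (t : R) i j, 0 <= t -> 0 <= p t i j;
  trans_sum1 : forall (t : R) i, 0 <= t -> (\esum_(j in setT) (p t i j)%:E = 1)%E;
  trans_0 : forall i j, p 0 i j = (i == j)%:R;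
  trans_chapman_kolmogorov : forall (s t : R) i j, 0 <= s -> 0 <= t ->
    ((p (s + t) i j)%:E = \esum_(k in setT) (p s i k * p t k j)%:E)%E;
  trans_rates : forall i j,
    (p t i j - (i == j)%:R) / t @[t --> 0^'+] --> q_matrix a i j }.

(* Probability that X^1_t - X^2_t = j for independent X^1, X^2 with transition
   probabilities p, started at i and at 0 respectively; by translation
   invariance only the initial difference i matters. *)
Definition symmetrized (R : realType) (d : nat)
    (p : R -> lattice d -> lattice d -> R) (t : R) (i j : lattice d) : \bar R :=
  (\esum_(k in setT) (p t i k * p t 0 (k - j)%R)%:E)%E.

Definition green (R : realType) (d : nat)
    (p : R -> lattice d -> lattice d -> R) : \bar R :=
  (\int[lebesgue_measure]_(t in `[0%R, +oo[) symmetrized p t 0%R 0%R)%E.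

Record filtration (R : realType) (disp : measure_display)
    (T : measurableType disp) (F : R -> set (set T)) : Prop := {
  filtration_sigma : forall t : R, 0 <= t -> sigma_algebra setT (F t);
  filtration_measurable : forall t : R, 0 <= t -> F t `<=` measurable;
  filtration_mono : forall s t : R, 0 <= s -> s <= t -> F s `<=` F t }.

Definition measurable_wrt (R : realType) (T : Type) (G : set (set T))
    (X : T -> R) : Prop :=
  forall B : set R, measurable B -> G (X @^-1` B).

Definition adapted (R : realType) (T : Type) (F : R -> set (set T))
    (X : R -> T -> R) : Prop :=
  forall t : R, 0 <= t -> measurable_wrt (F t) (X t).

Record martingale (R : realType) (disp : measure_display)
    (T : measurableType disp) (P : probability T R) (F : R -> set (set T))
    (X : R -> T -> R) : Prop := {
  martingale_adapted : adapted F X;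
  martingale_integrable : forall t : R, 0 <= t -> P.-integrable setT (EFin \o X t);
  martingale_eq : forall (s t : R) (A : set T), 0 <= s -> s <= t -> F s A ->
    (\int[P]_(w in A) (X t w)%:E = \int[P]_(w in A) (X s w)%:E)%E }.

(* <M, N>_t = r t, for square integrable martingales M and N. *)
Definition bracket_rate (R : realType) (disp : measure_display)
    (T : measurableType disp) (P : probability T R) (F : R -> set (set T))
    (M N : R -> T -> R) (r : R) : Prop :=
  martingale P F (fun t w => M t w * N t w - r * t).

Record brownian_motion (R : realType) (disp : measure_display)
    (T : measurableType disp) (P : probability T R) (F : R -> set (set T))
    (B : R -> T -> R) : Prop := {
  bm_adapted : adapted F B;
  bm_start : {ae P, forall w, B 0 w = 0};
  bm_continuous : {ae P, forall w,
    {within [set t : R | 0 <= t], continuous (fun t => B t w)}};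
  bm_increments : forall (s t : R) (A : set T) (U : set R),
    0 <= s -> s < t -> F s A -> measurable U ->
    (P (A `&` [set w | U (B t w - B s w)%R]) =
     P A * normal_prob 0%R (Num.sqrt (t - s)%R) U)%E }.

Record simple_process (R : realType) (T : Type) := SimpleProcess {
  simple_size : nat;
  simple_time : nat -> R;
  simple_coef : nat -> T -> R }.

Record admissible_simple (R : realType) (T : Type) (F : R -> set (set T))
    (h : simple_process R T) : Prop := {
  simple_time_ge0 : 0 <= simple_time h 0%N;
  simple_time_mono : forall k, (k < simple_size h)%N ->
    simple_time h k <= simple_time h k.+1;
  simple_coef_bounded : exists C : R, forall k w, (k < simple_size h)%N ->
    `|simple_coef h k w| <= C;
  simple_coef_measurable : forall k, (k < simple_size h)%N ->
    measurable_wrt (F (simple_time h k)) (simple_coef h k) }.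

Definition simple_value (R : realType) (T : Type) (h : simple_process R T)
    (s : R) (w : T) : R :=
  \sum_(k < simple_size h)
     simple_coef h k w * (simple_time h k < s <= simple_time h k.+1)%R%:R.

Definition simple_integral (R : realType) (T : Type) (h : simple_process R T)
    (B : R -> T -> R) (t : R) (w : T) : R :=
  \sum_(k < simple_size h) simple_coef h k w *
     (B (Num.min t (simple_time h k.+1)) w - B (Num.min t (simple_time h k)) w).

(* Convergence to 0 in probability of [0, oo]-valued functions. The exceptional
   events are only required to be covered by measurable sets of vanishing
   probability, since paths may be irregular on a null set. *)
Definition cvg0_in_probability (R : realType) (disp : measure_display)
    (T : measurableType disp) (P : probability T R) (X : nat -> T -> \bar R) :
    Prop :=
  forall eps : R, 0 < eps -> exists A : nat -> set T,
    [/\ forall n, measurable (A n),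
        forall n, [set w | (eps%:E <= X n w)%E] `<=` A n &
        P (A n) @[n --> \oo] --> 0%E].

(* M_t = int_0^t H_s dB_s for every t >= 0, for an adapted integrand H with
   int_0^t H_s^2 ds < oo: M is the limit in probability of the integrals of
   simple processes approximating H. *)
Definition ito_integral (R : realType) (disp : measure_display)
    (T : measurableType disp) (P : probability T R) (F : R -> set (set T))
    (H B M : R -> T -> R) : Prop :=
  exists h : nat -> simple_process R T,
    (forall n, admissible_simple F (h n)) /\
    forall t : R, 0 <= t ->
      cvg0_in_probability P (fun n w =>
        (\int[lebesgue_measure]_(s in `[0%R, t])
           ((simple_value (h n) s w - H s w) ^+ 2)%:E)%E) /\
      cvg0_in_probability P (fun n w =>
        `|simple_integral (h n) B t w - M t w|%:E).

Definition migration (R : realType) (d : nat)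
    (a : lattice d -> lattice d -> R) (f : lattice d -> R) (i : lattice d) : R :=
  lattice_sum (fun j => a i j * (f j - f i)).

(* du(t,i) = migration dt + sqrt(kappa u(t,i) v(t,i)) dB_t(i), for all i; the
   equation of v is obtained by exchanging u and v. *)
Definition sbm_equation (R : realType) (d : nat) (disp : measure_display)
    (T : measurableType disp) (P : probability T R) (F : R -> set (set T))
    (a : lattice d -> lattice d -> R) (kappa : R)
    (B : lattice d -> R -> T -> R) (u v : R -> lattice d -> T -> R) : Prop :=
  forall i, exists M : R -> T -> R,
    ito_integral P F (fun s w => Num.sqrt (kappa * u s i w * v s i w)) (B i) M /\
    {ae P, forall w, forall t : R, 0 <= t ->
      u t i w = u 0 i w
        + \int[lebesgue_measure]_(s in `[0, t]) migration a (fun j => u s j w) i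
        + M t w}.

(* W true i is W^1(i) and W false i is W^2(i). *)
Record driving_noise (R : realType) (d : nat) (disp : measure_display)
    (T : measurableType disp) (P : probability T R) (F : R -> set (set T))
    (rho : R) (W : bool -> lattice d -> R -> T -> R) : Prop := {
  noise_brownian : forall n i, brownian_motion P F (W n i);
  noise_brackets : forall n m i j, bracket_rate P F (W n i) (W m j)
    (if i == j then (if n == m then 1 else rho) else 0) }.

(* (u, v), living on (T, P), is a weak solution: there are a filtration and
   driving Brownian motions on (T, P) for which the equations hold. *)
Definition sbm_solution (R : realType) (d : nat) (disp : measure_display)
    (T : measurableType disp) (P : probability T R)
    (a : lattice d -> lattice d -> R) (omega : lattice d -> R) (kappa rho : R)
    (u v : R -> lattice d -> T -> R) : Prop :=
  exists (F : R -> set (set T)) (W : bool -> lattice d -> R -> T -> R),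
    [/\ filtration F,
        driving_noise P F rho W,
        (forall i, adapted F (fun t => u t i) /\ adapted F (fun t => v t i)),
        {ae P, forall w, continuous_path_in omega (fun t i => u t i w) /\
                         continuous_path_in omega (fun t i => v t i w)} &
        sbm_equation P F a kappa (W true) u v /\
        sbm_equation P F a kappa (W false) v u].

(* gamma = lim_t t^-1 log E[u(t,k)^2], for all k, and likewise for v. *)
Definition second_lyapunov_exponent (R : realType) (d : nat)
    (disp : measure_display) (T : measurableType disp) (P : probability T R)
    (u v : R -> lattice d -> T -> R) (gamma : R) : Prop :=
  forall k,
    ((t^-1)%:E * lne 'E_P[fun w => (u t k w ^+ 2)%R])%E @[t --> +oo%R]
      --> gamma%:E /\
    ((t^-1)%:E * lne 'E_P[fun w => (v t k w ^+ 2)%R])%E @[t --> +oo%R]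
      --> gamma%:E.

Definition intermittent (R : realType) (d : nat)
    (disp : measure_display) (T : measurableType disp) (P : probability T R)
    (u v : R -> lattice d -> T -> R) : Prop :=
  exists gamma, second_lyapunov_exponent P u v gamma /\ 0 < gamma.

(* Main.v *)
(* Write the equation in mild form: for the transition probabilities p_t(i,j),
     u_t(i) = 1 + sum_j int_0^t p_{t-s}(i,j) sqrt(kappa u_s(j) v_s(j)) dW^1_s(j),
   and likewise for v. Localizing, a Gronwall argument in the space weighted by
   omega^2 bounds the second moments, and the Ito isometry gives, with
   f_t(i) = kappa E[u_t(i) v_t(i)] and Phi_t(i) = sum_j int_0^t p_{t-s}(i,j)^2 f_s(j) ds,
     E[u_t(i)^2] = E[v_t(i)^2] = 1 + Phi_t(i),   f_t(i) = kappa (1 + rho Phi_t(i)).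
   Since sum_j p_t(i,j)^2 = q(t) is the return probability of the symmetrized walk, this
   is a renewal equation with kernel kappa rho q. Comparison with multiples of
   exp(lambda t), which are sub- or super-solutions according to whether
   kappa rho int_0^T exp(-lambda s) q(s) ds exceeds 1 for some T, shows that the second
   moment grows with exponential rate
     gamma = sup ({0} + {lambda > 0 : kappa rho int_0^T exp(-lambda s) q(s) ds > 1 for some T}),
   and gamma > 0 means that kappa rho int_0^oo q > 1. No stochastic calculus is needed
   beyond elementary integrals: the Ito integrals of the equation are identified, in
   probability, with limits of sums over dyadic grids. *)
Require Import Defs.
From mathcomp Require Import measurable_realfun ring lra zify.
Import Order.TTheory GRing.Theory Num.Theory.
Import numFieldNormedType.Exports.

Set Implicit Arguments.
Unset Strict Implicit.
Unset Printing Implicit Defensive.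

Local Open Scope classical_set_scope.
Local Open Scope ring_scope.

(** An Ito integral is known only as a limit in probability, at each fixed time, of integrals of
    unspecified simple processes, so neither an isometry nor a martingale property of it is at hand.
    The first obstacle is to replace those processes by dyadic freezings of the integrand itself;
    truncation at the accumulated quadratic variation does this without moments. Moments are then
    reached on events where the weighted mass has stayed below [N]. No stopping time is used: the
    integrand at time [s] is multiplied by the indicator of the event at time [s], which is adapted
    and left-continuous, and left dyadic sums require no more. The square of [omega] appears because
    [omega] controls each component in l^1 while the noise involves their product. The transition
    function is given through Chapman-Kolmogorov and its derivative at 0; the forward equation, its
    uniqueness and, from these, translation invariance and the weighted column bound are derived.
    Existence of the exponent is proved along with the criterion. *)

Notation Rintegrable mu D f := (mu.-integrable D (EFin \o f)).

(** * Real-valued integrals: linearity, domination, Fatou *)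

Section real_integral.
Context d (T : measurableType d) (R : realType) (mu : {measure set T -> \bar R}).
Variables (D : set T) (mD : measurable D).
Implicit Types f g : T -> R.

Lemma Rintegrable_measurable f : Rintegrable mu D f -> measurable_fun D f.
Proof. by move=> /measurable_int /measurable_EFinP. Qed.

Lemma EFin_Rintegral f : Rintegrable mu D f ->
  (\int[mu]_(x in D) f x)%:E = (\int[mu]_(x in D) (f x)%:E)%E.
Proof. by move=> fi; rewrite /Rintegral fineK//; exact: integrable_fin_num. Qed.

Lemma Rintegrable_le f g : measurable_fun D f -> Rintegrable mu D g ->
  (forall x, D x -> `|f x| <= g x) -> Rintegrable mu D f.
Proof.
move=> mf ig fg; apply: le_integrable ig => //; first exact/measurable_EFinP.
by move=> x Dx /=; rewrite lee_fin (le_trans (fg x Dx))// ler_norm.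
Qed.

Lemma RintegrableD f g : Rintegrable mu D f -> Rintegrable mu D g ->
  Rintegrable mu D (fun x => f x + g x).
Proof. by move=> fi gi; have := integrableD mD fi gi. Qed.

Lemma RintegrableB f g : Rintegrable mu D f -> Rintegrable mu D g ->
  Rintegrable mu D (fun x => f x - g x).
Proof. by move=> fi gi; have := integrableB mD fi gi. Qed.

Lemma RintegrableZ k f : Rintegrable mu D f -> Rintegrable mu D (fun x => k * f x).
Proof. by move=> fi; have := integrableZl mD k fi. Qed.

Lemma Rintegrable_norm f : Rintegrable mu D f -> Rintegrable mu D (fun x => `|f x|).
Proof. by move=> fi; exact: integrable_norm. Qed.

Lemma Rintegrable_eq f g : (forall x, D x -> f x = g x) ->
  Rintegrable mu D f -> Rintegrable mu D g.
Proof. by move=> fg; apply: eq_integrable => // x /set_mem xD /=; rewrite fg. Qed.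

Lemma Rintegral_eq f g : (forall x, D x -> f x = g x) ->
  \int[mu]_(x in D) f x = \int[mu]_(x in D) g x.
Proof. by move=> fg; apply: eq_Rintegral => x /set_mem; exact: fg. Qed.

Lemma Rintegrable_sum (I : Type) (s : seq I) (P : pred I) (f : I -> T -> R) :
  (forall i, P i -> Rintegrable mu D (f i)) ->
  Rintegrable mu D (fun x => \sum_(i <- s | P i) f i x).
Proof.
move=> fi; apply: (@eq_integrable _ _ _ mu D mD
  (fun x => \sum_(i <- s | P i) (f i x)%:E)%E).
  by move=> x _ /=; rewrite sumEFin.
exact: (integrable_sum mD s fi).
Qed.

Lemma Rintegral_sum (I : Type) (s : seq I) (P : pred I) (f : I -> T -> R) :
  (forall i, P i -> Rintegrable mu D (f i)) ->
  \int[mu]_(x in D) (\sum_(i <- s | P i) f i x) =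
  \sum_(i <- s | P i) \int[mu]_(x in D) f i x.
Proof.
move=> fi; elim: s => [|i s ih].
  rewrite big_nil (@Rintegral_eq _ (fun=> 0)) => [|x _]; last by rewrite big_nil.
  by rewrite Rintegral_cst// mul0r.
rewrite big_cons -ih (@Rintegral_eq _ (fun x => if P i
    then f i x + \sum_(j <- s | P j) f j x else \sum_(j <- s | P j) f j x));
  last by move=> x _; rewrite big_cons.
case: ifPn => // Pi; rewrite RintegralD//; first exact: fi.
exact: Rintegrable_sum.
Qed.

Lemma Rintegral_ae_eq f g : measurable_fun D f -> measurable_fun D g ->
  {ae mu, forall x, D x -> f x = g x} ->
  \int[mu]_(x in D) f x = \int[mu]_(x in D) g x.
Proof.
move=> mf mg fg; congr fine; apply: ae_eq_integral => //;
  try exact/measurable_EFinP.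
by apply: filterS fg => x fg Dx; rewrite fg.
Qed.

Lemma Rintegral_ae_le f g : Rintegrable mu D f -> Rintegrable mu D g ->
  {ae mu, forall x, D x -> f x <= g x} ->
  \int[mu]_(x in D) f x <= \int[mu]_(x in D) g x.
Proof.
move=> fi gi fg; have mf := Rintegrable_measurable fi.
have mg := Rintegrable_measurable gi.
rewrite (@Rintegral_ae_eq f (fun x => Num.min (f x) (g x)))//; last 2 first.
- exact: measurable_minr.
- by apply: filterS fg => x fg Dx; apply/esym/min_idPl/fg.
apply: le_Rintegral => //.
  apply: (@Rintegrable_le _ (fun x => `|f x| + `|g x|)).
  - exact: measurable_minr.
  - by apply: RintegrableD; exact: Rintegrable_norm.
  - by move=> x _; rewrite minEle; case: ifP => _; rewrite ?lerDl ?lerDr.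
by move=> x _; rewrite ge_min lexx orbT.
Qed.

Lemma Rintegral_dominated (f_ : nat -> T -> R) f g :
  (forall n, measurable_fun D (f_ n)) -> measurable_fun D f ->
  {ae mu, forall x, D x -> f_ n x @[n --> \oo] --> f x} ->
  Rintegrable mu D g ->
  {ae mu, forall x, D x -> forall n, `|f_ n x| <= g x} ->
  Rintegrable mu D f /\
  \int[mu]_(x in D) f_ n x @[n --> \oo] --> \int[mu]_(x in D) f x.
Proof.
move=> mf_ mf fcvg ig fg.
have [||||fi _ If] := @dominated_convergence _ _ _ mu D mD
  (fun n => EFin \o f_ n) (EFin \o f) (EFin \o g) _ _ _ ig.
- by move=> n; exact/measurable_EFinP.
- exact/measurable_EFinP.
- apply: filterS fcvg => x fx Dx; apply/fine_cvgP; split.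
    exact: nearW.
  exact: fx.
- by apply: filterS fg => x fx n Dx /=; rewrite lee_fin fx.
split=> //.
by apply: fine_cvg; rewrite EFin_Rintegral.
Qed.

(** Convergence is only almost everywhere, whereas the limit inferior has to be identified at every
    point: the sequence is first killed on a measurable null set, where its limit becomes 0.
    Integrability of [f] is part of the conclusion. *)
Lemma Rintegral_fatou (f_ : nat -> T -> R) f (C : R) :
  (forall n, Rintegrable mu D (f_ n)) -> measurable_fun D f ->
  (forall n x, D x -> 0 <= f_ n x) -> (forall x, D x -> 0 <= f x) ->
  {ae mu, forall x, D x -> f_ n x @[n --> \oo] --> f x} ->
  (forall n, \int[mu]_(x in D) f_ n x <= C) ->
  Rintegrable mu D f /\ \int[mu]_(x in D) f x <= C.
Proof.
move=> fi mf f0 f0' fcvg IC.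
have mf_ n : measurable_fun D (f_ n) by exact: Rintegrable_measurable.
have [Z [mZ Z0 subZ]] := fcvg.
have fZ x : D x -> ~ Z x -> f_ n x @[n --> \oo] --> f x.
  by move=> Dx; apply: contra_notP => fx; apply: subZ => /(_ Dx).
pose g n x := f_ n x * \1_(~` Z) x.
have mI : measurable_fun D (\1_(~` Z) : T -> R).
  by apply: measurable_indic; exact: measurableC.
have mg n : measurable_fun D (g n) by exact: measurable_funM.
have g0 n x : D x -> 0 <= g n x by move=> Dx; rewrite mulr_ge0 ?f0.
pose h x := f x * \1_(~` Z) x.
have gh x : D x -> limn_einf (fun n => (g n x)%:E) = (h x)%:E.
  move=> Dx; have H : ((g n x)%:E @[n --> \oo] --> (h x)%:E)%E.
    apply/fine_cvgP; split; first exact: nearW.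
    rewrite /h /g /= !indicE; have [Zx|Zx] := pselect (Z x).
      rewrite memNset ?mulr0; last by move=> /(_ Zx).
      by rewrite (_ : _ \o _ = cst 0); [exact: cvg_cst|apply/funext => n /=; rewrite mulr0].
    rewrite mem_set// mulr1.
    rewrite (_ : _ \o _ = f_^~ x); last by apply/funext => n /=; rewrite mulr1.
    exact: fZ.
  by rewrite is_cvg_limn_einfE; [exact/cvg_lim|apply/cvg_ex; exists (h x)%:E].
have IE : (\int[mu]_(x in D) (f x)%:E <= C%:E)%E.
  rewrite (@ge0_ae_eq_integral _ _ _ mu D _ (EFin \o h))//; last first.
  - exists Z; split => // x /= /not_implyP[Dx]; apply: contra_notP => Zx.
    by rewrite /h indicE mem_set// mulr1.
  - by move=> x Dx; rewrite lee_fin mulr_ge0 ?f0'.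
  - by apply/measurable_EFinP; exact: measurable_funM.
  - exact/measurable_EFinP.
  rewrite (eq_integral (fun x => limn_einf (fun n => (g n x)%:E))); last first.
    by move=> x /set_mem Dx; rewrite gh.
  apply: le_trans (fatou mu mD _ _) _ => [n|n x Dx|].
  - exact/measurable_EFinP.
  - by rewrite lee_fin g0.
  rewrite limn_einf_lim; apply: lime_le; first exact: is_cvg_einfs.
  apply: nearW => n; apply: (@le_trans _ _ (\int[mu]_(x in D) (g n x)%:E)%E).
    by apply: ereal_inf_lbound; exists n => //=.
  apply: (@le_trans _ _ (\int[mu]_(x in D) (f_ n x)%:E)%E); last first.
    by rewrite -EFin_Rintegral// lee_fin.
  apply: ge0_le_integral => //.
  - by move=> x Dx; rewrite lee_fin g0.
  - exact/measurable_EFinP.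
  - exact/measurable_EFinP.
  - move=> x Dx; rewrite lee_fin /g -[leRHS]mulr1 ler_wpM2l ?f0//.
have fint : Rintegrable mu D f.
  apply/integrableP; split; first exact/measurable_EFinP.
  under eq_integral => x /set_mem Dx do rewrite gee0_abs ?lee_fin ?f0'//.
  by rewrite (le_lt_trans IE)// ltry.
by split=> //; rewrite -lee_fin EFin_Rintegral.
Qed.

Lemma Rintegrable_bounded f (C : R) : (mu D < +oo)%E -> measurable_fun D f ->
  (forall x, D x -> `|f x| <= C) -> Rintegrable mu D f.
Proof.
move=> muD mf fC; apply: (@Rintegrable_le _ (fun=> C)) => //.
apply/integrableP; split; first exact: measurable_cst.
rewrite (eq_integral (cst `|C|%:E)) => [|x _ //].
by rewrite integral_cst// lte_mul_pinfty.
Qed.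

Lemma Rintegrable_mulr f g (C : R) : Rintegrable mu D f -> measurable_fun D g ->
  (forall x, D x -> `|g x| <= C) -> Rintegrable mu D (fun x => f x * g x).
Proof.
move=> fi mg gC; have := RintegrableZ `|C| (Rintegrable_norm fi).
move=> /Rintegrable_le; apply.
  by apply: measurable_funM => //; exact: Rintegrable_measurable.
move=> x Dx; rewrite normrM mulrC ler_wpM2r//.
by rewrite (le_trans (gC x Dx)) ?ler_norm.
Qed.

End real_integral.

(** * Series over the sites as integrals for the counting measure *)

Section nat_sum.
Context {R : realType}.
Implicit Types f g : nat -> R.

(* [nsum f] is the sum of [f] only when [f] is absolutely summable. *)
Definition nsum f : R := \int[@counting _ R]_(n in [set: nat]) f n.
Definition nsummable f := Rintegrable (@counting _ R) [set: nat] f.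

Lemma eq_nsum f g : f =1 g -> nsum f = nsum g.
Proof. by move=> fg; congr nsum; exact/funext. Qed.

Lemma nsummable_le f g : nsummable g -> (forall n, `|f n| <= g n) -> nsummable f.
Proof. by move=> sg fg; apply: Rintegrable_le sg _. Qed.

Lemma nsummableD f g : nsummable f -> nsummable g -> nsummable (fun n => f n + g n).
Proof. exact: RintegrableD. Qed.

Lemma nsummableB f g : nsummable f -> nsummable g -> nsummable (fun n => f n - g n).
Proof. exact: RintegrableB. Qed.

Lemma nsummableZ k f : nsummable f -> nsummable (fun n => k * f n).
Proof. exact: RintegrableZ. Qed.

Lemma nsumD f g : nsummable f -> nsummable g ->
  nsum (fun n => f n + g n) = nsum f + nsum g.
Proof. exact: RintegralD. Qed.

Lemma nsumB f g : nsummable f -> nsummable g ->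
  nsum (fun n => f n - g n) = nsum f - nsum g.
Proof. exact: RintegralB. Qed.

Lemma nsumZ k f : nsummable f -> nsum (fun n => k * f n) = k * nsum f.
Proof. exact: RintegralZl. Qed.

Lemma ler_nsum f g : nsummable f -> nsummable g -> (forall n, f n <= g n) ->
  nsum f <= nsum g.
Proof. by move=> sf sg fg; exact: le_Rintegral. Qed.

Lemma nsum_ge0 f : (forall n, 0 <= f n) -> 0 <= nsum f.
Proof. by move=> f0; exact: Rintegral_ge0. Qed.

Lemma ler_norm_nsum f : nsummable f -> `|nsum f| <= nsum (fun n => `|f n|).
Proof. by move=> sf; exact: le_normr_Rintegral. Qed.

Lemma nsummable_esum f : (forall n, 0 <= f n) ->
  (\esum_(n in setT) (f n)%:E < +oo)%E -> nsummable f.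
Proof.
move=> f0 foo; apply/integrableP; split => //.
rewrite ge0_integral_count; last by move=> ?; rewrite abse_ge0.
rewrite nneseries_esumT; last by move=> ?; rewrite abse_ge0.
by under eq_esum do rewrite gee0_abs ?lee_fin ?f0//.
Qed.

Lemma esum_nsum f : (forall n, 0 <= f n) -> nsummable f ->
  \esum_(n in setT) (f n)%:E = (nsum f)%:E.
Proof.
move=> f0 sf; rewrite EFin_Rintegral// ge0_integral_count; last first.
  by move=> n; rewrite lee_fin.
by rewrite nneseries_esumT// => n; rewrite lee_fin.
Qed.

Lemma nsummable_mask f (L : nat) : nsummable (fun n => if (n < L)%N then f n else 0).
Proof.
rewrite (_ : (fun n => _) = (fun n => \sum_(i < L) f i * (n == i :> nat)%:R)); last first.
  apply/funext => n; case: ltnP => nL.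
    rewrite (bigD1 (Ordinal nL))//= eqxx mulr1 big1 ?addr0// => i.
    by rewrite eq_sym -val_eqE/= => /negPf->; rewrite mulr0.
  by rewrite big1// => i _; rewrite gtn_eqF ?mulr0// (leq_trans (ltn_ord i)).
apply: Rintegrable_sum => // i _; apply: RintegrableZ => //.
apply/integrableP; split=> //; rewrite ge0_integral_count; last first.
  by move=> n; rewrite abse_ge0.
rewrite nneseries_esumT; last by move=> n; rewrite abse_ge0.
rewrite (_ : (esum _ _) = \esum_(n in [set nat_of_ord i]) 1)%E.
  by rewrite esum_set1 ?ltry.
rewrite [RHS]esum_mkcond; apply: eq_esum => n _ /=.
rewrite (_ : (n \in [set nat_of_ord i]) = (n == i :> nat)).
  by case: eqP; rewrite ?normr1 ?normr0.
by apply/idP/eqP => [/set_mem|->]; [|exact: mem_set].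
Qed.

Lemma nsum_mask f (L : nat) :
  nsum (fun n => if (n < L)%N then f n else 0) = \sum_(n < L) f n.
Proof.
have nsum_single i : nsum (fun n => (n == i :> nat)%:R) = 1.
  rewrite -[LHS]/(fine _).
  rewrite (_ : \int[_]_(x in _) _ = 1)%E// ge0_integral_count; last first.
    by move=> n; rewrite lee_fin.
  rewrite nneseries_esumT; last by move=> n; rewrite lee_fin.
  rewrite (_ : 1%E = \esum_(n in [set i]) 1)%E; last by rewrite esum_set1.
  rewrite [RHS]esum_mkcond; apply: eq_esum => n _.
  rewrite (_ : (n \in [set i]) = (n == i)); first by case: eqP.
  by apply/idP/eqP => [/set_mem|->]; [|exact: mem_set].
have single_summable i : nsummable (fun n => (n == i :> nat)%:R).
  have := nsummable_mask (fun n => (n == i :> nat)%:R) i.+1.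
  apply: Rintegrable_eq => // n _; case: ltnP => // ni.
  by rewrite gtn_eqF.
transitivity (nsum (fun n => \sum_(i < L) f i * (n == i :> nat)%:R)).
  apply: eq_nsum => n; case: ltnP => nL.
    rewrite (bigD1 (Ordinal nL))//= eqxx mulr1 big1 ?addr0// => i.
    by rewrite eq_sym -val_eqE/= => /negPf->; rewrite mulr0.
  by rewrite big1// => i _; rewrite gtn_eqF ?mulr0// (leq_trans (ltn_ord i)).
rewrite /nsum Rintegral_sum//; last by move=> i _; exact: nsummableZ.
by apply: eq_bigr => i _; rewrite -/(nsum _) nsumZ// nsum_single mulr1.
Qed.

Lemma nsum_partial f : nsummable f -> \sum_(n < L) f n @[L --> \oo] --> nsum f.
Proof.
move=> sf; under eq_cvg do rewrite -nsum_mask.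
apply: (proj2 (@Rintegral_dominated _ _ _ _ _ _ _ _ (fun n => `|f n|) _ _ _ _ _)) => //.
- apply: aeW => n _; apply/cvgrPdist_lt => e e0; exists n.+1 => // L /= nL.
  by rewrite nL subrr normr0.
- exact: Rintegrable_norm.
- by apply: aeW => n _ L; case: ifP => //; rewrite normr0.
Qed.

Lemma partial_le_nsum f L : (forall n, 0 <= f n) -> nsummable f ->
  \sum_(n < L) f n <= nsum f.
Proof.
move=> f0 sf; rewrite -nsum_mask; apply: ler_nsum => //.
  exact: nsummable_mask.
by move=> n; case: ifP.
Qed.

Lemma term_le_nsum f n : (forall n, 0 <= f n) -> nsummable f -> f n <= nsum f.
Proof.
move=> f0 sf; apply: le_trans (partial_le_nsum n.+1 f0 sf).
by rewrite big_ord_recr/= lerDr sumr_ge0.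
Qed.

(** Fatou for the counting measure, applied to the truncations at [L]. *)
Lemma nsummable_bounded f C : (forall n, 0 <= f n) ->
  (forall L, \sum_(n < L) f n <= C) -> nsummable f /\ nsum f <= C.
Proof.
move=> f0 fC; apply: (@Rintegral_fatou _ _ _ _ _ _
    (fun L n => if (n < L)%N then f n else 0)) => //.
- by move=> L; exact: nsummable_mask.
- by move=> L n _; case: ifP.
- apply: aeW => n _; apply/cvgrPdist_lt => e e0; exists n.+1 => // L /= nL.
  by rewrite nL subrr normr0.
- by move=> L; rewrite [leLHS]nsum_mask.
Qed.

Lemma nsum_tail f : nsummable f ->
  nsum (fun n => if (n < L)%N then 0 else f n) @[L --> \oo] --> 0.
Proof.
move=> sf; have E : nsum (fun=> 0 : R) = 0 by rewrite /nsum Rintegral_cst// mul0r.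
rewrite -[X in _ --> X]E.
apply: (proj2 (@Rintegral_dominated _ _ _ _ _ _ _ _ (fun n => `|f n|) _ _ _ _ _)) => //.
- apply: aeW => n _; apply/cvgrPdist_lt => e e0; exists n.+1 => // L /= nL.
  by rewrite nL subrr normr0.
- exact: Rintegrable_norm.
- by apply: aeW => n _ L; case: ifP => //; rewrite normr0.
Qed.

End nat_sum.

(** * Exchange of series and integrals *)

Section sum_integral.
Context d (T : measurableType d) (R : realType) (mu : {measure set T -> \bar R}).
Variables (D : set T) (mD : measurable D).
Variable f : nat -> T -> R.
Hypothesis f0 : forall j x, D x -> 0 <= f j x.
Hypothesis mf : forall j, measurable_fun D (f j).
Hypothesis sf : forall x, D x -> nsummable (f^~ x).

Lemma measurable_nsum : measurable_fun D (fun x => nsum (f^~ x)).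
Proof.
apply: (@measurable_fun_cvg _ _ _ _ (fun L x => \sum_(j < L) f j x)).
- by move=> L; apply: measurable_sum => j.
- by move=> x Dx; apply: nsum_partial; exact: sf.
Qed.

Let tonelli : (\int[mu]_(x in D) (nsum (f^~ x))%:E =
  \esum_(j in setT) \int[mu]_(x in D) (f j x)%:E)%E.
Proof.
rewrite -nneseries_esumT; last first.
  by move=> j; apply: integral_ge0 => x Dx; rewrite lee_fin f0.
rewrite -integral_nneseries//; last by move=> j; exact/measurable_EFinP.
apply: eq_integral => x /set_mem Dx.
rewrite -esum_nsum; [|by move=> j; exact: f0|exact: sf].
by rewrite nneseries_esumT// => j; rewrite lee_fin f0.
Qed.

Lemma Rintegral_nsum : Rintegrable mu D (fun x => nsum (f^~ x)) ->
  [/\ forall j, Rintegrable mu D (f j),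
      nsummable (fun j => \int[mu]_(x in D) f j x) &
      \int[mu]_(x in D) nsum (f^~ x) = nsum (fun j => \int[mu]_(x in D) f j x)].
Proof.
move=> iS.
have fi j : Rintegrable mu D (f j).
  apply: Rintegrable_le iS _ => // x Dx.
  rewrite ger0_norm ?f0//; apply: (@term_le_nsum _ (f^~ x)) => [n|]; [exact: f0|exact: sf].
have I0 j : 0 <= \int[mu]_(x in D) f j x by apply: Rintegral_ge0 => x; exact: f0.
have E : (\int[mu]_(x in D) (nsum (f^~ x))%:E =
    \esum_(j in setT) (\int[mu]_(x in D) f j x)%:E)%E.
  by rewrite tonelli; apply: eq_esum => j _; rewrite EFin_Rintegral.
have sI : nsummable (fun j => \int[mu]_(x in D) f j x).
  by apply: nsummable_esum => //; rewrite -E; exact: integrable_lty.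
by split=> //; apply: EFin_inj; rewrite EFin_Rintegral// E esum_nsum.
Qed.

End sum_integral.

(** Tonelli with the counting measure on both sides. *)
Lemma nsum_exchange (R : realType) (f : nat -> nat -> R) :
  (forall i j, 0 <= f i j) -> (forall i, nsummable (f i)) ->
  nsummable (fun i => nsum (f i)) ->
  [/\ forall j, nsummable (f^~ j),
      nsummable (fun j => nsum (f^~ j)) &
      nsum (fun i => nsum (f i)) = nsum (fun j => nsum (f^~ j))].
Proof.
move=> f0 sf sS.
exact: (@Rintegral_nsum _ _ _ (@counting _ R) _ measurableT (fun j i => f i j)).
Qed.

(** * Elementary stochastic integrals *)

Section sub_sigma_algebra.
Import HBSimple HBNNSimple.
Context (R : realType) disp (T : measurableType disp) (P : probability T R).
Implicit Types (X Y Z : T -> R) (G : set (set T)).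

Local Notation "''E' X" := (\int[P]_w X w) (at level 10, X at level 8).
Local Notation intble X := (Rintegrable P [set: T] X).

Lemma measurable_wrtE G X : sigma_algebra setT G ->
  measurable_wrt G X <->
  measurable_fun (T := g_sigma_algebraType G) setT (X : g_sigma_algebraType G -> R).
Proof.
move=> sG; split=> [mX _ B mB|mX B mB].
  by rewrite setTI; apply: sub_sigma_algebra; exact: mX.
have := mX measurableT B mB; rewrite setTI.
by rewrite {1}/measurable/= sigma_algebra_id.
Qed.

Lemma measurable_wrt_sub G X : G `<=` measurable -> measurable_wrt G X ->
  measurable_fun setT X.
Proof. by move=> Gm mX _ B mB; rewrite setTI; exact/Gm/mX. Qed.

Lemma measurable_wrt_le G G' X : G `<=` G' -> measurable_wrt G X ->
  measurable_wrt G' X.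
Proof. by move=> GG' mX B mB; exact/GG'/mX. Qed.

Lemma measurable_wrt_cst G (c : R) : sigma_algebra setT G ->
  measurable_wrt G (fun=> c).
Proof. by move=> sG; apply/measurable_wrtE => //; exact: measurable_cst. Qed.

Lemma measurable_wrtD G X Y : sigma_algebra setT G -> measurable_wrt G X ->
  measurable_wrt G Y -> measurable_wrt G (fun w => X w + Y w).
Proof.
move=> sG /measurable_wrtE mX /measurable_wrtE mY; apply/measurable_wrtE => //.
by apply: measurable_funD; [exact: mX|exact: mY].
Qed.

Lemma measurable_wrtM G X Y : sigma_algebra setT G -> measurable_wrt G X ->
  measurable_wrt G Y -> measurable_wrt G (fun w => X w * Y w).
Proof.
move=> sG /measurable_wrtE mX /measurable_wrtE mY; apply/measurable_wrtE => //.
by apply: measurable_funM; [exact: mX|exact: mY].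
Qed.

Lemma measurable_wrtB G X Y : sigma_algebra setT G -> measurable_wrt G X ->
  measurable_wrt G Y -> measurable_wrt G (fun w => X w - Y w).
Proof.
move=> sG /measurable_wrtE mX /measurable_wrtE mY; apply/measurable_wrtE => //.
by apply: measurable_funB; [exact: mX|exact: mY].
Qed.

Lemma measurable_wrt_comp G X (f : R -> R) : sigma_algebra setT G ->
  measurable_fun setT f -> measurable_wrt G X ->
  measurable_wrt G (fun w => f (X w)).
Proof.
move=> sG mf /measurable_wrtE mX; apply/measurable_wrtE => //.
by apply: measurableT_comp; [exact: mf|exact: mX].
Qed.

Lemma measurable_wrt_sum G (I : Type) (s : seq I) (Pr : pred I) (X : I -> T -> R) :
  sigma_algebra setT G -> (forall i, measurable_wrt G (X i)) ->
  measurable_wrt G (fun w => \sum_(i <- s | Pr i) X i w).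
Proof.
move=> sG mX; elim: s => [|i s ih].
  by under eq_fun do rewrite big_nil; exact: measurable_wrt_cst.
under eq_fun do rewrite big_cons.
by case: (Pr i) => //; exact: measurable_wrtD.
Qed.

Lemma measurable_wrt_indic G A : sigma_algebra setT G -> G A ->
  measurable_wrt G (\1_A : T -> R).
Proof.
move=> sG GA; apply/measurable_wrtE => //.
by apply: measurable_indic; exact: sub_sigma_algebra.
Qed.

(** Vanishing on the events of [G] extends to simple functions below a nonnegative [Y], then to [Y]
    by dominated convergence with bound [|X * Y|], and to [Z] by its positive and negative parts.
    Thus [Z] may be unbounded as long as the product is integrable. *)
Lemma expectation_orthogonal G X Z : sigma_algebra setT G -> G `<=` measurable ->
  measurable_wrt G Z -> intble X -> intble (fun w => X w * Z w) ->
  (forall A, G A -> \int[P]_(w in A) X w = 0) ->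
  'E (fun w => X w * Z w) = 0.
Proof.
move=> sG Gm mZ iX iXZ X0.
have X1 A : G A -> 'E (fun w => X w * \1_A w) = 0.
  by move=> GA; rewrite -[RHS](X0 A GA) [RHS]Rintegral_mkcond;
    apply: Rintegral_eq => w _; rewrite patchE indicE; case: ifP;
    rewrite ?mulr1 ?mulr0.
have mX := Rintegrable_measurable iX.
have iX1 (B : set T) : G B -> intble (fun w => X w * \1_B w).
  move=> GB; apply: (@Rintegrable_mulr _ _ _ _ _ _ _ _ 1) => //.
    exact: (measurable_indic (Gm _ GB)).
  by move=> w _; rewrite indicE ger0_norm// -[leRHS]/(1%:R) ler_nat leq_b1.
have nonneg (Y : T -> R) : measurable_wrt G Y -> (forall w, 0 <= Y w) ->
    intble (fun w => X w * Y w) -> 'E (fun w => X w * Y w) = 0.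
  move=> mY Y0 iXY.
  (* The simple approximations of [Y] must have their level sets in [G], where [X] integrates to 0;
     hence they are built on the space whose measurable sets are those of [G]. *)
  pose gT := g_sigma_algebraType G.
  have mY' : measurable_fun (T := gT) setT (EFin \o (Y : gT -> R)).
    by apply/measurable_EFinP; exact/measurable_wrtE.
  pose a := nnsfun_approx (@measurableT _ gT) mY'.
  have aY w : a n w @[n --> \oo] --> Y w.
    have := cvg_nnsfun_approx (@measurableT _ gT) mY' (fun w _ => Y0 w) (I : setT w).
    by move=> /fine_cvgP[].
  have nda w n m : (n <= m)%N -> a n w <= a m w.
    move=> nm; have := nd_nnsfun_approx (@measurableT _ gT) mY' nm.
    by move=> /lefP/(_ w).
  have a_le w n : a n w <= Y w.
    rewrite -(cvg_lim _ (aY w))//; apply: nondecreasing_cvgn_le.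
      by move=> k l; exact: nda.
    by apply/cvg_ex; exists (Y w).
  have ma n : measurable_wrt G (a n : T -> R).
    by apply/measurable_wrtE => //; exact: measurable_funP.
  have E0 n : 'E (fun w => X w * a n w) = 0.
    rewrite (@Rintegral_eq _ _ _ _ _ _ (fun w =>
      \sum_(i < size (finmap.enum_fset (fset_set (range (a n)))))
        (finmap.enum_fset (fset_set (range (a n))))`_i *
        (X w * \1_(a n @^-1` [set (finmap.enum_fset (fset_set (range (a n))))`_i]) w))).
      rewrite Rintegral_sum//.
        rewrite big1// => i _; rewrite RintegralZl//; last by apply: iX1; apply: ma; exact: measurable_set1.
        by rewrite X1 ?mulr0//; apply: ma; exact: measurable_set1.
      by move=> i _; apply: RintegrableZ => //; apply: iX1; apply: ma; exact: measurable_set1.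
    move=> w _; rewrite fimfunEord mulr_sumr; apply: eq_bigr => i _.
    by rewrite mulrCA.
  have [_ lim] : intble (fun w => X w * Y w) /\
      'E (fun w => X w * a n w) @[n --> \oo] --> 'E (fun w => X w * Y w).
    apply: (@Rintegral_dominated _ _ _ _ _ _ _ _ (fun w => `|X w * Y w|)) => //.
    - move=> n; apply: measurable_funM => //.
      by apply: measurable_wrt_sub (ma n).
    - by apply: measurable_funM => //; exact: measurable_wrt_sub mY.
    - by apply: aeW => w _; apply: cvgMr.
    - exact: Rintegrable_norm.
    - apply: aeW => w _ n; rewrite !normrM ler_wpM2l// ger0_norm// ger0_norm//.
  apply/esym; move: lim; under eq_cvg do rewrite E0.
  by move=> /cvg_lim <-//; rewrite lim_cst.
pose p := fun w => Num.max (Z w) 0.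
pose n := fun w => Num.max (- Z w) 0.
have mp : measurable_wrt G p.
  apply: (measurable_wrt_comp (f := fun x => Num.max x 0)) => //.
  by apply: measurable_maxr.
have mn : measurable_wrt G n.
  apply: (measurable_wrt_comp (f := fun x => Num.max (- x) 0)) => //.
  by apply: measurable_maxr => //; exact: oppr_measurable.
have ip (Y : T -> R) : measurable_wrt G Y -> (forall w, `|Y w| <= `|Z w|) ->
    intble (fun w => X w * Y w).
  move=> mY YZ; have iN := Rintegrable_norm iXZ.
  apply: (Rintegrable_le measurableT _ iN) => //.
    by apply: measurable_funM => //; exact: measurable_wrt_sub mY.
  by move=> w _; rewrite !normrM ler_wpM2l.
have pZ w : `|p w| <= `|Z w|.
  by rewrite /p maxEle; case: ifPn; rewrite ?normr0.
have nZ w : `|n w| <= `|Z w|.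
  by rewrite /n maxEle; case: ifPn; rewrite ?normr0 ?normrN.
rewrite (@Rintegral_eq _ _ _ _ _ _ (fun w => X w * p w - X w * n w)).
  rewrite RintegralB//; [|exact: ip..].
  rewrite !nonneg ?subrr//; try exact: ip.
  - by move=> w; rewrite le_max lexx orbT.
  - by move=> w; rewrite le_max lexx orbT.
move=> w _; rewrite -mulrBr /p /n; congr (_ * _).
by rewrite !maxEle; case: ifPn; case: ifPn; lra.
Qed.

End sub_sigma_algebra.

Section square_integrable.
Context (R : realType) disp (T : measurableType disp) (P : probability T R).
Implicit Types (X Y Z : T -> R).

Local Notation "''E' X" := (\int[P]_w X w) (at level 10, X at level 8).
Local Notation intble X := (Rintegrable P [set: T] X).

Definition sqint X := measurable_fun setT X /\ intble (fun w => X w ^+ 2).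

Lemma intble_bounded X (C : R) : measurable_fun setT X ->
  (forall w, `|X w| <= C) -> intble X.
Proof.
move=> mX XC; have P1 : (P setT < +oo)%E by rewrite probability_setT ltry.
exact: (Rintegrable_bounded measurableT P1 mX (fun w _ => XC w)).
Qed.

Lemma intble_cst (c : R) : intble (fun=> c).
Proof. exact: (@intble_bounded _ `|c|). Qed.

Lemma expectation_cstr (c : R) : 'E (fun=> c) = c.
Proof.
have P1 : fine (P setT) = 1 by rewrite probability_setT.
by rewrite Rintegral_cst// -[RHS]mulr1; congr (_ * _).
Qed.

Lemma sqint_bounded X (C : R) : measurable_fun setT X ->
  (forall w, `|X w| <= C) -> sqint X.
Proof.
move=> mX XC; split=> //; apply: (@intble_bounded _ (C ^+ 2)).
  exact: measurable_funX.
by move=> w; rewrite normrX lerXn2r// ?nnegrE// (le_trans _ (XC w)).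
Qed.

Lemma sqint_mul X Y : sqint X -> sqint Y -> intble (fun w => X w * Y w).
Proof.
move=> [mX iX] [mY iY].
apply: (Rintegrable_le measurableT _ (RintegrableD measurableT iX iY)).
  exact: measurable_funM.
move=> w _; rewrite ler_norml; have := sqr_ge0 (X w - Y w).
have := sqr_ge0 (X w + Y w); have := sqr_ge0 (X w); have := sqr_ge0 (Y w).
by rewrite !expr2; nra.
Qed.

Lemma sqint_cst (c : R) : sqint (fun=> c).
Proof. exact: (@sqint_bounded _ `|c|). Qed.

Lemma sqint_intble X : sqint X -> intble X.
Proof.
move=> sX; have := sqint_mul sX (sqint_cst 1).
by apply: Rintegrable_eq => // w _; rewrite mulr1.
Qed.

Lemma sqintD X Y : sqint X -> sqint Y -> sqint (fun w => X w + Y w).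
Proof.
move=> sX sY; split; first by apply: measurable_funD; [case: sX|case: sY].
have iXY := RintegrableZ measurableT 2 (sqint_mul sX sY).
have := RintegrableD measurableT (RintegrableD measurableT (proj2 sX) iXY) (proj2 sY).
by apply: Rintegrable_eq => // w _; ring.
Qed.

Lemma sqint_mulr X Y (C : R) : sqint X -> measurable_fun setT Y ->
  (forall w, `|Y w| <= C) -> sqint (fun w => X w * Y w).
Proof.
move=> [mX iX] mY YC; split; first exact: measurable_funM.
have := @Rintegrable_mulr _ _ _ P _ measurableT _ (fun w => Y w ^+ 2) (C ^+ 2) iX.
have mY2 : measurable_fun setT (fun w => Y w ^+ 2) by exact: measurable_funX.
have Y2C w : setT w -> `|Y w ^+ 2| <= C ^+ 2.
  by move=> _; rewrite normrX lerXn2r// ?nnegrE// (le_trans _ (YC w)).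
move=> /(_ mY2 Y2C).
by apply: Rintegrable_eq => // w _; rewrite exprMn.
Qed.

Lemma sqintZ (c : R) X : sqint X -> sqint (fun w => c * X w).
Proof.
move=> sX; under eq_fun do rewrite mulrC.
exact: (@sqint_mulr _ _ `|c|).
Qed.

Lemma sqintB X Y : sqint X -> sqint Y -> sqint (fun w => X w - Y w).
Proof.
move=> sX sY; have := sqintD sX (sqintZ (-1) sY).
by under eq_fun do rewrite mulN1r.
Qed.

Lemma sqint_sum (I : Type) (s : seq I) (Pr : pred I) (X : I -> T -> R) :
  (forall i, Pr i -> sqint (X i)) -> sqint (fun w => \sum_(i <- s | Pr i) X i w).
Proof.
move=> sX; elim: s => [|i s ih].
  by under eq_fun do rewrite big_nil; exact: sqint_cst.
under eq_fun do rewrite big_cons.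
by have [Pi|//] := boolP (Pr i); apply: sqintD => //; exact: sX.
Qed.

End square_integrable.

Section normal_symmetric.
Context (R : realType).

(** Symmetry is the one property of the Gaussian law that is exploited: it will make the increments
    centred. The density is defined by cases on [s == 0], hence the assumption. *)
Lemma normal_probN (s : R) (U : set R) : s != 0 -> measurable U ->
  normal_prob 0 s (-%R @^-1` U) = normal_prob 0 s U.
Proof.
move=> s0 mU; rewrite /normal_prob.
rewrite [RHS](_ : _ =
    \int[pushforward lebesgue_measure (-%R : R -> measurableTypeR R)]_(x in U)
      (normal_pdf 0 s x)%:E)%E; last first.
  by apply: eq_measure_integral => A mA _; exact/esym/lebesgue_measureN.
rewrite ge0_integral_pushforward//=.
- apply: eq_integral => x _ /=; congr EFin.
  by rewrite /normal_pdf (negbTE s0) /normal_fun !subr0 sqrrN.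
- by apply/measurable_EFinP/measurable_funTS; exact: measurable_normal_pdf.
- by move=> x _; rewrite lee_fin normal_pdf_ge0.
Qed.

End normal_symmetric.

Section brownian_family.
Context (R : realType) disp (T : measurableType disp) (P : probability T R).
Variables (F : R -> set (set T)) (hF : filtration F).
Variables (K : eqType) (B : K -> R -> T -> R) (c : K -> K -> R).
Hypothesis hB : forall k, brownian_motion P F (B k).
Hypothesis hc : forall k k', bracket_rate P F (B k) (B k') (c k k').

Local Notation "''E' X" := (\int[P]_w X w) (at level 10, X at level 8).
Local Notation intble X := (Rintegrable P [set: T] X).
Local Notation sqint := (sqint P).

Let Fs t (t0 : 0 <= t) : sigma_algebra setT (F t) := filtration_sigma hF t0.

Lemma adapted_measurable X t : adapted F X -> 0 <= t -> measurable_fun setT (X t).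
Proof.
move=> aX t0; apply: measurable_wrt_sub (aX t t0).
exact: filtration_measurable.
Qed.

Lemma adapted_later X s t : adapted F X -> 0 <= s -> s <= t ->
  measurable_wrt (F t) (X s).
Proof.
move=> aX s0 st; apply: measurable_wrt_le (aX s s0).
exact: filtration_mono.
Qed.

(** Square integrability is read off [bracket_rate], since the martingale [B^2 - c t] is integrable
    by definition. *)
Lemma brownian_sqint k t : 0 <= t -> sqint (B k t).
Proof.
move=> t0; split; first exact: adapted_measurable (bm_adapted (hB k)) t0.
have := martingale_integrable (hc k k) t0 => /=.
move=> /(RintegrableD measurableT (intble_cst P (c k k * t))).
by apply: Rintegrable_eq => // w _; rewrite addrC subrK expr2.
Qed.

Let increment_law k s t (U : set R) : 0 <= s -> s < t -> measurable U ->
  P [set w | U (B k t w - B k s w)] = normal_prob 0 (Num.sqrt (t - s)) U.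
Proof.
move=> s0 st mU; have sT : F s setT.
  by have [G0 GC _] := Fs s0; rewrite -(setD0 setT); exact: GC.
by have := bm_increments (hB k) s0 st sT mU; rewrite setTI probability_setT mul1e.
Qed.

(** The increment and its opposite have the same law, so their positive parts have the same
    integral; the mean is the difference of the two. *)
Let increment_mean k s t : 0 <= s -> s < t ->
  'E (fun w => B k t w - B k s w) = 0.
Proof.
move=> s0 st; have t0 : 0 <= t by rewrite (le_trans s0)// ltW.
pose D w := B k t w - B k s w.
have [mD _] : sqint D by apply: sqintB; exact: brownian_sqint.
have iD : intble D by apply: sqint_intble; apply: sqintB; exact: brownian_sqint.
have sts : Num.sqrt (t - s) != 0 by rewrite gt_eqF// sqrtr_gt0 subr_gt0.
have mN : measurable_fun setT (fun w => - D w) by exact: measurable_funN.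
have mpos : measurable_fun setT (fun x : R => (Num.max x 0)%:E).
  by apply/measurable_EFinP; exact: measurable_maxr.
have E : (\int[P]_w (Num.max (D w) 0)%:E = \int[P]_w (Num.max (- D w) 0)%:E)%E.
  transitivity (\int[pushforward P D]_x (Num.max x 0)%:E)%E.
    rewrite ge0_integral_pushforward// => x _.
    by rewrite lee_fin le_max lexx orbT.
  pose N : T -> R := fun w => - D w.
  transitivity (\int[pushforward P N]_x (Num.max x 0)%:E)%E.
    apply: eq_measure_integral => U mU _; rewrite /pushforward.
    rewrite -[LHS]/(P [set w | U (D w)]) increment_law//.
    rewrite -normal_probN//.
    rewrite -(increment_law k s0 st)//.
    by rewrite -[X in measurable X]setTI; exact: oppr_measurable.
  rewrite ge0_integral_pushforward// => x _.
  by rewrite lee_fin le_max lexx orbT.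
have ip : intble (fun w => Num.max (D w) 0).
  apply: (Rintegrable_le measurableT _ (Rintegrable_norm iD)).
    exact: measurable_maxr.
  by move=> w _; rewrite maxEle; case: ifPn; rewrite ?normr0.
have im : intble (fun w => Num.max (- D w) 0).
  apply: (Rintegrable_le measurableT _ (Rintegrable_norm iD)).
    exact: measurable_maxr.
  by move=> w _; rewrite maxEle; case: ifPn; rewrite ?normr0 ?normrN.
rewrite (@Rintegral_eq _ _ _ _ _ _ (fun w => Num.max (D w) 0 - Num.max (- D w) 0)).
  by rewrite RintegralB// /Rintegral E subrr.
move=> w _; rewrite -/(D w) !maxEle; case: ifPn; case: ifPn; lra.
Qed.

(** Independence is given for events only. [expectation_orthogonal] is used twice: with the
    sigma-algebra of the increment and a centred indicator, which gives mean 0 of the increment on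
    every [A] in [F s]; then with [F s] itself, to reach [Z]. *)
Lemma brownian_orthogonal k s t (Z : T -> R) : 0 <= s -> s <= t ->
  measurable_wrt (F s) Z -> sqint Z -> 'E (fun w => (B k t w - B k s w) * Z w) = 0.
Proof.
move=> s0; rewrite le_eqVlt => /predU1P[<-|st] mZ sZ.
  rewrite (@Rintegral_eq _ _ _ _ _ _ (fun=> 0)) ?expectation_cstr// => w _.
  by rewrite subrr mul0r.
have t0 : 0 <= t by rewrite (le_trans s0)// ltW.
pose D w := B k t w - B k s w.
have sD : sqint D by apply: sqintB; exact: brownian_sqint.
have [mD _] := sD.
apply: (expectation_orthogonal (Fs s0) _ mZ).
- exact: filtration_measurable.
- exact: sqint_intble.
- exact: sqint_mul.
move=> A FA; have mA : measurable A by apply: filtration_measurable FA.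
have sA (V : set T) : measurable V -> intble (\1_V : T -> R).
  move=> mV; apply: (@intble_bounded _ _ _ _ _ 1); first exact: measurable_indic.
  by move=> w; rewrite indicE ger0_norm// -[leRHS]/(1%:R) ler_nat leq_b1.
(* The centred indicator integrates to 0 on every event of the increment: this is [bm_increments]
   compared for [A] and for the whole space. *)
pose Y w := \1_A w - fine (P A).
have iY : intble Y by apply: RintegrableB => //; [exact: sA|exact: intble_cst].
have mY := Rintegrable_measurable iY.
have YC w : `|Y w| <= 2.
  have : 0 <= fine (P A) <= 1.
    by rewrite fine_ge0//= -lee_fin fineK ?probability_le1// fin_num_measure.
  rewrite /Y indicE; case: (w \in A) => /andP[? ?]; rewrite ler_norml /=; apply/andP; split; lra.
have iYD : intble (fun w => Y w * D w).
  apply: sqint_mul => //; exact: (@sqint_bounded _ _ _ _ _ 2).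
have E0 : 'E (fun w => Y w * D w) = 0.
  apply: (expectation_orthogonal (G := preimage_set_system setT D measurable)) => //.
  - exact/sigma_algebra_preimage/sigma_algebra_measurable.
  - by move=> _ [U mU <-]; exact: mD.
  - by move=> U mU; exists U => //; rewrite setTI.
  - move=> _ [U mU <-]; rewrite setTI /Y.
    have mDU : measurable (D @^-1` U) by rewrite -[X in measurable X]setTI; exact: mD.
    rewrite RintegralB//; last 2 first.
    + by apply: integrableS (sA _ mA).
    + by apply: integrableS (intble_cst P (fine (P A))).
    rewrite Rintegral_cst// /Rintegral integral_indic//.
    have sT : F s setT.
      by have [G0 GC _] := Fs s0; rewrite -(setD0 setT); exact: GC.
    have E1 := bm_increments (hB k) s0 st FA mU.
    have E2 := bm_increments (hB k) s0 st sT mU.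
    rewrite setTI probability_setT mul1e in E2.
    rewrite -[A `&` (D @^-1` U)]/(A `&` [set w | U (B k t w - B k s w)]).
    have E : fine (P (A `&` [set w | U (B k t w - B k s w)])) =
        fine (P A) * fine (P (D @^-1` U)).
      by rewrite E1 -E2 fineM// fin_num_measure.
    by apply/eqP; rewrite subr_eq0; apply/eqP.
have iD : intble D by exact: sqint_intble.
have E1 : 'E (fun w => D w * \1_A w) = 0.
  rewrite (@Rintegral_eq _ _ _ _ _ _ (fun w => Y w * D w + fine (P A) * D w)).
    rewrite RintegralD//; last exact: RintegrableZ.
    by rewrite E0 RintegralZl// increment_mean// mulr0 addr0.
  by move=> w _; rewrite /Y; ring.
rewrite -[RHS]E1 [LHS]Rintegral_mkcond; apply: Rintegral_eq => w _.
by rewrite patchE indicE; case: ifP; rewrite ?mulr1 ?mulr0.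
Qed.

End brownian_family.

(** * Elementary integrals on a grid and their covariances *)

Section elementary_integral.
Context (R : realType) disp (T : measurableType disp) (P : probability T R).
Variables (F : R -> set (set T)) (hF : filtration F).
Variables (K : eqType) (B : K -> R -> T -> R) (c : K -> K -> R).
Hypothesis hB : forall k, brownian_motion P F (B k).
Hypothesis hc : forall k k', bracket_rate P F (B k) (B k') (c k k').

Local Notation "''E' X" := (\int[P]_w X w) (at level 10, X at level 8).
Local Notation intble X := (Rintegrable P [set: T] X).
Local Notation sqint := (sqint P).

Let Fs t (t0 : 0 <= t) : sigma_algebra setT (F t) := filtration_sigma hF t0.

Let incr k s t w := B k t w - B k s w.

Lemma incr_sqint k s t : 0 <= s -> s <= t -> sqint (incr k s t).
Proof.
move=> s0 st; apply: sqintB; apply: (brownian_sqint hF hB hc) => //.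
exact: le_trans st.
Qed.

(** The product of increments is the increment of the product minus two cross terms, each an
    increment times a quantity known at time [s]. The cross terms vanish by orthogonality, and the
    rest is governed by the martingale in [bracket_rate]. *)
Lemma brownian_covariance k k' s t (Z : T -> R) (C : R) : 0 <= s -> s <= t ->
  measurable_wrt (F s) Z -> (forall w, `|Z w| <= C) ->
  'E (fun w => incr k s t w * incr k' s t w * Z w) = c k k' * (t - s) * 'E Z.
Proof.
move=> s0 st mZ ZC; have t0 : 0 <= t by exact: le_trans st.
have mZ' : measurable_fun setT Z.
  by apply: measurable_wrt_sub mZ; exact: filtration_measurable.
have iZ : intble Z by exact: intble_bounded ZC.
have bs := brownian_sqint hF hB hc.
have sD := incr_sqint _ s0 st.
have iDD : intble (fun w => incr k s t w * incr k' s t w) by exact: sqint_mul.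
pose X w := incr k s t w * incr k' s t w - c k k' * (t - s).
have iX : intble X by apply: RintegrableB => //; exact: intble_cst.
have E0 : 'E (fun w => X w * Z w) = 0.
  apply: (expectation_orthogonal (Fs s0) _ mZ) => //.
  - exact: filtration_measurable.
  - exact: (@Rintegrable_mulr _ _ _ _ _ _ _ _ C).
  move=> A FA; have mA : measurable A by apply: filtration_measurable FA.
  have bA w : `|\1_A w : R| <= 1.
    by rewrite indicE ger0_norm// -[leRHS]/(1%:R) ler_nat leq_b1.
  have mIA : measurable_fun setT (\1_A : T -> R) by exact: measurable_indic.
  have sBA k1 : sqint (fun w => B k1 s w * \1_A w).
    exact: (@sqint_mulr _ _ _ _ _ _ 1 (bs _ _ _)).
  have mBA k1 : measurable_wrt (F s) (fun w => B k1 s w * \1_A w).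
    apply: measurable_wrtM; [exact: Fs|exact: (bm_adapted (hB k1))|].
    exact: measurable_wrt_indic (Fs s0) FA.
  have EA (Y : T -> R) : \int[P]_(w in A) Y w = 'E (fun w => Y w * \1_A w).
    rewrite Rintegral_mkcond; apply: Rintegral_eq => w _.
    by rewrite patchE indicE; case: ifP; rewrite ?mulr1 ?mulr0.
  pose M t w := B k t w * B k' t w - c k k' * t.
  have EM : 'E (fun w => M t w * \1_A w) = 'E (fun w => M s w * \1_A w).
    rewrite -!EA; congr fine; exact: (martingale_eq (hc k k')) FA.
  have iM r : 0 <= r -> intble (M r).
    by move=> r0; apply: RintegrableB => //; [apply: sqint_mul; exact: bs|exact: intble_cst].
  have iMA r : 0 <= r -> intble (fun w => M r w * \1_A w).
    by move=> r0; apply: (@Rintegrable_mulr _ _ _ _ _ _ _ _ 1) => //; exact: iM.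
  rewrite EA (@Rintegral_eq _ _ _ _ _ _ (fun w =>
    (M t w * \1_A w - M s w * \1_A w) -
    (incr k' s t w * (B k s w * \1_A w) + incr k s t w * (B k' s w * \1_A w)))).
    rewrite RintegralB//; last 2 first.
    - by apply: RintegrableB => //; exact: iMA.
    - by apply: RintegrableD => //; apply: sqint_mul.
    rewrite RintegralB//; [|exact: iMA..].
    rewrite EM subrr RintegralD//; [|exact: sqint_mul..].
    by rewrite !(brownian_orthogonal hF hB hc)// addr0 subrr.
  by move=> w _; rewrite /X /M /incr; ring.
move: E0; rewrite (@Rintegral_eq _ _ _ _ _ _ (fun w =>
    incr k s t w * incr k' s t w * Z w - c k k' * (t - s) * Z w)).
  rewrite RintegralB//; last 2 first.
  - exact: (@Rintegrable_mulr _ _ _ _ _ _ _ _ C).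
  - exact: RintegrableZ.
  by rewrite RintegralZl// => /eqP; rewrite subr_eq0 => /eqP.
by move=> w _; rewrite /X mulrBl.
Qed.

(** The index type [K] stays abstract: a single Brownian motion is [K = unit], while the whole noise
    is indexed by pairs of a component and a site. *)
Definition grid_sum (ks : seq K) (G : K -> nat -> T -> R) (tau : nat -> R) (N : nat)
    (w : T) : R :=
  \sum_(l < N) \sum_(k <- ks) G k l w * incr k (tau l) (tau l.+1) w.

Variables (tau : nat -> R) (N : nat).
Hypothesis tau0 : 0 <= tau 0%N.
Hypothesis tau_nd : forall l, tau l <= tau l.+1.

Let tau_le l l' : (l <= l')%N -> tau l <= tau l'.
Proof.
move=> /subnKC <-; elim: (l' - l)%N => [|n ih]; first by rewrite addn0.
by rewrite addnS (le_trans ih).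
Qed.

Let tau_ge0 l : 0 <= tau l.
Proof. by apply: le_trans tau0 _; exact: tau_le. Qed.

Definition bounded_adapted (ks : seq K) (G : K -> nat -> T -> R) :=
  (forall k l, k \in ks -> measurable_wrt (F (tau l)) (G k l)) /\
  exists C : R, forall k l w, k \in ks -> `|G k l w| <= C.

Let bounded_adapted_measurable ks G k l : bounded_adapted ks G -> k \in ks ->
  measurable_fun setT (G k l).
Proof.
move=> [mG _] kks; apply: measurable_wrt_sub (mG k l kks).
exact: filtration_measurable.
Qed.

Let term_sqint ks G k l : bounded_adapted ks G -> k \in ks ->
  sqint (fun w => G k l w * incr k (tau l) (tau l.+1) w).
Proof.
move=> aG kks; have [mG [C GC]] := aG; under eq_fun do rewrite mulrC.
apply: (@sqint_mulr _ _ _ _ _ _ C).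
- by apply: incr_sqint.
- exact: bounded_adapted_measurable aG kks.
- by move=> w; exact: GC.
Qed.

Let term_cov ks ks' G G' k k' l l' : bounded_adapted ks G -> bounded_adapted ks' G' ->
  k \in ks -> k' \in ks' -> (l < l')%N ->
  'E (fun w => (G k l w * incr k (tau l) (tau l.+1) w) *
     (G' k' l' w * incr k' (tau l') (tau l'.+1) w)) = 0.
Proof.
move=> aG aG' kks kks' ll'.
rewrite (@Rintegral_eq _ _ _ _ _ _ (fun w => incr k' (tau l') (tau l'.+1) w *
  ((G k l w * incr k (tau l) (tau l.+1) w) * G' k' l' w))); last first.
  by move=> w _; ring.
apply: (brownian_orthogonal hF hB hc) => //.
  have s0 := Fs (tau_ge0 l').
  apply: measurable_wrtM => //; last by case: aG' => mG' _; exact: mG'.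
  apply: measurable_wrtM => //.
    case: aG => mG _; apply: measurable_wrt_le (mG k l kks).
    by apply: filtration_mono => //; apply: tau_le; exact: ltnW.
  apply: measurable_wrtB => //.
    by apply: (adapted_later hF (bm_adapted (hB k))) => //; exact: tau_le.
  by apply: (adapted_later hF (bm_adapted (hB k))) => //; apply: tau_le; exact: ltnW.
have [mG [C GC]] := aG'; apply: (@sqint_mulr _ _ _ _ _ _ C).
- exact: term_sqint aG kks.
- exact: bounded_adapted_measurable aG' kks'.
- by move=> w; exact: GC.
Qed.

Lemma grid_sum_sqint ks G : bounded_adapted ks G -> sqint (grid_sum ks G tau N).
Proof.
move=> aG; apply: sqint_sum => l _.
rewrite (_ : (fun w => _) = (fun w => \sum_(k <- ks | k \in ks)
   G k l w * incr k (tau l) (tau l.+1) w)); last first.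
  by apply/funext => w; rewrite [LHS]big_seq.
by apply: sqint_sum => k kks; exact: term_sqint aG kks.
Qed.

Lemma grid_sum_mean ks G : bounded_adapted ks G -> 'E (grid_sum ks G tau N) = 0.
Proof.
move=> aG; have [mG [C GC]] := aG.
rewrite Rintegral_sum//; last first.
  move=> l _; under eq_fun do rewrite big_seq.
  by apply: Rintegrable_sum => // k kks; apply: sqint_intble; exact: term_sqint aG kks.
rewrite big1// => l _.
under eq_fun do rewrite big_seq.
rewrite Rintegral_sum//; last first.
  by move=> k kks; apply: sqint_intble; exact: term_sqint aG kks.
rewrite big1// => k kks.
rewrite (@Rintegral_eq _ _ _ _ _ _ (fun w => incr k (tau l) (tau l.+1) w * G k l w)).
  apply: (brownian_orthogonal hF hB hc) => //; first exact: mG.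
  apply: (@sqint_bounded _ _ _ _ _ C); first exact: bounded_adapted_measurable aG kks.
  by move=> w; exact: GC.
by move=> w _; rewrite mulrC.
Qed.

(** The polarized discrete Ito isometry: terms at distinct times are orthogonal through the later
    increment, and at equal times [brownian_covariance] leaves the factor [c k k']. *)
Lemma grid_sum_cov ks ks' G G' : bounded_adapted ks G -> bounded_adapted ks' G' ->
  'E (fun w => grid_sum ks G tau N w * grid_sum ks' G' tau N w) =
  \sum_(l < N) (tau l.+1 - tau l) *
    \sum_(k <- ks) \sum_(k' <- ks')
       c k k' * 'E (fun w => G k l w * G' k' l w).
Proof.
move=> aG aG'.
pose a l k w := G k l w * incr k (tau l) (tau l.+1) w.
pose a' l k w := G' k l w * incr k (tau l) (tau l.+1) w.
have sa l k : k \in ks -> sqint (a l k) by exact: term_sqint aG.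
have sa' l k : k \in ks' -> sqint (a' l k) by exact: term_sqint aG'.
have cov l l' k k' : k \in ks -> k' \in ks' -> 'E (fun w => a l k w * a' l' k' w) =
    if l == l' then (tau l.+1 - tau l) *
      (c k k' * 'E (fun w => G k l w * G' k' l w)) else 0.
  move=> kks kks'; case: eqVneq => [<-|].
    rewrite (@Rintegral_eq _ _ _ _ _ _ (fun w =>
      incr k (tau l) (tau l.+1) w * incr k' (tau l) (tau l.+1) w *
      (G k l w * G' k' l w))); last by move=> w _; rewrite /a /a'; ring.
    have [mG [C GC]] := aG; have [mG' [C' GC']] := aG'.
    rewrite (@brownian_covariance _ _ _ _ _ (C * C'))//.
    - by rewrite mulrCA mulrA.
    - by apply: measurable_wrtM; [exact: Fs|exact: mG|exact: mG'].
    - by move=> w; rewrite normrM ler_pM// ?GC ?GC'.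
  rewrite neq_ltn => /orP[ll'|ll']; first exact: term_cov aG aG' kks kks' ll'.
  rewrite (@Rintegral_eq _ _ _ _ _ _ (fun w => a' l' k' w * a l k w)).
    exact: term_cov aG' aG kks' kks ll'.
  by move=> w _; rewrite mulrC.
rewrite (@Rintegral_eq _ _ _ _ _ _ (fun w => \sum_(l < N) \sum_(l' < N)
   \sum_(k <- ks | k \in ks) \sum_(k' <- ks' | k' \in ks') a l k w * a' l' k' w)); last first.
  move=> w _; rewrite /grid_sum mulr_suml; apply: eq_bigr => l _.
  rewrite mulr_sumr; apply: eq_bigr => l' _.
  rewrite mulr_suml [LHS]big_seq; apply: eq_bigr => k kks.
  by rewrite mulr_sumr [LHS]big_seq.
have i4 l l' k k' : k \in ks -> k' \in ks' -> intble (fun w => a l k w * a' l' k' w).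
  by move=> kks kks'; apply: sqint_mul; [exact: sa|exact: sa'].
have i3 l l' k : k \in ks -> intble (fun w => \sum_(k' <- ks' | k' \in ks') a l k w * a' l' k' w).
  by move=> kks; apply: Rintegrable_sum => // k' kks'; exact: i4.
have i2 l l' : intble (fun w => \sum_(k <- ks | k \in ks)
    \sum_(k' <- ks' | k' \in ks') a l k w * a' l' k' w).
  by apply: Rintegrable_sum => // k kks; exact: i3.
rewrite Rintegral_sum//; last by move=> l _; exact: Rintegrable_sum.
apply: eq_bigr => l _; rewrite Rintegral_sum//.
rewrite (bigD1 l)//= [X in _ + X]big1 ?addr0 => [|l' l'l].
  rewrite Rintegral_sum//; last by move=> k; exact: i3.
  rewrite mulr_sumr [RHS]big_seq; apply: eq_bigr => k kks.
  rewrite Rintegral_sum//; last by move=> k'; exact: i4.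
  rewrite mulr_sumr [RHS]big_seq; apply: eq_bigr => k' kks'.
  by rewrite cov// eqxx.
rewrite Rintegral_sum//; last by move=> k; exact: i3.
rewrite big1// => k kks; rewrite Rintegral_sum//; last by move=> k'; exact: i4.
by rewrite big1// => k' kks'; rewrite cov// ifN//; apply: contra l'l => /eqP/val_inj ->.
Qed.

End elementary_integral.

(** * Uniform grids, step functions and Riemann sums *)

Section uniform_grid.
Context {R : realType}.
Implicit Types (r s : R) (v : nat -> R).

Definition gpt r (N l : nat) : R := r * l%:R / N%:R.

Lemma gpt_le r N l l' : 0 <= r -> (l <= l')%N -> gpt r N l <= gpt r N l'.
Proof.
by move=> r0 ll'; rewrite /gpt ler_wpM2r ?invr_ge0// ler_wpM2l// ler_nat.
Qed.

Lemma gpt0 r N : gpt r N 0 = 0.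
Proof. by rewrite /gpt mulr0 mul0r. Qed.

Lemma gpt_ge0 r N l : 0 <= r -> 0 <= gpt r N l.
Proof. by move=> r0; rewrite -(gpt0 r N) gpt_le. Qed.

Lemma gptN r N : (0 < N)%N -> gpt r N N = r.
Proof. by move=> N0; rewrite /gpt mulfK// pnatr_eq0 -lt0n. Qed.

Lemma gptS r N l : gpt r N l.+1 - gpt r N l = r / N%:R.
Proof. by rewrite /gpt -mulrBl -mulrBr -natrB// subSnn mulr1. Qed.

(** Left-open as in [simple_value]: on a cell, a coefficient frozen at the left end is known
    strictly before the current time. *)
Definition gcell r N l s := gpt r N l < s <= gpt r N l.+1.

Lemma gcell_exists r N s : (0 < N)%N -> 0 < s <= r ->
  exists2 l, (l < N)%N & gcell r N l s.
Proof.
move=> N0 /andP[s0 sr]; have r0 : 0 <= r by rewrite (le_trans _ sr)// ltW.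
have ex : exists l, s <= gpt r N l by exists N; rewrite gptN.
case: (ex_minnP ex) => [[|l] sl min]; first by move: sl; rewrite gpt0 leNgt s0.
exists l; first by rewrite -ltnS; apply: min; rewrite gptN.
by rewrite /gcell sl andbT ltNge; apply/negP => /min; rewrite ltnn.
Qed.

Lemma gcell_uniq r N l l' s : 0 <= r -> gcell r N l s -> gcell r N l' s -> l = l'.
Proof.
move=> r0 /andP[a b] /andP[a' b'].
have H i j : gpt r N i < gpt r N j.+1 -> (i <= j)%N.
  by rewrite leqNgt => h; apply/negP => /(gpt_le N r0); rewrite leNgt h.
by apply/eqP; rewrite eqn_leq !H// ?(lt_le_trans a b') ?(lt_le_trans a' b).
Qed.

Lemma gcell_le r N l s : 0 <= r -> (l < N)%N -> gcell r N l s -> 0 < s <= r.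
Proof.
move=> r0 lN /andP[a b]; rewrite (le_lt_trans (gpt_ge0 N l r0) a)/=.
by rewrite (le_trans b)// -[leRHS](@gptN r N) ?gpt_le// (leq_ltn_trans _ lN).
Qed.

Lemma gcell_dist r N l s : gcell r N l s ->
  0 < s - gpt r N l <= r / N%:R /\ 0 <= gpt r N l.+1 - s < r / N%:R.
Proof.
move=> /andP[a b]; have E := gptS r N l; split; apply/andP; split.
- by rewrite subr_gt0.
- by rewrite -E lerD2r.
- by rewrite subr_ge0.
- by rewrite -E ltrD2l ltrN2.
Qed.

Lemma gpt_refine r N M l : (0 < M)%N -> gpt r (N * M) (l * M) = gpt r N l.
Proof.
move=> M0; rewrite /gpt !natrM invfM !mulrA mulrAC -!mulrA mulrCA !mulrA.
by rewrite mulfK ?pnatr_eq0 -?lt0n// [_ * r]mulrC.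
Qed.

(** The right end of a fine cell lies in the same coarse cell as the cell itself, while its left end
    may fall on the coarse boundary. This is why step errors are later sampled at right ends. *)
Lemma gcell_refine r N M l s : 0 <= r -> (0 < M)%N -> gcell r (N * M) l s ->
  gcell r N (l %/ M) s /\ gcell r N (l %/ M) (gpt r (N * M) l.+1).
Proof.
move=> r0 M0 /andP[a b].
have H1 : gpt r N (l %/ M) <= gpt r (N * M) l.
  by rewrite -(gpt_refine r N _ M0) gpt_le// leq_trunc_div.
have H2 : gpt r (N * M) l.+1 <= gpt r N (l %/ M).+1.
  by rewrite -(gpt_refine r N _ M0) gpt_le// -ltn_divLR.
rewrite /gcell (le_lt_trans H1 a) (le_trans b H2) H2 andbT; split=> //.
by rewrite andbT (le_lt_trans H1 (lt_le_trans a b)).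
Qed.

Lemma mesh_cvg0 r (N : nat -> nat) : (forall m, (m < N m)%N) ->
  r / (N m)%:R @[m --> \oo] --> 0.
Proof.
move=> mN; rewrite -[X in _ --> X](mulr0 r); apply: cvgMr.
apply/cvgrPdist_lt => e e0; near=> m.
rewrite sub0r normrN ger0_norm ?invr_ge0//.
have m1 : (e^-1 < m%:R) by near: m; exact: nbhs_infty_gtr.
have N1 : e^-1 < (N m)%:R by rewrite (lt_trans m1)// ltr_nat.
rewrite -[e]invrK ltf_pV2 ?posrE ?invr_gt0// (lt_trans _ N1)// invr_gt0//.
Unshelve. all: by end_near. Qed.

Definition gstep r N v s : R := \sum_(l < N) v l * (gcell r N l s)%:R.

Lemma gstepE r N v l s : 0 <= r -> (l < N)%N -> gcell r N l s -> gstep r N v s = v l.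
Proof.
move=> r0 lN ls; rewrite /gstep (bigD1 (Ordinal lN))//= ls mulr1 big1 ?addr0//.
move=> i il; case: (boolP (gcell r N i s)) => [is_|]; last by rewrite mulr0.
by move: il; rewrite -val_eqE/= (gcell_uniq r0 is_ ls) eqxx.
Qed.

Let mu := @lebesgue_measure R.

Let cell_indicE r N l s : (gcell r N l s)%:R = \1_`]gpt r N l, gpt r N l.+1] s :> R.
Proof.
rewrite indicE; congr (nat_of_bool _)%:R.
by apply/idP/idP => [h|/set_mem]; [apply/mem_set|]; rewrite /= in_itv.
Qed.

Lemma measurable_gstep r N v D : measurable D -> measurable_fun D (gstep r N v).
Proof.
move=> mD; apply: measurable_sum => l; apply: measurable_funM => //.
by under eq_fun do rewrite cell_indicE; exact: measurable_indic.
Qed.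

Let cell_integral r N l : 0 <= r -> (l < N)%N ->
  Rintegrable mu `]0, r] (fun s => (gcell r N l s)%:R) /\
  \int[mu]_(s in `]0, r]) (gcell r N l s)%:R = r / N%:R.
Proof.
move=> r0 lN.
have E : (\int[mu]_(s in `]0%R, r]) ((gcell r N l s)%:R)%:E = (r / N%:R)%:E)%E.
  under eq_integral do rewrite cell_indicE.
  rewrite integral_indic// setIidl; last first.
    by move=> s /= cs; rewrite in_itv/=; apply: (gcell_le r0 lN); move: cs; rewrite in_itv.
  apply: (eq_trans (lebesgue_measure_itv `]gpt r N l, gpt r N l.+1])).
  rewrite /= lte_fin; case: ltP => h; first by rewrite -EFinB gptS.
  apply/eqP; rewrite eq_le !lee_fin divr_ge0//=.
  by rewrite -(gptS r N l) subr_le0 h.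
split; last by rewrite /Rintegral E.
apply/integrableP; split.
  apply/measurable_EFinP.
  have -> : (fun s => (gcell r N l s)%:R) = \1_`]gpt r N l, gpt r N l.+1] :> (R -> R).
    by apply/funext => s; exact: cell_indicE.
  exact: measurable_indic.
under eq_integral => s _ do rewrite gee0_abs ?lee_fin ?ler0n//.
by rewrite E ltry.
Qed.

Lemma integrable_gstep r N v : 0 <= r -> Rintegrable mu `]0, r] (gstep r N v).
Proof.
move=> r0; apply: Rintegrable_sum => // l _; apply: RintegrableZ => //.
by case: (cell_integral r0 (ltn_ord l)).
Qed.

Lemma integral_gstep r N v : 0 <= r ->
  \int[mu]_(s in `]0, r]) gstep r N v s = \sum_(l < N) v l * (r / N%:R).
Proof.
move=> r0; rewrite Rintegral_sum//.
  apply: eq_bigr => l _; rewrite RintegralZl//; last by case: (cell_integral r0 (ltn_ord l)).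
  by case: (cell_integral r0 (ltn_ord l)) => _ ->.
by move=> l _; apply: RintegrableZ => //; case: (cell_integral r0 (ltn_ord l)).
Qed.

Lemma integrable_itv_bounded r (g : R -> R) (C : R) : measurable_fun `]0, r] g ->
  (forall s, 0 < s <= r -> `|g s| <= C) -> Rintegrable mu `]0, r] g.
Proof.
move=> mg gC; have mry : (mu `]0%R, r] < +oo)%E.
  by rewrite /mu lebesgue_measure_itv/=; case: ifP; rewrite -?EFinB ltry.
by apply: (Rintegrable_bounded _ mry mg (C := C)) => // s /=; rewrite in_itv; exact: gC.
Qed.

(** A Riemann sum is the integral of its step function, so dominated convergence applies; [g] is
    integrable as a bounded limit of step functions. *)
Lemma riemann_cvg r (N : nat -> nat) (v : nat -> nat -> R) (C : R) (g : R -> R) :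
  0 <= r -> (forall m l, (l < N m)%N -> `|v m l| <= C) -> (forall m, (0 < N m)%N) ->
  (forall s, 0 < s <= r -> gstep r (N m) (v m) s @[m --> \oo] --> g s) ->
  Rintegrable mu `]0, r] g /\
  \sum_(l < N m) v m l * (r / (N m)%:R) @[m --> \oo] --> \int[mu]_(s in `]0, r]) g s.
Proof.
move=> r0 vC N0 vg.
have mg : measurable_fun `]0, r] g.
  apply: (@measurable_fun_cvg _ _ _ _ (fun m => gstep r (N m) (v m))).
    by move=> m; exact: measurable_gstep.
  by move=> s /=; rewrite in_itv/=; exact: vg.
have bd m s : 0 < s <= r -> `|gstep r (N m) (v m) s| <= C.
  by move=> /(gcell_exists (N0 m))[l lN ls]; rewrite (gstepE _ r0 lN ls) vC.
have C0 : Rintegrable mu `]0, r] (fun=> C).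
  by apply: (@integrable_itv_bounded _ _ `|C|).
have -> : (fun m => \sum_(l < N m) v m l * (r / (N m)%:R)) =
    (fun m => \int[mu]_(s in `]0, r]) gstep r (N m) (v m) s).
  by apply/funext => m; rewrite integral_gstep.
apply: (@Rintegral_dominated _ _ _ mu _ _ _ _ (fun=> C)) => //.
- by move=> m; exact: measurable_gstep.
- by apply: aeW => s /=; rewrite in_itv/=; exact: vg.
- by apply: aeW => s /=; rewrite in_itv/= => sr m; exact: bd.
Qed.

End uniform_grid.

(** * Tail bounds for elementary integrals without moment assumptions *)

Section tail.
Context (R : realType) disp (T : measurableType disp) (P : probability T R).
Variables (F : R -> set (set T)) (hF : filtration F).
Variable B : R -> T -> R.
Hypothesis hB : brownian_motion P F B.
Hypothesis hBB : bracket_rate P F B B 1.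

Local Notation "''E' X" := (\int[P]_w X w) (at level 10, X at level 8).
Local Notation intble X := (Rintegrable P [set: T] X).
Local Notation sqint := (sqint P).

Lemma markov_sqr (Y : T -> R) (e : R) : sqint Y -> 0 < e ->
  (P [set w | (e <= `|Y w|)%R] <= ('E (fun w => Y w ^+ 2) / e ^+ 2)%:E)%E.
Proof.
move=> [mY iY] e0; set A := [set w | _].
have mA : measurable A.
  rewrite (_ : A = [set: T] `&` (fun w => `|Y w|) @^-1` `[e, +oo[).
    by apply: measurableT_comp => //; exact: measurable_itv.
  by rewrite setTI; apply/seteqP; split=> w; rewrite /A /= in_itv/= andbT.
have iA : intble (\1_A : T -> R).
  apply: (@intble_bounded _ _ _ _ _ 1); first exact: measurable_indic.
  by move=> w; rewrite indicE ger0_norm// -[leRHS]/(1%:R) ler_nat leq_b1.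
have PA : P A = ('E (\1_A : T -> R))%:E.
  by rewrite EFin_Rintegral// integral_indic// setIT.
rewrite PA lee_fin ler_pdivlMr ?exprn_gt0// mulrC.
rewrite -RintegralZl//; apply: le_Rintegral => //.
  exact: RintegrableZ.
move=> w _; rewrite indicE; have [/set_mem/= Aw|_] := boolP (w \in A).
  by rewrite mulr1 -[leRHS]real_normK ?num_real// lerXn2r ?nnegrE// ltW.
by rewrite mulr0 sqr_ge0.
Qed.

(** A Lenglart-type bound. The coefficient is switched off when the running quadratic variation
    exceeds [delta]; the truncated sum then has second moment at most [delta], and outside [A]
    nothing was switched off. *)
Lemma step_tail (tau : nat -> R) (N : nat) (d : nat -> T -> R) (A : set T) (delta e : R) :
  0 <= tau 0%N -> (forall l, tau l <= tau l.+1) ->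
  (forall l, (l < N)%N -> tau l < tau l.+1) ->
  (forall l, (l < N)%N -> measurable_wrt (F (tau l)) (d l)) ->
  measurable A -> 0 < delta -> 0 < e ->
  (forall w, ~ A w -> \sum_(l < N) d l w ^+ 2 * (tau l.+1 - tau l) <= delta) ->
  exists A', [/\ measurable A',
    [set w | e <= `|\sum_(l < N) d l w * (B (tau l.+1) w - B (tau l) w)|] `<=` A' &
    (P A' <= P A + (delta / e ^+ 2)%:E)%E].
Proof.
move=> t0 tnd tlt md mA delta0 e0 dA.
have tge0 l : 0 <= tau l.
  by elim: l => // l ih; rewrite (le_trans ih).
have tle l l' : (l <= l')%N -> tau l <= tau l'.
  move=> /subnKC <-; elim: (l' - l)%N => [|n ih]; first by rewrite addn0.
  by rewrite addnS (le_trans ih).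
(* The sum includes step [l] itself, which is legitimate because [d l] is known at [tau l]; the
   truncation thus bounds the very coefficient it multiplies. *)
pose V l w := \sum_(i < l.+1) d i w ^+ 2 * (tau i.+1 - tau i).
pose g (_ : unit) l w := if (l < N)%N then d l w * (V l w <= delta)%R%:R else 0.
have mV l : (l < N)%N -> measurable_wrt (F (tau l)) (V l).
  move=> lN; have sF := filtration_sigma hF (tge0 l).
  rewrite /V (_ : (fun w => _) = (fun w => \sum_(i < l.+1)
    (if (i < l.+1)%N then d i w ^+ 2 * (tau i.+1 - tau i) else 0))); last first.
    by apply/funext => w; apply: eq_bigr => i _; rewrite ltn_ord.
  apply: measurable_wrt_sum => // i; have il := ltn_ord i; rewrite il.
  apply: measurable_wrtM => //; last exact: measurable_wrt_cst.
  apply: (measurable_wrt_comp (f := fun x => x ^+ 2)) => //.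
  apply: measurable_wrt_le (md i _); last by rewrite (leq_ltn_trans _ lN).
  by apply: filtration_mono => //; exact: tle.
have Dpos l : (l < N)%N -> 0 < tau l.+1 - tau l by move=> /tlt; rewrite subr_gt0.
(* Where the truncation keeps it, [d^2 <= delta / step], and [|x| <= 1 + x^2]; the sum over [l] is a
   common bound for all steps. *)
pose C := \sum_(l < N) (1 + delta / (tau l.+1 - tau l)).
have Cterm l : (l < N)%N -> 1 + delta / (tau l.+1 - tau l) <= C.
  move=> lN; rewrite /C (bigD1 (Ordinal lN))//= lerDl sumr_ge0// => i _.
  by rewrite addr_ge0// divr_ge0// ltW// Dpos.
have C0 : 0 <= C.
  by apply: sumr_ge0 => i _; rewrite addr_ge0// divr_ge0// ltW// Dpos.
have Vterm l w i : (l < N)%N -> (i <= l)%N -> d i w ^+ 2 * (tau i.+1 - tau i) <= V l w.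
  move=> lN il; have il' : (i < l.+1)%N by [].
  rewrite /V (bigD1 (Ordinal il'))//= lerDl sumr_ge0// => k _.
  rewrite mulr_ge0 ?sqr_ge0// ltW// Dpos// (leq_ltn_trans _ lN)//.
  by rewrite -ltnS.
have ag : bounded_adapted F tau [:: tt] g.
  split=> [k l _|].
    have sF := filtration_sigma hF (tge0 l).
    rewrite /g; case: ltnP => lN; last exact: measurable_wrt_cst.
    apply: measurable_wrtM => //; first exact: md.
    apply: (measurable_wrt_comp (f := fun x => (x <= delta)%R%:R)) => //; last exact: mV.
    rewrite (_ : (fun x => _) = \1_`]-oo, delta]); first exact: measurable_indic.
    apply/funext => x; rewrite indicE; congr (nat_of_bool _)%:R.
    by apply/idP/idP => [h|/set_mem]; [apply/mem_set|]; rewrite /= in_itv.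
  exists C => k l w _; rewrite /g; case: ltnP => lN; last by rewrite normr0.
  have [Vd|_] := leP (V l w) delta; last by rewrite mulr0 normr0.
  rewrite mulr1; apply: le_trans (Cterm _ lN).
  have d2 : d l w ^+ 2 <= delta / (tau l.+1 - tau l).
    by rewrite ler_pdivlMr ?Dpos// (le_trans _ Vd)// Vterm.
  apply: le_trans (_ : 1 + d l w ^+ 2 <= _); last by rewrite lerD2l.
  by rewrite -[d l w ^+ 2]real_normK ?num_real//; nra.
have hB' (k : unit) : brownian_motion P F B by [].
have hc' (k k' : unit) : bracket_rate P F B B 1 by [].
have sY := grid_sum_sqint (K := unit) hF hB' hc' N t0 tnd ag.
have cY := grid_sum_cov (K := unit) hF hB' hc' N t0 tnd ag ag.
set Y := grid_sum _ _ _ _ _ in sY cY.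
have YE w : Y w = \sum_(l < N) g tt l w * (B (tau l.+1) w - B (tau l) w).
  by rewrite /Y /grid_sum; apply: eq_bigr => l _; rewrite big_seq1.
have ig l : intble (fun w => g tt l w * g tt l w).
  have [mg [D gD]] := ag.
  apply: (@intble_bounded _ _ _ _ _ (D * D)).
    have m1 : measurable_fun setT (g tt l).
      apply: measurable_wrt_sub (mg tt l _); last by rewrite inE.
      exact: filtration_measurable.
    exact: measurable_funM.
  by move=> w; rewrite normrM ler_pM// gD// inE.
have EY : 'E (fun w => Y w ^+ 2) <= delta.
  under eq_fun do rewrite expr2.
  rewrite cY (eq_bigr (fun l : 'I_N => 'E (fun w => (tau l.+1 - tau l) * (g tt l w * g tt l w)))); last first.
    by move=> l _; rewrite !big_seq1 mul1r RintegralZl.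
  rewrite -Rintegral_sum//; last by move=> l _; exact: RintegrableZ.
  rewrite -[leRHS](expectation_cstr P); apply: le_Rintegral => //.
    by apply: Rintegrable_sum => // l _; exact: RintegrableZ.
    exact: intble_cst.
  move=> w _.
  (* A term is added only when the full sum including it is at most [delta], and the truncated sum
     never exceeds the full one. *)
  have S n : (n <= N)%N ->
      \sum_(l < n) (tau l.+1 - tau l) * (g tt l w * g tt l w) <=
        \sum_(l < n) d l w ^+ 2 * (tau l.+1 - tau l) /\
      \sum_(l < n) (tau l.+1 - tau l) * (g tt l w * g tt l w) <= delta.
    elim: n => [|n ih] nN; first by rewrite !big_ord0 lexx ltW.
    have [ih1 ih2] := ih (ltnW nN).
    have Dn := Dpos _ nN.
    have gE : g tt n w = d n w * (V n w <= delta)%R%:R by rewrite /g nN.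
    rewrite big_ord_recr/= [X in _ <= X /\ _]big_ord_recr/= gE.
    have [Vd|Vd] := leP (V n w) delta.
      rewrite mulr1 -expr2 [X in _ + X]mulrC lerD2r; split=> //.
      by apply: le_trans Vd; rewrite /V big_ord_recr/= lerD2r.
    rewrite mulr0 mulr0 mulr0 addr0; split=> //.
    by rewrite (le_trans ih1)// lerDl mulr_ge0 ?sqr_ge0// ltW.
  by have [] := S N (leqnn N).
exists (A `|` [set w | e <= `|Y w|]).
have mYe : measurable [set w | e <= `|Y w|].
  have [mY _] := sY.
  rewrite (_ : [set w | _] = [set: T] `&` (fun w => `|Y w|) @^-1` `[e, +oo[).
    by apply: measurableT_comp => //; exact: measurable_itv.
  by rewrite setTI; apply/seteqP; split=> w; rewrite /= in_itv/= andbT.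
split.
- exact: measurableU.
- move=> w /= ew; have [Aw|Aw] := pselect (A w); [by left|right].
  rewrite YE (eq_bigr (fun l : 'I_N => d l w * (B (tau l.+1) w - B (tau l) w)))// => l _.
  rewrite /g ltn_ord; suff -> : V l w <= delta by rewrite mulr1.
  apply: le_trans (dA w Aw); rewrite /V.
  rewrite -(big_mkord xpredT (fun i => d i w ^+ 2 * (tau i.+1 - tau i))).
  rewrite -[leRHS](big_mkord xpredT (fun i => d i w ^+ 2 * (tau i.+1 - tau i))).
  rewrite [leRHS](@big_cat_nat _ _ _ l.+1)//= lerDl big_nat sumr_ge0// => i /andP[_ iN].
  by rewrite mulr_ge0 ?sqr_ge0// ltW// Dpos.
- apply: (le_trans (measureU2 _ _ _)) => //.
  apply: leeD2l; apply: (le_trans (markov_sqr sY e0)).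
  by rewrite lee_fin ler_pM2r// invr_gt0 exprn_gt0.
Qed.

(** The intervals may overlap and share end points. Their sorted end points form a partition on
    which the integrand is a step process, and [step_tail] applies to it. *)
Lemma interval_tail (n : nat) (a b : nat -> R) (c : nat -> T -> R) (r : R) (A : set T)
    (delta e : R) :
  (forall i, (i < n)%N -> 0 <= a i /\ a i <= b i /\ b i <= r) ->
  (forall i, (i < n)%N -> measurable_wrt (F (a i)) (c i)) ->
  measurable A -> 0 < delta -> 0 < e ->
  (forall w, ~ A w -> (\int[lebesgue_measure]_(s in `]0%R, r])
     ((\sum_(i < n) c i w * (a i < s <= b i)%R%:R) ^+ 2)%:E <= delta%:E)%E) ->
  exists A', [/\ measurable A',
    [set w | e <= `|\sum_(i < n) c i w * (B (b i) w - B (a i) w)|] `<=` A' &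
    (P A' <= P A + (delta / e ^+ 2)%:E)%E].
Proof.
move=> abr mc mA delta0 e0 dA.
case: n => [|n] in abr mc dA *.
  exists A; split=> // [w /=|]; first by rewrite big_ord0 normr0 leNgt e0.
  by rewrite leeDl// lee_fin divr_ge0// ?sqr_ge0// ltW.
(* Duplicates are removed because [step_tail] asks for strictly increasing times. *)
pose s := sort <=%R (undup ([seq a i | i <- iota 0 n.+1] ++ [seq b i | i <- iota 0 n.+1])).
have s_sorted : sorted <%R s.
  by rewrite lt_sorted_uniq_le sort_uniq undup_uniq sort_le_sorted.
have as_ i : (i < n.+1)%N -> a i \in s.
  by move=> il; rewrite mem_sort mem_undup mem_cat map_f// mem_iota.
have bs_ i : (i < n.+1)%N -> b i \in s.
  by move=> il; rewrite mem_sort mem_undup mem_cat orbC map_f// mem_iota.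
have s_bd x : x \in s -> 0 <= x <= r.
  rewrite mem_sort mem_undup mem_cat => /orP[|] /mapP[i]; rewrite mem_iota/= => il ->;
    have [? [? ?]] := abr i il; apply/andP; split=> //.
    exact: le_trans (_ : b i <= _).
  exact: le_trans (_ : a i <= _).
have ss : (0 < size s)%N by have := as_ 0%N isT; case: (s).
pose N := (size s).-1.
have NS : N.+1 = size s by rewrite prednK.
(* The default value is the last point, so that [tau] is nondecreasing at all indices. *)
pose tau l := nth (last 0 s) s l.
have tau_in l : tau l \in s.
  have [ls|ls] := ltnP l (size s); first exact: mem_nth.
  rewrite /tau nth_default//; by case: (s) ss => // x s' _; rewrite -[last 0 _]/(last x s') mem_last.
have tau_lt l l' : (l < l')%N -> (l' <= N)%N -> tau l < tau l'.
  move=> ll' l'N; apply: (sorted_ltn_nth lt_trans) => //=; rewrite !inE -NS ltnS//.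
  by rewrite (leq_trans _ l'N)// ltnW.
have tau_inj l l' : (l <= N)%N -> tau l < tau l' -> (l < l')%N.
  move=> lN h; rewrite ltnNge; apply/negP; rewrite leq_eqVlt => /predU1P[E|l'l].
    by rewrite E ltxx in h.
  by have := tau_lt _ _ l'l lN; rewrite ltNge ltW.
have tau_nd l : tau l <= tau l.+1.
  have [lN|lN] := ltnP l N; first by rewrite ltW// tau_lt.
  rewrite [leRHS]/tau nth_default -?NS//.
  have [lS|lS] := ltnP l (size s); last by rewrite /tau nth_default.
  have -> : l = N by apply/eqP; rewrite eqn_leq lN -ltnS NS lS.
  by rewrite /tau /N nth_last; case: (s) ss.
have idx x : x \in s -> exists2 l, (l <= N)%N & tau l = x.
  by move=> xs; exists (index x s); [rewrite -ltnS NS index_mem|rewrite /tau nth_index].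
have /choice[al alP] i : exists l, (i < n.+1)%N -> (l <= N)%N /\ tau l = a i.
  by have [/as_/idx[l lN E]|] := boolP (i < n.+1)%N; [exists l|exists 0%N].
have /choice[be beP] i : exists l, (i < n.+1)%N -> (l <= N)%N /\ tau l = b i.
  by have [/bs_/idx[l lN E]|] := boolP (i < n.+1)%N; [exists l|exists 0%N].
have albe i : (i < n.+1)%N -> (al i <= be i)%N.
  move=> il; rewrite leqNgt; apply/negP => h.
  have [aN Ea] := alP i il; have [bN Eb] := beP i il.
  by have := tau_lt _ _ h aN; rewrite Ea Eb ltNge; have [_ [-> _]] := abr i il.
(* The intervals active on cell [l] are those whose end indices enclose [l]. *)
pose d l w := \sum_(i < n.+1) c i w * (al i <= l < be i)%N%:R.
have cell l i x : (l < N)%N -> (i < n.+1)%N -> tau l < x <= tau l.+1 ->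
    (a i < x <= b i) = (al i <= l < be i)%N.
  move=> lN il /andP[tx xt]; have [aN Ea] := alP i il; have [bN Eb] := beP i il.
  rewrite -Ea -Eb; congr (_ && _); apply/idP/idP.
  - by move=> h; rewrite -ltnS; apply: tau_inj => //; exact: lt_le_trans xt.
  - move=> h; apply: le_lt_trans tx.
    by move: h; rewrite leq_eqVlt => /predU1P[->//|h]; rewrite ltW// tau_lt// ltnW.
  - by move=> h; apply: (tau_inj _ _ (ltnW lN)); exact: lt_le_trans tx h.
  - move=> h; apply: le_trans xt _.
    by move: h; rewrite leq_eqVlt => /predU1P[->//|h]; rewrite ltW// tau_lt.
have BE w : \sum_(i < n.+1) c i w * (B (b i) w - B (a i) w) =
    \sum_(l < N) d l w * (B (tau l.+1) w - B (tau l) w).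
  rewrite /d; under [RHS]eq_bigr do rewrite mulr_suml.
  rewrite exchange_big/=; apply: eq_bigr => i _.
  have [aN <-] := alP i (ltn_ord i); have [bN <-] := beP i (ltn_ord i).
  under [RHS]eq_bigr do rewrite -mulrA.
  rewrite -mulr_sumr; congr (_ * _).
  rewrite -(telescope_sumr (fun l => B (tau l) w) (albe i (ltn_ord i))).
  rewrite -(big_mkord xpredT (fun l => (al i <= l < be i)%N%:R * (B (tau l.+1) w - B (tau l) w))).
  rewrite (@big_cat_nat _ _ _ (al i) 0 N)//=.
  rewrite [X in _ = X + _]big_nat [X in _ = X + _]big1 ?add0r => [|l /andP[_ h]]; last first.
    by rewrite leqNgt h mul0r.
  rewrite (@big_cat_nat _ _ _ (be i) _ N)//=; last exact: albe.
  rewrite [X in _ = _ + X]big_nat [X in _ = _ + X]big1 ?addr0 => [|l /andP[h _]]; last first.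
    by rewrite ltnNge h andbF mul0r.
  rewrite [LHS]big_nat [RHS]big_nat; apply: eq_bigr => l ->.
  by rewrite mul1r.
have [||A' [mA' sA' PA']] := @step_tail tau N d A delta e
  (andP (s_bd _ (tau_in 0%N))).1 tau_nd (fun l lN => tau_lt l l.+1 (ltnSn l) lN)
  _ mA delta0 e0 _.
- move=> l lN; have tl0 : 0 <= tau l by have /andP[] := s_bd _ (tau_in l).
  have sF := filtration_sigma hF tl0.
  rewrite /d (_ : (fun w => _) = (fun w => \sum_(i < n.+1)
     if (al i <= l < be i)%N then c i w else 0)); last first.
    by apply/funext => w; apply: eq_bigr => i _; case: ifP; rewrite ?mulr1 ?mulr0.
  apply: measurable_wrt_sum => // i; have [/andP[h _]|_] := boolP (al i <= l < be i)%N; last first.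
    exact: measurable_wrt_cst.
  apply: measurable_wrt_le (mc i (ltn_ord i)).
  have [aN Ea] := alP i (ltn_ord i); have [a0 _] := abr i (ltn_ord i).
  apply: filtration_mono => //; rewrite -Ea.
  by move: h; rewrite leq_eqVlt => /predU1P[->//|h]; rewrite ltW// tau_lt// ltnW.
- move=> w Aw; rewrite -lee_fin; apply: le_trans (dA w Aw).
  have -> : (\sum_(l < N) d l w ^+ 2 * (tau l.+1 - tau l))%:E =
     (\int[lebesgue_measure]_(x in `]0%R, r])
        (\sum_(l < N) d l w ^+ 2 * \1_`]tau l, tau l.+1] x)%:E)%E.
    under eq_integral do rewrite -sumEFin.
    rewrite ge0_integral_sum//; last 2 first.
    - move=> l; apply/measurable_EFinP; apply: measurable_funM => //; exact: measurable_indic.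
    - by move=> l x _; rewrite lee_fin mulr_ge0 ?sqr_ge0.
    rewrite -sumEFin; apply: eq_bigr => l _.
    under eq_integral do rewrite EFinM.
    rewrite ge0_integralZl//; last 2 first.
    - by apply/measurable_EFinP; exact: measurable_indic.
    - by rewrite lee_fin sqr_ge0.
    rewrite integral_indic// EFinM; congr (_ * _)%E.
    rewrite setIidl; last first.
      move=> x /=; rewrite !in_itv/= => /andP[h1 h2].
      have /andP[? ?] := s_bd _ (tau_in l); have /andP[? ?] := s_bd _ (tau_in l.+1).
      by apply/andP; split; [exact: le_lt_trans h1|exact: le_trans h2 _].
    apply/esym; apply: (eq_trans (lebesgue_measure_itv `]tau l, tau l.+1])).
    by rewrite /= lte_fin tau_lt.
  apply: ge0_le_integral => //.
  - move=> x _; rewrite lee_fin sumr_ge0// => l _.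
    by rewrite mulr_ge0 ?sqr_ge0.
  - apply/measurable_EFinP; apply: measurable_sum => l; apply: measurable_funM => //; exact: measurable_indic.
  - apply/measurable_EFinP; apply: measurable_funX.
    apply: measurable_sum => i; apply: measurable_funM => //.
    have -> : (fun x => (a i < x <= b i)%R%:R) = \1_`]a i, b i] :> (R -> R).
      apply/funext => x; rewrite indicE; congr (nat_of_bool _)%:R.
      by apply/idP/idP => [h|/set_mem]; [apply/mem_set|]; rewrite /= in_itv.
    exact: measurable_indic.
  - move=> x _; rewrite lee_fin.
    have [[l lN lx]|nol] := pselect (exists2 l, (l < N)%N & tau l < x <= tau l.+1).
      rewrite (bigD1 (Ordinal lN))//= [X in _ + X]big1 ?addr0.
        rewrite indicE mem_set/= ?in_itv// mulr1 /d.
        rewrite (eq_bigr (fun i : 'I_n.+1 => c i w * (a i < x <= b i)%R%:R))// => i _.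
        by rewrite (cell l).
      move=> l' l'l; rewrite indicE; case: (boolP (_ \in _)) => [/set_mem/=|_]; last first.
        by rewrite mulr0.
      rewrite in_itv/= => /andP[h1 h2]; move: lx => /andP[h3 h4].
      move: l'l; rewrite -val_eqE/= neq_ltn => /orP[ll|ll].
        have H : tau l'.+1 <= tau l.
          by move: ll; rewrite leq_eqVlt => /predU1P[->//|h]; rewrite ltW// tau_lt// ltnW.
        by have := lt_le_trans h3 (le_trans h2 H); rewrite ltxx.
      have H : tau l.+1 <= tau l'.
        by move: ll; rewrite leq_eqVlt => /predU1P[->//|h]; rewrite ltW// tau_lt// ltnW.
      by have := lt_le_trans h1 (le_trans h4 H); rewrite ltxx.
    rewrite big1 ?sqr_ge0// => l _; rewrite indicE.
    case: (boolP (_ \in _)) => [/set_mem/=|_]; last by rewrite mulr0.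
    by rewrite in_itv/= => lx; exfalso; apply: nol; exists l.
exists A'; split=> // w /= ew; apply: sA' => /=.
by rewrite -BE.
Qed.

End tail.

(** * Pathwise identification of the Ito integral *)

Section paths.
Context {R : realType}.
Implicit Types (h : R -> R) (r s : R).
Let mu := @lebesgue_measure R.

Definition path_continuous h := forall s, 0 <= s ->
  h x @[x --> within [set x | 0 <= x] (nbhs s)] --> h s.

Lemma path_continuousP h : path_continuous h <->
  forall s, 0 <= s -> forall e, 0 < e -> exists2 dl, 0 < dl &
    forall x, 0 <= x -> `|s - x| < dl -> `|h s - h x| < e.
Proof.
split=> ch s s0.
  move=> e e0; have /cvgrPdist_lt/(_ e e0) := ch s s0.
  rewrite near_withinE => /nbhs_ballP[dl /= dl0 H]; exists dl => // x x0 sx.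
  exact: H.
apply/cvgrPdist_lt => e e0; rewrite near_withinE.
have [dl dl0 H] := ch s s0 e e0.
by apply/nbhs_ballP; exists dl => // x sx x0; exact: H.
Qed.

Lemma path_bounded h r : path_continuous h ->
  exists C : R, forall s, 0 <= s <= r -> `|h s| <= C.
Proof.
move=> ch; have ch' : {within `[0, r], continuous h}.
  apply/subspace_continuousP => s /=; rewrite in_itv/= => /andP[s0 sr].
  apply: cvg_trans (ch s s0); apply: cvg_app => A.
  rewrite !nbhs_nearE !near_withinE; apply: filterS => x H.
  by rewrite /= in_itv/= => /andP[x0 _]; exact: H.
have := compact_bounded (continuous_compact ch' (@segment_compact _ 0 r)).
move=> [C [_ HC]]; exists (C + 1) => s s0r; apply: HC; first by rewrite ltrDl.
by exists s => //=; rewrite in_itv.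
Qed.

Lemma gstep_path_cvg h r (N : nat -> nat) (p : nat -> nat -> R) s :
  0 <= r -> path_continuous h -> (forall m, (m < N m)%N) ->
  (forall m l x, gcell r (N m) l x -> 0 <= p m l /\ `|x - p m l| <= r / (N m)%:R) ->
  0 < s <= r -> gstep r (N m) (fun l => h (p m l)) s @[m --> \oo] --> h s.
Proof.
move=> r0 /path_continuousP ch mN pP s0r; have /andP[s0 sr] := s0r.
apply/cvgrPdist_lt => e e0; have [dl dl0 H] := ch s (ltW s0) e e0.
have /cvgrPdist_lt/(_ dl dl0) := mesh_cvg0 r mN.
apply: filterS => m; rewrite sub0r normrN => rN.
have [l lN ls] := gcell_exists (leq_ltn_trans (leq0n _) (mN m)) s0r.
rewrite (gstepE _ r0 lN ls); have [p0 px] := pP m l s ls.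
apply: H => //; apply: le_lt_trans px _.
exact: le_lt_trans (ler_norm _) rN.
Qed.

Lemma riemann_path h r (N : nat -> nat) (p : nat -> nat -> R) :
  0 <= r -> path_continuous h -> (forall m, (m < N m)%N) ->
  (forall m l x, gcell r (N m) l x -> 0 <= p m l /\ `|x - p m l| <= r / (N m)%:R) ->
  (forall m l, (l < N m)%N -> 0 <= p m l <= r) ->
  Rintegrable mu `]0, r] h /\
  \sum_(l < N m) h (p m l) * (r / (N m)%:R) @[m --> \oo] --> \int[mu]_(s in `]0, r]) h s.
Proof.
move=> r0 ch mN pP pr; have [C hC] := path_bounded r ch.
apply: (@riemann_cvg _ r N (fun m l => h (p m l)) C h) => //.
- by move=> m l lN; apply: hC; exact: pr.
- by move=> m; apply: leq_ltn_trans (mN m).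
- by move=> s s0r; exact: gstep_path_cvg.
Qed.

Variables (r : R) (q : nat).
Hypotheses (rpos : 0 < r) (q0 : (0 < q)%N).
Let r0 := ltW rpos.

(** Grids of [[0, r]] start from [q] cells: when [r] consists of [q] coarse cells of a longer
    interval, the dyadic grids of the two intervals match. *)
Let N m := (q * 2 ^ m)%N.

Lemma dyadic_gt m : (m < N m)%N.
Proof. by apply: leq_trans (ltn_expl m (ltnSn 1)) _; exact: leq_pmull. Qed.

Lemma left_tag m l x : gcell r (N m) l x ->
  0 <= gpt r (N m) l /\ `|x - gpt r (N m) l| <= r / (N m)%:R.
Proof.
move=> /gcell_dist[/andP[a b] _]; split; first exact: gpt_ge0.
by rewrite ger0_norm// ltW.
Qed.

Lemma right_tag m l x : gcell r (N m) l x ->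
  0 <= gpt r (N m) l.+1 /\ `|x - gpt r (N m) l.+1| <= r / (N m)%:R.
Proof.
move=> /gcell_dist[_ /andP[a b]]; split; first exact: gpt_ge0.
by rewrite distrC ger0_norm// ltW.
Qed.

Let gpt_ler m l : (l <= N m)%N -> 0 <= gpt r (N m) l <= r.
Proof.
move=> lN; rewrite gpt_ge0//= -[leRHS](@gptN _ r (N m)) ?gpt_le//.
exact: leq_ltn_trans (dyadic_gt m).
Qed.

Definition step_error h m s := h s - gstep r (N m) (fun l => h (gpt r (N m) l)) s.

Lemma step_error_riemann h m : path_continuous h ->
  Rintegrable mu `]0, r] (fun s => step_error h m s ^+ 2) /\
  \sum_(l < N m') step_error h m (gpt r (N m') l.+1) ^+ 2 * (r / (N m')%:R)
     @[m' --> \oo] --> \int[mu]_(s in `]0, r]) step_error h m s ^+ 2.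
Proof.
move=> ch; have [C hC] := path_bounded r ch.
have gC k s : 0 < s <= r -> `|gstep r (N k) (fun l => h (gpt r (N k) l)) s| <= C.
  move=> s0r; have [l lN ls] := gcell_exists (leq_ltn_trans (leq0n _) (dyadic_gt k)) s0r.
  by rewrite (gstepE _ r0 lN ls) hC// gpt_ler// ltnW.
have eC s : 0 < s <= r -> `|step_error h m s ^+ 2| <= (C + C) ^+ 2.
  move=> s0r; rewrite normrX lerXn2r ?nnegrE//.
    have /andP[s0 sr] := s0r; have := hC s; rewrite sr ltW// => /(_ isT) h1.
    by rewrite addr_ge0// (le_trans _ h1).
  apply: le_trans (ler_normB _ _) _; apply: lerD; last exact: gC.
  by case/andP: s0r => s0 sr; rewrite hC// sr ltW.
apply: (@riemann_cvg _ r N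
  (fun m' l => step_error h m (gpt r (N m') l.+1) ^+ 2) ((C + C) ^+ 2)
  (fun s => step_error h m s ^+ 2)) => //.
- move=> m' l lN; apply: eC.
  have /andP[_ ->] := gpt_ler lN; rewrite andbT.
  by rewrite /gpt divr_gt0 ?mulr_gt0 ?ltr0n// (leq_ltn_trans _ lN).
- by move=> m'; apply: leq_ltn_trans (dyadic_gt m').
- move=> s s0r.
  have E m' : (m <= m')%N ->
      gstep r (N m') (fun l => step_error h m (gpt r (N m') l.+1) ^+ 2) s =
      (gstep r (N m') (fun l => h (gpt r (N m') l.+1)) s -
       gstep r (N m) (fun l => h (gpt r (N m) l)) s) ^+ 2.
    move=> mm'; have [l lN ls] := gcell_exists (leq_ltn_trans (leq0n _) (dyadic_gt m')) s0r.
    rewrite !(gstepE _ r0 lN ls) /step_error.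
    have NE : N m' = (N m * 2 ^ (m' - m))%N by rewrite /N -mulnA -expnD subnKC.
    have M0 : (0 < 2 ^ (m' - m))%N by rewrite expn_gt0.
    move: (ls); rewrite NE => /(gcell_refine r0 M0)[c1 c2].
    have lN' : (l %/ 2 ^ (m' - m) < N m)%N by rewrite ltn_divLR// -NE.
    by rewrite !(gstepE _ r0 lN' c1) (gstepE _ r0 lN' c2).
  have cv : (gstep r (N m') (fun l => h (gpt r (N m') l.+1)) s -
       gstep r (N m) (fun l => h (gpt r (N m) l)) s) ^+ 2 @[m' --> \oo] -->
       step_error h m s ^+ 2.
    have H : gstep r (N m') (fun l => h (gpt r (N m') l.+1)) s -
        gstep r (N m) (fun l => h (gpt r (N m) l)) s @[m' --> \oo] --> step_error h m s.
      apply: cvgB; last exact: cvg_cst.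
      exact: (gstep_path_cvg r0 ch dyadic_gt right_tag s0r).
    exact: (cvgM H H).
  apply: cvg_trans cv; apply: near_eq_cvg; near=> m'.
  by rewrite E//; near: m'; exact: nbhs_infty_ge.
Unshelve. all: by end_near. Qed.

Lemma step_error_cvg0 h : path_continuous h ->
  \int[mu]_(s in `]0, r]) step_error h m s ^+ 2 @[m --> \oo] --> 0.
Proof.
move=> ch; have [C hC] := path_bounded r ch.
have I0 : \int[mu]_(s in `]0, r]) (0 : R) = 0 by rewrite Rintegral_cst// mul0r.
rewrite -[X in _ --> X]I0.
apply: (proj2 (@Rintegral_dominated _ _ _ mu `]0, r] (measurable_itv _)
  (fun m s => step_error h m s ^+ 2) (fun=> 0) (fun=> (C + C) ^+ 2) _ _ _ _ _)) => //.
- move=> m; apply: Rintegrable_measurable (proj1 (step_error_riemann m ch)).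
- apply: aeW => s /=; rewrite in_itv/= => s0r.
  have H : step_error h m s @[m --> \oo] --> h s - h s.
    apply: cvgB; first exact: cvg_cst.
    exact: (gstep_path_cvg r0 ch dyadic_gt left_tag s0r).
  have := cvgM H H; rewrite subrr mul0r; exact.
- exact: (@integrable_itv_bounded _ _ _ `|(C + C) ^+ 2|).
- apply: aeW => s /=; rewrite in_itv/= => s0r m.
  have [l lN ls] := gcell_exists (leq_ltn_trans (leq0n _) (dyadic_gt m)) s0r.
  have h1 : `|h s| <= C by case/andP: s0r => s0 sr; rewrite hC// sr ltW.
  rewrite normrX lerXn2r ?nnegrE//.
    by rewrite addr_ge0// (le_trans _ h1).
  rewrite /step_error (gstepE _ r0 lN ls).
  apply: le_trans (ler_normB _ _) _; apply: lerD => //.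
  by rewrite hC// gpt_ler// ltnW.
Qed.

Lemma riemann_left h : path_continuous h ->
  Rintegrable mu `]0, r] h /\
  \sum_(l < N m) h (gpt r (N m) l) * (r / (N m)%:R) @[m --> \oo] -->
    \int[mu]_(s in `]0, r]) h s.
Proof.
move=> ch; apply: (riemann_path r0 ch dyadic_gt left_tag) => m l /ltnW.
exact: gpt_ler.
Qed.

End paths.

Section convergence_in_probability.
Context (R : realType) disp (T : measurableType disp) (P : probability T R).

Lemma measurable_ge_norm (X : T -> R) (e : R) : measurable_fun setT X ->
  measurable [set w | e <= `|X w|].
Proof.
move=> mX; rewrite (_ : [set w | _] = [set: T] `&` (fun w => `|X w|) @^-1` `[e, +oo[).
  by apply: measurableT_comp => //; exact: measurable_itv.
by rewrite setTI; apply/seteqP; split=> w; rewrite /= in_itv/= andbT.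
Qed.

Lemma probability_fine (A : set T) : measurable A ->
  P A = (\int[P]_w (\1_A w : R))%:E.
Proof.
move=> mA; rewrite EFin_Rintegral// ?integral_indic ?setIT//.
apply: (@intble_bounded _ _ _ _ _ 1); first exact: measurable_indic.
by move=> w; rewrite indicE ger0_norm// -[leRHS]/(1%:R) ler_nat leq_b1.
Qed.

Lemma probabilityU2 (A B : set T) : measurable A -> measurable B ->
  (P (A `|` B) <= P A + P B)%E.
Proof. exact: measureU2. Qed.

Lemma cvg0_small_probability (X : nat -> T -> R) (e eta : R) :
  (forall m, measurable_fun setT (X m)) ->
  {ae P, forall w, X m w @[m --> \oo] --> 0} -> 0 < e -> 0 < eta ->
  \forall m \near \oo, (P [set w | (e <= `|X m w|)%R] <= eta%:E)%E.
Proof.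
move=> mX X0 e0 eta0; pose A m := [set w | e <= `|X m w|].
have mA m : measurable (A m) by exact: measurable_ge_norm.
have [||_] := @Rintegral_dominated _ _ _ P setT measurableT (fun m => \1_(A m) : T -> R)
  (fun=> 0 : R) (fun=> 1) (fun m => measurable_indic (mA m)) (@measurable_cst _ _ T R setT 0) _
  (intble_cst P 1) _.
- apply: filterS X0 => w /cvgrPdist_lt/(_ e e0) Xw _.
  apply/cvgrPdist_lt => x x0; apply: filterS Xw => m; rewrite !sub0r !normrN => Xe.
  rewrite indicE memNset ?normr0// /A /= => /(le_lt_trans)/(_ Xe).
  by rewrite ltxx.
- apply: aeW => w _ m; rewrite indicE ger0_norm// -[leRHS]/(1%:R) ler_nat leq_b1//.
- rewrite expectation_cstr => /cvgrPdist_lt/(_ eta eta0); apply: filterS => m.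
  rewrite sub0r normrN => H; rewrite -/(A m) probability_fine// lee_fin.
  exact: le_trans (ler_norm _) (ltW H).
Qed.

End convergence_in_probability.

(** * Ito integrals as limits of dyadic sums *)

Section ito_grid.
Context (R : realType) disp (T : measurableType disp) (P : probability T R).
Variables (F : R -> set (set T)) (hF : filtration F).
Variable B : R -> T -> R.
Hypothesis hB : brownian_motion P F B.
Hypothesis hBB : bracket_rate P F B B 1.
Variable H : R -> T -> R.
Hypothesis aH : adapted F H.
Hypothesis cH : {ae P, forall w, path_continuous (H^~ w)}.
Variables (r : R) (q : nat).
Hypotheses (rpos : 0 < r) (q0 : (0 < q)%N).

Let mu := @lebesgue_measure R.
Let N m := (q * 2 ^ m)%N.
Let r0 := ltW rpos.

Lemma step_error_small (dl eta : R) : 0 < dl -> 0 < eta ->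
  \forall m \near \oo, exists A, [/\ measurable A, (P A <= eta%:E)%E &
    forall w, ~ A w -> path_continuous (H^~ w) /\
      \int[mu]_(s in `]0, r]) step_error r q (H^~ w) m s ^+ 2 <= dl].
Proof.
move=> dl0 eta0; have [Z [mZ Z0 cHZ]] := cH.
have {}cHZ w : ~ Z w -> path_continuous (H^~ w) by move=> Zw; exact: contrapT (contra_not (@cHZ w) Zw).
(* Killing [H] on the null set makes all paths continuous, so that the integrated error is a
   pointwise limit of measurable sums. *)
pose H' s w := H s w * \1_(~` Z) w.
have H'E s w : ~ Z w -> H' s w = H s w.
  by move=> Zw; rewrite /H' indicE mem_set ?mulr1.
have cH' w : path_continuous (H'^~ w).
  have [Zw|Zw] := pselect (Z w).
    rewrite (_ : H'^~ w = cst 0); first by move=> s _; exact: cvg_cst.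
    by apply/funext => s; rewrite /H' indicE memNset ?mulr0//; apply; exact: Zw.
  by rewrite (_ : H'^~ w = H^~ w); [exact: cHZ|apply/funext => s; exact: H'E].
have mH' s : 0 <= s -> measurable_fun setT (H' s).
  move=> s0; apply: measurable_funM; first exact: adapted_measurable aH s0.
  by apply: measurable_indic; exact: measurableC.
pose X m w := \int[mu]_(s in `]0, r]) step_error r q (H'^~ w) m s ^+ 2.
have mX m : measurable_fun setT (X m).
  apply: (@measurable_fun_cvg _ _ _ _ (fun m' w => \sum_(l < N m')
     step_error r q (H'^~ w) m (gpt r (N m') l.+1) ^+ 2 * (r / (N m')%:R))).
    move=> m'; apply: measurable_sum => l; apply: measurable_funM => //.
    apply: measurable_funX; apply: measurable_funB.
      by apply: mH'; exact: gpt_ge0.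
    apply: measurable_sum => l'; apply: measurable_funM => //.
    by apply: mH'; exact: gpt_ge0.
  by move=> w _; have [_] := step_error_riemann rpos q0 m (cH' w).
have X0 w : X m w @[m --> \oo] --> 0 by exact: step_error_cvg0.
have := @cvg0_small_probability _ _ _ P X _ _ mX (aeW _ X0) dl0 eta0.
apply: filterS => m PX; exists (Z `|` [set w | dl <= `|X m w|]); split.
- by apply: measurableU => //; exact: measurable_ge_norm.
- apply: le_trans (probabilityU2 P mZ (measurable_ge_norm dl (mX m))) _.
  by rewrite Z0 add0e.
- move=> w /not_orP[Zw]; rewrite /= => /negP; rewrite -ltNge => Xw.
  split; first exact: cHZ.
  apply: le_trans (ltW (le_lt_trans (ler_norm _) Xw)).
  rewrite le_eqVlt; apply/orP; left; apply/eqP.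
  rewrite /X; suff -> : H'^~ w = H^~ w by [].
  by apply/funext => s; exact: H'E.
Qed.

Variable M : R -> T -> R.
Hypothesis itoM : ito_integral P F H B M.

(** The simple process [h n] and the dyadic step of [H] are both close to [H] in L^2 of time with
    high probability, hence to each other; [interval_tail] converts this into closeness of their
    integrals. *)
Lemma ito_grid_cvg (e eta : R) : 0 < e -> 0 < eta ->
  \forall m \near \oo, exists A, [/\ measurable A, (P A <= eta%:E)%E &
    [set w | e <= `|M r w - \sum_(l < N m) H (gpt r (N m) l) w *
       (B (gpt r (N m) l.+1) w - B (gpt r (N m) l) w)|] `<=` A].
Proof.
move=> e0 eta0; have [h [hadm hcvg]] := itoM.
have [cv1 cv2] := hcvg r r0.
(* With [4 * d1] and level [e / 2] the tail term is [eta / 4]; the other three quarters go to [A1],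
   [A2] and [A3]. The 4 comes from [(x + y)^2 <= 2 x^2 + 2 y^2]. *)
pose d1 := eta * e ^+ 2 / 64.
have d10 : 0 < d1 by rewrite divr_gt0// mulr_gt0// exprn_gt0.
have eta4 : 0 < eta / 4 by rewrite divr_gt0.
have [A1 [mA1 sA1 PA1]] := cv1 d1 d10.
have e20 : 0 < e / 2 by rewrite divr_gt0.
have [A2 [mA2 sA2 PA2]] := cv2 (e / 2) e20.
have small (A : nat -> set T) : (forall n, measurable (A n)) -> P (A n) @[n --> \oo] --> 0%E ->
    \forall n \near \oo, (P (A n) <= (eta / 4)%:E)%E.
  move=> mA /fine_cvgP[_ /cvgrPdist_lt/(_ _ eta4)]; apply: filterS => n.
  rewrite sub0r normrN => /ltW Hn.
  rewrite -[P (A n)]fineK ?fin_num_measure// lee_fin.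
  exact: le_trans (ler_norm _) Hn.
have [n [PA1n PA2n]] : exists n, (P (A1 n) <= (eta / 4)%:E)%E /\ (P (A2 n) <= (eta / 4)%:E)%E.
  have := filterI (small _ mA1 PA1) (small _ mA2 PA2).
  by move=> [k _ /(_ k (leqnn k)) H']; exists k.
have := step_error_small d10 eta4; apply: filterS => m [A3 [mA3 PA3 A3P]].
pose hn := h n; have hn_adm : admissible_simple F hn := hadm n.
pose K := simple_size hn.
pose t := simple_time hn.
have t_ge0 k : (k <= K)%N -> 0 <= t k.
  elim: k => [_|k ih kK]; first exact: simple_time_ge0 hn_adm.
  by rewrite (le_trans (ih (ltnW kK)))// (simple_time_mono hn_adm).
(* Indices below [K] are the intervals of the simple process clipped at [r]; the others are the grid
   cells, whose coefficients enter with a minus sign. *)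
pose a i := if (i < K)%N then Num.min r (t i) else gpt r (N m) (i - K).
pose b i := if (i < K)%N then Num.min r (t i.+1) else gpt r (N m) (i - K).+1.
(* An interval starting after [r] is clipped to a point. Its coefficient need not be known at time
   [r], so it is set to 0, which changes neither sum. *)
pose c i w := if (i < K)%N then (if t i <= r then simple_coef hn i w else 0)
  else - H (gpt r (N m) (i - K)) w.
have cE w s : 0 < s <= r -> \sum_(i < K + N m) c i w * (a i < s <= b i)%R%:R =
    (simple_value hn s w - H s w) + step_error r q (H^~ w) m s.
  move=> s0r; have /andP[s0 sr] := s0r; rewrite big_split_ord/= -/(N m).
  rewrite (eq_bigr (fun i : 'I_K => simple_coef hn i w * (t i < s <= t i.+1)%R%:R)); last first.
    move=> i _; rewrite /c /a /b ltn_ord gt_min (ltNge r) sr/= le_min sr/=.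
    case: (leP (t i) r) => // ti; rewrite mul0r ltNge (le_trans sr (ltW ti)) ?mulr0//.
  rewrite [X in _ + X](_ : _ = - gstep r (N m) (fun l => H (gpt r (N m) l) w) s).
    by rewrite /step_error /simple_value; ring.
  rewrite /gstep -sumrN; apply: eq_bigr => l _.
  by rewrite /c /a /b ltnNge leq_addr/= addKn mulNr.
have cB w : \sum_(i < K + N m) c i w * (B (b i) w - B (a i) w) =
    simple_integral hn B r w - \sum_(l < N m) H (gpt r (N m) l) w *
       (B (gpt r (N m) l.+1) w - B (gpt r (N m) l) w).
  rewrite big_split_ord/=; congr (_ + _).
    apply: eq_bigr => i _; rewrite /c /a /b ltn_ord -/t.
    case: ifPn => //; rewrite -ltNge => ri; rewrite (min_l (ltW ri)) min_l ?subrr ?mulr0//.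
    by rewrite (le_trans (ltW ri))// (simple_time_mono hn_adm).
  rewrite -sumrN; apply: eq_bigr => l _.
  by rewrite /c /a /b ltnNge leq_addr/= addKn mulNr.
have [||||A' [mA' sA' PA']] := @interval_tail _ _ _ P F hF B hB hBB (K + N m) a b c r
  (A1 n `|` A3) (4 * d1) (e / 2) _ _ (measurableU _ _ (mA1 n) mA3) _ e20 _.
- move=> i iKN; rewrite /a /b; case: ltnP => iK.
    rewrite le_min r0 t_ge0 ?(ltnW iK)//; split=> //; split; last by rewrite ge_min lexx.
    rewrite le_min !ge_min lexx/= (simple_time_mono hn_adm)// orbT//.
  have iN : (i - K < N m)%N by rewrite ltn_subLR.
  split; first exact: gpt_ge0.
  split; first exact: gpt_le.
  rewrite -[leRHS](@gptN _ r (N m)) ?gpt_le//.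
  exact: leq_ltn_trans (dyadic_gt q0 m).
- move=> i iKN; rewrite /c /a; case: ltnP => iK.
    have sF := filtration_sigma hF (t_ge0 i (ltnW iK)).
    have [ti|] := boolP (t i <= r); last rewrite -ltNge => ti.
      by rewrite min_r//; exact: (simple_coef_measurable hn_adm).
    by rewrite min_l ?ltW//; apply: measurable_wrt_cst; exact: filtration_sigma.
  have g0 := gpt_ge0 (N m) (i - K) r0.
  apply: (measurable_wrt_comp (f := -%R)) => //; first exact: filtration_sigma.
  exact: aH.
- by rewrite mulr_gt0.
- move=> w /not_orP[A1w A3w].
  have [cHw err] := A3P w A3w.
  have [iHw _] := riemann_left rpos q0 cHw.
  have [ierr _] := step_error_riemann rpos q0 m cHw.
  have mHw := Rintegrable_measurable iHw.
  have mval : measurable_fun `]0, r] (fun s => simple_value hn s w - H s w).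
    apply: measurable_funB => //; apply: measurable_sum => i.
    apply: measurable_funM => //.
    have -> : (fun x => (simple_time hn i < x <= simple_time hn i.+1)%R%:R) =
        \1_`]simple_time hn i, simple_time hn i.+1] :> (R -> R).
      apply/funext => x; rewrite indicE; congr (nat_of_bool _)%:R.
      by apply/idP/idP => [h'|/set_mem]; [apply/mem_set|]; rewrite /= in_itv.
    exact: measurable_indic.
  have val_small : (\int[mu]_(s in `]0%R, r]) ((simple_value hn s w - H s w) ^+ 2)%:E <= d1%:E)%E.
    rewrite integral_itv_obnd_cbnd; last first.
      by apply/measurable_EFinP; exact: measurable_funX.
    rewrite leNgt; apply/negP => /ltW big; apply: A1w; exact: (sA1 n).
  rewrite [leLHS](_ : _ = \int[mu]_(s in `]0%R, r])
      (((simple_value hn s w - H s w) + step_error r q (H^~ w) m s) ^+ 2)%:E)%E; last first.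
    by apply: eq_integral => s; rewrite inE/= in_itv/= => s0r; rewrite cE.
  apply: (@le_trans _ _ (\int[mu]_(s in `]0%R, r])
     (2%:E * ((simple_value hn s w - H s w) ^+ 2)%:E +
      2%:E * (step_error r q (H^~ w) m s ^+ 2)%:E))%E).
    have mse : measurable_fun `]0, r] (step_error r q (H^~ w) m).
      by apply: measurable_funB => //; exact: measurable_gstep.
    apply: ge0_le_integral => //.
    - by move=> s _; rewrite lee_fin sqr_ge0.
    - by apply/measurable_EFinP; apply: measurable_funX; exact: measurable_funD.
    - apply: emeasurable_funD; apply: measurable_funeM; apply/measurable_EFinP;
        exact: measurable_funX.
    - move=> s _; rewrite -!EFinM -EFinD lee_fin.
      have := sqr_ge0 (simple_value hn s w - H s w - step_error r q (H^~ w) m s).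
      by rewrite !expr2; nra.
  rewrite ge0_integralD//; last 4 first.
  - by move=> s _; rewrite -EFinM lee_fin mulr_ge0 ?sqr_ge0.
  - by apply: measurable_funeM; apply/measurable_EFinP; exact: measurable_funX.
  - by move=> s _; rewrite -EFinM lee_fin mulr_ge0 ?sqr_ge0.
  - apply: measurable_funeM; apply/measurable_EFinP; apply: measurable_funX.
    by apply: measurable_funB => //; exact: measurable_gstep.
  rewrite !ge0_integralZl//; last 4 first.
  - apply/measurable_EFinP; apply: measurable_funX.
    by apply: measurable_funB => //; exact: measurable_gstep.
  - by move=> s _; rewrite lee_fin sqr_ge0.
  - by apply/measurable_EFinP; exact: measurable_funX.
  - by move=> s _; rewrite lee_fin sqr_ge0.
  apply: (@le_trans _ _ (2%:E * d1%:E + 2%:E * d1%:E)%E).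
    apply: leeD; apply: lee_wpmul2l => //.
    by rewrite -EFin_Rintegral// lee_fin.
  by rewrite -!EFinM -EFinD lee_fin; lra.
exists (A' `|` A2 n); split.
- exact: measurableU.
- apply: le_trans (probabilityU2 P mA' (mA2 n)) _.
  have U := le_trans (probabilityU2 P (mA1 n) mA3) (leeD PA1n PA3).
  have PA'' := le_trans PA' (leeD U (lexx _)).
  apply: le_trans (leeD PA'' PA2n) _.
  rewrite -!EFinD lee_fin /d1 le_eqVlt; apply/orP; left; apply/eqP.
  by field; rewrite gt_eqF.
- move=> w /= ew; apply: contrapT => /not_orP[A'w A2w].
  have h1 : `|simple_integral hn B r w - M r w| < e / 2.
    by rewrite ltNge; apply/negP => big; apply: A2w; apply: (sA2 n); rewrite /= lee_fin.
  have h2 : `|\sum_(i < K + N m) c i w * (B (b i) w - B (a i) w)| < e / 2.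
    by rewrite ltNge; apply/negP => big; apply: A'w; exact: sA'.
  move: ew; rewrite leNgt => /negP; apply.
  rewrite cB in h2.
  rewrite -[M r w](subrK (simple_integral hn B r w)) -addrA.
  apply: le_lt_trans (ler_normD _ _) _.
  by rewrite distrC [e]splitr ltrD.
Qed.

End ito_grid.

(** * Paths in the weighted space and the mild equation *)

Section weighted_paths.
Context {R : realType}.
Variable om : nat -> R.
Hypothesis om0 : forall j, 0 < om j.
Implicit Types (f g : nat -> R) (z : R -> nat -> R).

Definition wsummable f := nsummable (fun j => `|f j| * om j).
Definition wnorm f := nsum (fun j => `|f j| * om j).

Let om_ge0 j : 0 <= om j. Proof. exact: ltW. Qed.

Let term_ge0 f j : 0 <= `|f j| * om j. Proof. exact: mulr_ge0. Qed.

Lemma wnorm_ge0 f : 0 <= wnorm f.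
Proof. exact: nsum_ge0. Qed.

Lemma wsummableD f g : wsummable f -> wsummable g -> wsummable (fun j => f j + g j).
Proof.
move=> sf sg; apply: nsummable_le (nsummableD sf sg) _ => j.
by rewrite (ger0_norm (term_ge0 (fun j => f j + g j) j)) -mulrDl ler_wpM2r ?ler_normD.
Qed.

Lemma wsummableB f g : wsummable f -> wsummable g -> wsummable (fun j => f j - g j).
Proof.
move=> sf sg; apply: nsummable_le (nsummableD sf sg) _ => j.
by rewrite (ger0_norm (term_ge0 (fun j => f j - g j) j)) -mulrDl ler_wpM2r ?ler_normB.
Qed.

Lemma wnormD f g : wsummable f -> wsummable g ->
  wnorm (fun j => f j + g j) <= wnorm f + wnorm g.
Proof.
move=> sf sg; rewrite /wnorm -nsumD//; apply: ler_nsum => //.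
- exact: wsummableD.
- exact: nsummableD.
- by move=> j; rewrite -mulrDl ler_wpM2r// ler_normD.
Qed.

Lemma wnormBC f g : wnorm (fun j => f j - g j) = wnorm (fun j => g j - f j).
Proof. by apply: eq_nsum => j; rewrite distrC. Qed.

Lemma wnorm_dist f g : wsummable f -> wsummable g ->
  `|wnorm f - wnorm g| <= wnorm (fun j => f j - g j).
Proof.
move=> sf sg; have sfg := wsummableB sf sg; have sgf := wsummableB sg sf.
rewrite ler_norml; apply/andP; split.
  rewrite lerNl opprB lerBlDr wnormBC.
  have := wnormD sgf sf; rewrite [X in X <= _ -> _](_ : _ = wnorm g)//.
  by apply: eq_nsum => j; rewrite subrK.
rewrite lerBlDr; have := wnormD sfg sg; rewrite [X in X <= _ -> _](_ : _ = wnorm f)//.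
by apply: eq_nsum => j; rewrite subrK.
Qed.

Lemma pairing_summable g f (C : R) : wsummable f -> (forall j, `|g j| <= C * om j) ->
  nsummable (fun j => g j * f j).
Proof.
move=> sf gC; apply: nsummable_le (nsummableZ C sf) _ => j.
by rewrite normrM [leRHS](_ : _ = C * om j * `|f j|) ?ler_wpM2r//; ring.
Qed.

Lemma pairing_bound g f (C : R) : wsummable f -> (forall j, `|g j| <= C * om j) ->
  `|nsum (fun j => g j * f j)| <= C * wnorm f.
Proof.
move=> sf gC; have sgf := pairing_summable sf gC.
apply: le_trans (ler_norm_nsum sgf) _; rewrite /wnorm -nsumZ//.
apply: ler_nsum.
- exact: Rintegrable_norm sgf.
- exact: nsummableZ.
- by move=> j; rewrite normrM [leRHS](_ : _ = C * om j * `|f j|) ?ler_wpM2r//; ring.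
Qed.

Record good_path z : Prop := {
  gp_summable : forall s, 0 <= s -> wsummable (z s);
  gp_cont : forall s, 0 <= s -> forall e, 0 < e -> exists2 dl, 0 < dl &
    forall s', 0 <= s' -> `|s - s'| < dl -> wnorm (fun j => z s j - z s' j) < e }.

Lemma good_path_site z j : good_path z -> path_continuous (z^~ j).
Proof.
move=> gz; apply/path_continuousP => s s0 e e0.
have [dl dl0 H] := gp_cont gz s0 (mulr_gt0 e0 (om0 j)).
exists dl => // x x0 sx; rewrite -(ltr_pM2r (om0 j)).
apply: le_lt_trans (H x x0 sx).
apply: (@term_le_nsum _ (fun j => `|z s j - z x j| * om j)).
  by move=> n; rewrite mulr_ge0// ltW.
by apply: wsummableB => //; exact: (gp_summable gz).
Qed.

Lemma good_path_dist z f : good_path z -> wsummable f ->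
  path_continuous (fun s => wnorm (fun j => z s j - f j)).
Proof.
move=> gz sf; apply/path_continuousP => s s0 e e0.
have [dl dl0 H] := gp_cont gz s0 e0; exists dl => // x x0 sx.
apply: le_lt_trans (H x x0 sx).
have := @wnorm_dist (fun j => z s j - f j) (fun j => z x j - f j).
move=> /(_ _ _)/le_trans; apply.
- by apply: wsummableB => //; exact: gp_summable gz _ s0.
- by apply: wsummableB => //; exact: gp_summable gz _ x0.
by rewrite le_eqVlt; apply/orP; left; apply/eqP/eq_nsum => j; rewrite opprB addrA subrK.
Qed.

Lemma good_path_norm z : good_path z -> path_continuous (fun s => wnorm (z s)).
Proof.
move=> gz; have sf0 : wsummable (fun=> 0).
  rewrite /wsummable; under eq_fun do rewrite normr0 mul0r.
  exact: nsummable_mask (fun=> 0) 0%N.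
have := good_path_dist gz sf0.
by under eq_fun do (under eq_fun do rewrite subr0).
Qed.

End weighted_paths.

(** * Localization by the weighted mass *)

Section localization.
Context {R : realType}.
Variable om : nat -> R.
Hypothesis om0 : forall j, 0 < om j.

Definition mass (y1 y2 : R -> nat -> R) L s : R :=
  \sum_(k < L) (`|y1 s k| + `|y2 s k|) * om k.

(* For continuous paths: the total mass stays below [N] on [[0, s]]. Only the
   rational fractions of [s] are tested, so that this is an event known at time [s]. *)
Definition stays (y1 y2 : R -> nat -> R) (N s : R) : Prop :=
  forall L i j : nat, (i <= j.+1)%N -> mass y1 y2 L (s * (i%:R / j.+1%:R)) <= N.

Variables y1 y2 : R -> nat -> R.

Lemma stays_mono N N' s : N <= N' -> stays y1 y2 N s -> stays y1 y2 N' s.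
Proof. by move=> NN' H L i j ij; rewrite (le_trans (H L i j ij)). Qed.

Lemma stays_mass N s L : stays y1 y2 N s -> mass y1 y2 L s <= N.
Proof. by move=> /(_ L 1%N 0%N isT); rewrite divff// mulr1. Qed.

Hypotheses (g1 : good_path om y1) (g2 : good_path om y2).

Lemma mass_continuous L : path_continuous (mass y1 y2 L).
Proof.
move=> s s0; rewrite /mass; elim: L => [|L IH].
  by under eq_fun do rewrite big_ord0; rewrite big_ord0; exact: cvg_cst.
under eq_fun do rewrite big_ord_recr/=.
rewrite big_ord_recr/=; apply: cvgD => //.
apply: cvgMl; apply: cvgD.
- by apply: cvg_norm; exact: (@good_path_site _ _ om0 _ L g1 s s0).
- by apply: cvg_norm; exact: (@good_path_site _ _ om0 _ L g2 s s0).
Qed.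

(** Each finite mass is continuous in time, so an excess at some [r] persists near [r] and is seen
    at a fraction of [s] with a large enough denominator. *)
Lemma staysP N s : 0 <= s ->
  stays y1 y2 N s <-> (forall r L, 0 <= r <= s -> mass y1 y2 L r <= N).
Proof.
move=> s0; split=> [H r L /andP[r0 rs]|H L i j ij]; last first.
  apply: H; apply/andP; split; first by rewrite mulr_ge0// divr_ge0.
  by rewrite ler_piMr// ler_pdivrMr ?ltr0n// mul1r ler_nat.
have [s_eq0|sn0] := eqVneq s 0.
  have -> : r = s by apply/eqP; rewrite eq_le rs s_eq0.
  exact: stays_mass.
have spos : 0 < s by rewrite lt_neqAle eq_sym sn0.
rewrite leNgt; apply/negP => Nm.
have /path_continuousP/(_ r r0 (mass y1 y2 L r - N)) := @mass_continuous L.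
rewrite subr_gt0 => /(_ Nm)[dl dl0 Hd].
(* a fraction i / (j + 1) of s within dl of r *)
pose j := Num.truncn (s / dl).
have jdl : s / j.+1%:R < dl.
  rewrite ltr_pdivrMr ?ltr0n// mulrC -ltr_pdivrMr//.
  by rewrite truncnS_gt.
pose i := Num.truncn (r / s * j.+1%:R).
have rsj : 0 <= r / s * j.+1%:R by rewrite mulr_ge0// divr_ge0.
have /andP[i1 i2] := truncn_itv rsj.
have ij : (i <= j.+1)%N.
  rewrite -(ler_nat R) (le_trans i1)// ler_piMl// ler_pdivrMr// mul1r//.
have x0 : 0 <= s * (i%:R / j.+1%:R) by rewrite mulr_ge0// divr_ge0.
have E : r = s * (r / s * j.+1%:R / j.+1%:R).
  by rewrite mulfK ?pnatr_eq0// mulrCA divff// mulr1.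
have D : `|r - s * (i%:R / j.+1%:R)| < dl.
  rewrite {1}E -mulrBr -mulrBl mulrA mulrAC normrM ger0_norm ?divr_ge0//.
  rewrite -[ltRHS]mulr1; apply: ltr_pM => //; first by rewrite divr_ge0.
  by rewrite ger0_norm ?subr_ge0// ltrBlDl -[X in _ + X]/(1%:R) -natrD addn1.
have := Hd _ x0 D; rewrite ltr_norml => /andP[_].
have := H L i j ij; lra.
Qed.

Lemma stays_le N r s : 0 <= r <= s -> stays y1 y2 N s -> stays y1 y2 N r.
Proof.
move=> /andP[r0 rs]; have s0 : 0 <= s by exact: le_trans rs.
move=> /(staysP _ s0) H; apply/(staysP _ r0) => x L /andP[x0 xr].
by apply: H; rewrite x0 (le_trans xr).
Qed.

(** The event shrinks with time. If it fails at [s], a strict excess occurs no later than [s], and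
    by continuity strictly before, so it fails already slightly earlier: the localizing indicator is
    left-continuous. *)
Lemma stays_left N s : 0 < s -> exists2 dl, 0 < dl &
  forall r, 0 <= r -> s - dl < r <= s -> stays y1 y2 N r <-> stays y1 y2 N s.
Proof.
move=> s0; have [Hs|Hs] := pselect (stays y1 y2 N s).
  exists 1 => // r r0 /andP[_ rs]; split=> // _.
  by apply: stays_le Hs; rewrite r0.
have [r1 [r1s H1]] : exists r1, 0 <= r1 < s /\ exists L, N < mass y1 y2 L r1.
  have /existsNP[r /existsNP[L /not_implyP[rs /negP]]] :
    ~ (forall r L, 0 <= r <= s -> mass y1 y2 L r <= N) by move=> /(staysP _ (ltW s0)).
  rewrite -ltNge => Nm; move: rs => /andP[r0]; rewrite le_eqVlt => /predU1P[E|rs]; last first.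
    by exists r; split; [rewrite r0|exists L].
  have /path_continuousP/(_ r r0 (mass y1 y2 L r - N)) := @mass_continuous L.
  rewrite subr_gt0 => /(_ Nm)[dl dl0 Hd].
  pose m := Num.min (s / 2) (dl / 2).
  have m0 : 0 < m by rewrite lt_min !divr_gt0.
  have ms : m <= s / 2 by rewrite ge_min lexx.
  have mdl : m <= dl / 2 by rewrite ge_min lexx orbT.
  exists (s - m); split; first by apply/andP; split; lra.
  exists L; have sm0 : 0 <= s - m by lra.
  have mdl' : `|r - (s - m)| < dl.
    by rewrite E [X in `|X|](_ : _ = m) ?ger0_norm; [lra|lra|ring].
  have := Hd (s - m) sm0 mdl'; rewrite ltr_norml => /andP[_]; lra.
have /andP[r10 r1s'] := r1s; have [L HL] := H1.
exists (s - r1); first by rewrite subr_gt0.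
move=> r r0 /andP[r1r rs]; split=> [Hr|//].
have {}r1r : r1 < r by lra.
move/(staysP _ r0) : Hr => /(_ r1 L); rewrite r10 ltW// => /(_ isT).
by rewrite leNgt HL.
Qed.

Lemma stays_eventually s : 0 <= s -> exists N0 : R, forall N, N0 <= N -> stays y1 y2 N s.
Proof.
move=> s0; have [C1 H1] := path_bounded s (good_path_norm om0 g1).
have [C2 H2] := path_bounded s (good_path_norm om0 g2).
exists (C1 + C2) => N CN; apply/staysP => // r L rs.
have /andP[r0 _] := rs.
apply: le_trans CN; rewrite /mass.
under eq_bigr do rewrite mulrDl.
rewrite big_split/=; apply: lerD.
  apply: le_trans (le_trans (ler_norm _) (H1 r rs)).
  apply: (@partial_le_nsum _ (fun k => `|y1 r k| * om k)).
    by move=> k; rewrite mulr_ge0// ltW.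
  exact: (gp_summable g1).
apply: le_trans (le_trans (ler_norm _) (H2 r rs)).
apply: (@partial_le_nsum _ (fun k => `|y2 r k| * om k)).
  by move=> k; rewrite mulr_ge0// ltW.
exact: (gp_summable g2).
Qed.

End localization.

(** Tonelli is applied to [|f|] and to [|f| + f], both nonnegative; [g] provides the integrable
    bound on the absolute sums. *)
Lemma Rintegral_nsum_signed d (T : measurableType d) (R : realType)
    (mu : {measure set T -> \bar R}) (D : set T) (mD : measurable D)
    (f : nat -> T -> R) (g : T -> R) :
  (forall j, measurable_fun D (f j)) ->
  (forall x, D x -> nsummable (f^~ x)) -> Rintegrable mu D g ->
  (forall x, D x -> nsum (fun j => `|f j x|) <= g x) ->
  nsummable (fun j => \int[mu]_(x in D) f j x) /\
  \int[mu]_(x in D) nsum (f^~ x) = nsum (fun j => \int[mu]_(x in D) f j x).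
Proof.
move=> mf sf ig fg.
have sa x : D x -> nsummable (fun j => `|f j x|).
  by move=> Dx; exact: Rintegrable_norm (sf x Dx).
have sp x : D x -> nsummable (fun j => `|f j x| + f j x).
  by move=> Dx; apply: nsummableD; [exact: sa|exact: sf].
have ma j : measurable_fun D (fun x => `|f j x|) by exact: measurableT_comp (mf j).
have mp j : measurable_fun D (fun x => `|f j x| + f j x) by exact: measurable_funD.
have iA : Rintegrable mu D (fun x => nsum (fun j => `|f j x|)).
  apply: (Rintegrable_le mD _ ig).
    exact: measurable_nsum.
  move=> x Dx; rewrite ger0_norm ?fg//; exact: nsum_ge0.
have iB : Rintegrable mu D (fun x => nsum (fun j => `|f j x| + f j x)).
  apply: (@Rintegrable_le _ _ _ _ _ mD _ (fun x => g x + g x)).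
  - exact: measurable_nsum.
  - exact: RintegrableD.
  - move=> x Dx; rewrite ger0_norm; last first.
      by apply: nsum_ge0 => j; rewrite -lerBlDr sub0r lerNl lerNnormlW.
    rewrite nsumD; [|exact: sa|exact: sf].
    apply: lerD; first exact: fg.
    by apply: le_trans (le_trans (ler_norm _) (ler_norm_nsum (sf x Dx))) (fg x Dx).
have p0 j x : 0 <= `|f j x| + f j x by rewrite -lerBlDr sub0r lerNl lerNnormlW.
have [ia sia Ea] := Rintegral_nsum mD (fun j x _ => normr_ge0 (f j x)) ma sa iA.
have [ib sib Eb] := Rintegral_nsum mD (fun j x _ => p0 j x) mp sp iB.
have E j : \int[mu]_(x in D) f j x =
    \int[mu]_(x in D) (`|f j x| + f j x) - \int[mu]_(x in D) `|f j x|.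
  by rewrite -RintegralB//; apply: Rintegral_eq => x _; rewrite addrC addKr.
have S : nsummable (fun j => \int[mu]_(x in D) f j x).
  by under eq_fun do rewrite E; exact: nsummableB.
split=> //; rewrite [RHS](eq_nsum E) nsumB// -Ea -Eb -RintegralB//.
apply: Rintegral_eq => x Dx; rewrite -nsumB; [|exact: sp|exact: sa].
by apply: eq_nsum => j; rewrite addrC addKr.
Qed.

(** * Integration by parts along a path *)

Section pathwise_mild.
Context {R : realType}.
Variable om : nat -> R.
Hypothesis om0 : forall j, 0 < om j.
Let mu := @lebesgue_measure R.

Definition wpair (g f : nat -> R) := nsum (fun j => g j * f j).

Lemma wpair_summable (g f : nat -> R) (C : R) : wsummable om f ->
  (forall j, `|g j| <= C * om j) -> nsummable (fun j => g j * f j).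
Proof. exact: pairing_summable. Qed.

Lemma wpair_le (g f : nat -> R) (C : R) : wsummable om f ->
  (forall j, `|g j| <= C * om j) -> `|wpair g f| <= C * wnorm om f.
Proof. exact: pairing_bound. Qed.

Lemma wpairB (g f f' : nat -> R) (C : R) :
  wsummable om f -> wsummable om f' -> (forall j, `|g j| <= C * om j) ->
  wpair g (fun j => f j - f' j) = wpair g f - wpair g f'.
Proof.
move=> sf sf' gC; rewrite /wpair -nsumB; try exact: pairing_summable gC.
by apply: eq_nsum => j; rewrite mulrBr.
Qed.

Lemma wpairBl (g g' f : nat -> R) (C C' : R) : wsummable om f ->
  (forall j, `|g j| <= C * om j) -> (forall j, `|g' j| <= C' * om j) ->
  wpair (fun j => g j - g' j) f = wpair g f - wpair g' f.
Proof.
move=> sf gC gC'; rewrite /wpair -nsumB; [|exact: pairing_summable gC|exact: pairing_summable gC'].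
by apply: eq_nsum => j; rewrite mulrBl.
Qed.

Lemma path_measurable (h : R -> R) (r s : R) : 0 <= r -> path_continuous h ->
  measurable_fun `]r, s] h.
Proof.
move=> r0 ch; have [rs|sr] := leP r s; last first.
  by rewrite set_itv_ge ?bnd_simp -?leNgt ?ltW//; exact: measurable_fun_set0.
have s0 := le_trans r0 rs.
have [/Rintegrable_measurable ih _] := riemann_left (ltr01 : 0 < 1) (ltnSn 0) ch.
apply: (@measurable_funS _ _ _ _ `]0, s]) => //.
  by apply: subset_itv; rewrite bnd_simp.
move: s0; rewrite le_eqVlt => /predU1P[<-|s0].
  by rewrite set_itv_ge ?bnd_simp ?ltxx//; exact: measurable_fun_set0.
by have [/Rintegrable_measurable] := riemann_left s0 (ltnSn 0) ch.
Qed.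

Variables u b : R -> nat -> R.
Hypotheses (gu : good_path om u) (gb : good_path om b).

(** What remains of [u] after removal of the initial value and the drift: along a solution, the path
    of the stochastic integral. *)
Definition defect (r : R) j := u r j - u 0 j - \int[mu]_(s in `]0, r]) b s j.

Variables (w z : R -> nat -> R) (C t : R).
Hypothesis t0 : 0 < t.
Hypothesis w_bound : forall s j, 0 <= s -> `|w s j| <= C * om j.
Hypothesis z_bound : forall s j, 0 <= s -> `|z s j| <= C * om j.
Hypothesis z_lip : forall s s' j, 0 <= s -> 0 <= s' ->
  `|z s j - z s' j| <= C * `|s - s'| * om j.
Hypothesis w_taylor : forall s h j, 0 <= s -> 0 <= h -> s + h <= t ->
  `|w (s + h) j - w s j + h * z (s + h) j| <= C * h ^+ 2 * om j.
Hypothesis wz : forall s s', 0 <= s -> 0 <= s' -> wpair (w s) (b s') = wpair (z s) (u s').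

Let C0 : 0 <= C.
Proof. by have := le_trans (normr_ge0 _) (w_bound 0%N (lexx 0)); rewrite pmulr_lge0. Qed.

Let G s := wpair (z s) (u s).

Let G_cont : path_continuous G.
Proof.
have [S hS] := path_bounded (t + t) (good_path_norm om0 gu).
apply/path_continuousP => s s0 e e0.
have nu := good_path_norm om0 gu.
have [S' hS'] := path_bounded (s + 1) nu.
have S'0 : 0 <= S' by apply: le_trans (hS' s _); rewrite ?normr_ge0// s0 lerDl ler01.
have e1 : 0 < e / (2 * (C + 1)) by rewrite divr_gt0// mulr_gt0// ltr_wpDl.
have [dl dl0 Hd] := gp_cont gu s0 e1.
exists (Num.min (Num.min dl 1) (e / (2 * ((C + 1) * (S' + 1))))).
  rewrite !lt_min dl0 ltr01/= divr_gt0// !mulr_gt0// ltr_wpDl//.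
move=> x x0; rewrite !lt_min => /andP[/andP[sd s1] se].
have su := gp_summable gu.
rewrite /G (_ : _ - _ = wpair (z s) (fun j => u s j - u x j) + wpair (fun j => z s j - z x j) (u x)); last first.
  rewrite (wpairB (su s s0) (su x x0) (fun j => z_bound j s0)).
  rewrite (wpairBl (su x x0) (fun j => z_bound j s0) (fun j => z_bound j x0)); ring.
apply: le_lt_trans (ler_normD _ _) _.
have A : `|wpair (z s) (fun j => u s j - u x j)| <= C * (e / (2 * (C + 1))).
  apply: le_trans (@wpair_le _ _ C _ (fun j => z_bound j s0)) _.
    by apply: wsummableB => //; exact: su.
  by rewrite ler_wpM2l// ltW// Hd.
have B : `|wpair (fun j => z s j - z x j) (u x)| <= C * `|s - x| * S'.
  apply: le_trans (@wpair_le _ _ (C * `|s - x|) (su x x0) (fun j => z_lip j s0 x0)) _.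
  rewrite ler_wpM2l ?mulr_ge0//; apply: le_trans (ler_norm _) (hS' x _).
  rewrite x0/=; move: s1; rewrite ltr_norml => /andP[+ _]; lra.
have A' : C * (e / (2 * (C + 1))) < e / 2.
  rewrite mulrA ltr_pdivrMr ?mulr_gt0 ?ltr_wpDl// [ltRHS](_ : _ = e * (C + 1)); last by field.
  by rewrite mulrC ltr_pM2l// ltrDl.
have B' : C * `|s - x| * S' <= e / 2.
  have CS : 0 < (C + 1) * (S' + 1) by rewrite mulr_gt0// ltr_wpDl.
  apply: (@le_trans _ _ (((C + 1) * (S' + 1)) * `|s - x|)).
    rewrite mulrAC ler_wpM2r//; apply: ler_pM => //; rewrite lerDl//.
  rewrite mulrC -ler_pdivlMr//; apply: le_trans (ltW se) _.
  by rewrite invfM mulrA.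
lra.
Qed.

Let integrable_path (h : R -> R) (r s : R) : 0 <= r -> path_continuous h ->
  Rintegrable mu `]r, s] h.
Proof.
move=> r0 ch; have [Ch hCh] := path_bounded s ch.
apply: (@Rintegrable_bounded _ _ _ _ _ _ _ Ch) => //.
- have : (lebesgue_measure (`]r, s] : set R) < +oo)%E.
    by rewrite lebesgue_measure_itv/=; case: ifP => // _; rewrite -EFinB ltry.
  exact.
- exact: path_measurable.
- move=> x /=; rewrite in_itv/= => /andP[rx xs]; apply: hCh.
  by rewrite xs (le_trans r0)// ltW.
Qed.

Let integral_pathB (h : R -> R) (r s : R) : 0 <= r <= s -> path_continuous h ->
  \int[mu]_(x in `]0, s]) h x - \int[mu]_(x in `]0, r]) h x = \int[mu]_(x in `]r, s]) h x.
Proof.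
move=> /andP[r0 rs] ch; apply: Rintegral_itvB; rewrite ?bnd_simp//.
exact: integrable_path.
Qed.

Let integral_le (h : R -> R) (r s D : R) : 0 <= r <= s -> Rintegrable mu `]r, s] h ->
  (forall x, r < x <= s -> `|h x| <= D) -> `|\int[mu]_(x in `]r, s]) h x| <= D * (s - r).
Proof.
move=> /andP[r0 rs] ih hD; apply: le_trans (le_normr_Rintegral _ ih) _ => //.
apply: (@le_trans _ _ (\int[mu]_(x in `]r, s]) D)).
  have mD : measurable (`]r, s] : set R) by [].
  apply: le_Rintegral => //.
  - exact: Rintegrable_norm.
  - apply: (@Rintegrable_bounded _ _ _ _ _ _ _ `|D|) => //.
    have : (lebesgue_measure (`]r, s] : set R) < +oo)%E.
      by rewrite lebesgue_measure_itv/=; case: ifP => // _; rewrite -EFinB ltry.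
    exact.
rewrite Rintegral_cst//.
have E : (mu `]r, s] = (s - r)%:E)%E.
  apply: (eq_trans (lebesgue_measure_itv `]r, s])) => /=.
  move: rs; rewrite le_eqVlt lte_fin => /predU1P[->|->].
    by rewrite ltxx subrr.
  by rewrite EFinB.
rewrite le_eqVlt; apply/orP; left; apply/eqP; congr (_ * _); exact: (congr1 fine E).
Qed.

Let su s : 0 <= s -> wsummable om (u s) := gp_summable gu (s := s).
Let sb s : 0 <= s -> wsummable om (b s) := gp_summable gb (s := s).

(** On one cell the weighted increment of the defect is the boundary difference of the pairing plus
    the error of a one-point quadrature of [G]. The Taylor bound on [w] and the Lipschitz bound on
    [z] make the remainder quadratic in the length. *)
Let cell_sum (S r s : R) : 0 <= r <= s -> s <= t -> (forall x, 0 <= x <= t -> wnorm om (u x) <= S) ->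
  nsummable (fun j => w r j * (defect s j - defect r j)) /\
  `|nsum (fun j => w r j * (defect s j - defect r j)) - (wpair (w s) (u s) - wpair (w r) (u r))
    - ((s - r) * G s - \int[mu]_(x in `]r, s]) G x)| <= 2 * C * (s - r) ^+ 2 * S.
Proof.
move=> rs st hS; have /andP[r0 rs'] := rs; have s0 : 0 <= s := le_trans r0 rs'.
have S0 : 0 <= S by apply: le_trans (hS 0 _); [exact: wnorm_ge0|rewrite lexx ltW].
have [Bb hBb] := path_bounded s (good_path_norm om0 gb).
have mD : measurable (`]r, s] : set R) by [].
have x_in x : (`]r, s]%classic : set R) x -> [/\ 0 <= x, x <= s & r < x].
  by rewrite /= in_itv/= => /andP[rx xs]; split=> //; rewrite (le_trans r0)// ltW.
have bw x j : `|w r j * b x j| <= C * (`|b x j| * om j).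
  by rewrite normrM [leRHS](_ : _ = C * om j * `|b x j|) ?ler_wpM2r ?w_bound//; ring.
have [sI EI] : nsummable (fun j => \int[mu]_(x in `]r, s]) (w r j * b x j)) /\
    \int[mu]_(x in `]r, s]) nsum (fun j => w r j * b x j) =
    nsum (fun j => \int[mu]_(x in `]r, s]) (w r j * b x j)).
  apply: (@Rintegral_nsum_signed _ _ _ mu _ mD (fun j x => w r j * b x j) (fun=> C * Bb)).
  - move=> j; apply: measurable_funM => //.
    by apply: path_measurable => //; exact: (good_path_site om0 gb).
  - by move=> x /x_in[x0 _ _]; exact: (wpair_summable (sb x0) (fun j => w_bound j r0)).
  - by apply: integrable_path => // x x0; exact: cvg_cst.
  - move=> x /x_in[x0 xs _]; apply: (@le_trans _ _ (C * wnorm om (b x))); last first.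
      by rewrite ler_wpM2l// (le_trans (ler_norm _) (hBb x _))// x0.
    rewrite /wnorm -nsumZ; last exact: sb.
    apply: ler_nsum => //.
      apply: Rintegrable_norm; exact: (wpair_summable (sb x0) (fun j => w_bound j r0)).
    by apply: nsummableZ; exact: sb.
have D j : w r j * (defect s j - defect r j) =
    w r j * (u s j - u r j) - \int[mu]_(x in `]r, s]) (w r j * b x j).
  rewrite RintegralZl//; last first.
    by apply: integrable_path => //; exact: (good_path_site om0 gb).
  rewrite -(integral_pathB rs (good_path_site om0 gb (j := j))) /defect; ring.
have sU : nsummable (fun j => w r j * (u s j - u r j)).
  by apply: (wpair_summable _ (fun j => w_bound j r0)); apply: wsummableB => //; exact: su.
split; first by under eq_fun do rewrite D; exact: nsummableB.
rewrite (eq_nsum D) nsumB// -EI.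
rewrite -/(wpair (w r) (fun j => u s j - u r j)) (wpairB (su s0) (su r0) (fun j => w_bound j r0)).
have -> : \int[mu]_(x in `]r, s]) nsum (fun j => w r j * b x j) =
    \int[mu]_(x in `]r, s]) wpair (z r) (u x).
  by apply: Rintegral_eq => x /x_in[x0 _ _]; exact: wz.
have TT : `|wpair (fun j => w s j - w r j + (s - r) * z s j) (u s)| <= C * (s - r) ^+ 2 * S.
  have H j : `|w s j - w r j + (s - r) * z s j| <= C * (s - r) ^+ 2 * om j.
    by have := @w_taylor r (s - r) j r0; rewrite subrKC subr_ge0; exact.
  apply: le_trans (wpair_le (su s0) H) _.
  by apply: ler_wpM2l; [rewrite mulr_ge0 ?sqr_ge0|apply: hS; rewrite s0].
have ET : wpair (fun j => w s j - w r j + (s - r) * z s j) (u s) =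
    wpair (w s) (u s) - wpair (w r) (u s) + (s - r) * G s.
  rewrite /G /wpair -nsumZ; last exact: (wpair_summable (su s0) (fun j => z_bound j s0)).
  rewrite -nsumB; try exact: (wpair_summable (su s0) (fun j => w_bound j _)).
  rewrite -nsumD; first by apply: eq_nsum => j; ring.
  - by apply: nsummableB; exact: (wpair_summable (su s0) (fun j => w_bound j _)).
  - by apply: nsummableZ; exact: (wpair_summable (su s0) (fun j => z_bound j s0)).
have zrx x : r < x <= s -> wpair (z r) (u x) - G x = wpair (fun j => z r j - z x j) (u x).
  move=> /andP[rx xs]; have x0 : 0 <= x by rewrite (le_trans r0)// ltW.
  by rewrite (wpairBl (su x0) (fun j => z_bound j r0) (fun j => z_bound j x0)).
have zrx_le x : r < x <= s -> `|wpair (z r) (u x) - G x| <= C * (s - r) * S.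
  move=> rxs; rewrite zrx//; move/andP : rxs => [rx xs].
  have x0 : 0 <= x by rewrite (le_trans r0)// ltW.
  apply: le_trans (wpair_le (su x0) (fun j => z_lip j r0 x0)) _.
  apply: ler_pM => //; rewrite ?mulr_ge0 ?wnorm_ge0//.
    by apply: ler_wpM2l => //; rewrite distrC ger0_norm; lra.
  by rewrite hS// x0 (le_trans xs).
have iz : Rintegrable mu `]r, s] (fun x => wpair (z r) (u x)).
  apply: integrable_path => // ; apply/path_continuousP => x x0 e e0.
  have e1 : 0 < e / (C + 1) by rewrite divr_gt0// ltr_wpDl.
  have [dl dl0 Hd] := gp_cont gu x0 e1; exists dl => // y y0 xy.
  rewrite -(wpairB (su x0) (su y0) (fun j => z_bound j r0)).
  apply: le_lt_trans (@wpair_le _ _ _ _ (fun j => z_bound j r0)) _.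
    by apply: wsummableB => //; exact: su.
  apply: (@le_lt_trans _ _ (C * (e / (C + 1)))).
    by rewrite ler_wpM2l// ltW// Hd.
  by rewrite mulrA ltr_pdivrMr ?ltr_wpDl// mulrC ltr_pM2l// ltrDl.
have iG : Rintegrable mu `]r, s] G by exact: integrable_path.
have II : `|\int[mu]_(x in `]r, s]) wpair (z r) (u x) - \int[mu]_(x in `]r, s]) G x|
    <= C * (s - r) * S * (s - r).
  rewrite -RintegralB//; apply: integral_le => //.
  exact: RintegrableB.
rewrite [X in `|X|](_ : _ = - wpair (fun j => w s j - w r j + (s - r) * z s j) (u s) -
  (\int[mu]_(x in `]r, s]) wpair (z r) (u x) - \int[mu]_(x in `]r, s]) G x)); last first.
  rewrite ET; ring.
apply: le_trans (ler_normB _ _) _; rewrite normrN.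
rewrite [leRHS](_ : _ = C * (s - r) ^+ 2 * S + C * (s - r) * S * (s - r)); last by ring.
exact: lerD.
Qed.

Let N n := (2 ^ n)%N.

(** Here [z] is minus the time derivative of [w], and [wz] transfers the drift onto the weight. The
    motion of the weight and the drift therefore cancel, and only boundary terms survive; the cell
    errors are quadratic in the mesh, so their sum vanishes. *)
Lemma pathwise_mild :
  (forall n k, (k < N n)%N ->
     nsummable (fun j => w (gpt t (N n) k) j * (defect (gpt t (N n) k.+1) j - defect (gpt t (N n) k) j))) /\
  \sum_(k < N n) nsum (fun j => w (gpt t (N n) k) j * (defect (gpt t (N n) k.+1) j - defect (gpt t (N n) k) j))
    @[n --> \oo] --> wpair (w t) (u t) - wpair (w 0) (u 0).
Proof.
have [S hS'] := path_bounded t (good_path_norm om0 gu).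
have hS x : 0 <= x <= t -> wnorm om (u x) <= S.
  by move=> /hS'; apply: le_trans; exact: ler_norm.
have t0' := ltW t0.
have gN n : gpt t (N n) (N n) = t by rewrite gptN ?expn_gt0.
have cell n k : (k < N n)%N -> 0 <= gpt t (N n) k <= gpt t (N n) k.+1 /\ gpt t (N n) k.+1 <= t.
  by move=> kn; rewrite gpt_ge0//= gpt_le// -[X in _ <= X](gN n) gpt_le.
split=> [n k kn|]; first by have [c1 c2] := cell n k kn; have [] := cell_sum c1 c2 hS.
set Y := (X in X @ _).
pose V := wpair (w t) (u t) - wpair (w 0) (u 0).
pose Gs n := \sum_(k < N n) G (gpt t (N n) k.+1) * (t / (N n)%:R).
have gt_in m l : (l < N m)%N -> 0 <= gpt t (N m) l.+1 <= t.
  by move=> /cell[/andP[c1 c2] ->]; rewrite (le_trans c1 c2).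
have Ngt n : (n < N n)%N by exact: ltn_expl.
have tag m l x : gcell t (N m) l x ->
    0 <= gpt t (N m) l.+1 /\ `|x - gpt t (N m) l.+1| <= t / (N m)%:R.
  move=> /gcell_dist[_ /andP[c1 c2]]; split; first exact: gpt_ge0.
  by rewrite distrC ger0_norm// ltW.
have [iG cG] := riemann_path t0' G_cont Ngt tag gt_in.
have E n : `|Y n - V - (Gs n - \int[mu]_(x in `]0, t]) G x)| <= 2 * C * S * t * (t / (N n)%:R).
  have -> : V = \sum_(k < N n) (wpair (w (gpt t (N n) k.+1)) (u (gpt t (N n) k.+1)) -
      wpair (w (gpt t (N n) k)) (u (gpt t (N n) k))).
    rewrite -(big_mkord xpredT (fun k => wpair (w (gpt t (N n) k.+1)) (u (gpt t (N n) k.+1)) -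
      wpair (w (gpt t (N n) k)) (u (gpt t (N n) k)))).
    by rewrite telescope_sumr// gN gpt0.
  have -> : \int[mu]_(x in `]0, t]) G x = \sum_(k < N n) \int[mu]_(x in `]gpt t (N n) k, gpt t (N n) k.+1]) G x.
    pose I s := \int[mu]_(x in `]0, s]) G x.
    transitivity (\sum_(0 <= k < N n) (I (gpt t (N n) k.+1) - I (gpt t (N n) k))).
      rewrite telescope_sumr// gN gpt0 /I [X in _ - X](_ : _ = 0) ?subr0//.
      by rewrite set_itv_ge ?bnd_simp ?ltxx// Rintegral_set0.
    rewrite big_mkord; apply: eq_bigr => k _; apply: integral_pathB => //.
    by have [] := cell n k (ltn_ord k).
  rewrite /Y /Gs -!sumrB; apply: le_trans (ler_norm_sum _ _ _) _.
  apply: (@le_trans _ _ (\sum_(k < N n) 2 * C * (t / (N n)%:R) ^+ 2 * S)).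
    apply: ler_sum => k _; have [c1 c2] := cell n k (ltn_ord k).
    have [_] := cell_sum c1 c2 hS; rewrite gptS; apply: le_trans.
    by rewrite [_ * G _]mulrC.
  rewrite sumr_const card_ord -[leLHS]mulr_natr le_eqVlt; apply/orP; left; apply/eqP.
  by field; rewrite pnatr_eq0 -lt0n expn_gt0.
have Z0 : (Y n - V - (Gs n - \int[mu]_(x in `]0, t]) G x)) @[n --> \oo] --> 0.
  apply/cvgrPdist_lt => e e0.
  have : 2 * C * S * t * (t / (N n)%:R) @[n --> \oo] --> 0.
    rewrite -[X in _ --> X](mulr0 (2 * C * S * t)); apply: cvgMr.
    exact: mesh_cvg0 Ngt.
  move=> /cvgrPdist_lt/(_ e e0); apply: filterS => n.
  rewrite !sub0r !normrN; apply: le_lt_trans.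
  by apply: le_trans (E n) (ler_norm _).
rewrite (_ : Y = fun n => (Y n - V - (Gs n - \int[mu]_(x in `]0, t]) G x)) +
    (Gs n - \int[mu]_(x in `]0, t]) G x) + V); last by apply/funext => n; ring.
rewrite -/V -[X in _ --> X]add0r; apply: cvgD; last exact: cvg_cst.
rewrite -[X in _ --> X](addr0 0); apply: cvgD => //.
rewrite -[X in _ --> X](subrr (\int[mu]_(x in `]0, t]) G x)).
by apply: cvgB; [exact: cG|exact: cvg_cst].
Qed.

End pathwise_mild.

(** * Smallness in probability and the mild equation *)

Section covered_events.
Context (R : realType) disp (T : measurableType disp) (P : probability T R).
Implicit Types (E : set T) (X Y : nat -> T -> R) (eta : R).

(* Paths are regular only almost surely, so that [E] need not be measurable. *)
Definition covered eta E :=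
  exists A, [/\ measurable A, (P A <= eta%:E)%E & E `<=` A].

Lemma coveredS eta E (E' : set T) : E `<=` E' -> covered eta E' -> covered eta E.
Proof. by move=> EE' [A [mA PA EA]]; exists A; split=> //; exact: subset_trans EE' EA. Qed.

Lemma coveredU eta (eta' : R) E (E' : set T) : covered eta E -> covered eta' E' ->
  covered (eta + eta') (E `|` E').
Proof.
move=> [A [mA PA EA]] [A' [mA' PA' EA']]; exists (A `|` A'); split.
- exact: measurableU.
- by apply: le_trans (probabilityU2 P mA mA') _; rewrite EFinD leeD.
- exact: setUSS.
Qed.

Lemma covered_ae eta E (E' : set T) : {ae P, forall w, E w -> E' w} -> covered eta E' ->
  covered eta E.
Proof.
move=> [Z [mZ PZ EZ]] [A [mA PA EA]]; exists (A `|` Z); split.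
- exact: measurableU.
- apply: le_trans (probabilityU2 P mA mZ) _.
  by rewrite -[leRHS]adde0; apply: leeD => //; rewrite PZ.
- move=> w Ew; have [E'w|nE'w] := pselect (E' w); first by left; exact: EA.
  by right; apply: EZ => /(_ Ew).
Qed.

Definition small_in_prob (X : nat -> T -> R) := forall e eta : R, 0 < e -> 0 < eta ->
  \forall m \near \oo, covered eta [set w | e <= `|X m w|].

Lemma small0 : small_in_prob (fun _ _ => 0).
Proof.
move=> e eta e0 eta0; apply: nearW => m; exists set0; split=> //.
  by rewrite measure0 lee_fin ltW.
by move=> w /=; rewrite normr0 leNgt e0.
Qed.

Lemma smallD X Y : small_in_prob X -> small_in_prob Y ->
  small_in_prob (fun m w => X m w + Y m w).
Proof.
move=> sX sY e eta e0 eta0.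
have e2 : 0 < e / 2 by rewrite divr_gt0.
have eta2 : 0 < eta / 2 by rewrite divr_gt0.
apply: filterS2 (sX _ _ e2 eta2) (sY _ _ e2 eta2) => m cX cY.
rewrite [eta](splitr eta); apply: coveredS (coveredU cX cY).
move=> w /= h; have [hX|hX] := leP (e / 2) `|X m w|; first by left.
right; have := ler_normD (X m w) (Y m w); lra.
Qed.

Lemma smallZ (c : R) X : small_in_prob X -> small_in_prob (fun m w => c * X m w).
Proof.
move=> sX e eta e0 eta0; have c1 : 0 < `|c| + 1 by rewrite ltr_wpDl.
apply: filterS (sX _ _ (divr_gt0 e0 c1) eta0) => m; apply: coveredS => w /= h.
rewrite ler_pdivrMr//; apply: le_trans h _.
by rewrite normrM mulrC ler_wpM2l// lerDl ler01.
Qed.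

Lemma small_sum (I : Type) (r : seq I) (X : I -> nat -> T -> R) :
  (forall i, small_in_prob (X i)) -> small_in_prob (fun m w => \sum_(i <- r) X i m w).
Proof.
move=> sX; elim: r => [|i r IH].
  rewrite (_ : (fun _ _ => _) = fun _ _ => 0); first exact: small0.
  by apply/funext => m; apply/funext => w; rewrite big_nil.
rewrite (_ : (fun _ _ => _) = fun m w => X i m w + \sum_(i <- r) X i m w).
  exact: smallD.
by apply/funext => m; apply/funext => w; rewrite big_cons.
Qed.

End covered_events.

(** Coefficients constant on blocks of fine steps turn a fine sum into a coarse sum of increments of
    partial sums, and these partial sums approximate the stochastic integral at the coarse times. *)
Lemma block_sum (R : realType) (g : nat -> R) (phi : nat -> R) (a b : nat) : (0 < b)%N ->
  \sum_(l < a * b) g (l %/ b)%N * phi l =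
  \sum_(k < a) g k * (\sum_(l < k.+1 * b) phi l - \sum_(l < k * b) phi l).
Proof.
move=> b0; elim: a => [|a IH]; first by rewrite mul0n !big_ord0.
rewrite big_ord_recr/= -IH mulSnr !big_split_ord/= addrAC subrr add0r; congr (_ + _).
rewrite mulr_sumr; apply: eq_bigr => i _; congr (g _ * _).
by rewrite divnMDl// divn_small ?addn0.
Qed.

Section mild_in_probability.
Context (R : realType) disp (T : measurableType disp) (P : probability T R).
Variables (F : R -> set (set T)) (hF : filtration F).
Variable B : nat -> R -> T -> R.
Hypothesis hB : forall j, brownian_motion P F (B j).
Hypothesis hBB : forall j, bracket_rate P F (B j) (B j) 1.
Variable H : R -> nat -> T -> R.
Hypothesis aH : forall j, adapted F (fun s => H s j).
Hypothesis cH : forall j, {ae P, forall w, path_continuous (fun s => H s j w)}.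

Variable om : nat -> R.
Hypothesis om0 : forall j, 0 < om j.
Variables x b : R -> nat -> T -> R.
Hypothesis mx : forall s j, 0 <= s -> measurable_fun setT (x s j).
Hypothesis mb : forall s j, 0 <= s -> measurable_fun setT (b s j).
Hypothesis gx : forall w, good_path om (fun s j => x s j w).
Hypothesis gb : forall w, good_path om (fun s j => b s j w).
Variable M : nat -> R -> T -> R.
Hypothesis itoM : forall j, ito_integral P F (fun s => H s j) (B j) (M j).

Definition path_defect r j w := defect (fun s j => x s j w) (fun s j => b s j w) r j.

Hypothesis MD : forall j, {ae P, forall w, forall s, 0 <= s -> M j s w = path_defect s j w}.

Lemma measurable_path_defect r j : 0 <= r -> measurable_fun setT (path_defect r j).
Proof.
move=> r0; apply: measurable_funB; first by apply: measurable_funB; apply: mx.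
move: r0; rewrite le_eqVlt => /predU1P[<-|r0].
  under eq_fun do rewrite set_itv_ge ?bnd_simp ?ltxx// Rintegral_set0.
  exact: measurable_cst.
apply: (@measurable_fun_cvg _ _ _ _ (fun m w =>
  \sum_(l < 1 * 2 ^ m) b (gpt r (1 * 2 ^ m) l) j w * (r / (1 * 2 ^ m)%:R))).
  move=> m; apply: measurable_sum => l; apply: measurable_funM => //.
  by apply: mb; exact/gpt_ge0/ltW.
move=> w _.
by have [_] := riemann_left r0 (ltnSn 0) (good_path_site om0 (gb w) (j := j)).
Qed.

Variables (w z : R -> nat -> R) (C t : R).
Hypothesis t0 : 0 < t.
Hypothesis w_bound : forall s j, 0 <= s -> `|w s j| <= C * om j.
Hypothesis z_bound : forall s j, 0 <= s -> `|z s j| <= C * om j.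
Hypothesis z_lip : forall s s' j, 0 <= s -> 0 <= s' ->
  `|z s j - z s' j| <= C * `|s - s'| * om j.
Hypothesis w_taylor : forall s h j, 0 <= s -> 0 <= h -> s + h <= t ->
  `|w (s + h) j - w s j + h * z (s + h) j| <= C * h ^+ 2 * om j.
Hypothesis wz : forall om' s s', 0 <= s -> 0 <= s' ->
  wpair (w s) (b s' ^~ om') = wpair (z s) (x s' ^~ om').
Variable D : T -> R.
Hypothesis DE : forall om', wpair (w t) (x t ^~ om') - wpair (w 0) (x 0 ^~ om') = D om'.

Variables (Hn : R -> nat -> T -> R) (E : set T).
Hypothesis HnE : {ae P, forall om', E om' -> forall s j, 0 <= s <= t ->
  Hn s j om' = H s j om'}.

(* The weight is frozen on the coarse grid of mesh [t / 2 ^ n], the integrand on its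
   refinement of mesh [t / 2 ^ (n + m)], and the sites are cut off at [L]: the limits
   are taken in the order [m], [L], [n]. *)
Definition noise_sum (h : R -> nat -> T -> R) n L m om' :=
  \sum_(l < 2 ^ n * 2 ^ m) \sum_(j < L)
    w (gpt t (2 ^ n) (l %/ 2 ^ m)) j * h (gpt t (2 ^ n * 2 ^ m) l) j om' *
    (B j (gpt t (2 ^ n * 2 ^ m) l.+1) om' - B j (gpt t (2 ^ n * 2 ^ m) l) om').

Let Yterm n k j om' := w (gpt t (2 ^ n) k) j *
  (path_defect (gpt t (2 ^ n) k.+1) j om' - path_defect (gpt t (2 ^ n) k) j om').

(** The integral at a coarse time [r] is approximated on the grid of [[0, r]] that starts from
    [k + 1] cells, since this is the trace on [[0, r]] of the fine grid of [[0, t]]. *)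
Let grid_ito n k j : (k <= 2 ^ n)%N -> small_in_prob P (fun m om' =>
  path_defect (gpt t (2 ^ n) k) j om' - \sum_(l < k * 2 ^ m)
    H (gpt t (2 ^ n * 2 ^ m) l) j om' *
    (B j (gpt t (2 ^ n * 2 ^ m) l.+1) om' - B j (gpt t (2 ^ n * 2 ^ m) l) om')).
Proof.
case: k => [_|k kn].
  have -> : (fun m om' => path_defect (gpt t (2 ^ n) 0) j om' - \sum_(l < 0 * 2 ^ m)
    H (gpt t (2 ^ n * 2 ^ m) l) j om' *
    (B j (gpt t (2 ^ n * 2 ^ m) l.+1) om' - B j (gpt t (2 ^ n * 2 ^ m) l) om')) = (fun _ _ => 0).
    apply/funext => m; apply/funext => om'; rewrite mul0n big_ord0 gpt0 /path_defect /defect.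
    by rewrite set_itv_ge ?bnd_simp ?ltxx// Rintegral_set0 !subrr.
  exact: small0.
set r := gpt t (2 ^ n) k.+1.
have r0 : 0 < r by rewrite /r /gpt divr_gt0 ?mulr_gt0// ltr0n ?expn_gt0.
move=> e eta e0 eta0.
have := ito_grid_cvg hF (hB j) (hBB j) (aH j) (cH j) r0 (ltn0Sn k) (itoM j) e0 eta0.
apply: filterS => m cov; apply: (@covered_ae _ _ _ _ _ _ _ _ cov).
move: (MD j); apply: filterS => om' /(_ r (ltW r0)) MDw /=; rewrite MDw.
have G l : gpt t (2 ^ n * 2 ^ m) l = gpt r (k.+1 * 2 ^ m) l.
  rewrite /r /gpt !natrM; field.
  by rewrite nat1r !pnatr_eq0 -!lt0n !expn_gt0.
by under eq_bigr do rewrite !G.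
Qed.

(** Three errors each receive a third of [e] and [eta]: the grid error of the pathwise formula
    ([n]), the cutoff of the sites ([L]), and the replacement of increments of the stochastic
    integrals by dyadic sums ([m]). [Hn] may stand for [H] only on [E], hence the event in the
    conclusion. *)
Lemma mild_in_probability (e eta : R) : 0 < e -> 0 < eta ->
  \forall n \near \oo, \forall L \near \oo, \forall m \near \oo,
    covered P eta [set om' | E om' /\ e <= `|D om' - noise_sum Hn n L m om'|].
Proof.
move=> e0 eta0.
have e3 : 0 < e / 3 by rewrite divr_gt0.
have eta3 : 0 < eta / 3 by rewrite divr_gt0.
have gt0 n k : 0 <= gpt t (2 ^ n) k by exact/gpt_ge0/ltW.
have mY n k j : measurable_fun setT (Yterm n k j).
  by apply: measurable_funM => //; apply: measurable_funB; exact: measurable_path_defect.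
have PM om' := pathwise_mild om0 (gx om') (gb om') t0 w_bound z_bound z_lip w_taylor (wz om').
pose Y n om' := \sum_(k < 2 ^ n) nsum (fun j => Yterm n k j om').
pose YL n L om' := \sum_(k < 2 ^ n) \sum_(j < L) Yterm n k j om'.
have mYL n L : measurable_fun setT (YL n L).
  by apply: measurable_sum => k; apply: measurable_sum.
have cYL n om' : YL n L om' @[L --> \oo] --> Y n om'.
  apply: cvg_big => [|k _]; first by move=> [? ?]; exact: add_continuous.
  apply: nsum_partial; exact: (PM om').1.
have mYn n : measurable_fun setT (Y n).
  by apply: (@measurable_fun_cvg _ _ _ _ (YL n)) => // om' _; exact: cYL.
have cY om' : Y n om' @[n --> \oo] --> D om' by rewrite -DE; exact: (PM om').2.
have mD : measurable_fun setT D.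
  by apply: (@measurable_fun_cvg _ _ _ _ Y) => // om' _; exact: cY.
have c1 : \forall n \near \oo, (P [set om' | (e / 3 <= `|D om' - Y n om'|)%R] <= (eta / 3)%:E)%E.
  apply: cvg0_small_probability => //; first by move=> n; exact: measurable_funB.
  apply: aeW => om'; rewrite -[X in _ --> X](subrr (D om')).
  by apply: cvgB; [exact: cvg_cst|exact: cY].
apply: filterS c1 => n c1.
have c2 : \forall L \near \oo, (P [set om' | (e / 3 <= `|Y n om' - YL n L om'|)%R] <= (eta / 3)%:E)%E.
  apply: cvg0_small_probability => //; first by move=> L; exact: measurable_funB.
  apply: aeW => om'; rewrite -[X in _ --> X](subrr (Y n om')).
  by apply: cvgB; [exact: cvg_cst|exact: cYL].
apply: filterS c2 => L c2.
have sm : small_in_prob P (fun m om' => YL n L om' - noise_sum H n L m om').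
  have := @small_sum _ _ _ P _ (index_enum 'I_(2 ^ n)) (fun k m om' => \sum_(j < L)
    w (gpt t (2 ^ n) k) j * (
    (path_defect (gpt t (2 ^ n) k.+1) j om' - \sum_(l < k.+1 * 2 ^ m)
    H (gpt t (2 ^ n * 2 ^ m) l) j om' *
    (B j (gpt t (2 ^ n * 2 ^ m) l.+1) om' - B j (gpt t (2 ^ n * 2 ^ m) l) om'))
    + (-1) * (path_defect (gpt t (2 ^ n) k) j om' - \sum_(l < k * 2 ^ m)
    H (gpt t (2 ^ n * 2 ^ m) l) j om' *
    (B j (gpt t (2 ^ n * 2 ^ m) l.+1) om' - B j (gpt t (2 ^ n * 2 ^ m) l) om')))) _.
  move=> /(_ _)-S; have {}S := S (fun k => @small_sum _ _ _ P _ (index_enum 'I_L) _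
    (fun j => smallZ _ (smallD (grid_ito j (ltn_ord k)) (smallZ (-1) (grid_ito j (ltnW (ltn_ord k))))))).
  move: S; congr small_in_prob; apply/funext => m; apply/funext => om'.
  rewrite /YL /noise_sum exchange_big/= [X in _ = X - _]exchange_big/=.
  rewrite [X in _ = _ - X]exchange_big/= -sumrB.
  apply: eq_bigr => j _; rewrite /Yterm.
  have := @block_sum R (fun k => w (gpt t (2 ^ n) k) j) (fun l => H (gpt t (2 ^ n * 2 ^ m) l) j om' *
    (B j (gpt t (2 ^ n * 2 ^ m) l.+1) om' - B j (gpt t (2 ^ n * 2 ^ m) l) om')) (2 ^ n) (2 ^ m).
  rewrite expn_gt0 => /(_ isT) BS.
  under [X in _ = _ - X]eq_bigr do rewrite -mulrA.
  rewrite BS -sumrB; apply: eq_bigr => k _; ring.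
apply: filterS (sm _ _ e3 eta3) => m c3.
rewrite (_ : eta = eta / 3 + eta / 3 + eta / 3); last by field.
have C1 : covered P (eta / 3) [set om' | e / 3 <= `|D om' - Y n om'|].
  by eexists; split; [|exact: c1|]; [apply: measurable_ge_norm; exact: measurable_funB|].
have C2 : covered P (eta / 3) [set om' | e / 3 <= `|Y n om' - YL n L om'|].
  by eexists; split; [|exact: c2|]; [apply: measurable_ge_norm; exact: measurable_funB|].
apply: covered_ae (coveredU (coveredU C1 C2) c3).
move: HnE; apply: filterS => om' HE /= [Eom h].
have ZE : noise_sum Hn n L m om' = noise_sum H n L m om'.
  apply: eq_bigr => l _; apply: eq_bigr => j _; rewrite HE//.
  have NN : (0 < 2 ^ n * 2 ^ m)%N by rewrite muln_gt0 !expn_gt0.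
  apply/andP; split; first exact/gpt_ge0/ltW.
  by apply: le_trans (gpt_le _ (ltW t0) (ltnW (ltn_ord l))) _; rewrite gptN.
rewrite ZE in h.
have [h1|h1] := leP (e / 3) `|D om' - Y n om'|; first by left; left.
have [h2|h2] := leP (e / 3) `|Y n om' - YL n L om'|; first by left; right.
right; have h12 := ler_normD (D om' - Y n om') (Y n om' - YL n L om').
have := ler_normD (D om' - Y n om' + (Y n om' - YL n L om')) (YL n L om' - noise_sum H n L m om').
rewrite (_ : D om' - Y n om' + (Y n om' - YL n L om') + (YL n L om' - noise_sum H n L m om') =
  D om' - noise_sum H n L m om'); last by ring.
lra.
Qed.

End mild_in_probability.

(** * Second moments of the mild equation *)

Section dyadic_floor.
Context {R : realType}.
Implicit Types t s : R.

(** The left end of the dyadic cell containing [s], and 0 outside []0, t]]. It is strictly below [s]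
    because cells are left-open, which fits a left-continuous localizing indicator. *)
Definition dfloor t k s := gstep t (2 ^ k) (gpt t (2 ^ k)) s.

Lemma dfloor_cell t k l s : 0 <= t -> (l < 2 ^ k)%N -> gcell t (2 ^ k) l s ->
  dfloor t k s = gpt t (2 ^ k) l.
Proof. exact: gstepE. Qed.

Lemma dfloor_itv t k s : 0 < s <= t ->
  [/\ 0 <= dfloor t k s, dfloor t k s < s & s - dfloor t k s <= t / (2 ^ k)%:R].
Proof.
move=> s0t; have /andP[s0 st] := s0t; have t0 : 0 <= t by rewrite ltW// (lt_le_trans s0).
have kN : (0 < 2 ^ k)%N by rewrite expn_gt0.
have [l lk ls] := gcell_exists kN s0t.
rewrite (dfloor_cell t0 lk ls); have [/andP[a b] _] := gcell_dist ls.
by split=> //; [exact: gpt_ge0|rewrite -subr_gt0].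
Qed.

Lemma dfloor_cvg t s : 0 < s <= t -> dfloor t k s @[k --> \oo] --> s.
Proof.
move=> s0t; apply/cvgrPdist_lt => e e0.
have /cvgrPdist_lt/(_ e e0) := mesh_cvg0 t (fun k => ltn_expl k (ltnSn 1)).
apply: filterS => k; have [_ a b] := dfloor_itv k s0t.
rewrite sub0r normrN => /(le_lt_trans (ler_norm _)) h.
by rewrite ger0_norm ?subr_ge0 ?(ltW a)// (le_lt_trans b).
Qed.

Lemma dfloor_refine t k K l s : 0 <= t -> (k <= K)%N -> (l < 2 ^ K)%N ->
  gcell t (2 ^ K) l s -> dfloor t k s = gpt t (2 ^ k) (l %/ 2 ^ (K - k)).
Proof.
move=> t0 kK lK ls; have E : (2 ^ K = 2 ^ k * 2 ^ (K - k))%N by rewrite -expnD subnKC.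
have ls' : gcell t (2 ^ k * 2 ^ (K - k)) l s by rewrite -E.
have p0 : (0 < 2 ^ (K - k))%N by rewrite expn_gt0.
have [ck _] := gcell_refine t0 p0 ls'.
by rewrite (dfloor_cell t0 _ ck)// ltn_divLR// -E.
Qed.

(** A function of dyadic floors is constant on the cells of a common refinement, whatever [phi]
    is. *)
Lemma measurable_dfloor3 t (phi : R -> R -> R -> R) k1 k2 k3 : 0 < t ->
  measurable_fun `]0, t] (fun s => phi (dfloor t k1 s) (dfloor t k2 s) (dfloor t k3 s)).
Proof.
move=> t0; pose K := (k1 + k2 + k3)%N.
pose g k l := gpt t (2 ^ k) (l %/ 2 ^ (K - k)).
apply: (eq_measurable_fun (gstep t (2 ^ K) (fun l => phi (g k1 l) (g k2 l) (g k3 l)))).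
  move=> s /set_mem; rewrite /= in_itv/= => s0t.
  have KN : (0 < 2 ^ K)%N by rewrite expn_gt0.
  have [l lK ls] := gcell_exists KN s0t.
  rewrite (gstepE _ (ltW t0) lK ls).
  by rewrite !(dfloor_refine (ltW t0) _ lK ls)// /K; lia.
exact: measurable_gstep.
Qed.

End dyadic_floor.

Section square_means.
Context (R : realType) disp (T : measurableType disp) (P : probability T R).
Implicit Types X Y Z : T -> R.

Lemma sq_mean_ge0 X : 0 <= \int[P]_w (X w ^+ 2).
Proof. by apply: Rintegral_ge0 => w _; exact: sqr_ge0. Qed.

Lemma sq_mean3 X Y Z W : sqint P X -> sqint P Y -> sqint P Z -> measurable_fun setT W ->
  (forall w, W w = X w + Y w + Z w) ->
  \int[P]_w (W w ^+ 2) <=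
  3 * (\int[P]_w (X w ^+ 2) + \int[P]_w (Y w ^+ 2) + \int[P]_w (Z w ^+ 2)).
Proof.
move=> sX sY sZ mW WE; have sW : sqint P W.
  by have := sqintD (sqintD sX sY) sZ; rewrite (_ : (fun w => _) = W)//; apply/funext => w.
have mT := @measurableT _ T.
have iXY := RintegrableD mT sX.2 sY.2.
have iXYZ := RintegrableD mT iXY sZ.2.
rewrite -(RintegralD mT sX.2 sY.2) -(RintegralD mT iXY sZ.2) -RintegralZl//.
apply: le_Rintegral => //; first exact: sW.2.
  exact: RintegrableZ.
move=> w _; rewrite WE.
have := sqr_ge0 (X w - Y w); have := sqr_ge0 (X w - Z w); have := sqr_ge0 (Y w - Z w); nra.
Qed.

Lemma sq_mean2 X Y W : sqint P X -> sqint P Y -> measurable_fun setT W ->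
  (forall w, W w = X w + Y w) ->
  \int[P]_w (W w ^+ 2) <= 2 * (\int[P]_w (X w ^+ 2) + \int[P]_w (Y w ^+ 2)).
Proof.
move=> sX sY mW WE; have sW : sqint P W.
  by have := sqintD sX sY; rewrite (_ : (fun w => _) = W)//; apply/funext => w.
have mT := @measurableT _ T.
have iXY := RintegrableD mT sX.2 sY.2.
rewrite -(RintegralD mT sX.2 sY.2) -RintegralZl//.
apply: le_Rintegral => //; first exact: sW.2.
  exact: RintegrableZ.
move=> w _; rewrite WE; have := sqr_ge0 (X w - Y w); nra.
Qed.

Lemma sq_meanZ (c : R) X : sqint P X ->
  \int[P]_w ((c * X w) ^+ 2) = c ^+ 2 * \int[P]_w (X w ^+ 2).
Proof.
by move=> sX; rewrite -RintegralZl//; [apply: Rintegral_eq => w _; rewrite exprMn|exact: sX.2].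
Qed.

End square_means.

Section integrands.
Context (R : realType) disp (T : measurableType disp) (P : probability T R).
Variables (F : R -> set (set T)) (hF : filtration F).
Variable om : nat -> R.
Hypothesis om0 : forall j, 0 < om j.
Variable t : R.
Hypothesis t0 : 0 < t.
Let mu := @lebesgue_measure R.
Let mT := @measurableT _ T.

(** The bound is deterministic because the integrand will be localized; limits are asked along
    dyadic left ends only, because the localizing indicator is merely left-continuous. *)
Record integrand (h : R -> nat -> T -> R) (C : R) : Prop := {
  integrand_adapted : forall j, adapted F (fun s => h s j);
  integrand_bound : forall s w L, 0 <= s -> \sum_(j < L) om j ^+ 2 * h s j w ^+ 2 <= C;
  integrand_left : forall s j, 0 < s <= t ->
    {ae P, forall w, h (dfloor t k s) j w @[k --> \oo] --> h s j w} }.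

Variables (h : R -> nat -> T -> R) (C : R).
Hypothesis ih : integrand h C.

Lemma integrand_measurable s j : 0 <= s -> measurable_fun setT (h s j).
Proof. by move=> s0; exact: (adapted_measurable hF (integrand_adapted ih j) s0). Qed.

Lemma integrand_C_ge0 : 0 <= C.
Proof. by have := integrand_bound ih point 0%N (lexx 0); rewrite big_ord0. Qed.

Lemma integrand_sq_site s j w : 0 <= s -> om j ^+ 2 * h s j w ^+ 2 <= C.
Proof.
move=> s0; apply: le_trans (integrand_bound ih w j.+1 s0).
by rewrite big_ord_recr/= lerDr sumr_ge0// => i _; rewrite mulr_ge0 ?sqr_ge0.
Qed.

(** [1 + C] serves as an upper bound for the square root of [C]. *)
Lemma integrand_site s j w : 0 <= s -> `|h s j w| <= (1 + C) / om j.
Proof.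
move=> s0; have := integrand_sq_site j w s0; rewrite ler_pdivlMr// -exprMn => H.
have C0 := integrand_C_ge0; rewrite leNgt; apply/negP => H1.
have : (1 + C) ^+ 2 < (om j * h s j w) ^+ 2.
  rewrite -[ltRHS]ger0_norm ?sqr_ge0// normrX ltrXn2r ?nnegrE ?addr_ge0//.
  by rewrite normrM (gtr0_norm (om0 j)) mulrC.
nra.
Qed.

Lemma integrand_sqint s j : 0 <= s -> sqint P (h s j).
Proof.
move=> s0; apply: (@sqint_bounded _ _ _ _ _ ((1 + C) / om j)).
  exact: integrand_measurable.
by move=> w; exact: integrand_site.
Qed.

Definition second_moment s j := \int[P]_w (h s j w ^+ 2).

Lemma second_moment_ge0 s j : 0 <= second_moment s j.
Proof. exact: sq_mean_ge0. Qed.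

Lemma second_moment_sum s : 0 <= s ->
  nsummable (fun j => om j ^+ 2 * second_moment s j) /\
  nsum (fun j => om j ^+ 2 * second_moment s j) <= C.
Proof.
move=> s0; apply: nsummable_bounded => [j|L].
  by rewrite mulr_ge0 ?sqr_ge0 ?second_moment_ge0.
rewrite (_ : \sum_(_ < L) _ = \int[P]_w \sum_(j < L) (om j ^+ 2 * h s j w ^+ 2)); last first.
  rewrite Rintegral_sum//; last by move=> j _; apply: RintegrableZ => //; exact: (integrand_sqint _ s0).2.
  by apply: eq_bigr => j _; rewrite RintegralZl//; exact: (integrand_sqint _ s0).2.
rewrite -[leRHS](expectation_cstr P C); apply: le_Rintegral => //.
- by apply: Rintegrable_sum => // j _; apply: RintegrableZ => //; exact: (integrand_sqint _ s0).2.
- exact: intble_cst.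
- by move=> w _; exact: integrand_bound.
Qed.

Lemma left_sq_mean s j (X : T -> R) (B : R) (c : nat -> R) (c0 Cc : R) : 0 < s <= t ->
  measurable_fun setT X -> (forall w, `|X w| <= B) ->
  (forall k, `|c k| <= Cc) -> c k @[k --> \oo] --> c0 ->
  \int[P]_w ((X w - c k * h (dfloor t k s) j w) ^+ 2) @[k --> \oo] -->
  \int[P]_w ((X w - c0 * h s j w) ^+ 2).
Proof.
move=> s0t mX XB cC cc; have /andP[s0 st] := s0t.
have D0 k : 0 <= dfloor t k s by case: (dfloor_itv k s0t).
apply: (proj2 (@Rintegral_dominated _ _ _ P _ mT
  (fun k w => (X w - c k * h (dfloor t k s) j w) ^+ 2) _
  (fun=> (B + Cc * ((1 + C) / om j)) ^+ 2) _ _ _ _ _)).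
- move=> k; apply: measurable_funX; apply: measurable_funB => //.
  by apply: measurable_funM => //; exact: integrand_measurable.
- apply: measurable_funX; apply: measurable_funB => //.
  by apply: measurable_funM => //; apply: integrand_measurable; exact: ltW.
- move: (integrand_left ih j s0t); apply: filterS => w hw _.
  have H : X w - c k * h (dfloor t k s) j w @[k --> \oo] --> X w - c0 * h s j w.
    by apply: cvgB; [exact: cvg_cst|exact: cvgM].
  by under eq_fun do rewrite expr2; rewrite expr2; apply: cvgM.
- exact: intble_cst.
- apply: aeW => w _ k; rewrite normrX lerXn2r ?nnegrE//.
    have /(le_trans (normr_ge0 _)) B0 := XB w.
    have /(le_trans (normr_ge0 _)) C0 := cC 0%N.
    by rewrite addr_ge0// mulr_ge0// divr_ge0 ?(ltW (om0 j))// addr_ge0// integrand_C_ge0.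
  apply: le_trans (ler_normB _ _) _; apply: lerD => //; rewrite normrM.
  by apply: ler_pM => //; exact: integrand_site.
Qed.

End integrands.

(** * Approximation of localized integrands by dyadic steps *)

Section step_approximation.
Context (R : realType) disp (T : measurableType disp) (P : probability T R).
Variables (F : R -> set (set T)) (hF : filtration F).
Variable om : nat -> R.
Hypothesis om0 : forall j, 0 < om j.
Variable t : R.
Hypothesis t0 : 0 < t.
Let mu := @lebesgue_measure R.
Let mT := @measurableT _ T.
Let mI : measurable (`]0%R, t] : set (measurableTypeR R)). Proof. by []. Qed.

Variables (wt : R -> nat -> R) (A : R).
Hypothesis wt_bound : forall s j, 0 <= s -> `|wt s j| <= A * om j.
Hypothesis wt_lip : forall s s' j, 0 <= s -> 0 <= s' ->
  `|wt s j - wt s' j| <= A * `|s - s'| * om j.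

Let A0 : 0 <= A.
Proof. by have := le_trans (normr_ge0 _) (wt_bound 0%N (lexx 0)); rewrite pmulr_lge0. Qed.

Let om_ge0 j : 0 <= om j. Proof. exact: ltW. Qed.

Lemma wt_sq s j : 0 <= s -> wt s j ^+ 2 <= A ^+ 2 * om j ^+ 2.
Proof.
move=> s0; rewrite -exprMn -(real_normK (num_real (wt s j))) lerXn2r ?nnegrE//.
  by rewrite mulr_ge0.
exact: wt_bound.
Qed.

Lemma wt_dfloor_cvg s j : 0 < s <= t -> wt (dfloor t k s) j @[k --> \oo] --> wt s j.
Proof.
move=> s0t; have D0 k : 0 <= dfloor t k s by case: (dfloor_itv k s0t).
have /andP[/ltW s0 _] := s0t.
apply/cvgrPdist_lt => e e0.
have e1 : 0 < e / (A * om j + 1) by rewrite divr_gt0// ltr_wpDl// mulr_ge0.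
have /cvgrPdist_lt/(_ _ e1) := dfloor_cvg s0t; apply: filterS => k sk.
apply: le_lt_trans (wt_lip j s0 (D0 k)) _.
move: sk; rewrite ltr_pdivlMr ?ltr_wpDl ?mulr_ge0// => sk.
by apply: le_lt_trans sk; rewrite mulrAC mulrC ler_wpM2l// lerDl.
Qed.

Section one_integrand.
Variables (h : R -> nat -> T -> R) (C : R).
Hypothesis ih : integrand P F om t h C.

Let C0 : 0 <= C. Proof. exact: integrand_C_ge0 ih. Qed.

Let hsq s j : 0 <= s -> sqint P (h s j).
Proof. by move=> s0; exact: (integrand_sqint hF om0 ih). Qed.

Let gs := second_moment P h.

Let gs0 s j : 0 <= gs s j. Proof. exact: sq_mean_ge0. Qed.

(** Joint measurability of [h] in time and chance is not at hand; the mean is instead a limit of its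
    values along dyadic floors, which are step functions of [s]. *)
Lemma measurable_sq_left j (psi : R -> R -> T -> R) (B : R) (k1 k2 : nat)
    (c : R -> R) (Cc : R) :
  (forall s s', 0 <= s -> 0 <= s' -> measurable_fun setT (psi s s')) ->
  (forall s s' w, 0 <= s -> 0 <= s' -> `|psi s s' w| <= B) ->
  (forall s, 0 <= s -> `|c s| <= Cc) ->
  (forall s, 0 < s <= t -> c (dfloor t k s) @[k --> \oo] --> c s) ->
  measurable_fun `]0, t] (fun s => \int[P]_w
    ((psi (dfloor t k1 s) (dfloor t k2 s) w - c s * h s j w) ^+ 2)).
Proof.
move=> mpsi psiB cC cc.
apply: (@measurable_fun_cvg _ _ _ _ (fun q s => \int[P]_w
    ((psi (dfloor t k1 s) (dfloor t k2 s) w - c (dfloor t q s) * h (dfloor t q s) j w) ^+ 2))).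
  move=> q; exact: (measurable_dfloor3 (fun x y z => \int[P]_w
    ((psi x y w - c z * h z j w) ^+ 2))).
move=> s; rewrite /= in_itv/= => s0t.
have D0 k : 0 <= dfloor t k s by case: (dfloor_itv k s0t).
apply: (left_sq_mean hF om0 ih (B := B) (Cc := Cc)) => //.
- exact: mpsi.
- by move=> w; exact: psiB.
- by move=> k; exact: cC.
- exact: cc.
Qed.

(** For [k = n + m] this is the integrand whose elementary integral is [noise_sum]: weight frozen at
    level [n], intensity at level [k], sites below [L]. *)
Definition wstep n L k s j w :=
  if (j < L)%N then wt (dfloor t n s) j * h (dfloor t k s) j w else 0.

Definition step_gap n L k s j := \int[P]_w ((wstep n L k s j w - wt s j * h s j w) ^+ 2).

Definition step_gap_total n L k := \int[mu]_(s in `]0, t]) nsum (step_gap n L k s).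

Lemma step_gap_ge0 n L k s j : 0 <= step_gap n L k s j.
Proof. exact: sq_mean_ge0. Qed.

Lemma measurable_step_gap n L k j : measurable_fun `]0, t] (fun s => step_gap n L k s j).
Proof.
rewrite /step_gap /wstep; apply: (@measurable_sq_left j
  (fun x y w => if (j < L)%N then wt x j * h y j w else 0)
  (A * om j * ((1 + C) / om j)) n k (fun s => wt s j) (A * om j)).
- move=> s s' s0 s'0; case: (boolP (j < L)%N) => _; last exact: measurable_cst.
  by apply: measurable_funM => //; exact: (hsq j s'0).1.
- move=> s s' w s0 s'0; case: (boolP (j < L)%N) => _; last first.
    by rewrite normr0; apply: mulr_ge0; [exact: mulr_ge0|apply: divr_ge0 => //; exact: addr_ge0].
  by rewrite normrM; apply: ler_pM => //; [exact: wt_bound|exact: (integrand_site om0 ih)].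
- by move=> s; exact: wt_bound.
- by move=> s; exact: wt_dfloor_cvg.
Qed.

Lemma measurable_second_moment j : measurable_fun `]0, t] (gs^~ j).
Proof.
have := @measurable_sq_left j (fun _ _ _ => 0) 0 0%N 0%N (fun=> 1) 1.
rewrite (_ : (fun s => \int[P]_w _) = gs^~ j); last first.
  by apply/funext => s; apply: Rintegral_eq => w _; rewrite sub0r mul1r sqrrN.
apply.
- by move=> *; exact: measurable_cst.
- by move=> *; rewrite normr0.
- by move=> *; rewrite normr1.
- by move=> *; exact: cvg_cst.
Qed.

Let gap k s j := \int[P]_w ((h (dfloor t k s) j w - h s j w) ^+ 2).

Let measurable_gap k j : measurable_fun `]0, t] (fun s => gap k s j).
Proof.
have := @measurable_sq_left j (fun _ y w => h y j w) ((1 + C) / om j) 0%N k (fun=> 1) 1.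
rewrite (_ : (fun s => \int[P]_w _) = (fun s => gap k s j)); last first.
  by apply/funext => s; apply: Rintegral_eq => w _; rewrite mul1r.
apply.
- by move=> s s' _ s'0; exact: (hsq j s'0).1.
- by move=> s s' w _ s'0; exact: (integrand_site om0 ih).
- by move=> *; rewrite normr1.
- by move=> *; exact: cvg_cst.
Qed.

Let in_I s : (`]0%R, t]%classic : set R) s -> 0 < s <= t.
Proof. by rewrite /= in_itv. Qed.

Let D0 k s : 0 < s <= t -> 0 <= dfloor t k s. Proof. by case/(dfloor_itv k). Qed.

Let step_sqint n L k s j : 0 < s <= t -> sqint P (wstep n L k s j).
Proof.
move=> s0t; rewrite /wstep; case: (boolP (j < L)%N) => _; last exact: sqint_cst.
by apply: sqintZ; apply: hsq; exact: D0.
Qed.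

Let wh_sqint s j : 0 < s <= t -> sqint P (fun w => wt s j * h s j w).
Proof. by move=> /andP[/ltW s0 _]; apply: sqintZ; exact: hsq. Qed.

Lemma step_gap_le n L k s j : 0 < s <= t -> step_gap n L k s j <=
  2 * A ^+ 2 * (om j ^+ 2 * gs (dfloor t k s) j + om j ^+ 2 * gs s j).
Proof.
move=> s0t; have /andP[/ltW s0 _] := s0t.
have := @sq_mean2 _ _ _ P (wstep n L k s j) (fun w => (- wt s j) * h s j w)
  (fun w => wstep n L k s j w - wt s j * h s j w) (step_sqint n L k j s0t)
  (sqintZ _ (hsq j s0)) _ _.
move=> /(_ _ _)/le_trans; apply.
- by apply: measurable_funB; [exact: (step_sqint n L k j s0t).1|exact: (wh_sqint j s0t).1].
- by move=> w; rewrite mulNr.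
rewrite -[leRHS]mulrA ler_wpM2l// mulrDr; apply: lerD; rewrite [leRHS]mulrA; last first.
  rewrite (sq_meanZ _ (hsq j s0)) sqrrN; apply: ler_wpM2r; [exact: gs0|exact: wt_sq].
rewrite /wstep; case: (boolP (j < L)%N) => _.
  rewrite (sq_meanZ _ (hsq j (D0 k s0t))).
  by apply: ler_wpM2r; [exact: gs0|apply: wt_sq; exact: D0].
rewrite (@Rintegral_eq _ _ _ P _ _ (fun=> 0)) => [|w _]; last by rewrite expr0n.
by rewrite expectation_cstr mulr_ge0// mulr_ge0 ?sqr_ge0.
Qed.

Lemma step_gap_sum n L k s : 0 < s <= t ->
  nsummable (step_gap n L k s) /\ nsum (step_gap n L k s) <= 4 * A ^+ 2 * C.
Proof.
move=> s0t; have /andP[/ltW s0 _] := s0t.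
have [s1 n1] := second_moment_sum hF om0 ih s0.
have [s2 n2] := second_moment_sum hF om0 ih (D0 k s0t).
have s12 := nsummableZ (2 * A ^+ 2) (nsummableD s2 s1).
have se : nsummable (step_gap n L k s).
  apply: nsummable_le s12 _ => j.
  by rewrite ger0_norm ?step_gap_ge0// step_gap_le.
split=> //; apply: le_trans (ler_nsum se s12 (fun j => step_gap_le n L k j s0t)) _.
rewrite nsumZ; last exact: nsummableD.
rewrite nsumD// [leRHS](_ : _ = 2 * A ^+ 2 * (C + C)); last by ring.
by rewrite ler_wpM2l ?mulr_ge0 ?sqr_ge0// lerD.
Qed.

Lemma integrable_bounded_time (f : R -> R) (B : R) : measurable_fun `]0, t] f ->
  (forall s, 0 < s <= t -> `|f s| <= B) -> Rintegrable mu `]0, t] f.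
Proof. exact: integrable_itv_bounded. Qed.

Lemma integrable_step_gap n L k :
  Rintegrable mu `]0, t] (fun s => nsum (step_gap n L k s)).
Proof.
apply: (@integrable_bounded_time _ (4 * A ^+ 2 * C)).
  apply: measurable_nsum => [j|s /in_I s0t]; first exact: measurable_step_gap.
  by case: (step_gap_sum n L k s0t).
move=> s s0t; rewrite ger0_norm; first by case: (step_gap_sum n L k s0t).
by apply: nsum_ge0 => j; exact: step_gap_ge0.
Qed.

Let gap_le k s j : 0 < s <= t -> gap k s j <= 4 * ((1 + C) / om j) ^+ 2.
Proof.
move=> s0t; have /andP[/ltW s0 _] := s0t.
rewrite -[leRHS](expectation_cstr P); apply: le_Rintegral => //.
- exact: (sqintB (hsq j (D0 k s0t)) (hsq j s0)).2.
- exact: intble_cst.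
move=> w _; have := integrand_site om0 ih j w (D0 k s0t).
have := integrand_site om0 ih j w s0.
have : 0 <= (1 + C) / om j by rewrite divr_ge0// addr_ge0.
rewrite !ler_norml; nra.
Qed.

Let gap_int k j : Rintegrable mu `]0, t] (fun s => gap k s j).
Proof.
apply: (@integrable_bounded_time _ (4 * ((1 + C) / om j) ^+ 2)); first exact: measurable_gap.
by move=> s s0t; rewrite ger0_norm ?sq_mean_ge0// gap_le.
Qed.

Let gap_cvg0 j : \int[mu]_(s in `]0, t]) gap k s j @[k --> \oo] --> 0.
Proof.
rewrite -[X in _ --> X](_ : \int[mu]_(s in `]0, t]) (fun=> 0 : R) s = 0); last first.
  by rewrite Rintegral_cst// mul0r.
apply: (proj2 (@Rintegral_dominated _ _ _ mu _ mI (fun k s => gap k s j) (fun=> 0)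
  (fun=> 4 * ((1 + C) / om j) ^+ 2) _ _ _ _ _)) => //.
- by move=> k; exact: measurable_gap.
- apply: aeW => s /in_I s0t; have /andP[/ltW s0 _] := s0t.
  have := @left_sq_mean _ _ _ P _ hF _ om0 _ _ _ ih s j (h s j) ((1 + C) / om j)
    (fun=> 1) 1 1 s0t (hsq j s0).1 (fun w => integrand_site om0 ih j w s0) _ _.
  move=> /(_ _ _) H.
  have {}H : \int[P]_w ((h s j w - 1 * h (dfloor t k s) j w) ^+ 2) @[k --> \oo] -->
     \int[P]_w ((h s j w - 1 * h s j w) ^+ 2).
    by apply: H; [move=> _; rewrite normr1|exact: cvg_cst].
  have E0 : \int[P]_w ((h s j w - 1 * h s j w) ^+ 2) = 0.
    rewrite (@Rintegral_eq _ _ _ P _ _ (fun=> 0)) ?expectation_cstr// => w _.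
    by rewrite mul1r subrr expr0n.
  rewrite E0 in H; rewrite (_ : (fun n => gap n s j) =
    fun k => \int[P]_w ((h s j w - 1 * h (dfloor t k s) j w) ^+ 2))//.
  apply/funext => k; apply: Rintegral_eq => w _.
  by rewrite mul1r -sqrrN opprB.
- by apply: (@integrable_bounded_time _ (4 * ((1 + C) / om j) ^+ 2)) => // s _; rewrite ger0_norm// mulr_ge0 ?sqr_ge0.
- by apply: aeW => s /in_I s0t k; rewrite ger0_norm ?sq_mean_ge0// gap_le.
Qed.

Let tail L s := nsum (fun j => if (j < L)%N then 0 else om j ^+ 2 * gs s j).

Let wg_ge0 s j : 0 <= om j ^+ 2 * gs s j. Proof. by rewrite mulr_ge0 ?sqr_ge0. Qed.

Let tail_summable L s : 0 <= s -> nsummable (fun j => if (j < L)%N then 0 else om j ^+ 2 * gs s j).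
Proof.
move=> s0; have [s1 _] := second_moment_sum hF om0 ih s0.
by apply: nsummable_le s1 _ => j; case: ifP => _; rewrite ?normr0// ger0_norm.
Qed.

Let tail_le L s : 0 <= s -> tail L s <= C.
Proof.
move=> s0; have [s1 n1] := second_moment_sum hF om0 ih s0; apply: le_trans n1.
by apply: ler_nsum => //; [exact: tail_summable|move=> j; case: ifP].
Qed.

Let tail_ge0 L s : 0 <= tail L s.
Proof. by apply: nsum_ge0 => j; case: ifP. Qed.

Let measurable_tail L : measurable_fun `]0, t] (tail L).
Proof.
apply: measurable_nsum => [j|s /in_I/andP[/ltW s0 _]]; last exact: tail_summable.
case: (boolP (j < L)%N) => _; first exact: measurable_cst.
by apply: measurable_funM => //; exact: measurable_second_moment.
Qed.

Let tail_int L : Rintegrable mu `]0, t] (tail L).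
Proof.
apply: (@integrable_bounded_time _ C) => [|s /andP[/ltW s0 _]].
  exact: measurable_tail.
by rewrite ger0_norm// tail_le.
Qed.

Let tail_cvg0 : \int[mu]_(s in `]0, t]) tail L s @[L --> \oo] --> 0.
Proof.
rewrite -[X in _ --> X](_ : \int[mu]_(s in `]0, t]) (fun=> 0 : R) s = 0); last first.
  by rewrite Rintegral_cst// mul0r.
apply: (proj2 (@Rintegral_dominated _ _ _ mu _ mI tail (fun=> 0) (fun=> C) _ _ _ _ _)) => //.
- apply: aeW => s /in_I/andP[/ltW s0 _].
  have [s1 _] := second_moment_sum hF om0 ih s0; exact: (nsum_tail s1).
- by apply: (@integrable_bounded_time _ C) => // s _; rewrite ger0_norm.
- by apply: aeW => s /in_I/andP[/ltW s0 _] L; rewrite ger0_norm// tail_le.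
Qed.

(** Three sources of error: freezing [h] on the sites kept, freezing the weight, which is Lipschitz
    over the mesh [t / 2 ^ n], and discarding the other sites. *)
Let gap3 n L k s j : 0 < s <= t -> step_gap n L k s j <=
  (if (j < L)%N then 2 * A ^+ 2 * om j ^+ 2 * gap k s j else 0) +
  2 * A ^+ 2 * (t / (2 ^ n)%:R) ^+ 2 * (om j ^+ 2 * gs s j) +
  A ^+ 2 * (if (j < L)%N then 0 else om j ^+ 2 * gs s j).
Proof.
move=> s0t; have /andP[/ltW s0 _] := s0t; have [d1 d2 d3] := dfloor_itv n s0t.
have t2 : 0 <= 2 * A ^+ 2 * (t / (2 ^ n)%:R) ^+ 2 by exact: (mulr_ge0 (mulr_ge0 (ler0n _ 2) (sqr_ge0 A)) (sqr_ge0 _)).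
rewrite /step_gap /wstep; case: ifP => jL; last first.
  rewrite add0r -[leLHS]add0r; apply: lerD; first exact: mulr_ge0.
  rewrite (@Rintegral_eq _ _ _ P _ _ (fun w => (wt s j * h s j w) ^+ 2)) => [|w _]; last first.
    by rewrite sub0r sqrrN.
  rewrite (sq_meanZ _ (hsq j s0)) [leRHS]mulrA.
  by apply: ler_wpM2r; [exact: gs0|exact: wt_sq].
rewrite mulr0 addr0.
have sg := sqintB (hsq j (D0 k s0t)) (hsq j s0).
have := @sq_mean2 _ _ _ P
  (fun w => wt (dfloor t n s) j * (h (dfloor t k s) j w - h s j w))
  (fun w => (wt (dfloor t n s) j - wt s j) * h s j w)
  (fun w => wt (dfloor t n s) j * h (dfloor t k s) j w - wt s j * h s j w)
  (sqintZ _ sg) (sqintZ _ (hsq j s0)) _ _.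
move=> /(_ _ _)/le_trans; apply.
- by apply: measurable_funB; [exact: (sqintZ _ (hsq j (D0 k s0t))).1|exact: (wh_sqint j s0t).1].
- by move=> w; ring.
rewrite mulrDr; apply: lerD.
  rewrite (sq_meanZ _ sg) [leRHS](_ : _ = 2 * (A ^+ 2 * om j ^+ 2 * gap k s j)); last by ring.
  by rewrite ler_wpM2l//; apply: ler_wpM2r; [exact: sq_mean_ge0|exact: wt_sq].
rewrite (sq_meanZ _ (hsq j s0)) [leRHS](_ : _ =
  2 * (A ^+ 2 * ((t / (2 ^ n)%:R) ^+ 2 * om j ^+ 2) * gs s j)); last by ring.
rewrite ler_wpM2l//; apply: ler_wpM2r; first exact: gs0.
rewrite -!exprMn -(real_normK (num_real (wt (dfloor t n s) j - _))) lerXn2r ?nnegrE//.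
  by apply: mulr_ge0 => //; apply: mulr_ge0 => //; apply: divr_ge0 => //; exact: ltW.
apply: le_trans (wt_lip j d1 s0) _; rewrite mulrA ler_wpM2r// ler_wpM2l//.
by rewrite distrC ger0_norm// subr_ge0 ltW.
Qed.

(** For fixed [n] and [L] only finitely many sites carry the error of freezing [h], so [m] goes to
    infinity last; the tail of the sites is governed by [L] uniformly in [m], and the freezing of
    the weight by [n] uniformly in both. *)
Lemma step_gap_total_cvg0 e : 0 < e ->
  \forall n \near \oo, \forall L \near \oo, \forall m \near \oo,
    step_gap_total n L (n + m) < e.
Proof.
move=> e0; have e3 : 0 < e / 3 by rewrite divr_gt0.
have t2 n : 0 <= 2 * A ^+ 2 * (t / (2 ^ n)%:R) ^+ 2.
  exact: (mulr_ge0 (mulr_ge0 (ler0n _ 2) (sqr_ge0 A)) (sqr_ge0 _)).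
have bound n L k : step_gap_total n L k <=
    \sum_(j < L) 2 * A ^+ 2 * om j ^+ 2 * \int[mu]_(s in `]0, t]) gap k s j +
    2 * A ^+ 2 * (t / (2 ^ n)%:R) ^+ 2 * C * t + A ^+ 2 * \int[mu]_(s in `]0, t]) tail L s.
  have i1 : Rintegrable mu `]0, t] (fun s => \sum_(j < L) 2 * A ^+ 2 * om j ^+ 2 * gap k s j).
    by apply: Rintegrable_sum => // j _; exact: RintegrableZ.
  have i2 : Rintegrable mu `]0, t] (fun=> 2 * A ^+ 2 * (t / (2 ^ n)%:R) ^+ 2 * C).
    apply: (@integrable_bounded_time _ (2 * A ^+ 2 * (t / (2 ^ n)%:R) ^+ 2 * C)) => // s _.
    by rewrite ger0_norm//; apply: mulr_ge0 => //; exact: t2.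
  have i3 : Rintegrable mu `]0, t] (fun s => A ^+ 2 * tail L s) by exact: RintegrableZ.
  have i12 := RintegrableD mI i1 i2.
  have -> : 2 * A ^+ 2 * (t / (2 ^ n)%:R) ^+ 2 * C * t =
      \int[mu]_(s in `]0, t]) (2 * A ^+ 2 * (t / (2 ^ n)%:R) ^+ 2 * C).
    rewrite Rintegral_cst//; congr (_ * _).
    have E : (mu `]0%R, t] = t%:E)%E.
      apply: (eq_trans (lebesgue_measure_itv `]0, t])) => /=.
      by rewrite lte_fin t0 oppr0 adde0.
    by rewrite (congr1 fine E).
  rewrite -RintegralZl// [X in X + _ + _](_ : _ =
      \int[mu]_(s in `]0, t]) \sum_(j < L) 2 * A ^+ 2 * om j ^+ 2 * gap k s j); last first.
    rewrite Rintegral_sum//; last by move=> j _; exact: RintegrableZ.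
    by apply: eq_bigr => j _; rewrite RintegralZl.
  rewrite -RintegralD// -RintegralD//; apply: le_Rintegral => //.
  - exact: integrable_step_gap.
  - exact: RintegrableD.
  move=> s /in_I s0t; have /andP[/ltW s0 _] := s0t.
  have [s1 n1] := second_moment_sum hF om0 ih s0.
  have [se _] := step_gap_sum n L k s0t.
  have sm := nsummable_mask (fun j => 2 * A ^+ 2 * om j ^+ 2 * gap k s j) L.
  have s2 := nsummableZ (2 * A ^+ 2 * (t / (2 ^ n)%:R) ^+ 2) s1.
  have s3 := nsummableZ (A ^+ 2) (tail_summable L s0).
  have s12 := nsummableD sm s2.
  apply: le_trans (ler_nsum se (nsummableD s12 s3) (fun j => gap3 n L k j s0t)) _.
  rewrite (nsumD s12 s3) (nsumD sm s2) nsum_mask nsumZ// nsumZ; last exact: tail_summable.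
  by rewrite lerD2r lerD2l; apply: ler_wpM2l => //; exact: t2.
have cn : 2 * A ^+ 2 * (t / (2 ^ n)%:R) ^+ 2 * C * t @[n --> \oo] --> 0.
  rewrite -[X in _ --> X](_ : 2 * A ^+ 2 * (0 * 0) * C * t = 0); last by ring.
  under eq_fun do rewrite expr2.
  have H := mesh_cvg0 t (fun k => ltn_expl k (ltnSn 1)).
  by do 2 (apply: cvgMl); apply: cvgMr; apply: cvgM.
have cL : A ^+ 2 * \int[mu]_(s in `]0, t]) tail L s @[L --> \oo] --> 0.
  by rewrite -[X in _ --> X](mulr0 (A ^+ 2)); apply: cvgMr.
move/cvgrPdist_lt : cn => /(_ _ e3); apply: filterS => n hn.
move/cvgrPdist_lt : cL => /(_ _ e3); apply: filterS => L hL.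
have cm : \sum_(j < L) 2 * A ^+ 2 * om j ^+ 2 * \int[mu]_(s in `]0, t]) gap (n + m) s j
    @[m --> \oo] --> 0.
  rewrite -[X in _ --> X](_ : \sum_(j < L) 0 = 0); last by rewrite big1.
  apply: cvg_big => [|j _]; first by move=> [? ?]; exact: add_continuous.
  rewrite -[X in _ --> X](mulr0 (2 * A ^+ 2 * om j ^+ 2)); apply: cvgMr.
  exact: (cvg_comp (fun m => (n + m)%N) _ (cvg_addnl n) (gap_cvg0 j)).
move/cvgrPdist_lt : cm => /(_ _ e3); apply: filterS => m hm.
apply: le_lt_trans (bound n L (n + m)%N) _.
move: hn hL hm; rewrite !sub0r !normrN !ltr_norml => /andP[_ ?] /andP[_ ?] /andP[_ ?]; lra.
Qed.

End one_integrand.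
End step_approximation.

(** * Isometry for sums driven by two correlated noises *)

Section noise_isometry.
Context (R : realType) disp (T : measurableType disp) (P : probability T R).
Variables (F : R -> set (set T)) (hF : filtration F).
Variable om : nat -> R.
Hypothesis om0 : forall j, 0 < om j.
Variable t : R.
Hypothesis t0 : 0 < t.
Let mu := @lebesgue_measure R.
Let mT := @measurableT _ T.
Let mI : measurable (`]0%R, t] : set (measurableTypeR R)). Proof. by []. Qed.

Variables (wt : R -> nat -> R) (A : R).
Hypothesis wt_bound : forall s j, 0 <= s -> `|wt s j| <= A * om j.
Hypothesis wt_lip : forall s s' j, 0 <= s -> 0 <= s' ->
  `|wt s j - wt s' j| <= A * `|s - s'| * om j.

Variables (B : bool -> nat -> R -> T -> R) (r : bool -> bool -> R).
Hypothesis hB : forall b j, brownian_motion P F (B b j).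
Hypothesis hr : forall b b' j j', bracket_rate P F (B b j) (B b' j')
  (if j == j' then r b b' else 0).
Hypothesis r1 : forall b, r b b = 1.

(** Both components enter one family, so that the covariance between the two noises falls under the
    same isometry. *)
Let key := (bool * nat)%type.
Let BK (k : key) := B k.1 k.2.
Let c (k k' : key) := if k.2 == k'.2 then r k.1 k'.1 else 0.
Let hBK k : brownian_motion P F (BK k). Proof. exact: hB. Qed.
Let hcK k k' : bracket_rate P F (BK k) (BK k') (c k k'). Proof. exact: hr. Qed.

Let keys (b : bool) LL : seq key := [seq (b, j) | j <- iota 0 LL].

Implicit Types h : R -> nat -> T -> R.

Let coef h n L k M l j w :=
  if (j < L)%N then wt (gpt t (2 ^ n) (l %/ 2 ^ (M - n))) j *
    h (gpt t (2 ^ k) (l %/ 2 ^ (M - k))) j w else 0.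

Let sum_keys (b : bool) LL (f : key -> R) :
  \sum_(k <- keys b LL) f k = \sum_(j < LL) f (b, j : nat).
Proof. by rewrite big_map -(big_mkord xpredT (fun j => f (b, j))) /index_iota subn0. Qed.

Lemma refine_sum (phi X : nat -> R) (N q : nat) : (0 < q)%N ->
  \sum_(l < N) phi l * (X (l.+1 * q)%N - X (l * q)%N) =
  \sum_(l < N * q) phi (l %/ q)%N * (X l.+1 - X l).
Proof.
move=> q0; rewrite (block_sum phi (fun l => X l.+1 - X l) N q0).
have S k : \sum_(l < k * q) (X l.+1 - X l) = X (k * q)%N - X 0%N.
  by rewrite -(big_mkord xpredT (fun l => X l.+1 - X l)) telescope_sumr.
apply: eq_bigr => l _; rewrite !S; ring.
Qed.

Let grid (b : bool) LL (G : nat -> nat -> T -> R) M :=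
  grid_sum BK (keys b LL) (fun k l => G l k.2) (gpt t (2 ^ M)) (2 ^ M).

(** A noise sum can be rewritten on a finer grid and with more sites; differences of noise sums with
    different parameters thereby become single grid sums. *)
Lemma noise_sum_grid b h n L m M LL w : (n + m <= M)%N -> (L <= LL)%N ->
  noise_sum (B b) wt t h n L m w = grid b LL (coef h n L (n + m) M) M w.
Proof.
move=> nmM LLL; rewrite /noise_sum /grid /grid_sum exchange_big/=.
under [RHS]eq_bigr do rewrite sum_keys/=.
rewrite [RHS]exchange_big/= (big_ord_widen LL (fun j => \sum_(l < 2 ^ n * 2 ^ m)
  wt (gpt t (2 ^ n) (l %/ 2 ^ m)) j * h (gpt t (2 ^ n * 2 ^ m) l) j w *
  (B b j (gpt t (2 ^ n * 2 ^ m) l.+1) w - B b j (gpt t (2 ^ n * 2 ^ m) l) w)) LLL) big_mkcond/=.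
apply: eq_bigr => j _; rewrite /coef; case: ifP => jL; last first.
  by rewrite big1// => l _; rewrite mul0r.
rewrite -expnD; set q := (2 ^ (M - (n + m)))%N.
have q0 : (0 < q)%N by rewrite expn_gt0.
have ME : (2 ^ M = 2 ^ (n + m) * q)%N by rewrite -expnD subnKC.
have G l : gpt t (2 ^ (n + m)) l = gpt t (2 ^ M) (l * q) by rewrite ME gpt_refine.
under [LHS]eq_bigr do rewrite [in B b j _ w]G [X in _ - B b j X w]G.
rewrite (@refine_sum (fun l => wt (gpt t (2 ^ n) (l %/ 2 ^ m)) j * h (gpt t (2 ^ (n + m)) l) j w)
  (fun l => B b j (gpt t (2 ^ M) l) w) _ q q0) -ME.
apply: eq_bigr => l _; rewrite -divnMA -expnD.
by rewrite (_ : M - (n + m) + m = M - n)%N; [|lia].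
Qed.

Let gle k M l : (k <= M)%N -> gpt t (2 ^ k) (l %/ 2 ^ (M - k)) <= gpt t (2 ^ M) l.
Proof.
move=> kM; have E : (2 ^ M = 2 ^ k * 2 ^ (M - k))%N by rewrite -expnD subnKC.
have q0 : (0 < 2 ^ (M - k))%N by rewrite expn_gt0.
rewrite -(gpt_refine t (2 ^ k) (l %/ 2 ^ (M - k)) q0) -E.
by apply: gpt_le; [exact: ltW|exact: leq_trunc_div].
Qed.

Let g0 N l : 0 <= gpt t N l. Proof. exact/gpt_ge0/ltW. Qed.

Lemma coef_measurable_wrt h C n L k M l j : integrand P F om t h C ->
  (k <= M)%N -> measurable_wrt (F (gpt t (2 ^ M) l)) (coef h n L k M l j).
Proof.
move=> ih kM; have sF : sigma_algebra setT (F (gpt t (2 ^ M) l)).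
  by apply: filtration_sigma => //; exact: g0.
rewrite /coef; case: (boolP (j < L)%N) => _; last exact: measurable_wrt_cst.
apply: measurable_wrtM => //; first exact: measurable_wrt_cst.
exact: (adapted_later hF (integrand_adapted ih j) (g0 _ _) (gle _ kM)).
Qed.

Lemma coef_bounded h C n L k M l j w : integrand P F om t h C ->
  `|coef h n L k M l j w| <= A * (1 + C).
Proof.
move=> ih; have C0 := integrand_C_ge0 ih.
have A0 : 0 <= A.
  by have := le_trans (normr_ge0 _) (wt_bound 0%N (lexx 0)); rewrite pmulr_lge0.
rewrite /coef; case: ifP => _; last by rewrite normr0; apply: mulr_ge0 => //; exact: addr_ge0.
have E : A * (1 + C) = A * om j * ((1 + C) / om j) by field; rewrite gt_eqF.
rewrite normrM E; apply: ler_pM => //; first exact: wt_bound.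
by apply: (integrand_site om0 ih).
Qed.

Lemma coef_cell h n L k M l j w s : (n <= M)%N -> (k <= M)%N -> (l < 2 ^ M)%N ->
  gcell t (2 ^ M) l s -> coef h n L k M l j w = wstep t wt h n L k s j w.
Proof.
move=> nM kM lM ls; rewrite /coef /wstep.
by rewrite (dfloor_refine (ltW t0) nM lM ls) (dfloor_refine (ltW t0) kM lM ls).
Qed.

Definition adapted_coef (G : nat -> nat -> T -> R) M :=
  (forall l j, measurable_wrt (F (gpt t (2 ^ M) l)) (G l j)) /\
  exists C : R, forall l j w, `|G l j w| <= C.

Let ba b LL G M : adapted_coef G M ->
  bounded_adapted F (gpt t (2 ^ M)) (keys b LL) (fun k l => G l k.2).
Proof.
by move=> [mG [C GC]]; split; [move=> k l _; exact: mG|exists C => k l w _; exact: GC].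
Qed.

Let tau0 M : 0 <= gpt t (2 ^ M) 0. Proof. exact: g0. Qed.
Let taund M l : gpt t (2 ^ M) l <= gpt t (2 ^ M) l.+1.
Proof. by apply: gpt_le; [exact: ltW|]. Qed.

Lemma grid_sqint b LL G M : adapted_coef G M -> sqint P (grid b LL G M).
Proof.
move=> aG.
exact: (grid_sum_sqint (K := key) hF hBK hcK (2 ^ M) (tau0 M) (@taund M) (ba b LL aG)).
Qed.

Lemma grid_mean b LL G M : adapted_coef G M -> \int[P]_w grid b LL G M w = 0.
Proof.
move=> aG.
exact: (grid_sum_mean (K := key) hF hBK hcK (2 ^ M) (tau0 M) (@taund M) (ba b LL aG)).
Qed.

Lemma grid_cov b b' LL G M : adapted_coef G M ->
  \int[P]_w (grid b LL G M w * grid b' LL G M w) =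
  r b b' * \sum_(l < 2 ^ M) (\sum_(j < LL) \int[P]_w (G l j w ^+ 2)) * (t / (2 ^ M)%:R).
Proof.
move=> aG.
rewrite (grid_sum_cov (K := key) hF hBK hcK (2 ^ M) (tau0 M) (@taund M) (ba b LL aG) (ba b' LL aG)).
rewrite mulr_sumr; apply: eq_bigr => l _; rewrite gptS [LHS]mulrC [RHS]mulrA; congr (_ * _).
rewrite sum_keys mulr_sumr; apply: eq_bigr => j _; rewrite sum_keys (bigD1 j)//= big1 ?addr0.
  rewrite /c/= eqxx; congr (_ * _); apply: Rintegral_eq => w _; rewrite expr2//.
move=> i ij; rewrite /c/=; case: eqP => [/val_inj E|_]; last by rewrite mul0r.
by rewrite E eqxx in ij.
Qed.

Lemma grid_dist b LL G G' M w :
  grid b LL G M w - grid b LL G' M w = grid b LL (fun l j w => G l j w - G' l j w) M w.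
Proof.
rewrite /grid /grid_sum -sumrB; apply: eq_bigr => l _; rewrite -sumrB.
by apply: eq_bigr => k _; rewrite mulrBl.
Qed.

Lemma cell_sum_le (v : nat -> R) (f : R -> R) N : (0 < N)%N -> Rintegrable mu `]0, t] f ->
  (forall l s, (l < N)%N -> gcell t N l s -> v l <= f s) ->
  \sum_(l < N) v l * (t / N%:R) <= \int[mu]_(s in `]0, t]) f s.
Proof.
move=> N0 fi vf; rewrite -(integral_gstep _ _ (ltW t0)).
apply: le_Rintegral => //; first exact: integrable_gstep (ltW t0).
move=> s; rewrite /= in_itv/= => s0t; have [l lN ls] := gcell_exists N0 s0t.
by rewrite (gstepE _ (ltW t0) lN ls) vf.
Qed.

Section two_integrands.
Variables (h h' : R -> nat -> T -> R) (C C' : R).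
Hypotheses (ih : integrand P F om t h C) (ih' : integrand P F om t h' C').
(* [h'] is obtained from [h] by restriction to a smaller event, or conversely. *)
Hypothesis hh' : forall s j w, (h s j w - h' s j w) ^+ 2 = h s j w ^+ 2 - h' s j w ^+ 2.

Definition moment_gap :=
  \int[mu]_(s in `]0, t]) nsum (fun j => wt s j ^+ 2 *
     (second_moment P h s j - second_moment P h' s j)).

Let dsq s j : 0 <= s ->
  \int[P]_w ((h s j w - h' s j w) ^+ 2) = second_moment P h s j - second_moment P h' s j.
Proof.
move=> s0; rewrite -RintegralB//.
- by apply: Rintegral_eq => w _; exact: hh'.
- exact: (integrand_sqint hF om0 ih _ s0).2.
- exact: (integrand_sqint hF om0 ih' _ s0).2.
Qed.

Let wsq_summable (h0 : R -> nat -> T -> R) C0 s : integrand P F om t h0 C0 -> 0 <= s ->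
  nsummable (fun j => wt s j ^+ 2 * second_moment P h0 s j) /\
  nsum (fun j => wt s j ^+ 2 * second_moment P h0 s j) <= A ^+ 2 * C0.
Proof.
move=> i0 s0; have [s1 n1] := second_moment_sum hF om0 i0 s0.
have H j : wt s j ^+ 2 * second_moment P h0 s j <= A ^+ 2 * (om j ^+ 2 * second_moment P h0 s j).
  by rewrite mulrA; apply: ler_wpM2r; [exact: second_moment_ge0|exact: (wt_sq om0 wt_bound)].
have sw : nsummable (fun j => wt s j ^+ 2 * second_moment P h0 s j).
  apply: nsummable_le (nsummableZ (A ^+ 2) s1) _ => j.
  by rewrite ger0_norm// mulr_ge0 ?sqr_ge0// second_moment_ge0.
split=> //; apply: le_trans (ler_nsum sw (nsummableZ (A ^+ 2) s1) H) _.
by rewrite nsumZ// ler_wpM2l ?sqr_ge0.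
Qed.

Let wt_meas j : measurable_fun `]0, t] (wt^~ j).
Proof.
apply: (@measurable_fun_cvg _ _ _ _ (fun k s => wt (dfloor t k s) j)).
  by move=> k; exact: (measurable_dfloor3 (fun x _ _ => wt x j) k k k t0).
by move=> s; rewrite /= in_itv/= => s0t; exact: (wt_dfloor_cvg om0 wt_bound wt_lip).
Qed.

Let wsq_int (h0 : R -> nat -> T -> R) C0 : integrand P F om t h0 C0 ->
  Rintegrable mu `]0, t] (fun s => nsum (fun j => wt s j ^+ 2 * second_moment P h0 s j)).
Proof.
move=> i0; have sm s j := second_moment_ge0 P h0 s j.
apply: (@integrable_itv_bounded _ _ _ (A ^+ 2 * C0)).
  apply: measurable_nsum => [j|s].
    apply: measurable_funM; first exact: (measurable_funX 2 (wt_meas j)).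
    exact: (measurable_second_moment hF om0 t0 i0).
  by rewrite /= in_itv/= => /andP[/ltW s0 _]; case: (wsq_summable i0 s0).
move=> s /andP[/ltW s0 _]; rewrite ger0_norm; first by case: (wsq_summable i0 s0).
by apply: nsum_ge0 => j; rewrite mulr_ge0 ?sqr_ge0.
Qed.

Lemma integrable_moment : Rintegrable mu `]0, t]
  (fun s => nsum (fun j => wt s j ^+ 2 * second_moment P h s j)).
Proof. exact: wsq_int ih. Qed.

Let gap_nsumB s : 0 <= s ->
  nsum (fun j => wt s j ^+ 2 * (second_moment P h s j - second_moment P h' s j)) =
  nsum (fun j => wt s j ^+ 2 * second_moment P h s j) -
  nsum (fun j => wt s j ^+ 2 * second_moment P h' s j).
Proof.
move=> s0; have [s1 _] := wsq_summable ih s0; have [s2 _] := wsq_summable ih' s0.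
by rewrite -nsumB//; apply: eq_nsum => j; rewrite mulrBr.
Qed.

Lemma moment_gapE : moment_gap =
  \int[mu]_(s in `]0, t]) nsum (fun j => wt s j ^+ 2 * second_moment P h s j) -
  \int[mu]_(s in `]0, t]) nsum (fun j => wt s j ^+ 2 * second_moment P h' s j).
Proof.
rewrite -RintegralB//; [|exact: wsq_int ih|exact: wsq_int ih'].
by apply: Rintegral_eq => s; rewrite /= in_itv/= => /andP[/ltW s0 _]; exact: gap_nsumB.
Qed.

Let gap_int : Rintegrable mu `]0, t] (fun s => nsum (fun j => wt s j ^+ 2 *
     (second_moment P h s j - second_moment P h' s j))).
Proof.
apply: (Rintegrable_eq mI _ (RintegrableB mI (wsq_int ih) (wsq_int ih'))) => s.
by rewrite /= in_itv/= => /andP[/ltW s0 _]; rewrite gap_nsumB.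
Qed.

Variables (n L m n' L' m' : nat).

Lemma noise_sum_sqint b : sqint P (noise_sum (B b) wt t h n L m).
Proof.
have -> : noise_sum (B b) wt t h n L m = grid b L (coef h n L (n + m) (n + m)) (n + m).
  by apply/funext => w; exact: noise_sum_grid.
apply: grid_sqint; split=> [l j|]; first exact: coef_measurable_wrt ih _.
by exists (A * (1 + C)) => l j w; exact: coef_bounded ih.
Qed.

Lemma noise_sum_mean b : \int[P]_w noise_sum (B b) wt t h n L m w = 0.
Proof.
have -> : noise_sum (B b) wt t h n L m = grid b L (coef h n L (n + m) (n + m)) (n + m).
  by apply/funext => w; exact: noise_sum_grid.
apply: grid_mean; split=> [l j|]; first exact: coef_measurable_wrt ih _.
by exists (A * (1 + C)) => l j w; exact: coef_bounded ih.
Qed.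

Lemma noise_sum_cov b b' :
  \int[P]_w (noise_sum (B b) wt t h n L m w * noise_sum (B b') wt t h n L m w) =
  r b b' * \int[P]_w (noise_sum (B b) wt t h n L m w ^+ 2).
Proof.
have E b0 w : noise_sum (B b0) wt t h n L m w = grid b0 L (coef h n L (n + m) (n + m)) (n + m) w.
  exact: noise_sum_grid.
have aG : adapted_coef (coef h n L (n + m) (n + m)) (n + m).
  split=> [l j|]; first exact: coef_measurable_wrt ih _.
  by exists (A * (1 + C)) => l j w; exact: coef_bounded ih.
rewrite (@Rintegral_eq _ _ _ P _ _ (fun w => grid b L (coef h n L (n + m) (n + m)) (n + m) w *
  grid b' L (coef h n L (n + m) (n + m)) (n + m) w)); last by move=> w _; rewrite !E.
rewrite [in RHS](@Rintegral_eq _ _ _ P _ _ (fun w => grid b L (coef h n L (n + m) (n + m)) (n + m) w *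
  grid b L (coef h n L (n + m) (n + m)) (n + m) w)); last by move=> w _; rewrite !E expr2.
by rewrite !grid_cov// r1 mul1r.
Qed.

Let step_in k s j : 0 < s <= t -> sqint P (wstep t wt h n L k s j).
Proof.
move=> /(dfloor_itv k)[D0 _ _]; rewrite /wstep; case: (boolP (j < L)%N) => _; last exact: sqint_cst.
by apply: sqintZ; exact: (integrand_sqint hF om0 ih).
Qed.

(** Both sums are put on the common grid of [2 ^ M] cells, where the isometry is exact. The
    difference of the coefficients is split through the two unfrozen integrands, whence the factor
    3; the middle piece is [moment_gap] by [hh']. *)
Lemma noise_sum_dist b :
  \int[P]_w ((noise_sum (B b) wt t h n L m w - noise_sum (B b) wt t h' n' L' m' w) ^+ 2) <=
  3 * (step_gap_total P t wt h n L (n + m) + step_gap_total P t wt h' n' L' (n' + m') +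
       moment_gap).
Proof.
pose M := (n + m + (n' + m'))%N; pose LL := (L + L')%N.
pose G l j w := coef h n L (n + m) M l j w - coef h' n' L' (n' + m') M l j w.
have aG : adapted_coef G M.
  split=> [l j|]; last first.
    exists (A * (1 + C) + A * (1 + C')) => l j w; apply: le_trans (ler_normB _ _) _.
    by apply: lerD; [exact: coef_bounded ih|exact: coef_bounded ih'].
  apply: measurable_wrtB; first by apply: filtration_sigma => //; exact: g0.
    by apply: (coef_measurable_wrt _ _ _ _ ih); rewrite /M; lia.
  by apply: (coef_measurable_wrt _ _ _ _ ih'); rewrite /M; lia.
have E w : noise_sum (B b) wt t h n L m w - noise_sum (B b) wt t h' n' L' m' w = grid b LL G M w.
  by rewrite -grid_dist; congr (_ - _); apply: noise_sum_grid; rewrite /M /LL; lia.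
rewrite (@Rintegral_eq _ _ _ P _ _ (fun w => grid b LL G M w * grid b LL G M w)); last first.
  by move=> w _; rewrite E expr2.
rewrite grid_cov// r1 mul1r.
have ig := integrable_step_gap hF om0 t0 wt_bound wt_lip ih n L (n + m).
have ig' := integrable_step_gap hF om0 t0 wt_bound wt_lip ih' n' L' (n' + m').
have i12 := RintegrableD mI ig ig'.
have i123 := RintegrableD mI i12 gap_int.
rewrite /step_gap_total /moment_gap -(RintegralD mI ig ig') -(RintegralD mI i12 gap_int).
rewrite -(RintegralZl _ mI i123).
apply: (@cell_sum_le (fun l => \sum_(j < LL) \int[P]_w (G l j w ^+ 2))); first by rewrite expn_gt0.
  exact: RintegrableZ.
move=> l s lM ls; have s0t := gcell_le (ltW t0) lM ls.
have /andP[/ltW s0 _] := s0t.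
have [sg _] := step_gap_sum hF om0 wt_bound ih n L (n + m) s0t.
have [sg' _] := step_gap_sum hF om0 wt_bound ih' n' L' (n' + m') s0t.
have [s1 _] := wsq_summable ih s0; have [s2 _] := wsq_summable ih' s0.
have s3 : nsummable (fun j => wt s j ^+ 2 * (second_moment P h s j - second_moment P h' s j)).
  by under eq_fun do rewrite mulrBr; exact: nsummableB.
rewrite -nsumD// -nsumD//; last exact: nsummableD.
have s123 := nsummableD (nsummableD sg sg') s3.
rewrite -nsumZ//.
apply: le_trans (partial_le_nsum LL _ (nsummableZ 3 s123)); last first.
  move=> j; apply: mulr_ge0 => //; apply: addr_ge0.
    by apply: addr_ge0; exact: step_gap_ge0.
  by apply: mulr_ge0; [exact: sqr_ge0|rewrite -dsq//; exact: sq_mean_ge0].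
apply: ler_sum => j _.
have hs := integrand_sqint hF om0 ih j s0; have hs' := integrand_sqint hF om0 ih' j s0.
have [D0 _ _] := dfloor_itv (n + m) s0t; have [D0' _ _] := dfloor_itv (n' + m') s0t.
have st : sqint P (wstep t wt h n L (n + m) s j) by exact: step_in.
have st' : sqint P (wstep t wt h' n' L' (n' + m') s j).
  rewrite /wstep; case: (boolP (j < L')%N) => _; last exact: sqint_cst.
  by apply: sqintZ; exact: (integrand_sqint hF om0 ih').
rewrite (@Rintegral_eq _ _ _ P _ _ (fun w => (wstep t wt h n L (n + m) s j w -
    wstep t wt h' n' L' (n' + m') s j w) ^+ 2)); last first.
  have [n1 n2 n3 n4] : [/\ (n <= M)%N, (n + m <= M)%N, (n' <= M)%N & (n' + m' <= M)%N].
    split; rewrite ?leq_addr ?leq_addl//; first by rewrite /M -addnA leq_addr.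
    exact: leq_trans (leq_addr m' n') (leq_addl _ _).
  move=> w _; rewrite /G (@coef_cell h n L (n + m) M l j w s n1 n2 lM ls).
  by rewrite (@coef_cell h' n' L' (n' + m') M l j w s n3 n4 lM ls).
have -> : step_gap P t wt h' n' L' (n' + m') s j =
    \int[P]_w ((wt s j * h' s j w - wstep t wt h' n' L' (n' + m') s j w) ^+ 2).
  by apply: Rintegral_eq => w _; rewrite -sqrrN opprB.
have -> : wt s j ^+ 2 * (second_moment P h s j - second_moment P h' s j) =
    \int[P]_w ((wt s j * (h s j w - h' s j w)) ^+ 2).
  by rewrite sq_meanZ ?dsq//; exact: sqintB.
apply: sq_mean3.
- by apply: sqintB => //; exact: sqintZ.
- by apply: sqintB => //; exact: sqintZ.
- by apply: sqintZ; exact: sqintB.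
- by case: (sqintB st st').
- by move=> w; ring.
Qed.

(* [|x ^ 2 - y ^ 2| <= (1 + 1 / d) (x - y) ^ 2 + d y ^ 2] *)
Lemma noise_sum_moment b d : 0 < d ->
  `|\int[P]_w (noise_sum (B b) wt t h n L m w ^+ 2) -
    \int[mu]_(s in `]0, t]) nsum (fun j => wt s j ^+ 2 * second_moment P h s j)| <=
  (1 + d^-1) * step_gap_total P t wt h n L (n + m) +
  d * \int[mu]_(s in `]0, t]) nsum (fun j => wt s j ^+ 2 * second_moment P h s j).
Proof.
move=> d0; pose M := (n + m)%N.
have aG : adapted_coef (coef h n L M M) M.
  split=> [l j|]; first exact: coef_measurable_wrt ih _.
  by exists (A * (1 + C)) => l j w; exact: coef_bounded ih.
rewrite (@Rintegral_eq _ _ _ P _ _ (fun w => grid b L (coef h n L M M) M w *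
  grid b L (coef h n L M M) M w)); last first.
  by move=> w _; rewrite -noise_sum_grid// expr2.
rewrite grid_cov// r1 mul1r -(integral_gstep (2 ^ M) (fun l => \sum_(j < L) \int[P]_w (coef h n L M M l j w ^+ 2)) (ltW t0)).
have ig := integrable_step_gap hF om0 t0 wt_bound wt_lip ih n L M.
have iw := wsq_int ih; have iv := integrable_gstep (2 ^ M) (fun l => \sum_(j < L) \int[P]_w (coef h n L M M l j w ^+ 2)) (ltW t0).
have iv2 := RintegrableB mI iv iw.
have iz1 := RintegrableZ mI (1 + d^-1) ig; have iz2 := RintegrableZ mI d iw.
rewrite -(RintegralB mI iv iw) /step_gap_total -(RintegralZl _ mI ig) -(RintegralZl _ mI iw).
rewrite -(RintegralD mI iz1 iz2).
apply: le_trans (le_normr_Rintegral _ iv2) _ => //.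
apply: le_Rintegral => //.
- exact: Rintegrable_norm.
- exact: RintegrableD.
move=> s; rewrite /= in_itv/= => s0t; have /andP[/ltW s0 _] := s0t.
have MN : (0 < 2 ^ M)%N by rewrite expn_gt0.
have [l lM ls] := gcell_exists MN s0t; rewrite (gstepE _ (ltW t0) lM ls).
have [sg _] := step_gap_sum hF om0 wt_bound ih n L M s0t.
have [s1 _] := wsq_summable ih s0.
have st j : sqint P (wstep t wt h n L M s j) by exact: step_in.
have hs j := integrand_sqint hF om0 ih j s0.
have -> : \sum_(j < L) \int[P]_w (coef h n L M M l j w ^+ 2) =
    nsum (fun j => \int[P]_w (wstep t wt h n L M s j w ^+ 2)).
  transitivity (\sum_(j < L) \int[P]_w (wstep t wt h n L M s j w ^+ 2)).
    apply: eq_bigr => j _; apply: Rintegral_eq => w _.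
    by rewrite (@coef_cell h n L M M l j w s (leq_addr _ _) (leqnn M) lM ls).
  rewrite -(nsum_mask (fun j => \int[P]_w (wstep t wt h n L M s j w ^+ 2)) L); apply: eq_nsum => j; case: ltnP => // Lj.
  rewrite (@Rintegral_eq _ _ _ P _ _ (fun=> 0)) ?expectation_cstr// => w _.
  by rewrite /wstep ltnNge Lj/= expr0n.
have s2 : nsummable (fun j => \int[P]_w (wstep t wt h n L M s j w ^+ 2)).
  rewrite (_ : (fun j => _) = fun j => if (j < L)%N then \int[P]_w (wstep t wt h n L M s j w ^+ 2) else 0).
    exact: nsummable_mask.
  apply/funext => j; case: ltnP => // Lj.
  rewrite (@Rintegral_eq _ _ _ P _ _ (fun=> 0)) ?expectation_cstr// => w _.
  by rewrite /wstep ltnNge Lj/= expr0n.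
rewrite -nsumB//; apply: le_trans (ler_norm_nsum (nsummableB s2 s1)) _.
rewrite -nsumZ// -nsumZ// -nsumD; try exact: nsummableZ.
apply: ler_nsum.
- exact: Rintegrable_norm (nsummableB s2 s1).
- by apply: nsummableD; exact: nsummableZ.
move=> j; have wh : sqint P (fun w => wt s j * h s j w) by exact: sqintZ.
have se : sqint P (fun w => wstep t wt h n L M s j w - wt s j * h s j w) by exact: sqintB.
rewrite -(sq_meanZ _ (hs j)) -RintegralB//; [|exact: (st j).2|exact: wh.2].
rewrite /step_gap -RintegralZl//; last exact: se.2.
rewrite -RintegralZl//; last exact: wh.2.
rewrite -RintegralD//; [|by apply: RintegrableZ => //; exact: se.2|by apply: RintegrableZ => //; exact: wh.2].
have i3 := RintegrableB mT (st j).2 wh.2.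
apply: le_trans (le_normr_Rintegral _ i3) _ => //.
apply: le_Rintegral => //; first exact: Rintegrable_norm.
  apply: RintegrableD => //; apply: RintegrableZ => //; [exact: se.2|exact: wh.2].
move=> w _ /=; set x := wstep _ _ _ _ _ _ _ _ _; set y := wt s j * _.
have E : x ^+ 2 - y ^+ 2 = (x - y) ^+ 2 + 2 * ((x - y) * y) by ring.
have H : `|2 * ((x - y) * y)| <= d^-1 * (x - y) ^+ 2 + d * y ^+ 2.
  have d1 : 0 <= d^-1 by rewrite invr_ge0 ltW.
  have dn : d != 0 by rewrite gt_eqF.
  have e1 : 0 <= d^-1 * (x - y) ^+ 2 + d * y ^+ 2 - 2 * ((x - y) * y).
    rewrite (_ : _ - _ = d^-1 * ((x - y) - d * y) ^+ 2); first by rewrite mulr_ge0 ?sqr_ge0.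
    by field.
  have e2 : 0 <= d^-1 * (x - y) ^+ 2 + d * y ^+ 2 + 2 * ((x - y) * y).
    rewrite (_ : _ + 2 * _ = d^-1 * ((x - y) + d * y) ^+ 2); first by rewrite mulr_ge0 ?sqr_ge0.
    by field.
  by rewrite ler_norml; apply/andP; split; lra.
rewrite E; apply: le_trans (ler_normD _ _) _; rewrite (ger0_norm (sqr_ge0 _)).
rewrite [leRHS](_ : _ = (x - y) ^+ 2 + (d^-1 * (x - y) ^+ 2 + d * y ^+ 2)) ?lerD2l//; ring.
Qed.

End two_integrands.
End noise_isometry.

Lemma le_of_small (R : realType) (x y K : R) : 0 <= K ->
  (forall e, 0 < e -> e <= 1 -> x <= y + K * e) -> x <= y.
Proof.
move=> K0 H; rewrite leNgt; apply/negP => yx.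
have K1 : 0 < K + 1 by rewrite ltr_wpDl.
pose e := Num.min 1 ((x - y) / (K + 1) / 2).
have xy : 0 < (x - y) / (K + 1) by rewrite divr_gt0// subr_gt0.
have e0 : 0 < e by rewrite lt_min ltr01/= divr_gt0.
have e1 : e <= 1 by rewrite ge_min lexx.
have e2 : e <= (x - y) / (K + 1) / 2 by rewrite ge_min lexx orbT.
have := H e e0 e1.
have : K * e <= (x - y) / 2.
  apply: (@le_trans _ _ ((K + 1) * ((x - y) / (K + 1) / 2))).
    by apply: ler_pM => //; [exact: ltW|rewrite lerDl].
  by rewrite le_eqVlt; apply/orP; left; apply/eqP; field; rewrite gt_eqF.
lra.
Qed.

Lemma approx_arith (R : realType) (a b m m0 phi e e' x : R) : a < e' / 3 -> b < e ->
  phi - m0 < e -> m <= phi -> x <= 3 * (a + b + (m - m0)) -> x <= 6 * e + e'.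
Proof. by move=> *; lra. Qed.

Lemma sq_arith (R : realType) (d : R) : 0 < d -> d <= 1 ->
  (1 + d^-1) * (d ^+ 2 / 24) <= d /\ (1 + d^-1) * (d ^+ 2 / 2) <= d.
Proof.
move=> d0 d1; have e1 : d ^+ 2 <= d by rewrite expr2 ler_piMl// ltW.
have -> : (1 + d^-1) * (d ^+ 2 / 24) = (d ^+ 2 + d) / 24 by field; rewrite gt_eqF.
have -> : (1 + d^-1) * (d ^+ 2 / 2) = (d ^+ 2 + d) / 2 by field; rewrite gt_eqF.
by split; lra.
Qed.

(** * From approximation in probability to second moments *)

Section fatou_in_probability.
Context (R : realType) disp (T : measurableType disp) (P : probability T R).
Let mT := @measurableT _ T.

Lemma sq_mean_fatou (X : nat -> T -> R) (Y : T -> R) (C : R) :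
  (forall n, sqint P (X n)) -> measurable_fun setT Y ->
  {ae P, forall w, X n w @[n --> \oo] --> Y w} ->
  (forall n, \int[P]_w (X n w ^+ 2) <= C) ->
  sqint P Y /\ \int[P]_w (Y w ^+ 2) <= C.
Proof.
move=> sX mY XY XC.
have XY2 : {ae P, forall w, setT w -> X n w ^+ 2 @[n --> \oo] --> Y w ^+ 2}.
  move: XY; apply: filterS => w /= H _.
  by under eq_fun do rewrite expr2; rewrite expr2; exact: cvgM.
have [iY YC] := @Rintegral_fatou _ _ _ P _ mT (fun n w => X n w ^+ 2) (fun w => Y w ^+ 2) C
  (fun n => (sX n).2) (measurable_funX 2 mY) (fun n w _ => sqr_ge0 _) (fun w _ => sqr_ge0 _) XY2 XC.
by split.
Qed.

(** [X] is merely close in probability, on [E], to variables with controlled second moment. After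
    truncation of [|X|] at [K] the exceptional event contributes at most [K^2 e]; [e] tends to 0
    first, then [K] to infinity by Fatou. The factor 2 comes from [(|Z| + e)^2 <= 2 Z^2 + 2 e^2]. *)
Lemma sq_mean_approx (X : T -> R) (E : set T) (C : R) : measurable_fun setT X ->
  measurable E -> 
  (forall e, 0 < e -> exists Z, [/\ sqint P Z,
     covered P e [set w | E w /\ e <= `|X w - Z w|] & \int[P]_w (Z w ^+ 2) <= C + e]) ->
  sqint P (fun w => X w * \1_E w) /\ \int[P]_w ((X w * \1_E w) ^+ 2) <= 2 * C.
Proof.
move=> mX mE H.
pose f (K : nat) w := Num.min `|X w| K%:R * \1_E w.
have mf K : measurable_fun setT (f K).
  apply: measurable_funM; last exact: measurable_indic.
  by apply: measurable_minr => //; exact: measurableT_comp.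
have fK K w : `|f K w| <= K%:R.
  rewrite /f normrM -[leRHS]mulr1; apply: ler_pM => //.
    by rewrite ger0_norm ?le_min ?normr_ge0 ?ler0n// ge_min lexx orbT.
  by rewrite indicE ger0_norm// -[leRHS]/(1%:R) ler_nat leq_b1.
have sf K : sqint P (f K) by exact: sqint_bounded (mf K) (fK K).
have mY : measurable_fun setT (fun w => `|X w| * \1_E w : R).
  by apply: measurable_funM; [exact: measurableT_comp|exact: measurable_indic].
have [] := @sq_mean_fatou f (fun w => `|X w| * \1_E w) (2 * C) sf mY.
- apply: aeW => w; apply: cvgMl.
  apply/cvgrPdist_lt => e e0; near=> K; rewrite min_l ?subrr ?normr0//.
  near: K; exact: nbhs_infty_ger.
(* [K^2 e] comes from the exceptional event, [2 e] from the bound on [Z], and [2 e^2] is at most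
   [2 e] for [e <= 1]. *)
- move=> K; apply: (@le_of_small _ _ _ (K%:R ^+ 2 + 4)).
    by rewrite addr_ge0 ?sqr_ge0.
  move=> e e0 e1; have [Z [sZ [A [mA PA HA]] ZC]] := H e e0.
  have iA : Rintegrable P setT (\1_A : T -> R).
    by apply: (@intble_bounded _ _ _ _ _ 1) => // w; rewrite indicE ger0_norm// -[leRHS]/(1%:R) ler_nat leq_b1.
  have EA : \int[P]_w (\1_A w : R) <= e.
    by rewrite -lee_fin -probability_fine.
  have i1 := RintegrableZ mT (K%:R ^+ 2) iA; have i2 := RintegrableZ mT 2 sZ.2.
  have i3 := intble_cst P (2 * e ^+ 2); have i12 := RintegrableD mT i1 i2.
  have i123 := RintegrableD mT i12 i3.
  apply: (@le_trans _ _ (\int[P]_w (K%:R ^+ 2 * \1_A w + 2 * Z w ^+ 2 + 2 * e ^+ 2))).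
    apply: (le_Rintegral mT (sf K).2 i123).
    move=> w _; have [Aw|nAw] := pselect (A w).
      rewrite [in leRHS]indicE mem_set// mulr1 -addrA.
      apply: (@le_trans _ _ (K%:R ^+ 2)); last first.
        by rewrite lerDl addr_ge0// mulr_ge0// sqr_ge0.
      by rewrite -(real_normK (num_real (f K w))) lerXn2r ?nnegrE.
    rewrite [in leRHS]indicE memNset// mulr0 add0r.
    have [Ew|nEw] := pselect (E w); last first.
      by rewrite /f indicE memNset// mulr0 expr0n/= addr_ge0// mulr_ge0// sqr_ge0.
    have XZ : `|X w - Z w| < e by rewrite ltNge; apply/negP => h; apply: nAw; exact: HA.
    rewrite /f indicE mem_set// mulr1.
    have : 0 <= Num.min `|X w| K%:R <= `|Z w| + e.
      rewrite le_min normr_ge0 ler0n/= ge_min; apply/orP; left.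
      have := ler_normD (X w - Z w) (Z w); rewrite subrK; lra.
    have := real_normK (num_real (Z w)); have := sqr_ge0 (`|Z w| - e); nra.
  rewrite (RintegralD mT i12 i3) (RintegralD mT i1 i2) (RintegralZl _ mT iA) (RintegralZl _ mT sZ.2).
  rewrite expectation_cstr; have := sqr_ge0 (K%:R : R); nra.
- move=> [_ iY] YC.
  have EE w : (`|X w| * \1_E w) ^+ 2 = (X w * \1_E w) ^+ 2 :> R.
    by rewrite !exprMn real_normK// num_real.
  split; last by rewrite (@Rintegral_eq _ _ _ P _ _ (fun w => (`|X w| * \1_E w) ^+ 2)).
  split; first by apply: measurable_funM => //; exact: measurable_indic.
  by apply: (Rintegrable_eq mT _ iY) => w _; exact: EE.
Unshelve. all: end_near. Qed.

End fatou_in_probability.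

Section mild_moments.
Context (R : realType) disp (T : measurableType disp) (P : probability T R).
Variables (F : R -> set (set T)) (hF : filtration F).
Variable om : nat -> R.
Hypothesis om0 : forall j, 0 < om j.
Variable t : R.
Hypothesis t0 : 0 < t.
Let mu := @lebesgue_measure R.
Let mT := @measurableT _ T.

Variables (wt : R -> nat -> R) (A : R).
Hypothesis wt_bound : forall s j, 0 <= s -> `|wt s j| <= A * om j.
Hypothesis wt_lip : forall s s' j, 0 <= s -> 0 <= s' ->
  `|wt s j - wt s' j| <= A * `|s - s'| * om j.

Variables (B : bool -> nat -> R -> T -> R) (r : bool -> bool -> R).
Hypothesis hB : forall b j, brownian_motion P F (B b j).
Hypothesis hr : forall b b' j j', bracket_rate P F (B b j) (B b' j')
  (if j == j' then r b b' else 0).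
Hypothesis r1 : forall b, r b b = 1.
Hypothesis r_le1 : forall b b', `|r b b'| <= 1.

Variables (h : nat -> R -> nat -> T -> R) (C : nat -> R).
Hypothesis ih : forall N, integrand P F om t (h N) (C N).
Hypothesis hh : forall N N', (N' <= N)%N -> forall s j w,
  (h N s j w - h N' s j w) ^+ 2 = h N s j w ^+ 2 - h N' s j w ^+ 2.
Variable E : nat -> set T.
Hypothesis mE : forall N, measurable (E N).
Hypothesis E_mono : forall N N', (N <= N')%N -> E N `<=` E N'.
Hypothesis E_cover : {ae P, forall w, exists N, E N w}.
Variable X : bool -> T -> R.
Hypothesis mX : forall b, measurable_fun setT (X b).
Hypothesis approx : forall N b e eta, 0 < e -> 0 < eta ->
  \forall n \near \oo, \forall L \near \oo, \forall m \near \oo,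
    covered P eta [set w | E N w /\ e <= `|X b w - noise_sum (B b) wt t (h N) n L m w|].

Definition moment N :=
  \int[mu]_(s in `]0, t]) nsum (fun j => wt s j ^+ 2 * second_moment P (h N) s j).

Lemma zero_integrand : integrand P F om t (fun _ _ _ => 0) 0.
Proof.
split=> [j s s0|s w L s0|s j s0t].
- by apply: measurable_wrt_cst; exact: filtration_sigma.
- by rewrite big1// => j _; rewrite expr0n mulr0.
- by apply: aeW => w; exact: cvg_cst.
Qed.

Let noise0 b n L m w : noise_sum (B b) wt t (fun _ _ _ => 0) n L m w = 0.
Proof. by apply: big1 => l _; apply: big1 => j _; rewrite mulr0 mul0r. Qed.

Let good_noise N e : 0 < e -> exists n L m,
  step_gap_total P t wt (h N) n L (n + m) < e /\
  forall b, covered P e [set w | E N w /\ e <= `|X b w - noise_sum (B b) wt t (h N) n L m w|].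
Proof.
move=> e0; have g := step_gap_total_cvg0 hF om0 t0 wt_bound wt_lip (ih N) e0.
have [n [[gn tn] fn]] := filter_ex (filterI (filterI g (approx N true e0 e0)) (approx N false e0 e0)).
have [L [[gL tL] fL]] := filter_ex (filterI (filterI gn tn) fn).
have [m [[gm tm] fm]] := filter_ex (filterI (filterI gL tL) fL).
by exists n, L, m; split=> // -[].
Qed.

Lemma moment_ge0 N : 0 <= moment N.
Proof.
apply: Rintegral_ge0 => s _; apply: nsum_ge0 => j.
by rewrite mulr_ge0 ?sqr_ge0// second_moment_ge0.
Qed.

Let nsum_zero (f : nat -> R) : (forall j, f j = 0) -> nsum f = 0.
Proof.
move=> f0; rewrite -[RHS](mul0r (nsum (fun=> 0))) -nsumZ; last exact: nsummable_mask (fun=> 0) 0%N.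
by apply: eq_nsum => j; rewrite f0 mul0r.
Qed.

Let int_zero (f : R -> R) : (forall s, f s = 0) -> \int[mu]_(s in `]0, t]) f s = 0.
Proof.
by move=> f0; rewrite (@Rintegral_eq _ _ _ _ _ _ (fun=> 0)) ?Rintegral_cst ?mul0r.
Qed.

Let sq_zero (f : T -> R) : (forall w, f w = 0) -> \int[P]_w (f w ^+ 2) = 0.
Proof.
move=> f0; rewrite (@Rintegral_eq _ _ _ P _ _ (fun=> 0)) ?expectation_cstr// => w _.
by rewrite f0 expr0n.
Qed.

Let mom0 : \int[mu]_(s in `]0, t]) nsum (fun j => wt s j ^+ 2 *
   second_moment P (fun _ _ _ => 0) s j) = 0.
Proof.
apply: int_zero => s; apply: nsum_zero => j.
by rewrite /second_moment sq_zero ?mulr0.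
Qed.

Let zero_gap : step_gap_total P t wt (fun _ _ _ => 0) 0 0 0 = 0.
Proof.
apply: int_zero => s; apply: nsum_zero => j; apply: sq_zero => w.
by rewrite /wstep/= mulr0 subrr.
Qed.

(** Comparison with the zero integrand gives a bound before [X] itself is known to be square
    integrable. The constant 6 is not sharp, 3 from [noise_sum_dist] times 2 from [sq_mean_approx];
    a Gronwall argument tolerates any constant. *)
Lemma localized_moment N b :
  sqint P (fun w => X b w * \1_(E N) w) /\
  \int[P]_w ((X b w * \1_(E N) w) ^+ 2) <= 6 * moment N.
Proof.
have -> : 6 * moment N = 2 * (3 * moment N) by ring.
apply: sq_mean_approx => // e e0; have e3 : 0 < e / 3 by rewrite divr_gt0.
have [n [L [m [g cov]]]] := good_noise N e3.
exists (noise_sum (B b) wt t (h N) n L m); split.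
- exact: (noise_sum_sqint hF om0 t0 wt_bound hB hr (ih N)).
- have e3e : e / 3 <= e by rewrite ler_pdivrMr// ler_peMr ?ltW// ltr1n.
  have [A' [mA' PA' HA']] := cov b; exists A'; split=> //.
    by apply: (le_trans PA'); rewrite lee_fin.
  by move=> w [Ew h1]; apply: HA'; split=> //; exact: le_trans h1.
- have := noise_sum_dist hF om0 t0 wt_bound wt_lip hB hr r1 (ih N) zero_integrand _ n L m 0 0 0 b.
  move=> /(_ _); rewrite (@Rintegral_eq _ _ _ P _ _
    (fun w => noise_sum (B b) wt t (h N) n L m w ^+ 2)); last by move=> w _; rewrite noise0 subr0.
  rewrite addn0 zero_gap (moment_gapE hF om0 t0 wt_bound wt_lip (ih N) zero_integrand) mom0.
  move=> H; apply: (le_trans (H _)); first by move=> s j w; rewrite subr0 expr0n subr0.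
  rewrite -/(moment N); lra.
Qed.

Variable Phi : R.
Hypothesis cPhi : moment N @[N --> \oo] --> Phi.

Let moment_mono N N' : (N' <= N)%N -> moment N' <= moment N.
Proof.
move=> NN; rewrite -subr_ge0 /moment.
rewrite -(moment_gapE hF om0 t0 wt_bound wt_lip (ih N) (ih N')).
apply: Rintegral_ge0 => s; rewrite /= in_itv/= => /andP[/ltW s0 _].
apply: nsum_ge0 => j; apply: mulr_ge0; first exact: sqr_ge0.
rewrite subr_ge0; apply: le_Rintegral => //.
- exact: (integrand_sqint hF om0 (ih N') j s0).2.
- exact: (integrand_sqint hF om0 (ih N) j s0).2.
- by move=> w _; rewrite -subr_ge0 -hh// sqr_ge0.
Qed.

Let moment_le N : moment N <= Phi.
Proof.
have nd : nondecreasing_seq moment by move=> N1 N2; exact: moment_mono.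
by have := nondecreasing_cvgn_le nd (cvgP _ cPhi) N; rewrite (cvg_lim _ cPhi).
Qed.

Let Phi0 : 0 <= Phi.
Proof. exact: le_trans (moment_ge0 0%N) (moment_le 0%N). Qed.

(* The same grid serves both components, which is what their covariance requires. *)
Lemma noise_approx e : 0 < e -> exists N n L m,
  [/\ step_gap_total P t wt (h N) n L (n + m) < e, Phi - moment N < e &
  forall b, sqint P (X b) /\
    \int[P]_w ((X b w - noise_sum (B b) wt t (h N) n L m w) ^+ 2) <= 12 * e].
Proof.
move=> e0; have /cvgrPdist_lt/(_ e e0) [N0 _ HN0] := cPhi.
have := HN0 N0 (leqnn N0); rewrite /= ger0_norm ?subr_ge0 ?moment_le// => N0e.
have [n0 [L0 [m0 [g0 _]]]] := good_noise N0 e0.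
exists N0, n0, L0, m0; split=> // b.
set Z0 := noise_sum (B b) wt t (h N0) n0 L0 m0.
have sZ0 : sqint P Z0 by exact: (noise_sum_sqint hF om0 t0 wt_bound hB hr (ih N0)).
(* On [E N] the difference [X b - Z0] is close in probability to a difference of two noise sums, of
   second moment at most [6 e + e'] by [approx_arith]; [sq_mean_approx] then doubles the
   constant. *)
have loc N : (N0 <= N)%N -> sqint P (fun w => (X b w - Z0 w) * \1_(E N) w) /\
    \int[P]_w (((X b w - Z0 w) * \1_(E N) w) ^+ 2) <= 2 * (6 * e).
  move=> NN; apply: sq_mean_approx => //; first by apply: measurable_funB => //; exact: sZ0.1.
  move=> e' e'0; have e3 : 0 < e' / 3 by rewrite divr_gt0.
  have [n [L [m [g cov]]]] := good_noise N e3.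
  have sZ : sqint P (noise_sum (B b) wt t (h N) n L m).
    exact: (noise_sum_sqint hF om0 t0 wt_bound hB hr (ih N)).
  exists (fun w => noise_sum (B b) wt t (h N) n L m w - Z0 w); split.
  - exact: sqintB.
  - have e3e : e' / 3 <= e' by rewrite ler_pdivrMr// ler_peMr ?ltW// ltr1n.
    have [A' [mA' PA' HA']] := cov b; exists A'; split=> //.
      by apply: (le_trans PA'); rewrite lee_fin.
    move=> w [Ew h1]; apply: HA'; split=> //.
    by move: h1; rewrite opprB addrA subrK; exact: le_trans.
  - have := noise_sum_dist hF om0 t0 wt_bound wt_lip hB hr r1 (ih N) (ih N0) (hh NN) n L m n0 L0 m0 b.
    rewrite (moment_gapE hF om0 t0 wt_bound wt_lip (ih N) (ih N0)) -!/(moment _).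
    exact: (approx_arith g g0 N0e (moment_le N)).
have mXZ : measurable_fun setT (fun w => X b w - Z0 w).
  by apply: measurable_funB => //; exact: sZ0.1.
(* The events [E N] exhaust almost the whole space, so the indicator disappears in the limit and
   Fatou keeps the bound. *)
have cX : {ae P, forall w, (X b w - Z0 w) * \1_(E (N0 + N)%N) w @[N --> \oo] --> X b w - Z0 w}.
  move: E_cover; apply: filterS => w [N1 EN1].
  apply/cvgrPdist_lt => d d0; exists N1 => // N /= NN1.
  rewrite indicE mem_set ?mulr1 ?subrr ?normr0//.
  by apply: E_mono EN1; apply: leq_trans NN1 (leq_addl _ _).
have bX N : \int[P]_w (((X b w - Z0 w) * \1_(E (N0 + N)%N) w) ^+ 2) <= 12 * e.
  by rewrite (_ : 12 * e = 2 * (6 * e)); [have [] := loc _ (leq_addr N N0)|ring].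
have [sXZ XZ] := sq_mean_fatou (fun N => (loc _ (leq_addr N N0)).1) mXZ cX bX.
split; last exact: XZ.
have := sqintD sXZ sZ0; rewrite (_ : (fun w => _) = X b)//.
by apply/funext => w; rewrite subrK.
Qed.

Lemma mild_sqint b : sqint P (X b).
Proof. by have [N [n [L [m [_ _ /(_ b)[]]]]]] := noise_approx ltr01. Qed.

Lemma mild_mean b : \int[P]_w X b w = 0.
Proof.
apply/eqP; rewrite -normr_eq0 eq_le normr_ge0 andbT.
apply: (@le_of_small _ _ _ 1) => // d d0 d1; rewrite add0r mul1r.
(* The second moment of [X b - Z] is then at most [d^2], so that [|x| <= x^2 / (2 d) + d / 2] bounds
   the mean by [d]. *)
have e0 : 0 < d ^+ 2 / 12 by rewrite divr_gt0// exprn_gt0.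
have [N [n [L [m [_ _ /(_ b)[sX XZ]]]]]] := noise_approx e0.
set Z := noise_sum (B b) wt t (h N) n L m in XZ.
have sZ : sqint P Z by exact: (noise_sum_sqint hF om0 t0 wt_bound hB hr (ih N)).
have Z0 : \int[P]_w Z w = 0 by exact: (noise_sum_mean hF om0 t0 wt_bound hB hr (ih N)).
have sXZ := sqintB sX sZ; have iX := sqint_intble sX; have iZ := sqint_intble sZ.
have iXZ := RintegrableB mT iX iZ.
rewrite -[X in `|X|]subr0 -[in X in `|X|]Z0 -(RintegralB mT iX iZ).
apply: le_trans (le_normr_Rintegral mT iXZ) _.
have i1 := RintegrableZ mT (2 * d)^-1 sXZ.2; have i2 := intble_cst P (d / 2).
have i12 := RintegrableD mT i1 i2.
apply: (@le_trans _ _ (\int[P]_w ((2 * d)^-1 * (X b w - Z w) ^+ 2 + d / 2))).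
  apply: (le_Rintegral mT (Rintegrable_norm iXZ) i12) => w _.
  have := sqr_ge0 (`|X b w - Z w| - d); rewrite sqrrB real_normK ?num_real// => H.
  rewrite -(ler_pM2l (_ : 0 < 2 * d)) ?mulr_gt0// [leRHS](_ : _ = (X b w - Z w) ^+ 2 + d ^+ 2).
    by lra.
  by field; rewrite gt_eqF.
rewrite (RintegralD mT i1 i2) (RintegralZl _ mT sXZ.2) expectation_cstr.
have d2 : 0 < (2 * d)^-1 by rewrite invr_gt0 mulr_gt0.
have : (2 * d)^-1 * \int[P]_w ((X b w - Z w) ^+ 2) <= (2 * d)^-1 * d ^+ 2.
  by rewrite ler_pM2l//; lra.
by rewrite (_ : (2 * d)^-1 * d ^+ 2 = d / 2); [lra|field; rewrite gt_eqF].
Qed.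

(** Both components are approximated on one grid, where [noise_sum_cov] gives exactly [r b b'] times
    the second moment; [noise_sum_moment] brings that moment to [Phi]. *)
Lemma mild_cov b b' : \int[P]_w (X b w * X b' w) = r b b' * Phi.
Proof.
apply/eqP; rewrite -subr_eq0 -normr_eq0 eq_le normr_ge0 andbT.
apply: (@le_of_small _ _ _ (3 * Phi + 30)); first by rewrite addr_ge0// mulr_ge0.
move=> d d0 d1; rewrite add0r.
(* The errors get multiplied below by [1 + 1 / d]; being of order [d^2], they remain of order [d],
   as quantified in [sq_arith]. *)
have e0 : 0 < d ^+ 2 / 24 by rewrite divr_gt0// exprn_gt0.
have [N [n [L [m [g gPhi H]]]]] := noise_approx e0.
have e1 : d ^+ 2 <= d by rewrite expr2 ler_piMl// ltW.
pose Z b := noise_sum (B b) wt t (h N) n L m.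
have sZ b0 : sqint P (Z b0) by exact: (noise_sum_sqint hF om0 t0 wt_bound hB hr (ih N)).
have [sX XZ] := H b; have [sX' XZ'] := H b'.
have mom b0 : `|\int[P]_w (Z b0 w ^+ 2) - Phi| <= (Phi + 2) * d.
  have := noise_sum_moment hF om0 t0 wt_bound wt_lip hB hr r1 (ih N) n L m b0 d0.
  rewrite -/(Z b0) -/(moment N) => H1.
  have : (1 + d^-1) * step_gap_total P t wt (h N) n L (n + m) <= d.
    apply: (@le_trans _ _ ((1 + d^-1) * (d ^+ 2 / 24))).
      by rewrite ler_wpM2l ?(ltW g)// addr_ge0// invr_ge0 ltW.
    by case: (sq_arith d0 d1).
  move=> H2; have Hl := moment_le N; have M0 := moment_ge0 N.
  have : d * moment N <= Phi * d by rewrite mulrC ler_wpM2r// ltW.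
  move: H1; rewrite !ler_norml => /andP[H1 H1'] H3; apply/andP; split; lra.
have sq b0 : \int[P]_w (Z b0 w ^+ 2) <= 2 * Phi + 2.
  have := mom b0; rewrite ler_norml => /andP[_].
  have : (Phi + 2) * d <= Phi + 2 by rewrite ler_piMr// addr_ge0.
  lra.
have i1 := sqint_mul sX sX'; have i2 := sqint_mul (sZ b) (sZ b').
have cZ : \int[P]_w (Z b w * Z b' w) = r b b' * \int[P]_w (Z b w ^+ 2).
  exact: (noise_sum_cov hF om0 t0 wt_bound hB hr r1 (ih N)).
have A1 : `|\int[P]_w (Z b w * Z b' w) - r b b' * Phi| <= (Phi + 2) * d.
  rewrite cZ -mulrBr normrM -[leRHS]mul1r; apply: ler_pM => //; exact: mom.
have A2 : `|\int[P]_w (X b w * X b' w) - \int[P]_w (Z b w * Z b' w)| <= (2 * Phi + 10) * d.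
  rewrite -(RintegralB mT i1 i2).
  have i12 := RintegrableB mT i1 i2.
  apply: le_trans (le_normr_Rintegral mT i12) _.
  have sD := sqintB sX (sZ b); have sD' := sqintB sX' (sZ b').
  pose c := 1 + d^-1.
  have j1 := RintegrableZ mT c sD.2; have j2 := RintegrableZ mT c sD'.2.
  have j3 := RintegrableZ mT d (sZ b).2; have j4 := RintegrableZ mT d (sZ b').2.
  have j12 := RintegrableD mT j1 j2; have j34 := RintegrableD mT j3 j4.
  have j := RintegrableZ mT 2^-1 (RintegrableD mT j12 j34).
  apply: (@le_trans _ _ (\int[P]_w (2^-1 * (c * (X b w - Z b w) ^+ 2 + c * (X b' w - Z b' w) ^+ 2
    + (d * Z b w ^+ 2 + d * Z b' w ^+ 2))))).
    apply: (le_Rintegral mT (Rintegrable_norm i12) j) => w _.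
    have dn : d != 0 by rewrite gt_eqF.
    have dV : 0 < d^-1 by rewrite invr_gt0.
    set p := X b w - Z b w; set q := X b' w - Z b' w.
    have -> : X b w * X b' w - Z b w * Z b' w = p * q + p * Z b' w + Z b w * q.
      by rewrite /p /q; ring.
    have Y (x y : R) : `|x * y| <= 2^-1 * (d^-1 * x ^+ 2 + d * y ^+ 2).
      have a1 : 0 <= d^-1 * (x - d * y) ^+ 2 by rewrite mulr_ge0 ?sqr_ge0// ltW.
      have a2 : 0 <= d^-1 * (x + d * y) ^+ 2 by rewrite mulr_ge0 ?sqr_ge0// ltW.
      have b1 : d^-1 * (x - d * y) ^+ 2 = d^-1 * x ^+ 2 + d * y ^+ 2 - 2 * (x * y) by field.
      have b2 : d^-1 * (x + d * y) ^+ 2 = d^-1 * x ^+ 2 + d * y ^+ 2 + 2 * (x * y) by field.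
      by rewrite ler_norml; apply/andP; split; lra.
    have Y1 : `|p * q| <= 2^-1 * (p ^+ 2 + q ^+ 2).
      have a1 := sqr_ge0 (p - q); have a2 := sqr_ge0 (p + q).
      by rewrite ler_norml; apply/andP; split; lra.
    apply: le_trans (ler_normD _ _) _; apply: le_trans (lerD (ler_normD _ _) (lexx _)) _.
    have := Y p (Z b' w); have := Y q (Z b w); rewrite (mulrC q) /c; lra.
  rewrite (RintegralZl _ mT (RintegrableD mT j12 j34)) (RintegralD mT j12 j34).
  rewrite (RintegralD mT j1 j2) (RintegralD mT j3 j4).
  rewrite (RintegralZl _ mT sD.2) (RintegralZl _ mT sD'.2) (RintegralZl _ mT (sZ b).2) (RintegralZl _ mT (sZ b').2).
  have cb (x : R) : x <= 12 * (d ^+ 2 / 24) -> c * x <= d.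
    move=> xd; apply: (@le_trans _ _ (c * (d ^+ 2 / 2))).
      rewrite ler_wpM2l ?addr_ge0 ?invr_ge0 ?(ltW d0)//; lra.
    by case: (sq_arith d0 d1).
  have := cb _ XZ; have := cb _ XZ'.
  have : d * \int[P]_w (Z b w ^+ 2) <= d * (2 * Phi + 2) by rewrite ler_pM2l.
  have : d * \int[P]_w (Z b' w ^+ 2) <= d * (2 * Phi + 2) by rewrite ler_pM2l.
  rewrite -/(Z b) -/(Z b'); lra.
rewrite -(subrK (\int[P]_w (Z b w * Z b' w)) (\int[P]_w (X b w * X b' w))) -addrA.
apply: le_trans (ler_normD _ _) _.
apply: le_trans (lerD A2 A1) _.
have : 0 <= Phi * d by rewrite mulr_ge0// ltW.
lra.
Qed.

End mild_moments.

(** * Transition kernels *)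

Section more_sums.
Context {R : realType}.
Implicit Types f g : nat -> R.

Lemma nsum_delta f j : nsummable (fun k => f k * (k == j)%:R) /\
  nsum (fun k => f k * (k == j)%:R) = f j.
Proof.
have E : (fun k => f k * (k == j)%:R) =
    fun k => if (k < j.+1)%N then f k * (k == j)%:R else 0.
  apply/funext => k; case: ltnP => // jk.
  by rewrite (gtn_eqF jk) mulr0.
rewrite E; split; first exact: nsummable_mask.
rewrite nsum_mask big_ord_recr/= eqxx mulr1 big1 ?add0r// => i _.
by rewrite (ltn_eqF (ltn_ord i)) mulr0.
Qed.

Lemma two_le_nsum f j k : (forall n, 0 <= f n) -> nsummable f -> j != k -> f j + f k <= nsum f.
Proof.
move=> f0 sf jk; have [s1 n1] := nsum_delta f j; have [s2 n2] := nsum_delta f k.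
rewrite -n1 -n2 -nsumD//; apply: ler_nsum => //; first exact: nsummableD.
move=> n; have [->|nj] := eqVneq n j; first by rewrite (negbTE jk) mulr0 addr0 mulr1.
by rewrite mulr0 add0r; case: eqP => _; rewrite ?mulr1 ?mulr0.
Qed.

Lemma nsum_dominated (f_ : nat -> nat -> R) f g : nsummable g ->
  (forall n k, `|f_ n k| <= g k) -> (forall k, f_ n k @[n --> \oo] --> f k) ->
  nsum (f_ n) @[n --> \oo] --> nsum f.
Proof.
move=> sg fg cf; apply: (proj2 (@Rintegral_dominated _ _ _ _ _ _ f_ f g _ _ _ sg _)) => //.
- by apply: aeW => k _; exact: cf.
- by apply: aeW => k _ n; exact: fg.
Qed.

Lemma nsum_zero f : (forall k, f k = 0) -> nsum f = 0.
Proof.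
move=> f0; rewrite -[RHS](mul0r (nsum (fun=> 0))) -nsumZ; last exact: nsummable_mask (fun=> 0) 0%N.
by apply: eq_nsum => j; rewrite f0 mul0r.
Qed.

Lemma bernoulli_ge (x : R) n : 0 <= x <= 1 -> 1 - n%:R * x <= (1 - x) ^+ n.
Proof.
move=> /andP[x0 x1]; elim: n => [|n IH]; first by rewrite mul0r subr0.
have : (1 - n%:R * x) * (1 - x) <= (1 - x) ^+ n * (1 - x) by rewrite ler_wpM2r// subr_ge0.
rewrite -exprSr; apply: le_trans; rewrite -natr1.
have : 0 <= n%:R * (x * x) by rewrite !mulr_ge0.
lra.
Qed.

End more_sums.

(** * Functions determined by a right derivative *)

Section right_derivative.
Context {R : realType}.
Let mu := @lebesgue_measure R.

Lemma path_integrable (h : R -> R) (r s : R) : 0 <= r -> path_continuous h ->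
  Rintegrable mu `]r, s] h.
Proof.
move=> r0 ch; have [Ch hCh] := path_bounded s ch.
apply: (@Rintegrable_bounded _ _ _ _ _ _ _ Ch) => //.
- have : (lebesgue_measure (`]r, s] : set R) < +oo)%E.
    by rewrite lebesgue_measure_itv/=; case: ifP => // _; rewrite -EFinB ltry.
  exact.
- exact: path_measurable.
- move=> x /=; rewrite in_itv/= => /andP[rx xs]; apply: hCh.
  by rewrite xs (le_trans r0)// ltW.
Qed.

Lemma itv_length (r s : R) : r <= s -> fine (mu `]r, s]) = s - r.
Proof.
move=> rs; have E : (mu `]r, s] = (s - r)%:E)%E; last by rewrite (congr1 fine E).
apply: (eq_trans (lebesgue_measure_itv `]r, s])) => /=.
move: rs; rewrite le_eqVlt lte_fin => /predU1P[->|->].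
  by rewrite ltxx subrr.
by rewrite EFinB.
Qed.

Lemma integral_itv_le (h : R -> R) (r s D : R) : r <= s -> Rintegrable mu `]r, s] h ->
  (forall x, r < x <= s -> `|h x| <= D) -> `|\int[mu]_(x in `]r, s]) h x| <= D * (s - r).
Proof.
move=> rs ih hD; apply: le_trans (le_normr_Rintegral _ ih) _ => //.
apply: (@le_trans _ _ (\int[mu]_(x in `]r, s]) D)).
  apply: le_Rintegral => //; first exact: Rintegrable_norm.
  apply: (@Rintegrable_bounded _ _ _ _ _ _ _ `|D|) => //.
  have : (lebesgue_measure (`]r, s] : set R) < +oo)%E.
    by rewrite lebesgue_measure_itv/=; case: ifP => // _; rewrite -EFinB ltry.
  exact.
by rewrite Rintegral_cst// itv_length.
Qed.

Lemma path_integralB (h : R -> R) (r s : R) : 0 <= r <= s -> path_continuous h ->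
  \int[mu]_(x in `]0, s]) h x - \int[mu]_(x in `]0, r]) h x = \int[mu]_(x in `]r, s]) h x.
Proof.
move=> /andP[r0 rs] ch; apply: Rintegral_itvB; rewrite ?bnd_simp//.
exact: path_integrable.
Qed.

(* The set of times up to which the increment is at most [e] times the elapsed time
   is closed, and open to the right. *)
Lemma right_derivative0 (F : R -> R) (a b : R) : a <= b ->
  (forall s e, a <= s <= b -> 0 < e -> exists2 dl, 0 < dl & forall x, a <= x <= b ->
     `|s - x| < dl -> `|F s - F x| < e) ->
  (forall s e, a <= s < b -> 0 < e -> exists2 dl, 0 < dl & forall h, 0 < h < dl ->
     `|F (s + h) - F s| <= e * h) -> F b = F a.
Proof.
move=> ab cF dF; apply/eqP; rewrite -subr_eq0 -normr_eq0 eq_le normr_ge0 andbT.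
suff H e : 0 < e -> `|F b - F a| <= e * (b - a).
  apply/ler_addgt0Pl => e e0; rewrite addr0.
  have b1 : 0 < b - a + 1 by rewrite ltr_wpDl// subr_ge0.
  apply: le_trans (H (e / (b - a + 1)) (divr_gt0 e0 b1)) _.
  rewrite -mulrA ler_piMr ?(ltW e0)// mulrC ler_pdivrMr// mul1r lerDl//.
move=> e0; pose S := [set t | a <= t <= b /\ forall s, a <= s <= t -> `|F s - F a| <= e * (s - a)].
have Sa : S a.
  split=> [|s]; first by rewrite lexx.
  by move=> /le_anti <-; rewrite !subrr normr0 mulr0.
have hS : has_sup S by split; [exists a|exists b => t [/andP[]]].
pose c := sup S.
have ac : a <= c by apply: ub_le_sup Sa; case: hS.
have cb : c <= b by apply: ge_sup; [exists a|move=> t [/andP[]]].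
have below s : a <= s -> s < c -> `|F s - F a| <= e * (s - a).
  move=> as_ sc; have cs0 : 0 < c - s by rewrite subr_gt0.
  have [t [_ St]] := sup_adherent cs0 hS; rewrite -/c subKr => st.
  by apply: St; rewrite as_ ltW.
have Sc : `|F c - F a| <= e * (c - a).
  move: (ac); rewrite le_eqVlt => /predU1P[<-|ac']; first by rewrite !subrr normr0 mulr0.
  apply/ler_addgt0Pl => d d0.
  have acb : a <= c <= b by rewrite ac.
  have [dl dl0 Hd] := cF c d acb d0.
  pose s := Num.max a (c - dl / 2).
  have as_ : a <= s by rewrite le_max lexx.
  have sc : s < c by rewrite gt_max ac'/= ltrBlDr ltrDl divr_gt0.
  have sd : `|c - s| < dl.
    rewrite ger0_norm ?subr_ge0 ?(ltW sc)//.
    have : c - dl / 2 <= s by rewrite le_max lexx orbT.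
    lra.
  have asb : a <= s <= b by rewrite as_ (le_trans (ltW sc)).
  have := Hd s asb sd; have := below s as_ sc; have := ler_normD (F c - F s) (F s - F a).
  rewrite addrA subrK; have : e * (s - a) <= e * (c - a) by rewrite ler_pM2l// lerB// ltW.
  lra.
have cE : c = b.
  apply/eqP; rewrite eq_le cb leNgt; apply/negP => cb'.
  have acb : a <= c < b by rewrite ac.
  have [dl dl0 Hd] := dF c e acb e0.
  pose h := Num.min (dl / 2) (b - c).
  have h0 : 0 < h by rewrite lt_min divr_gt0//= subr_gt0.
  have hd : h <= dl / 2 by rewrite ge_min lexx.
  have hb : h <= b - c by rewrite ge_min lexx orbT.
  have Sch : S (c + h).
    split=> [|s /andP[as_ sch]]; first by apply/andP; split; lra.
    have [sc|cs] := ltP s c; first exact: below.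
    move: cs; rewrite le_eqVlt => /predU1P[<-//|cs].
    have hs : 0 < s - c < dl by apply/andP; split; lra.
    have := Hd _ hs; rewrite subrKC => H1.
    have := ler_normD (F s - F c) (F c - F a); rewrite addrA subrK.
    have -> : e * (s - a) = e * (s - c) + e * (c - a) by ring.
    lra.
  have : c + h <= c by apply: ub_le_sup Sch; case: hS.
  by rewrite gerDl leNgt h0.
by rewrite -cE.
Qed.

(** Differentiating a semigroup through Chapman-Kolmogorov gives right derivatives only; continuity
    of [f] and [g] suffices to recover the increments, by applying [right_derivative0] to [f] minus
    the integral of [g]. *)
Lemma right_derivative_integral (f g : R -> R) (a b : R) : 0 <= a -> a <= b ->
  path_continuous f -> path_continuous g ->
  (forall s e, 0 <= s -> 0 < e -> exists2 dl, 0 < dl & forall h, 0 < h < dl ->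
     `|f (s + h) - f s - h * g s| <= e * h) ->
  f b - f a = \int[mu]_(s in `]a, b]) g s.
Proof.
move=> a0 ab cf cg fg; have b0 := le_trans a0 ab.
have [C hC] := path_bounded b cg.
pose G s := \int[mu]_(x in `]0, s]) g x.
have GB r s : 0 <= r -> r <= s -> G s - G r = \int[mu]_(x in `]r, s]) g x.
  by move=> r0 rs; apply: path_integralB => //; rewrite r0.
have Glip r s : 0 <= r -> r <= s -> s <= b -> `|G s - G r| <= `|C| * (s - r).
  move=> r0 rs sb; rewrite GB//; apply: integral_itv_le => //; first exact: path_integrable.
  move=> x /andP[rx xs]; apply: le_trans (ler_norm _); apply: hC.
  by rewrite (le_trans xs) ?(le_trans r0) ?(ltW rx).
suff : f b - G b = f a - G a by rewrite -GB//; lra.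
apply: (@right_derivative0 (fun s => f s - G s)) => //.
- move=> s e /andP[as_ sb] e0; have s0 := le_trans a0 as_.
  have e2 : 0 < e / 2 by rewrite divr_gt0.
  have /path_continuousP/(_ s s0 _ e2)[dl dl0 Hd] := cf.
  have C1 : 0 < `|C| + 1 by rewrite ltr_wpDl.
  exists (Num.min dl (e / 2 / (`|C| + 1))); first by rewrite lt_min dl0 divr_gt0.
  move=> x /andP[ax xb]; rewrite lt_min => /andP[sx1 sx2].
  have x0 := le_trans a0 ax; have H1 := Hd x x0 sx1.
  have H2 : `|G s - G x| <= `|C| * `|s - x|.
    have [xs|sx] := leP x s.
      by rewrite (ger0_norm (_ : 0 <= s - x)) ?subr_ge0// Glip.
    by rewrite distrC (distrC s) (ger0_norm (_ : 0 <= x - s)) ?subr_ge0 ?Glip// ltW.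
  have H3 : `|C| * `|s - x| <= e / 2.
    apply: (@le_trans _ _ ((`|C| + 1) * `|s - x|)); first by rewrite ler_wpM2r// lerDl.
    by rewrite mulrC -ler_pdivlMr// ltW.
  rewrite (_ : _ - _ = (f s - f x) - (G s - G x)); last by ring.
  have := ler_normB (f s - f x) (G s - G x); lra.
- move=> s e /andP[as_ sb] e0; have s0 := le_trans a0 as_.
  have e2 : 0 < e / 2 by rewrite divr_gt0.
  have [d1 d10 H1] := fg s _ s0 e2.
  have /path_continuousP/(_ s s0 _ e2)[d2 d20 H2] := cg.
  exists (Num.min (Num.min d1 d2) (b - s)); first by rewrite !lt_min d10 d20 subr_gt0.
  move=> h /andP[h0]; rewrite !lt_min => /andP[/andP[hd1 hd2] hb].
  have hh : 0 < h < d1 by rewrite h0.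
  have := H1 h hh; have sh : s <= s + h by rewrite lerDl ltW.
  have I1 : Rintegrable mu `]s, s + h] g by exact: path_integrable.
  have I2 : Rintegrable mu `]s, s + h] (fun=> g s) by apply: path_integrable => // x x0; exact: cvg_cst.
  have E : G (s + h) - G s - h * g s = \int[mu]_(x in `]s, s + h]) (g x - g s).
    rewrite GB// RintegralB//; congr (_ - _).
    by rewrite Rintegral_cst// itv_length// addrC addKr mulrC.
  have H3 : `|G (s + h) - G s - h * g s| <= e / 2 * h.
    have {3}-> : h = s + h - s by ring.
    rewrite E; apply: integral_itv_le => //; first exact: RintegrableB.
    move=> x /andP[sx xh]; rewrite distrC ltW// H2//; first by rewrite (le_trans s0)// ltW.
    rewrite distrC ger0_norm ?subr_ge0 ?(ltW sx)//; lra.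
  move=> H4; rewrite (_ : _ - _ = (f (s + h) - f s - h * g s) - (G (s + h) - G s - h * g s)); last by ring.
  have := ler_normB (f (s + h) - f s - h * g s) (G (s + h) - G s - h * g s).
  have -> : e * h = e / 2 * h + e / 2 * h by field.
  lra.
Qed.

Lemma lip_path_continuous (f : R -> R) (C : R) :
  (forall r s, 0 <= r -> r <= s -> `|f s - f r| <= C * (s - r)) -> path_continuous f.
Proof.
move=> H; apply/path_continuousP => s s0 e e0.
have C1 : 0 < `|C| + 1 by rewrite ltr_wpDl.
exists (e / (`|C| + 1)); first by rewrite divr_gt0.
move=> x x0; rewrite ltr_pdivlMr// => sx; apply: le_lt_trans sx.
have K : C * `|s - x| <= `|s - x| * (`|C| + 1).
  by rewrite mulrC ler_wpM2l//; have := ler_norm C; lra.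
apply: le_trans K; have [xs|sx] := leP x s.
  by rewrite (ger0_norm (_ : 0 <= s - x)) ?subr_ge0// H.
by rewrite distrC (distrC s) (ger0_norm (_ : 0 <= x - s)) ?subr_ge0 ?H// ltW.
Qed.

End right_derivative.

(** * The forward equation of the transition kernel *)

Section kernel.
Context {R : realType}.
Let mu := @lebesgue_measure R.
Variables (a : nat -> nat -> R) (p : R -> nat -> nat -> R).

Record stochastic_matrix (m : nat -> nat -> R) : Prop := {
  sm_ge0 : forall i j, 0 <= m i j;
  sm_summable : forall i, nsummable (m i);
  sm_sum : forall i, nsum (m i) = 1 }.

(** Rows of [a] sum to 1 with the diagonal entry included, so the generator is [a] minus the
    identity. *)
Record semigroup_of : Prop := {
  sg_rates : stochastic_matrix a;
  sg_stochastic : forall t, 0 <= t -> stochastic_matrix (p t);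
  sg_0 : forall i j, p 0 i j = (i == j)%:R;
  sg_ck : forall s t i j, 0 <= s -> 0 <= t ->
    p (s + t) i j = nsum (fun k => p s i k * p t k j);
  sg_deriv : forall i j, (p t i j - (i == j)%:R) / t @[t --> 0^'+] --> a i j - (i == j)%:R }.

Hypothesis hp : semigroup_of.

Let p_ge0 t i j : 0 <= t -> 0 <= p t i j.
Proof. by move=> t0; exact: sm_ge0 (sg_stochastic hp t0) i j. Qed.

Let p_sum t i : 0 <= t -> nsummable (p t i).
Proof. by move=> t0; exact: sm_summable (sg_stochastic hp t0) i. Qed.

Let p_sum1 t i : 0 <= t -> nsum (p t i) = 1.
Proof. by move=> t0; exact: sm_sum (sg_stochastic hp t0) i. Qed.

Lemma stochastic_le1 m i j : stochastic_matrix m -> m i j <= 1.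
Proof.
by move=> hm; rewrite -(sm_sum hm i) term_le_nsum//; [exact: sm_ge0|exact: sm_summable].
Qed.

Let p_le1 t i j : 0 <= t -> p t i j <= 1.
Proof. by move=> t0; apply: stochastic_le1; exact: sg_stochastic. Qed.

Let a_le1 i j : a i j <= 1. Proof. exact: stochastic_le1 (sg_rates hp). Qed.
Let a_ge0 i j : 0 <= a i j. Proof. exact: sm_ge0 (sg_rates hp) i j. Qed.

Let mul_summable t i (f : nat -> R) (C : R) : 0 <= t -> (forall k, `|f k| <= C) ->
  nsummable (fun k => p t i k * f k).
Proof.
move=> t0 fC; apply: nsummable_le (nsummableZ C (p_sum i t0)) _ => k.
by rewrite normrM ger0_norm ?p_ge0// mulrC ler_wpM2r// p_ge0.
Qed.

Lemma kernel_pow t i n : 0 <= t -> p t i i ^+ n <= p (n%:R * t) i i.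
Proof.
move=> t0; elim: n => [|n IH]; first by rewrite mul0r (sg_0 hp) eqxx.
have nt : 0 <= n%:R * t by rewrite mulr_ge0.
rewrite -natr1 mulrDl mul1r (sg_ck hp)//.
apply: (@le_trans _ _ (p (n%:R * t) i i * p t i i)).
  by rewrite exprSr ler_wpM2r// p_ge0.
apply: (@term_le_nsum _ (fun k => p (n%:R * t) i k * p t k i)).
  by move=> k; rewrite mulr_ge0// p_ge0.
by apply: (@mul_summable _ _ _ 1) => // k; rewrite ger0_norm ?p_ge0// p_le1.
Qed.

(** The derivative at 0 is pointwise in the site, while all later bounds must be uniform in [i]. On
    the diagonal it is [a i i - 1 >= -1]; [kernel_pow] and the Bernoulli inequality carry this from
    [h / n] to [h], with the same constant for every site. *)
Lemma kernel_diag h i : 0 <= h -> 1 - h <= p h i i.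
Proof.
move=> h0; apply/ler_addgt0Pl => e e0.
have h1 : 0 < h + 1 by rewrite ltr_wpDl.
pose e' := e / (h + 1); have e'0 : 0 < e' by rewrite divr_gt0.
have /cvgrPdist_lt/(_ _ e'0) := @sg_deriv hp i i; rewrite eqxx => -[dl /= dl0 Hd].
(* The first part puts [h / n] inside the range [dl] where the derivative at 0 is accurate; the
   second makes the base of the Bernoulli inequality nonnegative. *)
pose n := (Num.truncn (h / dl) + Num.truncn ((1 + e') * h)).+1.
have n0 : 0 < n%:R :> R by rewrite ltr0n.
have hn : h / n%:R < dl.
  rewrite ltr_pdivrMr// mulrC -ltr_pdivrMr//.
  by apply: lt_le_trans (truncnS_gt _) _; rewrite ler_nat /n ltnS leq_addr.
have hn1 : (1 + e') * (h / n%:R) <= 1.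
  rewrite mulrA ler_pdivrMr// mul1r.
  by apply: le_trans (ltW (truncnS_gt _)) _; rewrite ler_nat /n ltnS leq_addl.
have hn0 : 0 <= h / n%:R by rewrite divr_ge0.
have pn : 1 - (1 + e') * (h / n%:R) <= p (h / n%:R) i i.
  move: hn0; rewrite le_eqVlt => /predU1P[<-|hn0].
    by rewrite mulr0 subr0 (sg_0 hp) eqxx.
  have := Hd (h / n%:R); rewrite /= sub0r normrN gtr0_norm// => /(_ hn hn0).
  rewrite ltr_norml => /andP[_ H].
  have := a_ge0 i i; move: H; set x := h / n%:R in hn0 *.
  set y := (_ / x) => H ai.
  have yE : y * x = p x i i - 1 by rewrite /y divfK// gt_eqF.
  have : - (1 + e') * x <= y * x by rewrite ler_wpM2r ?(ltW hn0)//; lra.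
  rewrite yE; lra.
have x01 : 0 <= (1 + e') * (h / n%:R) <= 1.
  by rewrite hn1 andbT mulr_ge0// addr_ge0// ltW.
have := kernel_pow i n hn0; rewrite [n%:R * _]mulrC divfK ?gt_eqF//.
move=> kp; rewrite -lerBlDl; apply: le_trans kp; apply: (@le_trans _ _ ((1 - (1 + e') * (h / n%:R)) ^+ n)); last first.
  by rewrite lerXn2r ?nnegrE ?subr_ge0// p_ge0.
apply: le_trans (bernoulli_ge n x01).
have -> : n%:R * ((1 + e') * (h / n%:R)) = (1 + e') * h by field; rewrite gt_eqF.
have : e' * h <= e by rewrite /e' mulrAC ler_pdivrMr// ler_pM2l// lerDl.
lra.
Qed.

Lemma kernel_near_id h i j : 0 <= h -> `|p h i j - (i == j)%:R| <= h.
Proof.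
move=> h0; have [<-|ij] := eqVneq i j.
  have := kernel_diag i h0; have := p_le1 i i h0 => H1 H2.
  by rewrite -[true%:R]/(1 : R) ler_norml; apply/andP; split; lra.
rewrite -[false%:R]/(0 : R) subr0 ger0_norm ?p_ge0//; have := kernel_diag i h0.
have := two_le_nsum (p_ge0 i ^~ h0) (p_sum i h0) ij; rewrite p_sum1//; lra.
Qed.

Let incr_summable t h i j : 0 <= t -> 0 <= h ->
  nsummable (fun k => p t i k * (p h k j - (k == j)%:R)).
Proof. by move=> t0 h0; apply: (@mul_summable _ _ _ h) => // k; exact: kernel_near_id. Qed.

Lemma kernel_incr t h i j : 0 <= t -> 0 <= h ->
  p (t + h) i j - p t i j = nsum (fun k => p t i k * (p h k j - (k == j)%:R)).
Proof.
move=> t0 h0; have [s1 n1] := nsum_delta (p t i) j.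
rewrite (sg_ck hp)// -n1 -nsumB//; last first.
  by apply: (@mul_summable _ _ _ 1) => // k; rewrite ger0_norm ?p_ge0// p_le1.
by apply: eq_nsum => k; rewrite mulrBr.
Qed.

Lemma kernel_lip i j r s : 0 <= r -> r <= s -> `|p s i j - p r i j| <= 1 * (s - r).
Proof.
move=> r0 rs; have h0 : 0 <= s - r by rewrite subr_ge0.
rewrite -[X in p X i j - _](subrKC r s) kernel_incr//.
apply: le_trans (ler_norm_nsum (incr_summable i j r0 h0)) _.
have E : 1 * (s - r) = nsum (fun k => (s - r) * p r i k).
  by rewrite nsumZ ?p_sum// p_sum1// mul1r mulr1.
rewrite E.
apply: ler_nsum.
- exact: Rintegrable_norm (incr_summable i j r0 h0).
- by apply: nsummableZ; exact: p_sum.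
- move=> k; rewrite normrM ger0_norm ?p_ge0// mulrC ler_wpM2r ?p_ge0//.
  exact: kernel_near_id.
Qed.

Lemma kernel_path i j : path_continuous (fun t => p t i j).
Proof. exact: lip_path_continuous (kernel_lip i j). Qed.

Let row_dist h k : 0 <= h ->
  nsummable (fun j => `|p h k j - (k == j)%:R|) /\
  nsum (fun j => `|p h k j - (k == j)%:R|) <= 2 * h.
Proof.
move=> h0; have [s1 n1] := nsum_delta (fun=> 1 : R) k.
have s1' : nsummable (fun j => (k == j)%:R : R).
  by move: s1; under eq_fun do rewrite mul1r eq_sym.
have n1' : nsum (fun j => (k == j)%:R : R) = 1.
  by rewrite -[RHS]n1; apply: eq_nsum => j; rewrite mul1r eq_sym.
have sd := nsummableB (p_sum k h0) s1'.
split; first exact: Rintegrable_norm sd.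
(* Only the diagonal entry lies below that of the identity, so the distance is the signed
   difference, of sum 0, corrected by twice the diagonal deficit. *)
have E j : `|p h k j - (k == j)%:R| = p h k j - (k == j)%:R + 2 * (1 - p h k k) * (k == j)%:R.
  have [<-|kj] := eqVneq k j.
    by rewrite -[true%:R]/(1 : R) mulr1 ler0_norm ?subr_le0 ?p_le1//; ring.
  by rewrite -[false%:R]/(0 : R) mulr0 addr0 subr0 ger0_norm// p_ge0.
rewrite (eq_nsum E) nsumD//; last exact: nsummableZ.
rewrite nsumB ?p_sum// nsumZ// n1' p_sum1//; have := kernel_diag k h0; lra.
Qed.

Lemma kernel_row_lip i r s : 0 <= r -> r <= s ->
  nsummable (fun j => `|p s i j - p r i j|) /\
  nsum (fun j => `|p s i j - p r i j|) <= 2 * (s - r).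
Proof.
move=> r0 rs; have h0 : 0 <= s - r by rewrite subr_ge0.
set h := s - r in h0 *; pose f k j := p r i k * `|p h k j - (k == j)%:R|.
have f0 k j : 0 <= f k j by rewrite mulr_ge0// p_ge0.
have sf k : nsummable (f k) by apply: nsummableZ; case: (row_dist k h0).
have nf k : nsum (f k) <= 2 * h * p r i k.
  have [s1 n1] := row_dist k h0; rewrite nsumZ// mulrC ler_wpM2r//; exact: p_ge0.
have sS : nsummable (fun k => nsum (f k)).
  apply: nsummable_le (nsummableZ (2 * h) (p_sum i r0)) _ => k.
  by rewrite ger0_norm ?nsum_ge0.
have [sc sT ET] := nsum_exchange f0 sf sS.
have H j : `|p s i j - p r i j| <= nsum (f^~ j).
  rewrite -[X in p X i j - _](subrKC r s) kernel_incr//.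
  apply: le_trans (ler_norm_nsum (incr_summable i j r0 h0)) _.
  rewrite le_eqVlt; apply/orP; left; apply/eqP/eq_nsum => k.
  by rewrite normrM ger0_norm// p_ge0.
have sd : nsummable (fun j => `|p s i j - p r i j|).
  by apply: nsummable_le sT _ => j; rewrite normr_id.
split=> //; apply: le_trans (ler_nsum sd sT H) _; rewrite -ET.
apply: le_trans (ler_nsum sS (nsummableZ (2 * h) (p_sum i r0)) nf) _.
by rewrite nsumZ ?p_sum// p_sum1// mulr1.
Qed.

(** [kgen] is the right-hand side of the forward equation, the kernel followed by the generator;
    [kflow] is its incoming part. *)
Definition kflow t i j := nsum (fun k => p t i k * a k j).
Definition kgen t i j := kflow t i j - p t i j.

Lemma kflow_summable t i j : 0 <= t -> nsummable (fun k => p t i k * a k j).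
Proof. by move=> t0; apply: (@mul_summable _ _ _ 1) => // k; rewrite ger0_norm. Qed.

Lemma kflow_path i j : path_continuous (fun t => kflow t i j).
Proof.
apply: (@lip_path_continuous _ _ 2) => r s r0 rs; have s0 := le_trans r0 rs.
have [sd nd] := kernel_row_lip i r0 rs.
rewrite /kflow -nsumB; [|exact: kflow_summable|exact: kflow_summable].
have sb := nsummableB (kflow_summable i j s0) (kflow_summable i j r0).
apply: le_trans (ler_norm_nsum sb) (le_trans _ nd).
apply: ler_nsum => //; first exact: Rintegrable_norm sb.
by move=> k; rewrite -mulrBl normrM (ger0_norm (a_ge0 k j)) ler_piMr.
Qed.

Lemma kgen_path i j : path_continuous (fun t => kgen t i j).
Proof. by move=> s s0; apply: cvgB; [exact: kflow_path|exact: kernel_path]. Qed.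

(** The difference quotients of the last step are bounded by 1 through [kernel_near_id], so
    dominated convergence along [p t i] turns the derivatives at 0 into a right derivative at
    [t]. *)
Lemma kernel_deriv i j t e : 0 <= t -> 0 < e -> exists2 dl, 0 < dl & forall h, 0 < h < dl ->
  `|p (t + h) i j - p t i j - h * kgen t i j| <= e * h.
Proof.
move=> t0 e0.
have lim : (p (t + h) i j - p t i j) / h @[h --> 0^'+] --> kgen t i j.
  apply/cvg_at_rightP => h [h0 hc].
  have gE : kgen t i j = nsum (fun k => p t i k * (a k j - (k == j)%:R)).
    have [s1 n1] := nsum_delta (p t i) j.
    rewrite /kgen /kflow -n1 -nsumB//; last exact: kflow_summable.
    by apply: eq_nsum => k; rewrite mulrBr.
  have dE n : (p (t + h n) i j - p t i j) / h n =
      nsum (fun k => p t i k * ((p (h n) k j - (k == j)%:R) / h n)).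
    rewrite kernel_incr ?(ltW (h0 n))// mulrC -nsumZ; last exact: incr_summable t0 (ltW (h0 n)).
    by apply: eq_nsum => k; rewrite [LHS]mulrC mulrA.
  under eq_fun do rewrite dE.
  rewrite gE; apply: (@nsum_dominated _ _ _ (p t i)); first exact: p_sum.
    move=> n k; rewrite normrM ger0_norm ?p_ge0// ler_piMr ?p_ge0//.
    rewrite normrM normfV (gtr0_norm (h0 n)) ler_pdivrMr// mul1r.
    by apply: kernel_near_id; exact: ltW.
  move=> k; apply: cvgMr.
  by have /cvg_at_rightP/(_ h (conj h0 hc)) := @sg_deriv hp k j.
have /cvgrPdist_lt/(_ _ e0)[dl /= dl0 Hd] := lim.
exists dl => // h /andP[h0 hd].
have := Hd h; rewrite /= sub0r normrN gtr0_norm// => /(_ hd h0) H.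
rewrite -(ler_pM2r (_ : 0 < h^-1)) ?invr_gt0// mulfK ?gt_eqF//.
rewrite -[X in _ * X](gtr0_norm (_ : 0 < h^-1)) ?invr_gt0// -normrM mulrBl.
rewrite [h * _]mulrC mulfK ?gt_eqF// distrC; exact: ltW.
Qed.

Theorem kernel_forward i j r s : 0 <= r -> r <= s ->
  p s i j - p r i j = \int[mu]_(x in `]r, s]) kgen x i j.
Proof.
move=> r0 rs; apply: (@right_derivative_integral _ (fun t => p t i j)) => //; [exact: kernel_path|exact: kgen_path|].
by move=> t e t0 e0; exact: kernel_deriv.
Qed.

End kernel.

(** * Gronwall inequalities and uniqueness for the forward equation *)

Section gronwall.
Context {R : realType}.
Let mu := @lebesgue_measure R.

Lemma expR_taylor (x : R) : `|x| <= 2^-1 -> `|expR x - 1 - x| <= 2 * x ^+ 2.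
Proof.
rewrite ler_norml => /andP[x1 x2].
have l := expR_ge1Dx x; have l' := expR_ge1Dx (- x).
have e0 := expR_gt0 x.
have E : expR x * expR (- x) = 1 by rewrite -expRD subrr expR0.
rewrite ger0_norm; last by lra.
have : expR x * (1 - x) <= 1 by rewrite -[leRHS]E ler_pM2l.
have x20 := sqr_ge0 x.
nra.
Qed.

Lemma exp_path (c : R) : path_continuous (fun s => expR (c * s)).
Proof.
move=> s s0; apply: (@cvg_within_filter _ _ (fun s => expR (c * s))).
apply: (@continuous_comp _ _ _ (fun s => c * s) expR); last exact: continuous_expR.
exact: mulrl_continuous.
Qed.

Lemma exp_integral (c a b : R) : 0 <= a -> a <= b ->
  expR (c * b) - expR (c * a) = \int[mu]_(s in `]a, b]) (c * expR (c * s)).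
Proof.
move=> a0 ab; apply: (@right_derivative_integral _ (fun s => expR (c * s))) => //.
- exact: exp_path.
- by move=> s s0; apply: cvgMr; exact: exp_path.
move=> s e s0 e0.
pose k := 2 * expR (c * s) * c ^+ 2 + 1.
have k0 : 0 < k.
  by apply: ltr_wpDl => //; apply: mulr_ge0; [rewrite mulr_ge0 ?expR_ge0|exact: sqr_ge0].
have c1 : 0 < `|c| + 1 by rewrite ltr_wpDl.
exists (Num.min (e / k) ((`|c| + 1)^-1 / 2)).
  by rewrite lt_min !divr_gt0// invr_gt0.
move=> h /andP[h0]; rewrite lt_min => /andP[h1 h2].
have ch : `|c * h| <= 2^-1.
  rewrite normrM (gtr0_norm h0); apply: (@le_trans _ _ ((`|c| + 1) * h)).
    by rewrite ler_wpM2r ?(ltW h0)// lerDl.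
  by rewrite mulrC -ler_pdivlMr// mulrC ltW.
have H := expR_taylor ch.
have -> : expR (c * (s + h)) - expR (c * s) - h * (c * expR (c * s)) =
    expR (c * s) * (expR (c * h) - 1 - c * h) by rewrite mulrDr expRD; ring.
rewrite normrM (ger0_norm (expR_ge0 _)).
apply: (@le_trans _ _ (k * h * h)).
  apply: (@le_trans _ _ (expR (c * s) * (2 * (c * h) ^+ 2))).
    by rewrite ler_wpM2l ?expR_ge0.
  have -> : expR (c * s) * (2 * (c * h) ^+ 2) = (k - 1) * h * h by rewrite /k; ring.
  by rewrite !ler_wpM2r ?(ltW h0)// gerBl.
rewrite ler_wpM2r ?(ltW h0)// mulrC -ler_pdivlMr//; exact: ltW.
Qed.

(* The hypothesis halves the constant [S] up to the additive term [C]; iterate it. *)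
Lemma gronwall_iter (g : R -> R) (T M C b : R) : 0 <= C -> 0 <= M -> 0 <= b ->
  (forall s, 0 <= s <= T -> g s <= M) ->
  (forall S, 0 <= S -> (forall s, 0 <= s <= T -> g s <= S * expR (b * s)) ->
     forall r, 0 <= r <= T -> g r <= C + S / 2 * expR (b * r)) ->
  forall r, 0 <= r <= T -> g r <= 2 * C * expR (b * r).
Proof.
move=> C0 M0 b0 gM H.
have e1 s : 0 <= s <= T -> 1 <= expR (b * s).
  by move=> /andP[s0 _]; rewrite -expR0 ler_expR mulr_ge0.
have It n : forall s, 0 <= s <= T -> g s <= (2 * C + M / 2 ^+ n) * expR (b * s).
  elim: n => [|n IH] s sT.
    rewrite expr0 divr1; apply: le_trans (gM s sT) _; rewrite -[leLHS]mulr1.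
    by apply: ler_pM => //; [rewrite lerDr mulr_ge0|exact: e1].
  have S0 : 0 <= 2 * C + M / 2 ^+ n by rewrite addr_ge0// ?mulr_ge0// divr_ge0// exprn_ge0.
  apply: le_trans (H _ S0 IH s sT) _.
  have -> : (2 * C + M / 2 ^+ n.+1) = C + (2 * C + M / 2 ^+ n) / 2.
    by rewrite exprS; field; rewrite expf_neq0.
  by rewrite [leRHS]mulrDl lerD2r ler_peMr// e1.
move=> r rT; apply/ler_addgt0Pr => e e0.
pose k := M * expR (b * r) / e; have k0 : 0 <= k.
  by apply: divr_ge0; [rewrite mulr_ge0 ?expR_ge0|exact: ltW].
have := It (Num.truncn k) r rT; move/le_trans; apply; rewrite mulrDl lerD2l.
rewrite mulrAC ler_pdivrMr ?exprn_gt0// [leRHS]mulrC -ler_pdivrMr// -/k.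
apply: le_trans (ltW (truncnS_gt k)) _; rewrite -natrX ler_nat; exact: ltn_expl.
Qed.

Variable a : nat -> nat -> R.
Hypothesis ha : stochastic_matrix a.

Let a_le1 i j : a i j <= 1. Proof. exact: stochastic_le1. Qed.
Let a_ge0 i j : 0 <= a i j. Proof. exact: sm_ge0 ha i j. Qed.

Lemma flow_summable (y : nat -> R) j : nsummable y -> nsummable (fun l => y l * a l j).
Proof.
move=> sy; apply: nsummable_le (Rintegrable_norm sy) _ => l.
by rewrite normrM (ger0_norm (a_ge0 l j)) ler_piMr.
Qed.

Lemma flow_sum (y : nat -> R) L : (forall l, 0 <= y l) -> nsummable y ->
  \sum_(j < L) nsum (fun l => y l * a l j) <= nsum y.
Proof.
move=> y0 sy.
have sr l : nsummable (fun j => y l * a l j) by apply: nsummableZ; exact: sm_summable ha l.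
have nr l : nsum (fun j => y l * a l j) = y l.
  by rewrite nsumZ ?(sm_sum ha) ?mulr1//; exact: sm_summable ha l.
have [] := @nsum_exchange R (fun l j => y l * a l j) (fun l j => mulr_ge0 (y0 l) (a_ge0 l j)) sr.
  by under eq_fun do rewrite nr.
move=> _ sc; under [LHS]eq_nsum do rewrite nr.
move=> ->; apply: partial_le_nsum => // j; apply: nsum_ge0 => l; exact: mulr_ge0.
Qed.

(** Rows of [a] sum to 1, so summing over the sites bounds the total mass by twice its own time
    integral, and [gronwall_iter] without source makes it vanish. It serves as uniqueness for the
    forward equation. *)
Lemma l1_gronwall (D : R -> nat -> R) (T M : R) : 
  (forall s j, 0 <= s <= T -> 0 <= D s j) ->
  (forall s, 0 <= s <= T -> nsummable (D s) /\ nsum (D s) <= M) ->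
  (forall j, measurable_fun `]0, T] (D^~ j)) ->
  (forall r j, 0 <= r <= T -> D r j <=
     \int[mu]_(s in `]0, r]) (nsum (fun l => D s l * a l j) + D s j)) ->
  forall r j, 0 <= r <= T -> D r j = 0.
Proof.
move=> D0 sD mD HD.
have N0 s : 0 <= s <= T -> 0 <= nsum (D s) by move=> sT; apply: nsum_ge0 => j; exact: D0.
suff N_eq0 r : 0 <= r <= T -> nsum (D r) <= 0.
  move=> r j rT; apply/eqP; rewrite eq_le D0// andbT; apply: le_trans (N_eq0 r rT).
  by apply: term_le_nsum => [k|]; [exact: D0|case: (sD r rT)].
move=> rT; have M0 : 0 <= M by apply: le_trans (N0 r rT) _; case: (sD r rT).
(* The mass grows at rate at most 2, one for the inflow and one for [D] itself; the exponent 4 is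
   twice this rate, which halves the constant at each iteration. *)
have := @gronwall_iter (fun s => nsum (D s)) T M 0 4 (lexx 0) M0 _ _ _ r rT.
rewrite mulr0 mul0r; apply=> // [s sT|S S0 HS {r rT} r rT]; first by case: (sD s sT).
have /andP[r0 rT'] := rT; rewrite add0r.
have [sr _] := sD r rT; apply: (proj2 (nsummable_bounded _ _)) => [j|L]; first exact: D0.
have inT s : (`]0, r]%classic : set R) s -> 0 <= s <= T.
  by rewrite /= in_itv/= => /andP[s0 sr']; rewrite ltW//= (le_trans sr').
have mI : measurable (`]0%R, r] : set (measurableTypeR R)) by [].
have mDr j : measurable_fun `]0, r] (D^~ j).
  apply: (@measurable_funS _ _ _ _ `]0, T]) => //.
  by apply: subset_itv; rewrite bnd_simp.
have mF j : measurable_fun `]0, r] (fun s => nsum (fun l => D s l * a l j) + D s j).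
  apply: measurable_funD => //; apply: measurable_nsum => [l|s /inT sT].
    by apply: measurable_funM.
  by apply: flow_summable; case: (sD s sT).
have F0 s j : 0 <= s <= T -> 0 <= nsum (fun l => D s l * a l j) + D s j.
  move=> sT; rewrite addr_ge0 ?D0//; apply: nsum_ge0 => l; rewrite mulr_ge0// D0//.
have FS s : 0 <= s <= T -> \sum_(j < L) (nsum (fun l => D s l * a l j) + D s j) <= 2 * nsum (D s).
  move=> sT; have [s1 _] := sD s sT; rewrite big_split/= mulr_natl mulr2n; apply: lerD.
    by apply: flow_sum => // l; exact: D0.
  by apply: partial_le_nsum => // l; exact: D0.
have iF j : (j < L)%N -> Rintegrable mu `]0, r] (fun s => nsum (fun l => D s l * a l j) + D s j).
  move=> jL; apply: (@integrable_itv_bounded _ _ _ (2 * M)) => // s s0r.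
  have sT := inT s s0r; rewrite ger0_norm ?F0//.
  apply: (@le_trans _ _ (2 * nsum (D s))); last by rewrite ler_wpM2l//; case: (sD s sT).
  apply: le_trans (FS s sT); rewrite (bigD1 (Ordinal jL))//= lerDl sumr_ge0// => l _; exact: F0.
apply: (@le_trans _ _ (\sum_(j < L) \int[mu]_(s in `]0, r])
    (nsum (fun l => D s l * a l j) + D s j))).
  by apply: ler_sum => j _; exact: HD.
rewrite -Rintegral_sum//; last by move=> j _; exact: iF.
have -> : S / 2 * expR (4 * r) = S / 2 + \int[mu]_(s in `]0, r]) (S / 2 * (4 * expR (4 * s))).
  rewrite RintegralZl//; last first.
    apply: path_integrable => // s s0; apply: cvgMr; exact: exp_path.
  by rewrite -exp_integral// mulr0 expR0; ring.
apply: (@le_trans _ _ (\int[mu]_(s in `]0, r]) (S / 2 * (4 * expR (4 * s))))); last first.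
  by rewrite lerDr divr_ge0.
apply: le_Rintegral => //.
- by apply: Rintegrable_sum => // j _; exact: iF.
- by apply: path_integrable => // s s0; apply: cvgMr; apply: cvgMr; exact: exp_path.
move=> s /inT sT; apply: le_trans (FS s sT) _.
rewrite (_ : S / 2 * _ = 2 * (S * expR (4 * s))); last by field.
by rewrite ler_wpM2l// HS.
Qed.

End gronwall.

Section kernel_bounds.
Context {R : realType}.
Let mu := @lebesgue_measure R.
Variables (a : nat -> nat -> R) (p : R -> nat -> nat -> R).
Hypothesis hp : semigroup_of a p.

Let ha : stochastic_matrix a := sg_rates hp.
Let p_ge0 t i j : 0 <= t -> 0 <= p t i j.
Proof. by move=> t0; exact: sm_ge0 (sg_stochastic hp t0) i j. Qed.
Let p_sum t i : 0 <= t -> nsummable (p t i).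
Proof. by move=> t0; exact: sm_summable (sg_stochastic hp t0) i. Qed.
Let p_sum1 t i : 0 <= t -> nsum (p t i) = 1.
Proof. by move=> t0; exact: sm_sum (sg_stochastic hp t0) i. Qed.
Let p_le1 t i j : 0 <= t -> p t i j <= 1.
Proof. by move=> t0; apply: stochastic_le1; exact: (sg_stochastic hp). Qed.
Let a_ge0 i j : 0 <= a i j. Proof. exact: sm_ge0 ha i j. Qed.
Let a_le1 i j : a i j <= 1. Proof. exact: stochastic_le1. Qed.

Lemma nsum_reindex (f : nat -> R) (tau sigma : nat -> nat) :
  cancel tau sigma -> cancel sigma tau -> (forall j, 0 <= f j) -> nsummable f ->
  nsummable (f \o tau) /\ nsum (f \o tau) = nsum f.
Proof.
move=> ts st f0 sf.
have E : (\esum_(n in setT) (f (tau n))%:E = \esum_(n in setT) (f n)%:E)%E.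
  rewrite [RHS](@reindex_esum _ _ _ setT setT tau)//.
    split=> //; first by move=> x y _ _ /(can_inj ts).
    by move=> y _; exists (sigma y).
have sft : nsummable (f \o tau).
  apply: nsummable_esum => [n|]; first exact: f0.
  by rewrite E esum_nsum// ltry.
split=> //; apply: EFin_inj; rewrite -!esum_nsum//= => n; exact: f0.
Qed.

(** Invariance is assumed for the rates only. The relabelled row and the original one solve the same
    forward equation from the same initial row, and [l1_gronwall] applied to their distance
    identifies them. *)
Lemma kernel_invariant (tau sigma : nat -> nat) :
  cancel tau sigma -> cancel sigma tau -> (forall i j, a (tau i) (tau j) = a i j) ->
  forall t i j, 0 <= t -> p t (tau i) (tau j) = p t i j.
Proof.
move=> ts st at_ t i j t0.
have flowT s k : 0 <= s -> kflow a p s (tau i) (tau k) = nsum (fun l => p s (tau i) (tau l) * a l k).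
  move=> s0; have [] := nsum_reindex ts st (f := fun l => p s (tau i) l * a l (tau k)).
  - by move=> l; rewrite mulr_ge0// p_ge0.
  - exact: (kflow_summable hp).
  by rewrite /kflow => _ <-; apply: eq_nsum => l; rewrite /= at_.
have pts s : 0 <= s -> nsummable (fun l => p s (tau i) (tau l)) /\ nsum (fun l => p s (tau i) (tau l)) = 1.
  by move=> s0; rewrite -(p_sum1 (tau i) s0); apply: (nsum_reindex ts st) => [l|]; [exact: p_ge0|exact: p_sum].
pose d s k := p s (tau i) (tau k) - p s i k.
have sd s : 0 <= s -> nsummable (d s).
  by move=> s0; apply: nsummableB; [case: (pts s s0)|exact: p_sum].
have pd k : path_continuous (fun s => d s k).
  by move=> s s0; apply: cvgB; exact: (kernel_path hp).
suff H : forall r k, 0 <= r <= t -> `|d r k| = 0.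
  have := H t j; rewrite t0 lexx => /(_ isT)/eqP; rewrite normr_eq0 subr_eq0 => /eqP.
  exact.
apply: (@l1_gronwall _ a ha (fun s k => `|d s k|) t 2) => //.
- move=> s /andP[s0 _]; split; first exact: Rintegrable_norm (sd s s0).
  have [s1 n1] := pts s s0; have s2 := p_sum i s0.
  apply: (@le_trans _ _ (nsum (fun k => p s (tau i) (tau k) + p s i k))); last first.
    by rewrite nsumD// n1 p_sum1.
  apply: ler_nsum; [exact: Rintegrable_norm (sd s s0)|exact: nsummableD|].
  by move=> k; apply: le_trans (ler_normB _ _) _; rewrite !ger0_norm// p_ge0.
- by move=> k; apply: measurableT_comp => //; exact: path_measurable.
move=> r k /andP[r0 rt].
have dE : d r k = \int[mu]_(s in `]0, r]) (kgen a p s (tau i) (tau k) - kgen a p s i k).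
  rewrite RintegralB//; try by apply: path_integrable => //; exact: (kgen_path hp).
  rewrite -!(kernel_forward hp)// !(sg_0 hp) (can_eq ts) /d; ring.
have pg : path_continuous (fun s => kgen a p s (tau i) (tau k) - kgen a p s i k).
  by move=> s s0; apply: cvgB; exact: (kgen_path hp).
rewrite dE; apply: le_trans (le_normr_Rintegral _ (path_integrable _ (lexx 0) pg)) _ => //.
have inr s : (`]0, r]%classic : set R) s -> 0 <= s by rewrite /= in_itv/= => /andP[/ltW].
have mI : measurable (`]0%R, r] : set (measurableTypeR R)) by [].
apply: le_Rintegral => //.
- by apply: Rintegrable_norm; exact: path_integrable.
- have mfl : measurable_fun `]0, r] (fun s => nsum (fun l => `|d s l| * a l k)).
    apply: measurable_nsum => [l|s /inr s0].
      by apply: measurable_funM => //; apply: measurableT_comp => //; exact: path_measurable.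
    by apply: flow_summable => //; exact: Rintegrable_norm (sd s s0).
  apply: (@integrable_itv_bounded _ _ _ 4).
    apply: measurable_funD => //; apply: measurableT_comp => //; exact: path_measurable.
  move=> s /andP[/ltW s0 _].
  have sa := Rintegrable_norm (sd s s0).
  have n2 : nsum (fun l => `|d s l|) <= 2.
    have [s1 n1] := pts s s0; have s2 := p_sum i s0.
    apply: (@le_trans _ _ (nsum (fun k => p s (tau i) (tau k) + p s i k))); last first.
      by rewrite nsumD// n1 p_sum1.
    apply: ler_nsum => //; first exact: nsummableD.
    by move=> l; apply: le_trans (ler_normB _ _) _; rewrite !ger0_norm// p_ge0.
  have f1 : nsum (fun l => `|d s l| * a l k) <= 2.
    apply: le_trans n2; apply: ler_nsum => //; first exact: flow_summable.
    by move=> l; rewrite ler_piMr.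
  have f2 : `|d s k| <= 2 by apply: le_trans n2; exact: (@term_le_nsum _ (fun l => `|d s l|)).
  rewrite ger0_norm; first by lra.
  by rewrite addr_ge0//; apply: nsum_ge0 => l; rewrite mulr_ge0.
move=> s /inr s0.
rewrite (_ : _ - _ = (kflow a p s (tau i) (tau k) - kflow a p s i k) - d s k); last by rewrite /kgen /d; ring.
apply: le_trans (ler_normB _ _) _; rewrite lerD2r flowT// /kflow.
have [s1 _] := pts s s0.
rewrite -nsumB; [|exact: flow_summable|exact: (kflow_summable hp)].
have sf : nsummable (fun l => p s (tau i) (tau l) * a l k - p s i l * a l k).
  by apply: nsummableB; [exact: flow_summable|exact: (kflow_summable hp)].
apply: le_trans (ler_norm_nsum sf) _; apply: ler_nsum.
- exact: Rintegrable_norm sf.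
- by apply: flow_summable => //; exact: Rintegrable_norm (sd s s0).
- by move=> l; rewrite -mulrBl normrM (ger0_norm (a_ge0 l k)).
Qed.

Variables (om : nat -> R) (K : R).
Hypothesis om0 : forall j, 0 < om j.
Hypothesis som : nsummable om.
Hypothesis omK : forall j, nsum (fun i => om i * a i j) <= K * om j.

Lemma weight_flow_summable j : nsummable (fun i => om i * a i j).
Proof. exact: flow_summable. Qed.

Lemma weight_constant_ge0 : 0 <= K.
Proof.
have : 0 <= K * om 0%N by apply: le_trans (omK 0%N); apply: nsum_ge0 => i; rewrite mulr_ge0// ltW.
by rewrite pmulr_lge0.
Qed.

(* The positive part of the excess of [sum_i om i * p t i j] over [exp (K t) * om j]
   is a summable subsolution of the forward equation. *)
Lemma kernel_column t j : 0 <= t ->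
  nsummable (fun i => om i * p t i j) /\
  nsum (fun i => om i * p t i j) <= expR (K * t) * om j.
Proof.
move=> t0; apply: nsummable_bounded => [i|L]; first by rewrite mulr_ge0 ?p_ge0// ltW.
have K0 := weight_constant_ge0; have omg k : 0 <= om k by exact: ltW.
(* Only finitely many starting sites, so that [y] is summable with a mass constant in time; the
   bound obtained does not depend on [L]. *)
pose y s k := \sum_(i < L) om i * p s i k.
have y0 s k : 0 <= s -> 0 <= y s k.
  by move=> s0; apply: sumr_ge0 => i _; rewrite mulr_ge0// p_ge0.
have sy s : 0 <= s -> nsummable (y s).
  move=> s0; rewrite /y; apply: Rintegrable_sum => // i _; apply: nsummableZ; exact: p_sum.
have ny s : 0 <= s -> nsum (y s) = \sum_(i < L) om i.
  move=> s0; rewrite /nsum /y Rintegral_sum//; last by move=> i _; apply: nsummableZ; exact: p_sum.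
  by apply: eq_bigr => i _; rewrite -/(nsum _) nsumZ ?p_sum// p_sum1// mulr1.
have py k : path_continuous (y^~ k).
  move=> s s0; rewrite /y; apply: cvg_big => [|i _]; first by move=> [? ?]; exact: add_continuous.
  by apply: cvgMr; exact: (kernel_path hp).
(* By [omK] the time derivative of this function dominates its inflow, so it is a supersolution. *)
pose e s k := expR (K * s) * om k.
have pe k : path_continuous (e^~ k) by move=> s s0; apply: cvgMl; exact: exp_path.
pose D s k := Num.max 0 (y s k - e s k).
have D0 s k : 0 <= D s k by rewrite le_max lexx.
have Dy s k : 0 <= s -> D s k <= y s k.
  by move=> s0; rewrite ge_max y0//= gerBl /e mulr_ge0 ?expR_ge0.
have sD s : 0 <= s -> nsummable (D s).
  by move=> s0; apply: nsummable_le (sy s s0) _ => k; rewrite ger0_norm// Dy.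
have nD s : 0 <= s -> nsum (D s) <= \sum_(i < L) om i.
  by move=> s0; rewrite -(ny s s0); apply: ler_nsum => [||k]; [exact: sD|exact: sy|exact: Dy].
suff H : forall r k, 0 <= r <= t -> D r k = 0.
  have := H t j; rewrite t0 lexx => /(_ isT) Dt.
  by rewrite -subr_le0 -[leRHS]Dt le_max lexx orbT.
have mD k : measurable_fun `]0, t] (D^~ k).
  apply: measurable_maxr => //; apply: measurable_funB; exact: path_measurable.
apply: (@l1_gronwall _ a ha D t (\sum_(i < L) om i)) => //.
- by move=> s /andP[s0 _]; split; [exact: sD|exact: nD].
move=> r k /andP[r0 rt].
have inr s : (`]0, r]%classic : set R) s -> 0 <= s by rewrite /= in_itv/= => /andP[/ltW].
have mI : measurable (`]0%R, r] : set (measurableTypeR R)) by [].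
have mDr l : measurable_fun `]0, r] (D^~ l).
  by apply: (@measurable_funS _ _ _ _ `]0, t]) => //; apply: subset_itv; rewrite bnd_simp.
have iF : Rintegrable mu `]0, r] (fun s => nsum (fun l => D s l * a l k) + D s k).
  apply: (@integrable_itv_bounded _ _ _ (2 * \sum_(i < L) om i)).
    apply: measurable_funD => //; apply: measurable_nsum => [l|s /inr s0].
      exact: measurable_funM.
    by apply: flow_summable => //; exact: sD.
  move=> s /andP[/ltW s0 _]; rewrite ger0_norm; last first.
    by rewrite addr_ge0//; apply: nsum_ge0 => l; rewrite mulr_ge0.
  have n := nD s s0; rewrite mulr_natl mulr2n; apply: lerD.
    apply: le_trans n; apply: ler_nsum; [apply: flow_summable => //; exact: sD|exact: sD|].
    by move=> l; rewrite ler_piMr.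
  by apply: le_trans n; apply: term_le_nsum => //; exact: sD.
have F0 : 0 <= \int[mu]_(s in `]0, r]) (nsum (fun l => D s l * a l k) + D s k).
  by apply: Rintegral_ge0 => s _; rewrite addr_ge0//; apply: nsum_ge0 => l; rewrite mulr_ge0.
rewrite ge_max F0/=.
have yE : y r k - y 0 k = \int[mu]_(s in `]0, r]) \sum_(i < L) om i * kgen a p s i k.
  rewrite Rintegral_sum//; last first.
    by move=> i _; apply: RintegrableZ => //; apply: path_integrable => //; exact: (kgen_path hp).
  rewrite /y -sumrB; apply: eq_bigr => i _.
  rewrite RintegralZl//; last by apply: path_integrable => //; exact: (kgen_path hp).
  by rewrite -(kernel_forward hp)// mulrBr.
have eE : e r k - e 0 k = \int[mu]_(s in `]0, r]) (om k * (K * expR (K * s))).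
  rewrite RintegralZl//; last by apply: path_integrable => // s s0; apply: cvgMr; exact: exp_path.
  by rewrite -exp_integral// /e; ring.
have ye0 : y 0 k <= e 0 k.
  rewrite /e mulr0 expR0 mul1r /y; have [s1 n1] := nsum_delta om k.
  rewrite -n1; apply: le_trans (partial_le_nsum L _ s1) => [|i]; last by rewrite mulr_ge0.
  by rewrite le_eqVlt; apply/orP; left; apply/eqP/eq_bigr => i _; rewrite (sg_0 hp).
have i1 : Rintegrable mu `]0, r] (fun s => \sum_(i < L) om i * kgen a p s i k).
  apply: Rintegrable_sum => // i _; apply: RintegrableZ => //; apply: path_integrable => //.
  exact: (kgen_path hp).
have i2 : Rintegrable mu `]0, r] (fun s => om k * (K * expR (K * s))).
  by apply: path_integrable => // s s0; apply: cvgMr; apply: cvgMr; exact: exp_path.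
apply: (@le_trans _ _ ((y r k - y 0 k) - (e r k - e 0 k))); first by lra.
rewrite yE eE -(RintegralB mI i1 i2); apply: (le_Rintegral mI (RintegrableB mI i1 i2) iF).
move=> s /inr s0.
have gE : \sum_(i < L) om i * kgen a p s i k = nsum (fun l => y s l * a l k) - y s k.
  rewrite /kgen; under eq_bigr do rewrite mulrBr.
  rewrite sumrB; congr (_ - _).
  rewrite (@eq_nsum _ _ (fun l => \sum_(i < L) om i * (p s i l * a l k))); last first.
    by move=> l; rewrite /y mulr_suml; apply: eq_bigr => i _; rewrite mulrA.
  rewrite /nsum Rintegral_sum//; last by move=> i _; apply: nsummableZ; exact: (kflow_summable hp).
  by apply: eq_bigr => i _; rewrite -/(nsum _) nsumZ//; exact: (kflow_summable hp).
rewrite gE.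
have sya := flow_summable ha k (sy s s0).
have swa := weight_flow_summable k.
have sea := nsummableZ (expR (K * s)) swa.
(* Replacing [y - e] by its positive part only increases the inflow. *)
have L1 : nsum (fun l => y s l * a l k) - nsum (fun l => expR (K * s) * (om l * a l k)) <=
    nsum (fun l => D s l * a l k).
  rewrite -nsumB//; apply: ler_nsum; [exact: nsummableB|apply: flow_summable => //; exact: sD|].
  by move=> l; rewrite mulrA -mulrBl ler_wpM2r// le_max lexx orbT.
have L2 : nsum (fun l => expR (K * s) * (om l * a l k)) <= om k * (K * expR (K * s)).
  rewrite nsumZ// (_ : om k * _ = expR (K * s) * (K * om k)); last by ring.
  by rewrite ler_wpM2l ?expR_ge0.
have := y0 s k s0; have := D0 s k; lra.
Qed.

End kernel_bounds.

(** * The meeting probability and the backward weight *)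

Section kernel_weights.
Context {R : realType}.
Let mu := @lebesgue_measure R.
Variables (a : nat -> nat -> R) (p : R -> nat -> nat -> R).
Hypothesis hp : semigroup_of a p.

Let ha : stochastic_matrix a := sg_rates hp.
Let p_ge0 t i j : 0 <= t -> 0 <= p t i j.
Proof. by move=> t0; exact: sm_ge0 (sg_stochastic hp t0) i j. Qed.
Let p_sum t i : 0 <= t -> nsummable (p t i).
Proof. by move=> t0; exact: sm_summable (sg_stochastic hp t0) i. Qed.
Let p_sum1 t i : 0 <= t -> nsum (p t i) = 1.
Proof. by move=> t0; exact: sm_sum (sg_stochastic hp t0) i. Qed.
Let p_le1 t i j : 0 <= t -> p t i j <= 1.
Proof. by move=> t0; apply: stochastic_le1; exact: (sg_stochastic hp). Qed.
Let a_ge0 i j : 0 <= a i j. Proof. exact: sm_ge0 ha i j. Qed.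
Let a_le1 i j : a i j <= 1. Proof. exact: stochastic_le1. Qed.

Lemma sq_summable t i : 0 <= t -> nsummable (fun j => p t i j ^+ 2).
Proof.
move=> t0; apply: nsummable_le (p_sum i t0) _ => j.
by rewrite ger0_norm ?sqr_ge0// expr2 ler_piMr ?p_ge0 ?p_le1.
Qed.

(* The probability that two independent walks started at the same site meet at time
   [t], that is, the return probability of their difference. *)
Definition meeting t := nsum (fun j => p t 0%N j ^+ 2).

Hypothesis transitive : forall i, exists tau sigma, [/\ cancel tau sigma,
  cancel sigma tau, forall k l, a (tau k) (tau l) = a k l & tau 0%N = i].

Lemma meetingE t i : 0 <= t -> nsum (fun j => p t i j ^+ 2) = meeting t.
Proof.
move=> t0; have [tau [sigma [ts st at_ <-]]] := transitive i.
have [_ <-] := nsum_reindex ts st (fun j => sqr_ge0 (p t (tau 0%N) j)) (sq_summable (tau 0%N) t0).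
by apply: eq_nsum => j; rewrite /= (kernel_invariant hp ts st at_).
Qed.

Lemma meeting_ge0 t : 0 <= meeting t.
Proof. by apply: nsum_ge0 => j; exact: sqr_ge0. Qed.

Lemma meeting_le1 t : 0 <= t -> meeting t <= 1.
Proof.
move=> t0; rewrite -(p_sum1 0%N t0); apply: ler_nsum; [exact: sq_summable|exact: p_sum|].
by move=> j; rewrite expr2 ler_piMr ?p_ge0 ?p_le1.
Qed.

(** Only the term of the starting site is kept. Positivity on a definite time interval is what makes
    [laplace_strict] quantitative. *)
Lemma meeting_lb t : 0 <= t -> t <= 1 -> (1 - t) ^+ 2 <= meeting t.
Proof.
move=> t0 t1; apply: (@le_trans _ _ (p t 0%N 0%N ^+ 2)).
  by rewrite lerXn2r ?nnegrE ?subr_ge0 ?p_ge0//; exact: (kernel_diag hp).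
apply: (@term_le_nsum _ (fun j => p t 0%N j ^+ 2)); last exact: sq_summable.
by move=> j; exact: sqr_ge0.
Qed.

Lemma meeting_path : path_continuous meeting.
Proof.
apply: (@lip_path_continuous _ _ 4) => r s r0 rs; have s0 := le_trans r0 rs.
have [sd nd] := kernel_row_lip hp 0%N r0 rs.
rewrite /meeting -nsumB; [|exact: sq_summable|exact: sq_summable].
have sb := nsummableB (sq_summable 0%N s0) (sq_summable 0%N r0).
apply: le_trans (ler_norm_nsum sb) _.
apply: (@le_trans _ _ (2 * (2 * (s - r)))); last by rewrite mulrA; apply: ler_wpM2r; lra.
apply: le_trans (ler_wpM2l _ nd) => //; rewrite -nsumZ//; apply: ler_nsum.
- exact: Rintegrable_norm sb.
- exact: nsummableZ.
move=> j; rewrite subr_sqr normrM mulrC ler_wpM2r//.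
by rewrite ger0_norm ?addr_ge0 ?p_ge0//; have := p_le1 0%N j s0; have := p_le1 0%N j r0; lra.
Qed.

Variables (om : nat -> R) (K : R).
Hypothesis om0 : forall j, 0 < om j.
Hypothesis som : nsummable om.
Hypothesis omK : forall j, nsum (fun i => om i * a i j) <= K * om j.

Let om_ge0 j : 0 <= om j. Proof. exact: ltW. Qed.
Let K0 : 0 <= K. Proof. exact: (weight_constant_ge0 hp om0 omK). Qed.

(** Each term [om i * p t i j] is at most the bound [S] on the column, so the sum of squares is at
    most [S] times the sum. *)
Lemma kernel_column_sq t j : 0 <= t ->
  nsummable (fun i => om i ^+ 2 * p t i j ^+ 2) /\
  nsum (fun i => om i ^+ 2 * p t i j ^+ 2) <= expR (K * t) ^+ 2 * om j ^+ 2.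
Proof.
move=> t0; have [s1 n1] := kernel_column hp om0 som omK j t0.
set S := expR (K * t) * om j in n1.
have S0 : 0 <= S by rewrite mulr_ge0 ?expR_ge0.
have x0 i : 0 <= om i * p t i j by rewrite mulr_ge0 ?p_ge0.
have xS i : om i * p t i j <= S.
  by apply: le_trans n1; exact: (@term_le_nsum _ (fun i => om i * p t i j)).
have H i : om i ^+ 2 * p t i j ^+ 2 <= S * (om i * p t i j).
  by rewrite -exprMn expr2 ler_wpM2r.
have s2 : nsummable (fun i => om i ^+ 2 * p t i j ^+ 2).
  apply: nsummable_le (nsummableZ S s1) _ => i.
  by rewrite ger0_norm// mulr_ge0 ?sqr_ge0.
split=> //; apply: le_trans (ler_nsum s2 (nsummableZ S s1) H) _.
by rewrite nsumZ// -exprMn expr2 ler_wpM2l.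
Qed.

Variables (i : nat) (t : R).
Hypothesis t0 : 0 <= t.

(** Keeping the single term [i] of the column bound dominates the kernel from [i], up to time [t],
    by [wbase * om j]. *)
Definition wbase := expR (K * t) / om i.

Let e0 : 0 <= wbase. Proof. by rewrite divr_ge0 ?expR_ge0. Qed.

Lemma kernel_site r j : 0 <= r -> r <= t -> p r i j <= wbase * om j.
Proof.
move=> r0 rt; rewrite /wbase mulrAC ler_pdivlMr// mulrC.
have [s1 n1] := kernel_column hp om0 som omK j r0.
apply: (@le_trans _ _ (expR (K * r) * om j)); last first.
  by rewrite ler_wpM2r// ler_expR ler_wpM2l.
apply: le_trans n1; apply: (@term_le_nsum _ (fun i => om i * p r i j)) => // k.
by rewrite mulr_ge0 ?p_ge0.
Qed.

Let flow_le (y : nat -> R) (c : R) j : 0 <= c -> nsummable y -> (forall l, `|y l| <= c * om l) ->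
  `|nsum (fun l => y l * a l j)| <= c * K * om j.
Proof.
move=> c0 sy yc; have sf := flow_summable ha j sy.
apply: le_trans (ler_norm_nsum sf) _.
have sw := nsummableZ c (flow_summable ha j som).
apply: (@le_trans _ _ (nsum (fun l => c * (om l * a l j)))).
  apply: ler_nsum => //; first exact: Rintegrable_norm sf.
  by move=> l; rewrite normrM (ger0_norm (a_ge0 l j)) mulrA ler_wpM2r.
by rewrite nsumZ ?flow_summable// -mulrA ler_wpM2l.
Qed.

Lemma kgen_bound r j : 0 <= r -> r <= t -> `|kgen a p r i j| <= wbase * (K + 1) * om j.
Proof.
move=> r0 rt; rewrite /kgen; apply: le_trans (ler_normB _ _) _.
have -> : wbase * (K + 1) * om j = wbase * K * om j + wbase * om j by ring.
apply: lerD.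
  by apply: flow_le => // [|l]; [exact: p_sum|rewrite ger0_norm ?p_ge0// kernel_site].
by rewrite ger0_norm ?p_ge0// kernel_site.
Qed.

Lemma kernel_site_lip r s j : 0 <= r -> r <= s -> s <= t ->
  `|p s i j - p r i j| <= wbase * (K + 1) * (s - r) * om j.
Proof.
move=> r0 rs st; rewrite (kernel_forward hp)// [leRHS]mulrAC.
apply: integral_itv_le => //; first by apply: path_integrable => //; exact: (kgen_path hp).
move=> x /andP[rx xs]; apply: kgen_bound; first by rewrite (le_trans r0)// ltW.
exact: le_trans xs st.
Qed.

Lemma kgen_lip r s j : 0 <= r -> r <= s -> s <= t ->
  `|kgen a p s i j - kgen a p r i j| <= wbase * (K + 1) ^+ 2 * (s - r) * om j.
Proof.
move=> r0 rs st; have s0 := le_trans r0 rs.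
have rs0 : 0 <= s - r by rewrite subr_ge0.
have K1 : 0 <= K + 1 by rewrite addr_ge0.
have -> : kgen a p s i j - kgen a p r i j =
    nsum (fun l => (p s i l - p r i l) * a l j) - (p s i j - p r i j).
  under eq_nsum do rewrite mulrBl.
  rewrite nsumB; [rewrite /kgen /kflow; ring|exact: (kflow_summable hp)|exact: (kflow_summable hp)].
apply: le_trans (ler_normB _ _) _.
have -> : wbase * (K + 1) ^+ 2 * (s - r) * om j =
  wbase * (K + 1) * (s - r) * K * om j + wbase * (K + 1) * (s - r) * om j by ring.
apply: lerD; last exact: kernel_site_lip.
apply: flow_le => [||l]; [exact: mulr_ge0 (mulr_ge0 e0 K1) rs0| |exact: kernel_site_lip].
by apply: nsummableB; exact: p_sum.
Qed.

Lemma kernel_taylor r h j : 0 <= r -> 0 <= h -> r + h <= t ->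
  `|p (r + h) i j - p r i j - h * kgen a p r i j| <= wbase * (K + 1) ^+ 2 * h ^+ 2 * om j.
Proof.
move=> r0 h0 rht; have rh : r <= r + h by rewrite lerDl.
have pg : path_continuous (fun s => kgen a p s i j) by exact: (kgen_path hp).
have i1 : Rintegrable mu `]r, r + h] (fun s => kgen a p s i j) by exact: path_integrable.
have i2 : Rintegrable mu `]r, r + h] (fun=> kgen a p r i j).
  by apply: path_integrable => // s s0; exact: cvg_cst.
have -> : p (r + h) i j - p r i j - h * kgen a p r i j =
    \int[mu]_(s in `]r, r + h]) (kgen a p s i j - kgen a p r i j).
  rewrite RintegralB// (kernel_forward hp)//; congr (_ - _).
  by rewrite Rintegral_cst// itv_length// addrC addKr mulrC.
have -> : wbase * (K + 1) ^+ 2 * h ^+ 2 * om j =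
    wbase * (K + 1) ^+ 2 * h * om j * (r + h - r) by ring.
apply: integral_itv_le => //; first exact: RintegrableB.
move=> x /andP[rx xh]; apply: le_trans (kgen_lip j r0 (ltW rx) _) _.
  exact: le_trans xh rht.
have c0 : 0 <= wbase * (K + 1) ^+ 2 by rewrite mulr_ge0// sqr_ge0.
by rewrite ler_wpM2r// ler_wpM2l//; lra.
Qed.

(* Frozen after time [t], so that the bounds below hold for all [s >= 0]. *)
Definition wker s j := p (Num.max (t - s) 0) i j.
Definition wgen s j := kgen a p (Num.max (t - s) 0) i j.
(** Each application of the generator costs a factor [K + 1]. The Lipschitz bound on [wgen] involves
    two of them, and the same constant dominates the other bounds. *)
Definition wconst := wbase * (K + 1) ^+ 2.

Let rest s : 0 <= s -> 0 <= Num.max (t - s) 0 <= t.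
Proof. by move=> s0; rewrite le_max lexx orbT ge_max t0 andbT/= gerBl. Qed.

Let rest_dist s s' : `|Num.max (t - s) 0 - Num.max (t - s') 0| <= `|s - s'|.
Proof.
have [] := leP (t - s) 0; have [] := leP (t - s') 0 => h1 h2.
- by rewrite subrr normr0.
- rewrite sub0r normrN gtr0_norm//; apply: le_trans (ler_norm _); lra.
- rewrite subr0 gtr0_norm// distrC; apply: le_trans (ler_norm _); lra.
- have -> : t - s - (t - s') = - (s - s') by ring.
  by rewrite normrN.
Qed.

Let K1 : 1 <= K + 1. Proof. by rewrite lerDr. Qed.
Let K10 : 0 <= K + 1. Proof. by rewrite addr_ge0. Qed.

Let wconst_ge : wbase <= wconst /\ wbase * (K + 1) <= wconst.
Proof.
rewrite /wconst; split; first by rewrite ler_peMr// exprn_ege1.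
by rewrite ler_wpM2l// expr2 ler_peMr.
Qed.

Let wconst0 : 0 <= wconst. Proof. by rewrite mulr_ge0// exprn_ge0. Qed.

Lemma wker_bound s j : 0 <= s -> `|wker s j| <= wconst * om j.
Proof.
move=> s0; have /andP[r0 rt] := rest s0; rewrite ger0_norm ?p_ge0//.
by apply: le_trans (kernel_site j r0 rt) _; rewrite ler_wpM2r//; case: wconst_ge.
Qed.

Lemma wgen_bound s j : 0 <= s -> `|wgen s j| <= wconst * om j.
Proof.
move=> s0; have /andP[r0 rt] := rest s0.
by apply: le_trans (kgen_bound j r0 rt) _; rewrite ler_wpM2r//; case: wconst_ge.
Qed.

Lemma wker_lip s s' j : 0 <= s -> 0 <= s' -> `|wker s j - wker s' j| <= wconst * `|s - s'| * om j.
Proof.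
wlog H : s s' / Num.max (t - s') 0 <= Num.max (t - s) 0.
  move=> W s0 s'0; have [h|/ltW h] := leP (Num.max (t - s') 0) (Num.max (t - s) 0); first exact: W.
  by rewrite distrC (distrC s); exact: W.
move=> s0 s'0; have /andP[r0 rt] := rest s0; have /andP[r0' rt'] := rest s'0.
apply: le_trans (kernel_site_lip j r0' H rt) _; rewrite ler_wpM2r//.
apply: (@le_trans _ _ (wconst * (Num.max (t - s) 0 - Num.max (t - s') 0))).
  by rewrite ler_wpM2r ?subr_ge0//; case: wconst_ge.
by rewrite ler_wpM2l//; exact: le_trans (ler_norm _) (rest_dist s s').
Qed.

Lemma wgen_lip s s' j : 0 <= s -> 0 <= s' -> `|wgen s j - wgen s' j| <= wconst * `|s - s'| * om j.
Proof.
wlog H : s s' / Num.max (t - s') 0 <= Num.max (t - s) 0.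
  move=> W s0 s'0; have [h|/ltW h] := leP (Num.max (t - s') 0) (Num.max (t - s) 0); first exact: W.
  by rewrite distrC (distrC s); exact: W.
move=> s0 s'0; have /andP[r0 rt] := rest s0; have /andP[r0' rt'] := rest s'0.
apply: le_trans (kgen_lip j r0' H rt) _; rewrite ler_wpM2r//; apply: ler_wpM2l => //.
exact: le_trans (ler_norm _) (rest_dist s s').
Qed.

Lemma wker_taylor s h j : 0 <= s -> 0 <= h -> s + h <= t ->
  `|wker (s + h) j - wker s j + h * wgen (s + h) j| <= wconst * h ^+ 2 * om j.
Proof.
move=> s0 h0 sht; have r0 : 0 <= t - (s + h) by rewrite subr_ge0.
have E1 : Num.max (t - (s + h)) 0 = t - (s + h) by rewrite max_l.
have E2 : Num.max (t - s) 0 = t - (s + h) + h by rewrite max_l; lra.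
rewrite /wker /wgen E1 E2 -normrN.
have -> : - (p (t - (s + h)) i j - p (t - (s + h) + h) i j + h * kgen a p (t - (s + h)) i j) =
  p (t - (s + h) + h) i j - p (t - (s + h)) i j - h * kgen a p (t - (s + h)) i j by ring.
by apply: kernel_taylor => //; rewrite opprD addrA subrK gerBl.
Qed.

Lemma wker_final j : wker t j = (i == j)%:R.
Proof. by rewrite /wker subrr maxxx (sg_0 hp). Qed.

Lemma wker_sum s : 0 <= s -> nsummable (wker s) /\ nsum (wker s) = 1.
Proof. by move=> s0; have /andP[r0 rt] := rest s0; rewrite p_sum1//; split => //; exact: p_sum. Qed.

(** Nonnegativity of [x] lets Tonelli move the migration from the field to the kernel. This is the
    duality [wz] of the pathwise mild formula. *)
Lemma flow_pairing (x : nat -> R) s : 0 <= s -> (forall j, 0 <= x j) -> wsummable om x ->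
  [/\ forall j, nsummable (fun l => a j l * x l),
      nsummable (fun j => wker s j * (nsum (fun l => a j l * x l) - x j)) &
  nsum (fun j => wker s j * (nsum (fun l => a j l * x l) - x j)) =
  nsum (fun j => wgen s j * x j)].
Proof.
move=> s0 x0 sx; have /andP[r0 rt] := rest s0; set r := Num.max _ _ in r0 rt.
have sx' : nsummable (fun j => x j * om j).
  by move: sx; rewrite /wsummable; under eq_fun do rewrite ger0_norm//.
pose f l j := (p r i j * a j l) * x l.
have f0 l j : 0 <= f l j by rewrite !mulr_ge0 ?p_ge0.
have sf l : nsummable (f l).
  by rewrite /f; under eq_fun do rewrite mulrC; apply: nsummableZ; exact: (kflow_summable hp).
have nf l : nsum (f l) = kflow a p r i l * x l.
  rewrite /f; under eq_nsum do rewrite mulrC.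
  by rewrite (nsumZ _ (kflow_summable hp i l r0)) mulrC.
have k0 l : 0 <= kflow a p r i l by apply: nsum_ge0 => j; rewrite mulr_ge0 ?p_ge0.
have sS : nsummable (fun l => nsum (f l)).
  under eq_fun do rewrite nf.
  apply: nsummable_le (nsummableZ (wbase * K) sx') _ => l.
  rewrite ger0_norm ?mulr_ge0// (_ : wbase * K * _ = wbase * K * om l * x l); last by ring.
  rewrite ler_wpM2r// -(ger0_norm (k0 l)).
  by apply: flow_le => // [|m]; [exact: p_sum|rewrite ger0_norm ?p_ge0// kernel_site].
have [sc sT ET] := nsum_exchange f0 sf sS.
have sax j : nsummable (fun l => a j l * x l).
  have aom l : a j l <= K / om j * om l.
    rewrite mulrAC ler_pdivlMr// mulrC; apply: le_trans (omK l).
    apply: (@term_le_nsum _ (fun i => om i * a i l)); last exact: flow_summable.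
    by move=> k; rewrite mulr_ge0.
  apply: nsummable_le (nsummableZ (K / om j) sx') _ => l.
  rewrite ger0_norm ?mulr_ge0// (_ : K / om j * _ = K / om j * om l * x l); last by ring.
  by rewrite ler_wpM2r.
have cE j : nsum (f^~ j) = wker s j * nsum (fun l => a j l * x l).
  by rewrite -nsumZ//; apply: eq_nsum => l; rewrite /f /wker mulrA.
have swx : nsummable (fun j => wker s j * x j).
  exact: (wpair_summable sx (fun j => wker_bound j s0)).
have scE : nsummable (fun j => wker s j * nsum (fun l => a j l * x l)).
  by move: sT; under eq_fun do rewrite cE.
split=> //.
  by under eq_fun do rewrite mulrBr; exact: nsummableB.
rewrite (@eq_nsum _ _ (fun j => wker s j * nsum (fun l => a j l * x l) - wker s j * x j)); last first.
  by move=> j; rewrite mulrBr.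
rewrite nsumB// -(eq_nsum cE) -ET (eq_nsum nf) -nsumB//; last by move: sS; under eq_fun do rewrite nf.
by apply: eq_nsum => j; rewrite /wgen /kgen /wker -/r mulrBl.
Qed.

End kernel_weights.

(** * Second moments of the symbiotic branching model *)

Section migration_operator.
Context {R : realType}.
Variables (a : nat -> nat -> R) (om : nat -> R) (K : R).
Hypothesis ha : stochastic_matrix a.
Hypothesis om0 : forall j, 0 < om j.
Hypothesis som : nsummable om.
Hypothesis omK : forall j, nsum (fun i => om i * a i j) <= K * om j.

Let a_ge0 i j : 0 <= a i j. Proof. exact: sm_ge0 ha i j. Qed.
Let om_ge0 j : 0 <= om j. Proof. exact: ltW. Qed.

Definition mig (f : nat -> R) j := nsum (fun l => a j l * f l) - f j.

Lemma mig_summable f j : wsummable om f -> nsummable (fun l => a j l * f l).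
Proof.
move=> sf; have aom l : a j l <= K / om j * om l.
  rewrite mulrAC ler_pdivlMr// mulrC; apply: le_trans (omK l).
  apply: (@term_le_nsum _ (fun i => om i * a i l)); last exact: flow_summable.
  by move=> k; rewrite mulr_ge0.
apply: nsummable_le (nsummableZ (K / om j) sf) _ => l.
rewrite normrM ger0_norm// (_ : K / om j * _ = K / om j * om l * `|f l|); last by ring.
by rewrite ler_wpM2r.
Qed.

Lemma migB f g j : wsummable om f -> wsummable om g ->
  mig (fun l => f l - g l) j = mig f j - mig g j.
Proof.
move=> sf sg; rewrite /mig; under eq_nsum do rewrite mulrBr.
rewrite nsumB; [ring|exact: mig_summable|exact: mig_summable].
Qed.

(** Tonelli and [omK] give the norm [K] for the incoming part; the departing part adds 1. *)
Lemma mig_norm f : wsummable om f ->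
  wsummable om (mig f) /\ wnorm om (mig f) <= (K + 1) * wnorm om f.
Proof.
move=> sf; pose F l j := `|f l| * (om j * a j l).
have F0 l j : 0 <= F l j by rewrite !mulr_ge0.
have sF l : nsummable (F l) by apply: nsummableZ; exact: flow_summable.
have nF l : nsum (F l) <= K * (`|f l| * om l).
  by rewrite nsumZ ?flow_summable// mulrCA ler_wpM2l.
have sS : nsummable (fun l => nsum (F l)).
  apply: nsummable_le (nsummableZ K sf) _ => l; rewrite ger0_norm//; exact: nsum_ge0.
have [sc sT ET] := nsum_exchange F0 sF sS.
have sum2 := nsummableD sT sf.
have sabs j : nsummable (fun l => a j l * `|f l|).
  have := Rintegrable_norm (mig_summable j sf); apply: Rintegrable_eq => // l _ /=.
  by rewrite normrM ger0_norm.
have H j : `|mig f j| * om j <= nsum (F^~ j) + `|f j| * om j.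
  apply: (@le_trans _ _ ((nsum (fun l => a j l * `|f l|) + `|f j|) * om j)).
    rewrite ler_wpM2r//; apply: le_trans (ler_normB _ _) _; rewrite lerD2r.
    apply: le_trans (ler_norm_nsum (mig_summable j sf)) _.
    rewrite le_eqVlt; apply/orP; left; apply/eqP/eq_nsum => l.
    by rewrite normrM ger0_norm.
  rewrite mulrDl lerD2r mulrC -nsumZ// le_eqVlt; apply/orP; left; apply/eqP/eq_nsum => l.
  by rewrite /F; ring.
have sm : wsummable om (mig f).
  by apply: nsummable_le sum2 _ => j; rewrite ger0_norm// mulr_ge0.
split=> //; apply: le_trans (ler_nsum sm sum2 H) _.
rewrite nsumD// -ET mulrDl mul1r lerD2r /wnorm -nsumZ//.
apply: ler_nsum => //; exact: nsummableZ.
Qed.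

Lemma mig_path z : good_path om z -> good_path om (fun s => mig (z s)).
Proof.
move=> gz; have sz := gp_summable gz.
have K1 : 0 < K + 1.
  have : 0 <= K * om 0%N by apply: le_trans (omK 0%N); apply: nsum_ge0 => i; rewrite mulr_ge0.
  by rewrite pmulr_lge0// => K0; rewrite ltr_wpDl.
split=> [s s0|s s0 e e0]; first by case: (mig_norm (sz s s0)).
have [dl dl0 Hd] := gp_cont gz s0 (divr_gt0 e0 K1); exists dl => // s' s'0 ss'.
have [_] := mig_norm (wsummableB om0 (sz s s0) (sz s' s'0)).
rewrite (_ : wnorm om (mig _) = wnorm om (fun j => mig (z s) j - mig (z s') j)); last first.
  by apply: eq_nsum => j; rewrite migB//; exact: sz.
move=> /le_lt_trans; apply; rewrite mulrC -ltr_pdivlMr//; exact: Hd.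
Qed.

Lemma const_path c : good_path om (fun _ _ => c).
Proof.
split=> [s s0|s s0 e e0]; first by rewrite /wsummable; exact: nsummableZ.
exists 1 => // s' _ _; rewrite /wnorm nsum_zero// => j.
by rewrite subrr normr0 mul0r.
Qed.

End migration_operator.

(** * Localized intensities of the model *)

Section localization_events.
Context (R : realType) disp (T : measurableType disp) (P : probability T R).
Variables (F : R -> set (set T)) (hF : filtration F).
Variable om : nat -> R.
Hypothesis om0 : forall j, 0 < om j.
Variable x : bool -> R -> nat -> T -> R.
Hypothesis ax : forall b j, adapted F (fun s => x b s j).
Hypothesis gx : {ae P, forall w, forall b, good_path om (fun s j => x b s j w)}.
Variable kap : R.
Hypothesis kap0 : 0 < kap.

Definition intensity s j w := Num.sqrt (kap * x true s j w * x false s j w).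

Definition local_event (N : nat) s :=
  [set w | stays om (fun r j => x true r j w) (fun r j => x false r j w) N%:R s].

(** Multiplying by the event at the current time, instead of stopping the process, keeps the
    integrand adapted and left-continuous while bounding it by a constant depending on [N]. *)
Definition local_intensity N s j w := intensity s j w * \1_(local_event N s) w.

Lemma sigma_bigcap (G : set (set T)) (A : nat -> set T) : sigma_algebra setT G ->
  (forall n, G (A n)) -> G (\bigcap_n A n).
Proof.
move=> [_ GC GU] GA; rewrite -[X in G X]setCK setC_bigcap -setTD.
apply: (GC); apply: (GU) => n; rewrite -setTD; apply: (GC); exact: GA.
Qed.

Lemma mass_measurable_wrt L s r : 0 <= r -> r <= s ->
  measurable_wrt (F s) (fun w => mass om (fun r j => x true r j w) (fun r j => x false r j w) L r).
Proof.
move=> r0 rs; have s0 := le_trans r0 rs; have sF := filtration_sigma hF s0.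
have H (k : 'I_L) : measurable_wrt (F s)
    (fun w => (`|x true r k w| + `|x false r k w|) * om k).
  apply: measurable_wrtM => //; last exact: measurable_wrt_cst.
  apply: measurable_wrtD => //; apply: (measurable_wrt_comp (f := fun y : R => `|y|)) => //;
    exact: (adapted_later hF (ax _ _) r0 rs).
exact: (measurable_wrt_sum (index_enum 'I_L) xpredT sF H).
Qed.

Lemma local_event_measurable N s : 0 <= s -> F s (local_event N s).
Proof.
move=> s0; have sF := filtration_sigma hF s0.
rewrite (_ : local_event N s = \bigcap_L \bigcap_i \bigcap_j
   [set w | (i <= j.+1)%N -> mass om (fun r j => x true r j w) (fun r j => x false r j w) L
      (s * (i%:R / j.+1%:R)) <= N%:R]); last first.
  apply/seteqP; split=> w H; first by move=> L _ i _ j _ ij; exact: H.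
  by move=> L i j ij; exact: (H L I i I j I ij).
apply: sigma_bigcap => // L; apply: sigma_bigcap => // i; apply: sigma_bigcap => // j.
have [ij|ij] := leqP i j.+1; last first.
  rewrite (_ : [set w | _] = setT); last by apply/seteqP; split.
  by case: (sF) => h0 hC _; rewrite -setC0 -setTD; exact: hC.
rewrite (_ : [set w | _] =
  (fun w => mass om (fun r j => x true r j w) (fun r j => x false r j w) L
      (s * (i%:R / j.+1%:R))) @^-1` `]-oo, N%:R]); last first.
  apply/seteqP; split=> w; rewrite /= in_itv/=; first exact.
  by move=> H _.
apply: mass_measurable_wrt => //.
  by rewrite mulr_ge0// divr_ge0.
by rewrite ler_piMr// ler_pdivrMr ?ltr0n// mul1r ler_nat.
Qed.

Lemma intensity_adapted j : adapted F (fun s => intensity s j).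
Proof.
move=> s s0; have sF := filtration_sigma hF s0.
apply: (measurable_wrt_comp (f := Num.sqrt)) => //; first by apply: continuous_measurable_fun; exact: sqrt_continuous.
apply: measurable_wrtM => //; last exact: ax.
by apply: measurable_wrtM => //; [exact: measurable_wrt_cst|exact: ax].
Qed.

Lemma local_intensity_adapted N j : adapted F (fun s => local_intensity N s j).
Proof.
move=> s s0; have sF := filtration_sigma hF s0.
apply: measurable_wrtM => //; first exact: intensity_adapted.
by apply: measurable_wrt_indic => //; exact: local_event_measurable.
Qed.

Lemma intensity_continuous j : {ae P, forall w, path_continuous (fun s => intensity s j w)}.
Proof.
apply: filterS gx => w gw s s0; rewrite /intensity.
apply: (cvg_comp _ Num.sqrt) (@sqrt_continuous _ _).
apply: cvgM; last exact: (good_path_site om0 (gw false)).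
by apply: cvgMr; exact: (good_path_site om0 (gw true)).
Qed.

Lemma local_event_sub N N' s : (N <= N')%N -> local_event N s `<=` local_event N' s.
Proof. by move=> NN w; apply: stays_mono; rewrite ler_nat. Qed.

(** The two indicators are nested, so the cross term equals the square of the smaller integrand. *)
Lemma local_intensity_diff N N' : (N' <= N)%N -> forall s j w,
  (local_intensity N s j w - local_intensity N' s j w) ^+ 2 =
  local_intensity N s j w ^+ 2 - local_intensity N' s j w ^+ 2.
Proof.
move=> NN s j w; rewrite /local_intensity !indicE.
have := @local_event_sub _ _ s NN w.
have [a|a] := pselect (local_event N' s w); have [b|b] := pselect (local_event N s w) => H.
- by rewrite !mem_set//; ring.
- by case: b; exact: H.
- by rewrite (mem_set b) memNset// -[true%:R]/(1 : R) -[false%:R]/(0 : R); ring.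
- by rewrite !memNset// -[false%:R]/(0 : R); ring.
Qed.

Lemma sum_prod_le (I : Type) (r : seq I) (f g : I -> R) :
  (forall i, 0 <= f i) -> (forall i, 0 <= g i) ->
  \sum_(i <- r) f i * g i <= (\sum_(i <- r) f i) * (\sum_(i <- r) g i).
Proof.
move=> f0 g0; elim: r => [|i r IH]; first by rewrite !big_nil mulr0.
rewrite !big_cons; set A := \sum_(_ <- _) _ in IH *.
have S0 h : (forall i, 0 <= h i) -> 0 <= \sum_(i <- r) h i :> R by move=> h0; exact: sumr_ge0.
rewrite mulrDl !mulrDr -addrA lerD2l; apply: le_trans IH _.
by rewrite addrA lerDr addr_ge0// mulr_ge0// S0.
Qed.

(** The squared intensity is at most [kap |u| |v|], and the sum of a product over the sites is at
    most the product of the sums, each bounded by the mass [N]. This is why the weight is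
    squared. *)
Lemma local_intensity_bound N s w L : 0 <= s ->
  \sum_(j < L) om j ^+ 2 * local_intensity N s j w ^+ 2 <= kap * N%:R ^+ 2.
Proof.
move=> s0; rewrite /local_intensity indicE.
have [b|b] := pselect (local_event N s w); last first.
  rewrite big1 ?mulr_ge0 ?sqr_ge0 ?(ltW kap0)// => j _.
  by rewrite memNset// mulr0 expr0n mulr0.
rewrite mem_set// -[true%:R]/(1 : R); have := stays_mass L b; rewrite /mass => mL.
have key c : 0 <= c -> (Num.sqrt c) ^+ 2 = c by move=> ?; exact: sqr_sqrtr.
have bnd j : om j ^+ 2 * (intensity s j w * 1) ^+ 2 <=
   kap * ((`|x true s j w| * om j) * (`|x false s j w| * om j)).
  rewrite mulr1 [leRHS](_ : _ = om j ^+ 2 * (kap * (`|x true s j w| * `|x false s j w|))); last by ring.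
  rewrite ler_wpM2l ?sqr_ge0// /intensity.
  (* Nonnegativity of the fields holds almost surely only; where the product is negative the square
     root is 0 by convention. *)
  have [c0|c0] := leP 0 (kap * x true s j w * x false s j w).
    rewrite key// -mulrA -normrM ler_wpM2l ?(ltW kap0)//; exact: ler_norm.
  by rewrite ler0_sqrtr ?(ltW c0)// expr0n/= !mulr_ge0// ltW.
apply: le_trans (ler_sum _ (fun (j : 'I_L) _ => bnd j)) _.
rewrite -mulr_sumr ler_wpM2l ?(ltW kap0)//.
have o0 j : 0 <= om j by exact: ltW.
have := @sum_prod_le _ (index_enum 'I_L) (fun j : 'I_L => `|x true s j w| * om j)
  (fun j : 'I_L => `|x false s j w| * om j).
move=> /(_ (fun j => mulr_ge0 (normr_ge0 _) (o0 _)) (fun j => mulr_ge0 (normr_ge0 _) (o0 _))).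
move=> /le_trans; apply; rewrite expr2.
apply: ler_pM => //; try by apply: sumr_ge0 => j _; rewrite mulr_ge0.
  by apply: le_trans _ mL; apply: ler_sum => j _; rewrite ler_wpM2r// lerDl.
by apply: le_trans _ mL; apply: ler_sum => j _; rewrite ler_wpM2r// lerDr.
Qed.

(** The intensity has continuous paths, and [stays_left] makes the indicator constant on a left
    neighbourhood of [s], which the dyadic floors eventually enter. *)
Lemma local_intensity_left N t s j : 0 < s <= t ->
  {ae P, forall w, local_intensity N (dfloor t k s) j w @[k --> \oo] --> local_intensity N s j w}.
Proof.
move=> st; have /andP[s0 _] := st.
apply: filterS2 gx (intensity_continuous j) => w gw cw.
have D0 k : 0 <= dfloor t k s by case: (dfloor_itv k st).
apply: cvgM.
  apply/cvgrPdist_lt => e e0.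
  have [d d0 H] := (path_continuousP _).1 cw s (ltW s0) e e0.
  have /cvgrPdist_lt/(_ _ d0) := dfloor_cvg st.
  by apply: filterS => k kd; exact: H.
have [dl dl0 H] := stays_left om0 (gw true) (gw false) N%:R s0.
apply: cvg_near_cst.
have /cvgrPdist_lt/(_ _ dl0) := dfloor_cvg st.
apply: filterS => k; have [_ ks _] := dfloor_itv k st.
rewrite ger0_norm ?subr_ge0 ?(ltW ks)// => kd; rewrite !indicE.
have := H _ (D0 k); rewrite ltrBlDr (ltW ks) andbT -ltrBlDl kd => /(_ isT) E.
by congr (_%:R); congr nat_of_bool; apply/idP/idP; rewrite !inE => /E.
Qed.

Lemma local_intensity_integrand N t :
  integrand P F om t (local_intensity N) (kap * N%:R ^+ 2).
Proof.
split; [exact: local_intensity_adapted|by move=> *; exact: local_intensity_bound|].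
by move=> s j; exact: local_intensity_left.
Qed.

Lemma local_intensityE N t : 0 <= t ->
  {ae P, forall w, local_event N t w -> forall s j, 0 <= s <= t ->
    local_intensity N s j w = intensity s j w}.
Proof.
move=> t0; apply: filterS gx => w gw Ew s j st.
rewrite /local_intensity indicE mem_set ?mulr1//.
exact: (stays_le om0 (gw true) (gw false) st Ew).
Qed.

Lemma local_event_cover t : 0 <= t -> {ae P, forall w, exists N, local_event N t w}.
Proof.
move=> t0; apply: filterS gx => w gw.
have [N0 H] := stays_eventually om0 (gw true) (gw false) t0.
exists (Num.bound `|N0|); apply: H; apply: le_trans (ler_norm N0) _.
by rewrite ltW// archi_boundP.
Qed.

End localization_events.

(** * Quadratic convolution with the kernel *)

Section spreading.
Context {R : realType}.
Variables (a : nat -> nat -> R) (p : R -> nat -> nat -> R).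
Hypothesis hp : semigroup_of a p.
Variables (om : nat -> R) (K : R).
Hypothesis om0 : forall j, 0 < om j.
Hypothesis som : nsummable om.
Hypothesis omK : forall j, nsum (fun i => om i * a i j) <= K * om j.
Let mu := @lebesgue_measure R.

(** The variance at time [t] and site [i] of a stochastic convolution with the kernel whose
    integrand has second moments [g]. *)
Definition spread g t i : R :=
  \int[mu]_(s in `]0, t]) nsum (fun j => wker p i t s j ^+ 2 * g s j).

Let wker_measurable i (t : R) j : measurable_fun `]0, t] (fun s => wker p i t s j).
Proof.
have [t0|t0] := leP 0 t; last first.
  by rewrite set_itv_ge ?bnd_simp -?leNgt ?(ltW t0)//; exact: measurable_fun_set0.
apply: path_measurable => //; apply: (@lip_path_continuous _ _ (wconst om K i t * om j)) => s s' s0 s'0.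
have s'0' := le_trans s0 s'0; rewrite mulrAC -[X in _ * X * _](@ger0_norm _ (s' - s)) ?subr_ge0//.
exact: (wker_lip hp om0 som omK).
Qed.

Section bounded_profile.
Variables (g : R -> nat -> R) (t M : R).
Hypothesis t0 : 0 <= t.
Hypothesis g0 : forall s j, 0 <= s <= t -> 0 <= g s j.
Hypothesis mg : forall j, measurable_fun `]0, t] (fun s => g s j).
Hypothesis gsum : forall s, 0 <= s <= t -> nsummable (fun j => om j ^+ 2 * g s j).
Hypothesis gM : forall s, 0 <= s <= t -> nsum (fun j => om j ^+ 2 * g s j) <= M.

Let in0 s : `]0, t]%classic s -> 0 <= s <= t.
Proof. by rewrite /= in_itv/= => /andP[s0 ->]; rewrite ltW. Qed.

Lemma spread_summable i s : 0 <= s <= t ->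
  nsummable (fun j => wker p i t s j ^+ 2 * g s j) /\
  nsum (fun j => wker p i t s j ^+ 2 * g s j) <= wconst om K i t ^+ 2 * M.
Proof.
move=> st; have /andP[s0 _] := st.
have H j : wker p i t s j ^+ 2 * g s j <= wconst om K i t ^+ 2 * (om j ^+ 2 * g s j).
  rewrite mulrA ler_wpM2r ?g0// -exprMn -real_normK ?num_real//.
  by rewrite ler_pXn2r ?nnegrE// ?(le_trans (normr_ge0 _) (wker_bound hp om0 som omK i t0 j s0))//;
    exact: (wker_bound hp om0 som omK).
have sZ := nsummableZ (wconst om K i t ^+ 2) (gsum st).
have s1 : nsummable (fun j => wker p i t s j ^+ 2 * g s j).
  by apply: nsummable_le sZ _ => j; rewrite ger0_norm// mulr_ge0 ?sqr_ge0 ?g0.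
split=> //; apply: le_trans (ler_nsum s1 sZ H) _.
by rewrite nsumZ ?gsum// ler_wpM2l ?sqr_ge0 ?gM.
Qed.

Lemma spread_integrable i :
  Rintegrable mu `]0, t] (fun s => nsum (fun j => wker p i t s j ^+ 2 * g s j)).
Proof.
apply: (@Rintegrable_bounded _ _ _ _ _ _ _ (wconst om K i t ^+ 2 * M)) => //.
- rewrite -[ltLHS]/(lebesgue_measure `]0, t]).
  by rewrite lebesgue_measure_itv/=; case: ifP => // _; rewrite -EFinB ltry.
- apply: (@measurable_nsum _ _ _ _ (fun j s => wker p i t s j ^+ 2 * g s j)) => [j|s /in0 st].
    apply: measurable_funM => //; apply: measurable_funX; exact: wker_measurable.
  by case: (spread_summable i st).
- move=> s /in0 st; rewrite ger0_norm ?(spread_summable i st).2//.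
  by apply: nsum_ge0 => j; rewrite mulr_ge0 ?sqr_ge0 ?g0.
Qed.

Lemma spread_ge0 i : 0 <= spread g t i.
Proof.
apply: Rintegral_ge0 => s /in0 st.
by apply: nsum_ge0 => j; rewrite mulr_ge0 ?sqr_ge0 ?g0.
Qed.

(** Summing over the starting site first, [kernel_column_sq] absorbs the squared kernel into the
    squared weight; the cutoff [L] makes the exchange with the time integral a finite one. *)
Lemma spread_weighted (G : R -> R) : Rintegrable mu `]0, t] G ->
  (forall s, 0 <= s <= t -> nsum (fun j => om j ^+ 2 * g s j) <= G s) ->
  nsummable (fun i => om i ^+ 2 * spread g t i) /\
  nsum (fun i => om i ^+ 2 * spread g t i) <= expR (K * t) ^+ 2 * \int[mu]_(s in `]0, t]) G s.
Proof.
move=> iG gG; have K0 := weight_constant_ge0 hp om0 omK.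
apply: nsummable_bounded => [i|L]; first by rewrite mulr_ge0 ?sqr_ge0 ?spread_ge0.
have iS i : Rintegrable mu `]0, t]
    (fun s => om i ^+ 2 * nsum (fun j => wker p i t s j ^+ 2 * g s j)).
  by apply: RintegrableZ => //; exact: spread_integrable.
rewrite (_ : \sum_(n < L) _ = \int[mu]_(s in `]0, t])
    \sum_(i < L) om i ^+ 2 * nsum (fun j => wker p i t s j ^+ 2 * g s j)); last first.
  rewrite Rintegral_sum//; apply: eq_bigr => i _.
  by rewrite RintegralZl//; exact: spread_integrable.
rewrite -RintegralZl//.
apply: le_Rintegral => //; [exact: Rintegrable_sum|exact: RintegrableZ|].
move=> s /in0 st; have /andP[s0 s1] := st.
have sw i := (spread_summable i st).1.
apply: (@le_trans _ _ (nsum (fun j => (expR (K * t) ^+ 2) * (om j ^+ 2 * g s j)))); last first.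
  by rewrite nsumZ ?gsum// ler_wpM2l ?sqr_ge0 ?gG.
under eq_bigr => i _ do rewrite -nsumZ//.
rewrite -(@Rintegral_sum _ _ _ (@counting _ R) setT _ _ _ _
   (fun (i : 'I_L) j => om i ^+ 2 * (wker p i t s j ^+ 2 * g s j))); first last.
- by move=> i _; exact: nsummableZ.
- exact: measurableT.
apply: ler_nsum; [by apply: Rintegrable_sum => // i _; exact: nsummableZ|exact/nsummableZ/gsum|].
move=> j; have ts : 0 <= t - s by rewrite subr_ge0.
have [c1 c2] := kernel_column_sq hp om0 som omK j ts.
rewrite [leLHS](_ : _ = (\sum_(i < L) om i ^+ 2 * p (t - s) i j ^+ 2) * g s j); last first.
  rewrite mulr_suml; apply: eq_bigr => i _; rewrite /wker max_l//; ring.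
rewrite mulrA ler_wpM2r ?g0//; apply: le_trans (partial_le_nsum _ _ c1) _.
  by move=> i; rewrite mulr_ge0 ?sqr_ge0.
apply: le_trans c2 _; rewrite ler_wpM2r ?sqr_ge0// ler_pXn2r ?nnegrE ?expR_ge0// ler_expR.
by rewrite ler_wpM2l// gerBl.
Qed.

End bounded_profile.

Lemma weighted_gronwall (g : R -> nat -> R) (T M A be : R) :
  0 <= T -> 0 <= A -> 0 <= be ->
  (forall s j, 0 <= s <= T -> 0 <= g s j) ->
  (forall j, measurable_fun `]0, T] (fun s => g s j)) ->
  (forall s, 0 <= s <= T -> nsummable (fun j => om j ^+ 2 * g s j)) ->
  (forall s, 0 <= s <= T -> nsum (fun j => om j ^+ 2 * g s j) <= M) ->
  (forall s j, 0 <= s <= T -> g s j <= A + be * spread g s j) ->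
  forall s, 0 <= s <= T -> nsum (fun j => om j ^+ 2 * g s j) <=
    2 * (A * nsum (fun j => om j ^+ 2)) * expR (2 * be * expR (K * T) ^+ 2 * s).
Proof.
move=> T0 A0 be0 g0 mg gsum gM gA s sT.
have K0 := weight_constant_ge0 hp om0 omK.
have som2 : nsummable (fun j => om j ^+ 2).
  have := @term_le_nsum _ om => tl; apply: nsummable_le (nsummableZ (nsum om) som) _ => j.
  rewrite ger0_norm ?sqr_ge0// expr2 ler_wpM2r ?(ltW (om0 j))//.
  by apply: tl => // k; exact: ltW.
have Om0 : 0 <= nsum (fun j => om j ^+ 2) by apply: nsum_ge0 => j; exact: sqr_ge0.
(* The exponent is twice the rate given by [spread_weighted], so that the time integral returns half
   of the constant, as [gronwall_iter] demands. *)
set b := 2 * be * _; have b0 : 0 <= b by rewrite !mulr_ge0// sqr_ge0.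
have M0 : 0 <= M.
  apply: le_trans (gM 0 _); last by rewrite lexx.
  by apply: nsum_ge0 => j; rewrite mulr_ge0 ?sqr_ge0 ?g0 ?lexx.
apply: (@gronwall_iter _ (fun s => nsum (fun j => om j ^+ 2 * g s j)) T M) => //.
  exact: mulr_ge0.
move=> S S0 gS t tT; have /andP[t0 tT'] := tT.
have sub u : 0 <= u <= t -> 0 <= u <= T by move=> /andP[-> /le_trans->].
have mg' j : measurable_fun `]0, t] (fun s => g s j).
  apply: measurable_funS (mg j) => // u; rewrite /= !in_itv/= => /andP[-> /le_trans]; exact.
have iE : Rintegrable mu `]0, t] (fun s => S * expR (b * s)).
  apply: RintegrableZ => //; apply: path_integrable => //; exact: exp_path.
have [sw lw] := @spread_weighted g t M t0 (fun s j st => g0 s j (sub s st)) mg'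
  (fun s st => gsum s (sub s st)) (fun s st => gM s (sub s st)) _ iE
  (fun s st => gS s (sub s st)).
have s1 := nsummableD (nsummableZ A som2) (nsummableZ be sw).
apply: le_trans (ler_nsum (gsum t tT) s1 _) _.
  move=> j; apply: le_trans (ler_wpM2l (sqr_ge0 _) (gA t j tT)) _.
  by rewrite le_eqVlt; apply/orP; left; apply/eqP; ring.
rewrite nsumD ?nsumZ//; [|exact: nsummableZ|exact: nsummableZ].
rewrite lerD2l; apply: le_trans (ler_wpM2l be0 lw) _.
apply: (@le_trans _ _ (be * (expR (K * T) ^+ 2 * \int[mu]_(s in `]0, t]) (S * expR (b * s))))).
  rewrite ler_wpM2l// ler_wpM2r//.
    by apply: Rintegral_ge0 => u _; rewrite mulr_ge0 ?expR_ge0.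
  by rewrite ler_pXn2r ?nnegrE ?expR_ge0// ler_expR ler_wpM2l.
have ie : Rintegrable mu `]0, t] (fun s => expR (b * s)).
  apply: path_integrable => //; exact: exp_path.
have EI := exp_integral b (lexx 0) t0; rewrite RintegralZl// in EI.
rewrite RintegralZl//.
rewrite [leLHS](_ : _ = S / 2 * (b * \int[mu]_(x in `]0, t]) expR (b * x))); last first.
  by rewrite /b; field.
by rewrite -EI ler_wpM2l ?divr_ge0// gerBl expR_ge0.
Qed.

End spreading.

Record regular_field {R : realType} {disp} {T : measurableType disp} (om : nat -> R)
    (y : bool -> R -> nat -> T -> R) : Prop := {
  rf_measurable : forall b s j, 0 <= s -> measurable_fun setT (y b s j);
  rf_path : forall b w, good_path om (fun s j => y b s j w);
  rf_ge0 : forall b s j w, 0 <= s -> 0 <= y b s j w;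
  rf_init : forall b j w, y b 0 j w = 1 }.

(** On the exceptional null set the field is replaced by the constant 1, which meets all
    requirements. This may destroy adaptedness, so measurability with respect to the filtration
    stays with [x], while pathwise arguments use [y]. *)
Lemma regular_version (R : realType) disp (T : measurableType disp) (P : probability T R)
    (om : nat -> R) (x : bool -> R -> nat -> T -> R) :
  nsummable om ->
  (forall b s j, 0 <= s -> measurable_fun setT (x b s j)) ->
  {ae P, forall w b, [/\ good_path om (fun s j => x b s j w),
      forall s j, 0 <= s -> 0 <= x b s j w & forall j, x b 0 j w = 1]} ->
  exists2 y, regular_field om y & {ae P, forall w b s j, y b s j w = x b s j w}.
Proof.
move=> som mx [Z [mZ Z0 HZ]].
pose y b s j w := x b s j w * \1_(~` Z) w + \1_Z w.
have yZ b s j w : Z w -> y b s j w = 1.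
  by move=> Zw; rewrite /y !indicE memNset// mem_set// mulr0 add0r.
have yN b s j w : ~ Z w -> y b s j w = x b s j w.
  by move=> Zw; rewrite /y !indicE mem_set// memNset// mulr1 addr0.
have good w : ~ Z w -> forall b, [/\ good_path om (fun s j => x b s j w),
      forall s j, 0 <= s -> 0 <= x b s j w & forall j, x b 0 j w = 1].
  by move=> Zw; apply/not_notP => H; apply: Zw; exact: HZ.
exists y; last first.
  exists Z; split=> // w; apply: contra_notP => Zw b s j; exact: yN.
split=> [b s j s0|b w|b s j w s0|b j w].
- apply: measurable_funD; last exact: measurable_indic.
  apply: measurable_funM; first exact: mx.
  by apply: measurable_indic; exact: measurableC.
- have [Zw|Zw] := pselect (Z w).
    rewrite (_ : (fun s j => _) = fun _ _ => 1); first exact: const_path.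
    by apply/funext => s; apply/funext => j; rewrite yZ.
  rewrite (_ : (fun s j => _) = fun s j => x b s j w); first by case: (good _ Zw b).
  by apply/funext => s; apply/funext => j; rewrite yN.
- have [Zw|Zw] := pselect (Z w); first by rewrite yZ.
  by rewrite yN//; case: (good _ Zw b) => _ ->.
- have [Zw|Zw] := pselect (Z w); first by rewrite yZ.
  by rewrite yN//; case: (good _ Zw b).
Qed.

Lemma prod_le_sq_dist (R : realType) (u v : R) :
  u * v <= 2 + ((u - 1) ^+ 2 + (v - 1) ^+ 2).
Proof.
have := sqr_ge0 (u - v); have := sqr_ge0 (u - 2); have := sqr_ge0 (v - 2); nra.
Qed.

(** * Moments of the solution *)

Section model.
Context (R : realType) disp (T : measurableType disp) (P : probability T R).
Variables (F : R -> set (set T)) (hF : filtration F).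
Variables (a : nat -> nat -> R) (p : R -> nat -> nat -> R).
Hypothesis hp : semigroup_of a p.
Variables (om : nat -> R) (K : R).
Hypothesis om0 : forall j, 0 < om j.
Hypothesis som : nsummable om.
Hypothesis omK : forall j, nsum (fun i => om i * a i j) <= K * om j.
Variable x : bool -> R -> nat -> T -> R.
Hypothesis ax : forall b j, adapted F (fun s => x b s j).
Variable y : bool -> R -> nat -> T -> R.
Hypothesis hy : regular_field om y.
Hypothesis yx : {ae P, forall w b s j, y b s j w = x b s j w}.
Variables kap : R.
Hypothesis kap0 : 0 < kap.
Variables (B : bool -> nat -> R -> T -> R) (r : bool -> bool -> R).
Hypothesis hB : forall b j, brownian_motion P F (B b j).
Hypothesis hr : forall b b' j j', bracket_rate P F (B b j) (B b' j')
  (if j == j' then r b b' else 0).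
Hypothesis r1 : forall b, r b b = 1.
Hypothesis r_le1 : forall b b', `|r b b'| <= 1.
Variable M : bool -> nat -> R -> T -> R.
Let H := intensity x kap.
Hypothesis itoM : forall b j, ito_integral P F (fun s => H s j) (B b j) (M b j).
Let mu := @lebesgue_measure R.
Let mT := @measurableT _ T.
Hypothesis eqM : forall b j, {ae P, forall w t, 0 <= t ->
  x b t j w = x b 0 j w + \int[mu]_(s in `]0, t]) mig a (fun l => x b s l w) j + M b j t w}.

Let ha := sg_rates hp.

Let gx : {ae P, forall w, forall b, good_path om (fun s j => x b s j w)}.
Proof.
apply: filterS yx => w E b.
rewrite (_ : (fun s j => _) = fun s j => y b s j w); first exact: rf_path hy b w.
by apply/funext => s; apply/funext => j; rewrite E.
Qed.

Let h := local_intensity om x kap.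
Let mg b s j w := mig a (fun l => y b s l w) j.

Let ysum b s w : 0 <= s -> wsummable om (fun j => y b s j w).
Proof. exact: (gp_summable (rf_path hy b w)). Qed.

(** The weight is [wker], with [wgen] minus its time derivative. At the final time the weight is a
    point mass at [i]; at time 0 the field is 1 and the kernel has mass 1, so the boundary terms
    reduce to [y b t i - 1]. *)
Lemma noise_representation t i N b e eta : 0 < t -> 0 < e -> 0 < eta ->
  \forall n \near \oo, \forall L \near \oo, \forall m \near \oo,
    covered P eta [set w | local_event om x N t w /\
      e <= `|(y b t i w - 1) - noise_sum (B b) (wker p i t) t (h N) n L m w|].
Proof.
move=> t0 e0 eta0; have t0' := ltW t0.
have aH j : adapted F (fun s => H s j) by exact: intensity_adapted.
have cH j : {ae P, forall w, path_continuous (fun s => H s j w)}.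
  exact: intensity_continuous.
have mb s j : 0 <= s -> measurable_fun setT (mg b s j).
  move=> s0; apply: measurable_funB; last exact: (rf_measurable hy b j s0).
  apply: (@measurable_nsum _ _ _ setT (fun l w => a j l * y b s l w)) => [l|w _].
    by apply: measurable_funM => //; exact: (rf_measurable hy b l s0).
  apply: (mig_summable ha om0 som omK); exact: ysum.
have gb w : good_path om (fun s j => mg b s j w).
  exact: (mig_path ha om0 som omK (rf_path hy b w)).
have hBB j : bracket_rate P F (B b j) (B b j) 1.
  by have := hr b b j j; rewrite eqxx r1.
have MD j : {ae P, forall w s, 0 <= s -> M b j s w = path_defect (y b) (mg b) s j w}.
  apply: filterS2 yx (eqM b j) => w E eM s s0.
  rewrite /path_defect /defect !E eM//.
  have -> : \int[mu]_(s1 in `]0, s]) mg b s1 j w =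
     \int[mu]_(s1 in `]0, s]) mig a (fun l => x b s1 l w) j; last by ring.
  by apply: Rintegral_eq => // s1 _; rewrite /mg; congr (mig a _ j); apply/funext => l; rewrite E.
have wz w s s' : 0 <= s -> 0 <= s' ->
    wpair (wker p i t s) (fun j => mg b s' j w) = wpair (wgen a p i t s) (fun j => y b s' j w).
  move=> s0 s'0; have y0 j : 0 <= y b s' j w by exact: (rf_ge0 hy b j w).
  by have [_ _] := flow_pairing hp om0 som omK i t0' s0 y0 (ysum b w s'0).
have DE w : wpair (wker p i t t) (fun j => y b t j w) - wpair (wker p i t 0) (fun j => y b 0 j w)
    = y b t i w - 1.
  rewrite /wpair; under eq_nsum do rewrite (wker_final hp).
  rewrite (_ : nsum _ = y b t i w); last first.
    rewrite -[RHS](nsum_delta (fun j => y b t j w) i).2.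
    by apply: eq_nsum => j; rewrite mulrC// eq_sym.
  under [X in _ - X]eq_nsum do rewrite (rf_init hy) mulr1.
  by rewrite (wker_sum hp i t0' (lexx 0)).2.
have hE := local_intensityE om0 gx kap N t0'.
have Q := (mild_in_probability hF (hB b) hBB aH cH om0 (rf_measurable hy b) mb
  (rf_path hy b) gb (itoM b) MD t0
  (wker_bound hp om0 som omK i t0') (wgen_bound hp om0 som omK i t0')
  (wgen_lip hp om0 som omK i t0') (fun s h j => @wker_taylor _ _ _ hp _ _ om0 som omK i t s h j)
  wz DE hE e0 eta0).
exact: Q.
Qed.


Local Notation intble P X := (Rintegrable P [set: T] X).

Let ih t N : integrand P F om t (h N) (kap * N%:R ^+ 2).
Proof. exact: local_intensity_integrand. Qed.

Let mE t N : 0 <= t -> measurable (local_event om x N t).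
Proof.
move=> t0; apply: (filtration_measurable hF t0); exact: local_event_measurable.
Qed.

Let my b s j : 0 <= s -> measurable_fun setT (y b s j).
Proof. exact: (rf_measurable hy b j). Qed.

Let prod s j w := kap * y true s j w * y false s j w.

Let prod_ge0 s j w : 0 <= s -> 0 <= prod s j w.
Proof. by move=> s0; rewrite /prod mulr_ge0 ?mulr_ge0 ?(ltW kap0) ?(rf_ge0 hy). Qed.

Let m_prod s j : 0 <= s -> measurable_fun setT (prod s j).
Proof.
by move=> s0; apply: measurable_funM; [apply: measurable_funM => //|]; exact: my.
Qed.

Let h_sq : {ae P, forall w N s j, 0 <= s ->
  h N s j w ^+ 2 = prod s j w * \1_(local_event om x N s) w}.
Proof.
apply: filterS yx => w E N s j s0.
rewrite /h /local_intensity exprMn /intensity -!E sqr_sqrtr ?prod_ge0//.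
by rewrite indicE; case: (_ \in _); rewrite ?expr1n ?expr0n.
Qed.

Let g N s j := second_moment P (h N) s j.

(* The localized second moment is bounded by the mild equation, whose stochastic
   integral is controlled by the same moments: this closes the Gronwall loop. *)
Lemma local_moment_bound N t i : 0 <= t -> g N t i <= kap * 2 + kap * 12 * spread p (g N) t i.
Proof.
move=> t0; have s0 : 0 <= spread p (g N) t i.
  apply: Rintegral_ge0 => s _; apply: nsum_ge0 => j.
  by rewrite mulr_ge0 ?sqr_ge0 ?second_moment_ge0.
have hs : sqint P (h N t i) by exact: (integrand_sqint hF om0 (ih t N)).
have [t1|t1] := leP t 0.
  have tE : t = 0 by apply/eqP; rewrite eq_le t1.
  apply: (@le_trans _ _ kap); last first.
    rewrite -[leLHS]addr0 lerD ?mulr_ge0 ?(ltW kap0)//.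
    by rewrite ler_peMr ?(ltW kap0)// ler1n.
  rewrite /g /second_moment -[leRHS](expectation_cstr P).
  apply: Rintegral_ae_le => //; [by case: hs|exact: intble_cst|].
  apply: filterS h_sq => w E _; rewrite E// /prod tE !(rf_init hy) !mulr1 ler_piMr ?(ltW kap0)//.
pose X b w := y b t i w - 1.
have mX b : measurable_fun setT (X b) by apply: measurable_funB => //; exact: my.
have approx N' b e eta (e0 : 0 < e) (eta0 : 0 < eta) :=
  noise_representation i N' b t1 e0 eta0.
have LM b := localized_moment hF om0 t1 (wker_bound hp om0 som omK i t0)
  (wker_lip hp om0 som omK i t0) hB hr r1 (ih t) (fun N' => mE N' t0) mX approx N b.
have [[_ iT] bT] := LM true; have [[_ iF] bF] := LM false.
pose Q b w := (X b w * \1_(local_event om x N t) w) ^+ 2.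
have iQ b : intble P (Q b) by case: b.
have iS := RintegrableD mT (iQ true) (iQ false).
have i2 := RintegrableD mT (intble_cst P 2) iS.
have i3 : intble P (fun w => kap * (2 + (Q true w + Q false w))) by apply: RintegrableZ.
(* [Q b] is the squared deviation from 1 on the local event; the product is bounded through it
   because the centred components are the ones controlled by the noise. *)
apply: (@le_trans _ _ (\int[P]_w (kap * (2 + (Q true w + Q false w))))).
  apply: Rintegral_ae_le => //; first by case: hs.
  apply: filterS h_sq => w E _; rewrite E// /prod -mulrA -mulrA ler_wpM2l ?(ltW kap0)//.
  rewrite /Q /X indicE; case: (_ \in _); last first.
    by rewrite -[false%:R]/(0 : R) !mulr0 expr0n/= addr0 addr0.
  rewrite -[true%:R]/(1 : R) !mulr1.
  exact: prod_le_sq_dist.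
have EI : \int[P]_w (kap * (2 + (Q true w + Q false w))) =
    kap * (2 + (\int[P]_w Q true w + \int[P]_w Q false w)).
  rewrite RintegralZl// RintegralD//; last exact: intble_cst.
  by congr (_ * (_ + _)); [exact: expectation_cstr|exact: RintegralD].
rewrite EI mulrDr lerD2l -mulrA ler_wpM2l ?(ltW kap0)//.
(* One factor 6 from [localized_moment] for each component. *)
have E12 : 12 * spread p (g N) t i = 6 * spread p (g N) t i + 6 * spread p (g N) t i by ring.
by rewrite E12; apply: lerD.
Qed.

(** The a priori bound [kap * N^2] only lets the iteration start; the constant that
    [weighted_gronwall] delivers is free of [N]. *)
Lemma local_moment_uniform t : 0 < t -> exists C, forall N s, 0 <= s <= t ->
  nsum (fun j => om j ^+ 2 * g N s j) <= C.
Proof.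
move=> t0; have t0' := ltW t0; have kap0' := ltW kap0.
pose b := 2 * (kap * 12) * expR (K * t) ^+ 2.
have b0 : 0 <= b by rewrite !mulr_ge0 ?sqr_ge0.
exists (2 * (kap * 2 * nsum (fun j => om j ^+ 2)) * expR (b * t)) => N s st.
have /andP[s0 st'] := st.
apply: le_trans (_ : _ <= 2 * (kap * 2 * nsum (fun j => om j ^+ 2)) * expR (b * s)) _.
  apply: (@weighted_gronwall _ a p hp om K om0 som omK (g N) t (kap * N%:R ^+ 2)) => //.
  - exact: mulr_ge0.
  - exact: mulr_ge0.
  - by move=> u j _; exact: second_moment_ge0.
  - exact: (measurable_second_moment hF om0 t0 (ih t N)).
  - by move=> u /andP[u0 _]; exact: (second_moment_sum hF om0 (ih t N) u0).1.
  - by move=> u /andP[u0 _]; exact: (second_moment_sum hF om0 (ih t N) u0).2.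
  - by move=> u j /andP[u0 _]; exact: local_moment_bound.
rewrite ler_wpM2l ?ler_expR ?ler_wpM2l//.
by rewrite !mulr_ge0//; apply: nsum_ge0 => j; exact: sqr_ge0.
Qed.

Definition product_moment s j := \int[P]_w (kap * y true s j w * y false s j w).

(** The uniform bound on localized moments and Fatou give integrability of the product, which then
    dominates the localized squares, so that their means converge. *)
Lemma product_integrable s j : 0 <= s ->
  [/\ intble P (prod s j), forall N, g N s j <= product_moment s j &
      g N s j @[N --> \oo] --> product_moment s j].
Proof.
move=> s0; have s1 : 0 < s + 1 by rewrite ltr_wpDl.
have [C hC] := local_moment_uniform s1.
have gC N : g N s j <= C / om j ^+ 2.
  rewrite ler_pdivlMr ?exprn_gt0// mulrC.
  have [sg _] := second_moment_sum hF om0 (ih s N) s0.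
  have sI : 0 <= s <= s + 1 by rewrite s0 lerDl ler01.
  apply: le_trans (hC N s sI).
  apply: (@term_le_nsum _ (fun j => om j ^+ 2 * g N s j)) => // k.
  by rewrite mulr_ge0 ?sqr_ge0 ?second_moment_ge0.
have hs N : sqint P (h N s j) by exact: (integrand_sqint hF om0 (ih s N)).
have hcv : {ae P, forall w, setT w -> h N s j w ^+ 2 @[N --> \oo] --> prod s j w}.
  apply: filterS2 h_sq (local_event_cover om0 gx s0) => w E [N0 EN] _.
  apply: cvg_near_cst; near=> N; rewrite E// indicE mem_set ?mulr1//.
  by apply: (@local_event_sub _ _ _ om x N0) => //; near: N; exists N0.
have mp := m_prod j s0.
have [ip _] : Rintegrable P setT (prod s j) /\ \int[P]_w prod s j w <= C / om j ^+ 2.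
  apply: (@Rintegral_fatou _ _ _ _ _ _ (fun N w => h N s j w ^+ 2)) => //.
  - by move=> N; case: (hs N).
  - by move=> N w _; exact: sqr_ge0.
  - by move=> w _; exact: prod_ge0.
split=> // [N|].
  apply: Rintegral_ae_le => //; first by case: (hs N).
  apply: filterS h_sq => w E _; rewrite E// ler_piMr ?prod_ge0//.
apply: (proj2 (@Rintegral_dominated _ _ _ _ _ _ (fun N w => h N s j w ^+ 2) _ (prod s j) _ _ _ _ _)) => //.
- by move=> N; case: (hs N) => _; exact: Rintegrable_measurable.
- apply: filterS h_sq => w E _ N; rewrite E// ger0_norm; last by apply: mulr_ge0 => //; exact: prod_ge0.
  by rewrite ler_piMr ?prod_ge0.
Unshelve. all: by end_near. Qed.

Let f := product_moment.

Lemma product_moment_ge0 s j : 0 <= s -> 0 <= f s j.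
Proof. by move=> s0; apply: Rintegral_ge0 => w _; exact: prod_ge0. Qed.

Lemma product_moment_sum t : 0 < t -> exists C, forall s, 0 <= s <= t ->
  nsummable (fun j => om j ^+ 2 * f s j) /\ nsum (fun j => om j ^+ 2 * f s j) <= C.
Proof.
move=> t0; have [C hC] := local_moment_uniform t0.
exists C => s st; have /andP[s0 _] := st; apply: nsummable_bounded => [j|L].
  by rewrite mulr_ge0 ?sqr_ge0 ?product_moment_ge0.
have cv : \sum_(j < L) om j ^+ 2 * g N s j @[N --> \oo] --> \sum_(j < L) om j ^+ 2 * f s j.
  apply: cvg_big => [|j _]; first by move=> [? ?]; exact: add_continuous.
  by apply: cvgMr; have [] := product_integrable j s0.
apply: (ler_cvg_to cv (cvg_cst C)); apply: nearW => N; apply: le_trans (hC N s st).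
have [sg _] := second_moment_sum hF om0 (ih s N) s0.
apply: (@partial_le_nsum _ (fun j => om j ^+ 2 * g N s j)) => // k.
by rewrite mulr_ge0 ?sqr_ge0 ?second_moment_ge0.
Qed.

Lemma product_moment_measurable (t : R) j : 0 < t -> measurable_fun `]0, t] (fun s => f s j).
Proof.
move=> t0; apply: (@measurable_fun_cvg _ _ _ _ (fun N s => g N s j)).
  by move=> N; exact: (measurable_second_moment hF om0 t0 (ih t N)).
by move=> s; rewrite /= in_itv/= => /andP[/ltW s0 _]; have [] := product_integrable j s0.
Qed.

(** Domination by the summand with [product_moment], over the sites and then in time. It identifies
    the limit [Phi] required by the mild moment formulas. *)
Lemma spread_moment_cvg (t : R) i : 0 < t -> spread p (g N) t i @[N --> \oo] --> spread p f t i.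
Proof.
move=> t0; have [C hC] := product_moment_sum t0; have t0' := ltW t0.
have f0 s j : 0 <= s <= t -> 0 <= f s j by move=> /andP[s0 _]; exact: product_moment_ge0.
have in0 s : `]0, t]%classic s -> 0 <= s <= t.
  by rewrite /= in_itv/= => /andP[s0 ->]; rewrite ltW.
have sS := spread_summable hp om0 som omK t0' f0 (fun s st => (hC s st).1) (fun s st => (hC s st).2) i.
have mf j := product_moment_measurable j t0.
have iS := spread_integrable hp om0 som omK t0' f0 mf (fun s st => (hC s st).1)
  (fun s st => (hC s st).2) i.
have igN N := integrable_moment hF om0 t0 (wker_bound hp om0 som omK i t0')
  (wker_lip hp om0 som omK i t0') (ih t N).
have mgN N := Rintegrable_measurable (igN N).
have H1 : {ae mu, forall s, `]0, t]%classic s ->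
    nsum (fun j => wker p i t s j ^+ 2 * g N s j) @[N --> \oo] -->
    nsum (fun j => wker p i t s j ^+ 2 * f s j)}.
  apply: aeW => s /in0 st; have /andP[s0 _] := st.
  apply: (@nsum_dominated _ _ _ (fun j => wker p i t s j ^+ 2 * f s j)).
  - by case: (sS s st).
  - move=> N j; rewrite ger0_norm; last by rewrite mulr_ge0 ?sqr_ge0 ?second_moment_ge0.
    by rewrite ler_wpM2l ?sqr_ge0//; have [] := product_integrable j s0.
  - by move=> j; apply: cvgMr; have [] := product_integrable j s0.
have H2 : {ae mu, forall s, `]0, t]%classic s -> forall N,
    `|nsum (fun j => wker p i t s j ^+ 2 * g N s j)| <=
    nsum (fun j => wker p i t s j ^+ 2 * f s j)}.
  apply: aeW => s /in0 st N; have /andP[s0 _] := st.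
  have [s1 _] := sS s st.
  have H' j : wker p i t s j ^+ 2 * g N s j <= wker p i t s j ^+ 2 * f s j.
    by rewrite ler_wpM2l ?sqr_ge0//; have [] := product_integrable j s0.
  have g0 j : 0 <= wker p i t s j ^+ 2 * g N s j.
    by rewrite mulr_ge0 ?sqr_ge0 ?second_moment_ge0.
  rewrite ger0_norm; last exact: nsum_ge0.
  by apply: ler_nsum => //; apply: nsummable_le s1 _ => j; rewrite ger0_norm.
have mI : measurable (`]0, t] : set (measurableTypeR R)) by [].
exact: (proj2 (@Rintegral_dominated _ _ _ mu _ mI
  (fun N s => nsum (fun j => wker p i t s j ^+ 2 * g N s j))
  (fun s => nsum (fun j => wker p i t s j ^+ 2 * f s j))
  (fun s => nsum (fun j => wker p i t s j ^+ 2 * f s j))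
  mgN (Rintegrable_measurable iS) H1 iS H2)).
Qed.

Theorem second_moments t i : 0 <= t ->
  [/\ forall b, sqint P (y b t i),
      forall b, \int[P]_w (y b t i w ^+ 2) = 1 + spread p f t i &
      f t i = kap * (1 + r true false * spread p f t i)].
Proof.
(* At time 0 the fields equal 1 and the interval of integration is empty; the grid arguments ask for
   [0 < t]. *)
move=> t0; have [t1|t1] := leP t 0.
  have tE : t = 0 by apply/eqP; rewrite eq_le t1.
  have S0 : spread p f t i = 0.
    by rewrite /spread tE set_itv_ge ?bnd_simp// Rintegral_set0.
  have y1 b w : y b t i w = 1 by rewrite tE (rf_init hy).
  rewrite S0 addr0 mulr0 addr0; split.
  - move=> b; rewrite (_ : y b t i = cst 1); last by apply/funext => w; rewrite y1.
    split; first exact: measurable_cst.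
    by apply: Rintegrable_eq (intble_cst P 1) => // w _; rewrite /= expr1n.
  - move=> b; rewrite -[RHS](expectation_cstr P 1).
    by apply: Rintegral_eq => // w _; rewrite y1 expr1n.
  - rewrite mulr1 -[RHS](expectation_cstr P kap).
    by apply: Rintegral_eq => // w _; rewrite !y1 !mulr1.
pose X b w := y b t i w - 1.
have mX b : measurable_fun setT (X b) by apply: measurable_funB => //; exact: my.
have approx N' b e eta (e0 : 0 < e) (eta0 : 0 < eta) :=
  noise_representation i N' b t1 e0 eta0.
have hh := @local_intensity_diff _ _ _ om x kap.
have cov := local_event_cover om0 gx t0.
have cPhi := @spread_moment_cvg t i t1.
have sX b : sqint P (X b).
  exact: (mild_sqint hF om0 t1 (wker_bound hp om0 som omK i t0)
    (wker_lip hp om0 som omK i t0) hB hr r1 (ih t) hh (fun N' => mE N' t0)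
    (fun N N' => @local_event_sub _ _ _ om x N N' t) cov mX approx cPhi b).
have iX b : intble P (X b) by exact: sqint_intble.
have EX b : \int[P]_w X b w = 0.
  exact: (mild_mean hF om0 t1 (wker_bound hp om0 som omK i t0)
    (wker_lip hp om0 som omK i t0) hB hr r1 (ih t) hh (fun N' => mE N' t0)
    (fun N N' => @local_event_sub _ _ _ om x N N' t) cov mX approx cPhi b).
have CX b b' : \int[P]_w (X b w * X b' w) = r b b' * spread p f t i.
  exact: (mild_cov hF om0 t1 (wker_bound hp om0 som omK i t0)
    (wker_lip hp om0 som omK i t0) hB hr r1 r_le1 (ih t) hh (fun N' => mE N' t0)
    (fun N N' => @local_event_sub _ _ _ om x N N' t) cov mX approx cPhi b b').
have iXX b b' : intble P (fun w => X b w * X b' w) by exact: sqint_mul.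
have CY b b' : intble P (fun w => y b t i w * y b' t i w) /\
    \int[P]_w (y b t i w * y b' t i w) = 1 + r b b' * spread p f t i.
  have i1 := RintegrableD mT (intble_cst P 1) (iX b).
  have i2 := RintegrableD mT i1 (iX b').
  have i3 := RintegrableD mT i2 (iXX b b').
  have E w : 1 + X b w + X b' w + X b w * X b' w = y b t i w * y b' t i w.
    by rewrite /X; ring.
  split; first by apply: Rintegrable_eq i3 => // w _; exact: E.
  have -> : \int[P]_w (y b t i w * y b' t i w) =
      \int[P]_w (1 + X b w + X b' w + X b w * X b' w).
    by apply: Rintegral_eq => w _; rewrite E.
  rewrite RintegralD// RintegralD// RintegralD//; last exact: intble_cst.
  by rewrite !EX CX !addr0; congr (_ + _); exact: expectation_cstr.
split=> [b|b|].
- split; first exact: my.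
  by apply: Rintegrable_eq (CY b b).1 => // w _; rewrite expr2.
- have := (CY b b).2; rewrite r1 mul1r => <-.
  by apply: Rintegral_eq => w _; rewrite expr2.
- have [ic Ec] := CY true false; rewrite -Ec -RintegralZl//.
  by apply: Rintegral_eq => w _; rewrite mulrA.
Qed.

End model.

(** * Exponential growth of the renewal equation *)

Section reflection.
Context {R : realType}.
Let mu := @lebesgue_measure R.

Lemma reflected_path (k : R -> R) r : path_continuous k ->
  path_continuous (fun s => k (Num.max (r - s) 0)).
Proof.
move=> ck; have max0 s : 0 <= Num.max (r - s) 0 by rewrite le_max lexx orbT.
apply/path_continuousP => s s0 e e0.
have [d d0 H] := (path_continuousP k).1 ck (Num.max (r - s) 0) (max0 s) e e0.
exists d => // x x0 sx; apply: H => //; apply: le_lt_trans sx.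
clear; rewrite /Num.max; do 2 case: ifPn; rewrite -?leNgt => a b.
- by rewrite subrr normr0 normr_ge0.
- by rewrite sub0r normrN ler_norml; have := ler_norm (s - x); have := ler_norm (- (s - x));
    rewrite normrN; lra.
- by rewrite subr0 ler_norml; have := ler_norm (s - x); have := ler_norm (- (s - x));
    rewrite normrN; lra.
- by rewrite ler_norml; have := ler_norm (s - x); have := ler_norm (- (s - x));
    rewrite normrN; lra.
Qed.

(** Both integrals are limits of Riemann sums over one grid; reversing the order of the cells turns
    the left tags of one into the right tags of the other. *)
Lemma integral_reflect (k : R -> R) r : 0 <= r -> path_continuous k ->
  \int[mu]_(s in `]0, r]) k (Num.max (r - s) 0) = \int[mu]_(s in `]0, r]) k s.
Proof.
move=> r0 ck; have ck' := reflected_path (r := r) ck.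
have gptr N l : (l <= N)%N -> (0 < N)%N -> 0 <= gpt r N l <= r.
  by move=> lN N0; rewrite gpt_ge0//= -[leRHS](@gptN _ r N)// gpt_le.
have tag m l x : gcell r m.+1 l x ->
    0 <= gpt r m.+1 l /\ `|x - gpt r m.+1 l| <= r / m.+1%:R.
  move=> c; split; first exact: gpt_ge0.
  by have [/andP[a b] _] := gcell_dist c; rewrite ger0_norm// ltW.
have tag' m l x : gcell r m.+1 l x ->
    0 <= gpt r m.+1 l.+1 /\ `|x - gpt r m.+1 l.+1| <= r / m.+1%:R.
  move=> c; split; first exact: gpt_ge0.
  by have [_ /andP[a b]] := gcell_dist c; rewrite distrC ger0_norm// ltW.
have [_ c1] := @riemann_path _ _ r (fun m => m.+1) (fun m l => gpt r m.+1 l.+1) r0 ck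
  (fun m => ltnSn m) tag' (fun m l lm => gptr m.+1 l.+1 lm isT).
have [_ c2] := @riemann_path _ _ r (fun m => m.+1) (fun m l => gpt r m.+1 l) r0 ck'
  (fun m => ltnSn m) tag (fun m l lm => gptr m.+1 l (ltnW lm) isT).
have E : (fun m => \sum_(l < m.+1) k (Num.max (r - gpt r m.+1 l) 0) * (r / m.+1%:R)) =
    (fun m => \sum_(l < m.+1) k (gpt r m.+1 l.+1) * (r / m.+1%:R)); last first.
  by rewrite E in c2; exact: (cvg_unique (@Rhausdorff R) c2 c1).
apply/funext => m.
rewrite (reindex_inj rev_ord_inj)/=; apply: eq_bigr => l _; congr (k _ * _).
have lm : (l < m.+1)%N by [].
rewrite subSS /gpt natrB// max_l.
  by move: (nat_of_ord l) => n; rewrite -!natr1; field; rewrite natr1 pnatr_eq0.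
rewrite subr_ge0 ler_pdivrMr ?ltr0n// ler_wpM2l// -natrB// ler_nat; lia.
Qed.

End reflection.

(** * Comparison with exponentials and the growth rate *)

Section growth.
Context {R : realType}.
Variables (a : nat -> nat -> R) (p : R -> nat -> nat -> R).
Hypothesis hp : semigroup_of a p.
Hypothesis transitive : forall i, exists tau sigma, [/\ cancel tau sigma,
  cancel sigma tau, forall k l, a (tau k) (tau l) = a k l & tau 0%N = i].
Variables (om : nat -> R) (K : R).
Hypothesis om0 : forall j, 0 < om j.
Hypothesis som : nsummable om.
Hypothesis omK : forall j, nsum (fun i => om i * a i j) <= K * om j.
Let mu := @lebesgue_measure R.

Definition damped lam s := expR (- lam * s) * meeting p s.

Definition laplace lam t := \int[mu]_(s in `]0, t]) damped lam s.

Let damped_path lam : path_continuous (damped lam).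
Proof. by move=> s s0; apply: cvgM; [exact: exp_path|exact: (meeting_path hp)]. Qed.

Let damped_ge0 lam s : 0 <= damped lam s.
Proof. by rewrite mulr_ge0 ?expR_ge0 ?meeting_ge0. Qed.

Let damped_integrable lam t : Rintegrable mu `]0, t] (damped lam).
Proof. exact: path_integrable. Qed.

Let in_itv0 (t s : R) : (`]0, t]%classic s) -> 0 < s <= t.
Proof. by rewrite /= in_itv. Qed.

Lemma laplace_ge0 lam t : 0 <= laplace lam t.
Proof. by apply: Rintegral_ge0 => s _; exact: damped_ge0. Qed.

Lemma laplace_mono lam s t : 0 <= s <= t -> laplace lam s <= laplace lam t.
Proof.
move=> st; rewrite -subr_ge0 /laplace (path_integralB st (@damped_path lam)).
by apply: Rintegral_ge0 => u _; exact: damped_ge0.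
Qed.

Lemma laplace_anti lam lam' t : lam <= lam' -> laplace lam' t <= laplace lam t.
Proof.
move=> ll; apply: le_Rintegral => //.
move=> s /in_itv0/andP[s0 _]; rewrite /damped ler_wpM2r ?meeting_ge0// ler_expR.
by rewrite ler_wpM2r ?(ltW s0)// lerN2.
Qed.

(** Bounds the loss caused by damping on a bounded interval; it connects the exponent 0 with
    positive ones. *)
Lemma laplace_tilt lam t : 0 <= lam -> expR (- lam * t) * laplace 0 t <= laplace lam t.
Proof.
move=> l0; rewrite /laplace -RintegralZl//.
apply: le_Rintegral => //; first exact: RintegrableZ.
move=> s /in_itv0/andP[s0 st]; rewrite /damped mulrA ler_wpM2r ?meeting_ge0//.
by rewrite oppr0 mul0r expR0 mulr1 ler_expR !mulNr lerN2 ler_wpM2l.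
Qed.

Lemma laplace_bound lam t : 0 <= t -> lam * laplace lam t <= 1.
Proof.
move=> t0; have [l0|l0] := leP 0 lam; last first.
  by apply: (@le_trans _ _ 0) => //; rewrite nmulr_rle0 ?laplace_ge0.
have ie : Rintegrable mu `]0, t] (fun s => expR (- lam * s)).
  by apply: path_integrable => //; exact: exp_path.
have := exp_integral (- lam) (lexx 0) t0; rewrite RintegralZl// mulr0 expR0 => E.
apply: (@le_trans _ _ (lam * \int[mu]_(s in `]0, t]) expR (- lam * s))); last first.
  by have := expR_ge0 (- lam * t); move: E; rewrite mulNr => E; lra.
rewrite ler_wpM2l//; apply: le_Rintegral => //.
by move=> s /in_itv0/andP[/ltW s0 _]; rewrite ler_piMr ?expR_ge0 ?(meeting_le1 hp).
Qed.

Let quarter : (0 : R) <= (4^-1 : R) <= (2^-1 : R).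
Proof. by apply/andP; split; lra. Qed.

(* The gap [dl] is uniform in time; it makes room for the source term of a super-solution. *)
Lemma laplace_strict lam lam' : 0 <= lam -> lam < lam' -> exists2 dl, 0 < dl &
  forall T, 0 <= T -> exists T', 0 <= T' /\ laplace lam' T <= laplace lam T' - dl.
Proof.
move=> l0 ll; pose h s := damped lam s - damped lam' s.
have ch : path_continuous h by move=> s s0; apply: cvgB; exact: damped_path.
have h0 s : 0 <= s -> 0 <= h s.
  move=> s0; rewrite /h subr_ge0 ler_wpM2r ?meeting_ge0// ler_expR.
  by rewrite ler_wpM2r// lerN2 ltW.
have hE t : laplace lam t - laplace lam' t = \int[mu]_(s in `]0, t]) h s.
  by rewrite /h RintegralB//; exact: damped_integrable.
(* On [(1/4, 1/2]] the factors bound below the weaker damping, the relative difference of the two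
   exponentials, and the meeting probability, which is at least [(1 - 1/2)^2]. The length of this
   interval gives a further [4^-1] in the gap. *)
pose m := expR (- lam) * (1 - expR (- (lam' - lam) * 4^-1)) * 4^-1.
have m0 : 0 < m.
  rewrite /m !mulr_gt0 ?expR_gt0 ?invr_gt0// subr_gt0 expR_lt1.
  by rewrite mulNr oppr_lt0 mulr_gt0 ?invr_gt0// subr_gt0.
have hm s : 4^-1 < s <= 2^-1 -> m <= h s.
  move=> /andP[s4 s2]; have s0 : 0 <= s by apply: le_trans (ltW s4); rewrite invr_ge0.
  have -> : h s = expR (- lam * s) * (1 - expR (- (lam' - lam) * s)) * meeting p s.
    rewrite /h /damped -mulrBl; congr (_ * _); rewrite mulrBr mulr1 -expRD; congr (_ - expR _); ring.
  have q4 : 4^-1 <= meeting p s.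
    have s1 : s <= 1 by lra.
    apply: le_trans (meeting_lb hp s0 s1).
    rewrite (_ : 4^-1 = 2^-1 ^+ 2); last by field.
    by rewrite ler_pXn2r ?nnegrE ?invr_ge0//; lra.
  have e1 : expR (- lam) <= expR (- lam * s).
    by rewrite ler_expR mulNr lerN2; nra.
  have e2 : 1 - expR (- (lam' - lam) * 4^-1) <= 1 - expR (- (lam' - lam) * s).
    by rewrite lerB// ler_expR !mulNr lerN2 ler_wpM2l ?subr_ge0 ?ltW.
  have e20 : 0 <= 1 - expR (- (lam' - lam) * 4^-1).
    rewrite subr_ge0 ltW// expR_lt1 mulNr oppr_lt0 mulr_gt0 ?invr_gt0// subr_gt0//.
  rewrite /m; apply: ler_pM => //; first by rewrite mulr_ge0 ?expR_ge0.
  by apply: ler_pM => //; exact: expR_ge0.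
have D : m * 4^-1 <= \int[mu]_(s in `]0, 2^-1]) h s.
  have -> : \int[mu]_(s in `]0, 2^-1]) h s =
      \int[mu]_(s in `]4^-1, 2^-1]) h s + \int[mu]_(s in `]0, 4^-1]) h s.
    by rewrite -(path_integralB quarter ch) subrK.
  apply: (@le_trans _ _ (\int[mu]_(s in `]4^-1, 2^-1]) m)).
    rewrite Rintegral_cst// itv_length; last lra.
    by rewrite le_eqVlt; apply/orP; left; apply/eqP; field.
  rewrite -[leLHS]addr0; apply: lerD.
    have i1 : Rintegrable mu `]4^-1, 2^-1] (fun=> m).
      by apply: path_integrable; [rewrite invr_ge0|move=> s s0; exact: cvg_cst].
    have i2 : Rintegrable mu `]4^-1, 2^-1] h by apply: path_integrable; rewrite ?invr_ge0.
    by apply: le_Rintegral => // s; rewrite /= in_itv/=; exact: hm.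
  by apply: Rintegral_ge0 => s /in_itv0/andP[/ltW s0 _]; exact: h0.
exists (m * 4^-1); first by rewrite mulr_gt0 ?invr_gt0.
have P T : 2^-1 <= T -> laplace lam' T <= laplace lam T - m * 4^-1.
  move=> T2; rewrite lerBrDr -lerBrDl hE; apply: le_trans D _.
  rewrite -subr_ge0 path_integralB//; last by rewrite T2 invr_ge0 ler0n.
  apply: Rintegral_ge0 => s; rewrite /= in_itv/= => /andP[s2 _]; apply: h0.
  by rewrite ltW// (le_lt_trans _ s2)// invr_ge0.
move=> T T0; have [T2|T2] := leP 2^-1 T; first by exists T; split=> //; exact: P.
exists 2^-1; split; first by rewrite invr_ge0.
apply: le_trans (P _ (lexx _)); apply: laplace_mono; rewrite T0 ltW//.
Qed.

Record profile (g : R -> nat -> R) : Prop := {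
  profile_ge0 : forall s j, 0 <= s -> 0 <= g s j;
  profile_measurable : forall (t : R) j, measurable_fun `]0, t] (fun s => g s j);
  profile_sum : forall t, exists C, forall s, 0 <= s <= t ->
    nsummable (fun j => om j ^+ 2 * g s j) /\ nsum (fun j => om j ^+ 2 * g s j) <= C }.

Let nonneg g t : profile g -> forall s j, 0 <= s <= t -> 0 <= g s j.
Proof. by move=> hg s j /andP[s0 _]; exact: profile_ge0. Qed.

Lemma profile_spread_integrable g t i : 0 <= t -> profile g ->
  (forall s, 0 <= s <= t -> nsummable (fun j => wker p i t s j ^+ 2 * g s j)) /\
  Rintegrable mu `]0, t] (fun s => nsum (fun j => wker p i t s j ^+ 2 * g s j)).
Proof.
move=> t0 hg; have [C hC] := profile_sum hg t; split=> [s st|].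
  exact: (spread_summable hp om0 som omK t0 (nonneg (t := t) hg) (fun s st => (hC s st).1)
    (fun s st => (hC s st).2) i st).1.
exact: (spread_integrable hp om0 som omK t0 (nonneg (t := t) hg) (fun j => @profile_measurable g hg t j)
  (fun s st => (hC s st).1) (fun s st => (hC s st).2) i).
Qed.

(* The positive part of [phi - psi] satisfies the same inequality without source. *)
Lemma sub_super_solution (phi psi : R -> nat -> R) A be : 0 <= be ->
  profile phi -> profile psi ->
  (forall t i, 0 <= t -> phi t i <= A + be * spread p phi t i) ->
  (forall t i, 0 <= t -> A + be * spread p psi t i <= psi t i) ->
  forall t i, 0 <= t -> phi t i <= psi t i.
Proof.
move=> be0 hphi hpsi sub super t i t0.
pose D s j := Num.max (phi s j - psi s j) 0.
have D0 s j : 0 <= D s j by rewrite le_max lexx orbT.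
have Dphi s j : 0 <= s -> D s j <= phi s j.
  by move=> s0; rewrite ge_max profile_ge0// andbT gerBl profile_ge0.
have Dd s j : phi s j - psi s j <= D s j by rewrite le_max lexx.
have hD : profile D.
  split=> // [u j|u].
    apply: measurable_maxr => //; apply: measurable_funB; exact: profile_measurable.
  have [C hC] := profile_sum hphi u; exists C => s su; have [s1 s2] := hC s su.
  have /andP[s0 _] := su.
  have H j : om j ^+ 2 * D s j <= om j ^+ 2 * phi s j by rewrite ler_wpM2l ?sqr_ge0 ?Dphi.
  have sD : nsummable (fun j => om j ^+ 2 * D s j).
    by apply: nsummable_le s1 _ => j; rewrite ger0_norm// mulr_ge0 ?sqr_ge0.
  by split=> //; apply: le_trans s2; exact: ler_nsum.
have key s j : 0 <= s -> D s j <= be * spread p D s j.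
  move=> s0; rewrite ge_max; apply/andP; split; last first.
    rewrite mulr_ge0//; apply: Rintegral_ge0 => u _; apply: nsum_ge0 => k.
    by rewrite mulr_ge0 ?sqr_ge0.
  have := sub s j s0; have := super s j s0.
  suff : spread p phi s j - spread p psi s j <= spread p D s j.
    move=> /(ler_wpM2l be0); rewrite mulrBr.
    by move: (be * _) (be * _) (be * _) => x y z; lra.
  have [n1 i1] := profile_spread_integrable j s0 hphi.
  have [n2 i2] := profile_spread_integrable j s0 hpsi.
  have [n3 i3] := profile_spread_integrable j s0 hD.
  rewrite /spread -RintegralB//; apply: le_Rintegral => //; first exact: RintegrableB.
  move=> u /in_itv0/andP[/ltW u0 us]; have uI : 0 <= u <= s by rewrite u0.
  rewrite -nsumB; [|exact: n1|exact: n2]; apply: ler_nsum; [|exact: n3|].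
    by apply: nsummableB; [exact: n1|exact: n2].
  by move=> k; rewrite -mulrBr ler_wpM2l ?sqr_ge0.
have [C hC] := profile_sum hD t.
have key' s j : 0 <= s <= t -> D s j <= 0 + be * spread p D s j.
  by move=> /andP[s0 _]; rewrite add0r; exact: key.
have tt : 0 <= t <= t by rewrite t0 lexx.
have G := weighted_gronwall hp om0 som omK t0 (lexx 0) be0 (nonneg (t := t) hD)
  (fun j => @profile_measurable D hD t j) (fun s st => (hC s st).1) (fun s st => (hC s st).2) key' tt.
rewrite mul0r mulr0 mul0r in G.
have := le_trans (@term_le_nsum _ (fun j => om j ^+ 2 * D t j) i
  (fun j => mulr_ge0 (sqr_ge0 _) (D0 t j)) (hC t tt).1) G.
rewrite pmulr_rle0 ?exprn_gt0// => /(le_trans (Dd t i)).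
by rewrite subr_le0.
Qed.

Let som2 : nsummable (fun j => om j ^+ 2).
Proof.
apply: nsummable_le (nsummableZ (nsum om) som) _ => j.
rewrite ger0_norm ?sqr_ge0// expr2 ler_wpM2r ?(ltW (om0 j))//.
by apply: term_le_nsum => // k; exact: ltW.
Qed.

Lemma exp_profile c lam : 0 <= c -> profile (fun s _ => c * expR (lam * s)).
Proof.
move=> c0; have cp : path_continuous (fun s => c * expR (lam * s)).
  by move=> s s0; apply: cvgMr; exact: exp_path.
split=> [s j s0|t j|t]; first by rewrite mulr_ge0 ?expR_ge0.
  exact: path_measurable.
exists (nsum (fun j => om j ^+ 2) * (c * expR (`|lam| * `|t|))) => s /andP[s0 st].
have sZ := nsummableZ (c * expR (lam * s)) som2.
have E : (fun j => om j ^+ 2 * (c * expR (lam * s))) = (fun j => c * expR (lam * s) * om j ^+ 2).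
  by apply/funext => j; rewrite mulrC.
rewrite E; split=> //; rewrite nsumZ// mulrC ler_wpM2l//.
  by apply: nsum_ge0 => j; exact: sqr_ge0.
rewrite ler_wpM2l// ler_expR; apply: le_trans (ler_norm _) _.
by rewrite normrM ler_wpM2l// (ger0_norm s0) (le_trans st)// ler_norm.
Qed.

(** For a spatially constant profile the sum of the squared kernel is the meeting probability,
    whatever the starting site; reversing time pulls out [expR (lam * t)] and leaves the damped
    integral. Exponentials can thus be tested as sub- and super-solutions. *)
Lemma spread_exp c lam t i : 0 <= t ->
  spread p (fun s _ => c * expR (lam * s)) t i = c * expR (lam * t) * laplace lam t.
Proof.
move=> t0; rewrite /laplace -(integral_reflect t0 (@damped_path lam)).
have ck := reflected_path (r := t) (@damped_path lam).
rewrite -RintegralZl//; last exact: path_integrable.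
apply: Rintegral_eq => s /in_itv0/andP[s0 st]; have ts : 0 <= t - s by rewrite subr_ge0.
rewrite /wker max_l// /damped -(meetingE hp transitive i ts).
rewrite [RHS](_ : _ = c * expR (lam * s) * nsum (fun j => p (t - s) i j ^+ 2)); last first.
  rewrite !mulrA; congr (_ * _); rewrite -mulrA -expRD; congr (_ * expR _); ring.
rewrite -nsumZ; last exact: (sq_summable hp i ts).
by apply: eq_nsum => j; rewrite mulrC.
Qed.

Section second_moment_growth.
Variables (kap rho : R) (f : R -> nat -> R).
Hypothesis kap0 : 0 < kap.
Hypothesis rho1 : rho <= 1.
Hypothesis hf : profile f.
Hypothesis fE : forall t i, 0 <= t -> f t i = kap * (1 + rho * spread p f t i).

Let be := kap * rho.

Let fE' t i : 0 <= t -> f t i = kap + be * spread p f t i.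
Proof. by move=> t0; rewrite fE// /be; ring. Qed.

Let f_ge0 s j : 0 <= s -> 0 <= f s j. Proof. exact: profile_ge0. Qed.

Let S_ge0 t i : 0 <= spread p f t i.
Proof.
apply: Rintegral_ge0 => s /in_itv0/andP[/ltW s0 _]; apply: nsum_ge0 => j.
by rewrite mulr_ge0 ?sqr_ge0 ?f_ge0.
Qed.

(** The sub-solution is [kap * expR (- lam * T) * expR (lam * t)]. Up to time [T] it stays below the
    source [kap]; afterwards the damped kernel, with mass at least 1 up to [T], sustains it
    alone. *)
Lemma lower_growth lam T t i : 0 < rho -> 0 <= lam -> 0 <= T -> 1 <= be * laplace lam T ->
  0 <= t -> expR (- lam * T) * expR (lam * t) <= 1 + spread p f t i.
Proof.
move=> r0 l0 T0 bT t0; have be0 : 0 < be by rewrite mulr_gt0.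
have c0 : 0 <= kap * expR (- lam * T) by rewrite mulr_ge0 ?expR_ge0 ?ltW.
have H : kap * expR (- lam * T) * expR (lam * t) <= f t i.
  apply: (@sub_super_solution (fun s _ => kap * expR (- lam * T) * expR (lam * s)) f kap be) => //.
  - exact: ltW.
  - exact: exp_profile.
  - move=> s j s0; rewrite spread_exp//.
    have [sT|Ts] := leP s T.
      apply: (@le_trans _ _ kap).
        by rewrite -mulrA ler_piMr ?(ltW kap0)// -expRD -expR0 ler_expR mulNr addrC subr_le0 ler_wpM2l.
      by rewrite lerDl mulr_ge0 ?(ltW be0)// !mulr_ge0 ?expR_ge0 ?laplace_ge0 ?(ltW kap0).
    apply: (@le_trans _ _ (be * (kap * expR (- lam * T) * expR (lam * s) * laplace lam s))).
      rewrite mulrCA ler_peMr//; first by apply: mulr_ge0 => //; exact: expR_ge0.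
      apply: le_trans bT _.
      by rewrite ler_wpM2l ?(ltW be0)// laplace_mono// T0 ltW.
    by rewrite lerDr ltW.
  - by move=> s j s0; rewrite -fE'.
have S0 := S_ge0 t i; rewrite fE// -mulrA ler_pM2l// in H.
by apply: le_trans H _; rewrite lerD2l ler_piMl.
Qed.

(** The fraction [1 - th] left over by the kernel pays for the source, which dictates [A]. The bound
    on [f] is turned into one on [spread] by dividing by [be]. *)
Lemma upper_growth lam th : 0 < rho -> 0 <= lam -> th < 1 ->
  (forall t, 0 <= t -> be * laplace lam t <= th) ->
  exists2 C, 0 < C & forall t i, 0 <= t -> 1 + spread p f t i <= C * expR (lam * t).
Proof.
move=> r0 l0 th1 bL; have be0 : 0 < be by rewrite mulr_gt0.
have th1' : 0 < 1 - th by rewrite subr_gt0.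
pose A := kap / (1 - th); have A0 : 0 < A by rewrite divr_gt0.
have H t i : 0 <= t -> f t i <= A * expR (lam * t).
  apply: (@sub_super_solution f (fun s _ => A * expR (lam * s)) kap be) => //.
  - exact: ltW.
  - by apply: exp_profile; exact: ltW.
  - by move=> s j s0; rewrite -fE'.
  - move=> s j s0; rewrite spread_exp// mulrCA.
    have e1 : 1 <= expR (lam * s) by rewrite -expR0 ler_expR mulr_ge0.
    have k1 : kap <= A * (1 - th) * expR (lam * s) by rewrite /A mulfVK ?gt_eqF// ler_peMr// ltW.
    have l1 : A * expR (lam * s) * (be * laplace lam s) <= A * expR (lam * s) * th.
      by rewrite ler_wpM2l ?bL// mulr_ge0 ?expR_ge0// ltW.
    apply: le_trans (lerD k1 l1) _.
    by rewrite le_eqVlt; apply/orP; left; apply/eqP; ring.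
exists (1 + A / be); first by rewrite addr_gt0// divr_gt0.
move=> t i t0; have e1 : 1 <= expR (lam * t) by rewrite -expR0 ler_expR mulr_ge0.
rewrite mulrDl mul1r; apply: lerD => //; rewrite mulrAC ler_pdivlMr// mulrC.
by apply: le_trans (H t i t0); rewrite fE'// lerDr ltW.
Qed.

(** For [rho <= 0] the renewal equation gives [f <= kap], hence a second moment that grows at most
    linearly, and the rate is 0. For [rho > 0] the mass of the damped kernel is always taken up to a
    finite [T], which avoids improper integrals. *)
Theorem second_moment_rate : exists g, [/\ 0 <= g,
  forall lam, lam < g -> exists2 c, 0 < c & forall t i, 0 <= t ->
    c * expR (lam * t) <= 1 + spread p f t i,
  forall lam, g < lam -> exists2 C, 0 < C & forall t i, 0 <= t ->
    1 + spread p f t i <= C * expR (lam * t) &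
  0 < g <-> exists2 T, 0 <= T & 1 < be * laplace 0 T].
Proof.
have trivial_lower lam : lam < 0 -> exists2 c, 0 < c & forall t i, 0 <= t ->
    c * expR (lam * t) <= 1 + spread p f t i.
  move=> l0; exists 1 => // t i t0; rewrite mul1r; apply: (@le_trans _ _ 1); last by rewrite lerDl.
  by rewrite -expR0 ler_expR nmulr_rle0.
have [r0|r0] := leP rho 0.
  exists 0; split=> //; last first.
    split; first by rewrite ltxx.
    move=> [T T0]; rewrite ltNge => /negP; case; apply: (@le_trans _ _ 0) => //.
    by rewrite /be -mulrA pmulr_rle0// mulr_le0_ge0 ?laplace_ge0.
  move=> lam l0; exists (1 + kap / lam); first by rewrite addr_gt0// divr_gt0.
  move=> t i t0; have e1 : 1 <= expR (lam * t) by rewrite -expR0 ler_expR mulr_ge0// ltW.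
  rewrite mulrDl mul1r; apply: lerD => //.
  have fk s j : 0 <= s -> f s j <= kap.
    by move=> s0; rewrite fE'// gerDl /be -mulrA pmulr_rle0// mulr_le0_ge0.
  have hk : profile (fun s _ => kap * expR (0 * s)) by apply: exp_profile; exact: ltW.
  have [n1 i1] := profile_spread_integrable i t0 hf.
  have [n2 i2] := profile_spread_integrable i t0 hk.
  apply: (@le_trans _ _ (spread p (fun s _ => kap * expR (0 * s)) t i)).
    apply: le_Rintegral => // s /in_itv0/andP[/ltW s0 st].
    have sI : 0 <= s <= t by rewrite s0.
    apply: ler_nsum; [exact: n1|exact: n2|] => j.
    by rewrite ler_wpM2l ?sqr_ge0// mul0r expR0 mulr1 fk.
  (* The undamped integral up to [t] is at most [expR (lam * t)] times the damped one, itself at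
     most [1 / lam]. *)
  rewrite spread_exp// mul0r expR0 mulr1 -mulrA ler_wpM2l ?(ltW kap0)//.
  rewrite ler_pdivlMl//; have := laplace_bound lam t0.
  have := laplace_tilt t (ltW l0); rewrite mulNr expRN ler_pdivrMl ?expR_gt0// => h1 h2.
  apply: le_trans (ler_wpM2l (ltW l0) h1) _; rewrite mulrCA.
  by rewrite -[leRHS]mulr1 ler_wpM2l ?expR_ge0.
have be0 : 0 < be by rewrite mulr_gt0.
(* 0 is put in so that the supremum exists and is nonnegative; [laplace_bound] shows that [be] is an
   upper bound. *)
pose L := [set l : R | l = 0 \/ 0 < l /\ exists2 T, 0 <= T & 1 < be * laplace l T].
have Lub : ubound L be.
  move=> l [->|[l0 [T T0 H]]]; first exact: ltW.
  have := laplace_bound l T0; rewrite -ler_pdivlMl// mulr1 => H'.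
  have := lt_le_trans H (ler_wpM2l (ltW be0) H').
  by rewrite ltr_pdivlMr// mul1r => /ltW.
have L0 : L 0 by left.
have hL : has_sup L by split; [exists 0|exists be].
have g0 : 0 <= sup L by apply: ub_le_sup => //; exists be.
exists (sup L); split=> //.
- move=> lam lg; have e0 : 0 < sup L - lam by rewrite subr_gt0.
  have [l Ll] := sup_adherent e0 hL; rewrite subKr => lam_l.
  case: Ll => [E|[l0 [T T0 bT]]]; first by apply: trivial_lower; rewrite -E.
  exists (expR (- l * T)); first exact: expR_gt0.
  move=> t i t0; apply: le_trans (lower_growth i r0 (ltW l0) T0 (ltW bT) t0).
  by rewrite ler_wpM2l ?expR_ge0// ler_expR ler_wpM2r// ltW.
(* At the intermediate exponent [l] the kernel mass is only known to be at most 1; [laplace_strict]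
   between [l] and [lam] lowers it below 1 by a uniform amount. *)
- move=> lam gl; pose l := (sup L + lam) / 2.
  have gl' : sup L < l by rewrite /l; lra.
  have ll : l < lam by rewrite /l; lra.
  have l0 : 0 < l by exact: le_lt_trans gl'.
  have bl T : 0 <= T -> be * laplace l T <= 1.
    move=> T0; rewrite leNgt; apply/negP => H; move: gl'; apply/negP; rewrite -leNgt.
    by apply: ub_le_sup; [exists be|right; split=> //; exists T].
  have [d d0 hd] := laplace_strict (ltW l0) ll.
  apply: (@upper_growth lam (1 - be * d)) => //.
  - by rewrite (le_trans (ltW l0))// ltW.
  - by rewrite gtrBl mulr_gt0.
  - move=> t t0; have [T' [T'0 H]] := hd t t0.
    apply: le_trans (ler_wpM2l (ltW be0) H) _; rewrite mulrBr lerD2r; exact: bl.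
- split=> [g1|[T T0 bT]].
    have [l [E|[l0 [T T0 bT]]] lg] := sup_adherent g1 hL.
      by move: lg; rewrite subrr E ltxx.
    exists T => //; apply: lt_le_trans bT _.
    by rewrite ler_wpM2l ?(ltW be0)// laplace_anti// ltW.
  (* Small enough that [l * T < ln (be * laplace 0 T)], so the damped integral still exceeds
     [1 / be]; [T + 1] guards against [T = 0]. *)
  pose l := ln (be * laplace 0 T) / 2 / (T + 1).
  have T1 : 0 < T + 1 by rewrite ltr_wpDl.
  have l0 : 0 < l by rewrite !divr_gt0// ln_gt0.
  apply: (lt_le_trans l0); apply: ub_le_sup; first by exists be.
  right; split=> //; exists T => //.
  apply: (@lt_le_trans _ _ (be * (expR (- l * T) * laplace 0 T))); last first.
    by rewrite ler_wpM2l ?(ltW be0)// laplace_tilt// ltW.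
  have b0 : 0 < be * laplace 0 T by exact: lt_trans bT.
  rewrite mulrCA -[X in _ * X]lnK// -expRD -expR0 ltr_expR.
  rewrite mulNr addrC subr_gt0.
  have lb : 0 < ln (be * laplace 0 T) by rewrite ln_gt0.
  have -> : ln (be * laplace 0 T) = l * (2 * (T + 1)).
    by rewrite /l; field; rewrite gt_eqF.
  by rewrite ltr_pM2l//; lra.
Qed.

End second_moment_growth.
End growth.

(** Infinity of the lattice, seen on constant vectors, is where [0 < d] enters; with countability it
    gives a bijection with [nat]. *)
Lemma lattice_enumeration d : (0 < d)%N ->
  exists (e : nat -> lattice d) (e' : lattice d -> nat), cancel e e' /\ cancel e' e.
Proof.
case: d => // d _.
have inf : ~ finite_set [set: lattice d.+1].
  pose f (n : nat) : lattice d.+1 := const_mx n%:Z.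
  have injf : injective f.
    by move=> m n /matrixP/(_ ord0 ord0); rewrite !mxE => -[].
  move=> fin; apply: infinite_nat; apply: sub_finite_set (finite_preimage (f := f) _ fin) => //.
  by move=> x y _ _; exact: injf.
have /card_set_bijP[e' [_ inj surj]] := eq_card_nat (countableP [set: lattice d.+1]) inf.
have ex n : exists x, e' x = n by have [x _ <-] := surj n I; exists x.
have [e eP] := choice ex.
exists e, e'; split=> [//|x]; apply: inj; rewrite ?in_setT//; exact: eP.
Qed.

(** * From the lattice to the theorem *)

Lemma dist_max0 (R : realDomainType) (s t : R) :
  `|Num.max s 0 - Num.max t 0| <= `|s - t|.
Proof.
have := ler_norm (s - t); have := ler_norm (- (s - t)); rewrite normrN => h1 h2.
have := normr_ge0 (s - t); move: h1 h2; move: (`|s - t|) => D h1 h2 D0.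
by rewrite ler_norml /Order.max; do 2 case: ifPn; rewrite -?leNgt => ? ?; lra.
Qed.

Section enumeration.
Context {R : realType} {d : nat}.
Variables (e : nat -> lattice d) (e' : lattice d -> nat).
Hypotheses (eK : cancel e e') (e'K : cancel e' e).

Let e_inj : injective e. Proof. exact: can_inj eK. Qed.

Lemma enum_esum (f : lattice d -> \bar R) :
  (\esum_(j in setT) f j = \esum_(n in setT) f (e n))%E.
Proof.
apply: reindex_esum; split=> //.
  by move=> x y _ _; exact: e_inj.
by move=> x _; exists (e' x) => //; rewrite e'K.
Qed.

Lemma enum_nsummable (f : lattice d -> R) : (forall j, 0 <= f j) ->
  (\esum_(j in setT) (f j)%:E < +oo)%E ->
  nsummable (fun n => f (e n)) /\ (\esum_(j in setT) (f j)%:E = (nsum (fun n => f (e n)))%:E)%E.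
Proof.
move=> f0; rewrite enum_esum => foo; have sf := nsummable_esum (fun n => f0 (e n)) foo.
by split=> //; rewrite (esum_nsum _ sf).
Qed.

Lemma enum_nsum (f : lattice d -> R) (c : R) : (forall j, 0 <= f j) ->
  (\esum_(j in setT) (f j)%:E = c%:E)%E ->
  nsummable (fun n => f (e n)) /\ nsum (fun n => f (e n)) = c.
Proof.
move=> f0 E; have [|sf E'] := enum_nsummable f0; first by rewrite E ltry.
by split=> //; apply/EFin_inj; rewrite -E' E.
Qed.

Lemma enum_lattice_sum (f : lattice d -> R) : nsummable (fun n => f (e n)) ->
  lattice_sum f = nsum (fun n => f (e n)).
Proof.
move=> sf; have sa := Rintegrable_norm sf.
have sp : nsummable (fun n => f^\+ (e n)).
  apply: nsummable_le sa _ => n; rewrite ger0_norm ?funrpos_ge0// /funrpos.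
  by rewrite ge_max ler_norm normr_ge0.
have sn : nsummable (fun n => f^\- (e n)).
  apply: nsummable_le sa _ => n; rewrite ger0_norm ?funrneg_ge0// /funrneg.
  by rewrite ge_max normr_ge0 andbT -normrN ler_norm.
rewrite /lattice_sum !enum_esum !esum_nsum//= -nsumB//.
apply: eq_nsum => n; rewrite /funrpos /funrneg /Order.max.
by do 2 case: ifPn; rewrite -?leNgt ?ltNge ?oppr_le0 => ? ?; lra.
Qed.

Section rates.
Variables (a : lattice d -> lattice d -> R) (ha : transition_rates a).
Variables (p : R -> lattice d -> lattice d -> R) (hp : transition_probabilities a p).

Let a' i j := a (e i) (e j).
Let p' t i j := p t (e i) (e j).

Lemma enum_stochastic (m : lattice d -> lattice d -> R) :
  (forall i j, 0 <= m i j) -> (forall i, (\esum_(j in setT) (m i j)%:E = 1)%E) ->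
  stochastic_matrix (fun i j => m (e i) (e j)).
Proof.
move=> m0 m1; have H i := enum_nsum (m0 (e i)) (m1 (e i)).
by split=> [i j|i|i]; [exact: m0|exact: (H i).1|exact: (H i).2].
Qed.

(** The rows sum to 1, so minus the off-diagonal sum is the diagonal entry minus 1. *)
Lemma enum_q_matrix i j : q_matrix a (e i) (e j) = a' i j - (i == j)%:R.
Proof.
rewrite /q_matrix (inj_eq e_inj); case: eqVneq => [->|_]; last by rewrite subr0.
have a0 k : (0 <= (a (e j) k)%:E)%E by rewrite lee_fin (rates_ge0 ha).
have := rates_sum1 ha (e j); rewrite (esumID [set e j]); last by move=> k _; exact: a0.
rewrite !setTI esum_set1//.
rewrite (_ : ~` [set e j] = [set k | k != e j]); last first.
  by apply/seteqP; split=> k /=; [move=> /eqP|move=> /eqP].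
have : (0 <= \esum_(k in [set k | k != e j]) (a (e j) k)%:E)%E by apply: esum_ge0.
case: (esum _ _) => [r _ /=|//|//]; rewrite -EFinD => -[E].
by rewrite -[true%:R]/(1 : R) -E /a'; ring.
Qed.

Lemma enum_semigroup : semigroup_of a' p'.
Proof.
have p0 t i j : 0 <= t -> 0 <= p t i j by exact: (trans_ge0 hp).
split.
- by apply: enum_stochastic; [exact: rates_ge0 ha|exact: rates_sum1 ha].
- move=> t t0; apply: (@enum_stochastic (p t)) => [i j|i]; first exact: p0.
  exact: (trans_sum1 hp).
- by move=> i j; rewrite /p' (trans_0 hp) (inj_eq e_inj).
- move=> s t i j s0 t0; rewrite /p'.
  have f0 k : 0 <= p s (e i) k * p t k (e j) by rewrite mulr_ge0 ?p0.
  by have [_ ->] := enum_nsum f0 (esym (trans_chapman_kolmogorov hp (e i) (e j) s0 t0)).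
- move=> i j; rewrite -enum_q_matrix -(inj_eq e_inj); exact: (trans_rates hp).
Qed.

(** Translations act transitively on the lattice and preserve the rates; conjugated by the
    enumeration they become permutations of [nat]. *)
Lemma enum_transitive i : exists tau sigma, [/\ cancel tau sigma,
  cancel sigma tau, forall k l, a' (tau k) (tau l) = a' k l & tau 0%N = i].
Proof.
exists (fun k => e' (e k + (e i - e 0%N))), (fun k => e' (e k - (e i - e 0%N))).
split=> [k|k|k l|].
- by rewrite e'K addrK eK.
- by rewrite e'K subrK eK.
- rewrite /a' !e'K (rates_shift ha) [RHS](rates_shift ha); congr (a 0 _).
  by rewrite opprD addrACA subrr addr0.
- by rewrite addrC subrK eK.
Qed.

(** With both arguments at the origin the sum is that of the squares of [p t 0 k]. The origin need
    not be enumerated first, hence [meetingE] at its index [e0]. *)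
Lemma enum_symmetrized t : 0 <= t -> symmetrized p t 0 0 = (meeting p' t)%:E.
Proof.
move=> t0; have hs := enum_semigroup.
rewrite /symmetrized; have f0 k : 0 <= p t 0 k * p t 0 (k - 0).
  by rewrite mulr_ge0 ?(trans_ge0 hp).
have [e0 E0] : {n | e n = 0} by exists (e' 0); rewrite e'K.
rewrite -(meetingE hs enum_transitive e0 t0) enum_esum -esum_nsum.
- by apply: eq_esum => n _; rewrite /p' E0 subr0 expr2.
- by move=> n; exact: sqr_ge0.
- exact: (sq_summable hs e0 t0).
Qed.

(** [green p] is the increasing limit of [laplace] at exponent 0, so a strict inequality against it
    is already attained at a finite [T]. When it is infinite, the convention that its inverse is 0
    applies. *)
Lemma green_laplace (be : R) :
  (be%:E > (green p)^-1)%E <-> exists2 T, 0 <= T & 1 < be * laplace p' 0 T.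
Proof.
have hs := enum_semigroup.
(* [meeting] is controlled at nonnegative times; freezing it at time 0 for negative ones gives a
   continuous, hence measurable, function on the line. *)
pose k t := meeting p' (Num.max t 0).
have max0 (t : R) : 0 <= Num.max t 0 by rewrite le_max lexx orbT.
have k0 t : 0 <= k t by exact: meeting_ge0.
have mk : measurable_fun setT k.
  apply: continuous_measurable_fun => t; apply/cvgrPdist_lt => eps eps0.
  have [dl dl0 H] := (path_continuousP _).1 (meeting_path hs) _ (max0 t) eps eps0.
  apply/nbhs_ballP; exists dl => // x tx; apply: H => //.
  exact: le_lt_trans (dist_max0 _ _) tx.
have gE : green p = (\int[lebesgue_measure]_(t in `[0%R, +oo[) (k t)%:E)%E.
  apply: eq_integral => t; rewrite inE/= in_itv/= andbT => t0.
  by rewrite enum_symmetrized// /k max_l.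
have kE (n : nat) : (\int[lebesgue_measure]_(t in `[0%R, n%:R]) (k t)%:E)%E =
    (laplace p' 0 n%:R)%:E.
  rewrite -integral_itv_obnd_cbnd; last exact/measurable_funTS/measurable_EFinP.
  have dp : path_continuous (damped p' 0).
    by move=> s s0; apply: cvgM; [exact: exp_path|exact: (meeting_path hs)].
  rewrite /laplace EFin_Rintegral//; last exact: path_integrable.
  apply: eq_integral => t; rewrite inE/= in_itv/= => /andP[/ltW t0 _].
  by rewrite /damped oppr0 mul0r expR0 mul1r /k max_l.
have cv := ge0_cvgn_integral (mu := lebesgue_measure) k0 mk.
rewrite -gE (_ : (fun n => _) = fun n => (laplace p' 0 n%:R)%:E) in cv; last exact/funext.
have Lup (T : R) : 0 <= T -> ((laplace p' 0 T)%:E <= green p)%E.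
  move=> T0; rewrite -(cvg_lim _ cv)//; apply: lime_ge; first by apply/cvg_ex; eexists; exact: cv.
  near=> n; rewrite lee_fin (laplace_mono hs)// T0 /=.
  apply: le_trans (ltW (archi_boundP T0)) _; rewrite ler_nat; near: n.
  exact: nbhs_infty_ge.
have Gle c : (forall T, 0 <= T -> laplace p' 0 T <= c) -> (green p <= c%:E)%E.
  move=> H; rewrite -(cvg_lim _ cv)//; apply: lime_le; first by apply/cvg_ex; eexists; exact: cv.
  by apply: nearW => n; rewrite lee_fin H.
(* A positive Green function excludes the degenerate inverse of 0. Positivity is [laplace_strict]
   for the exponents 0 and 1, read at time 0. *)
have [T1 T10 L1] : exists2 T, 0 <= T & 0 < laplace p' 0 T.
  have [dl dl0 /(_ _ (lexx 0))[T [T0 H]]] := laplace_strict hs (lexx 0) ltr01.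
  exists T => //; have := laplace_ge0 p' 1 0; lra.
have G0 : (0 < green p)%E by apply: lt_le_trans (Lup T1 T10); rewrite lte_fin.
split=> [H|[T T0 H]].
- have [//|nT] := pselect (exists2 T, 0 <= T & 1 < be * laplace p' 0 T); exfalso.
  have bL T : 0 <= T -> be * laplace p' 0 T <= 1.
    by move=> T0; rewrite leNgt; apply/negP => h; apply: nT; exists T.
  have be0 : 0 < be.
    rewrite -lte_fin; apply: le_lt_trans H; case: (green p) G0 => [g|//|//].
    by rewrite lte_fin => g0; rewrite inver gt_eqF// lee_fin invr_ge0 ltW.
  have Gb : (green p <= be^-1%:E)%E.
    by apply: Gle => T T0; rewrite -[be^-1]mulr1 ler_pdivlMl// bL.
  move: H Gb G0; case: (green p) => [g|//|//]; rewrite lee_fin lte_fin => H gb g0.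
  move: H; rewrite inver gt_eqF// lte_fin ltNge => /negP; apply.
  by rewrite -[be]invrK lef_pV2 ?posrE ?invr_gt0.
- have L0 : 0 < laplace p' 0 T.
    rewrite lt_neqAle laplace_ge0 andbT eq_sym; apply/eqP => E.
    by move: H; rewrite E mulr0 ltr10.
  have be0 : 0 < be by rewrite -(pmulr_lgt0 _ L0) (lt_trans _ H).
  move: (Lup T T0) G0; case: (green p) => [g|//|//]; rewrite ?invey ?lte_fin//.
  rewrite lee_fin => Lg g0; rewrite inver gt_eqF// lte_fin -[be]invrK ltf_pV2 ?posrE ?invr_gt0//.
  by apply: lt_le_trans Lg; rewrite -[be^-1]mulr1 ltr_pdivrMl.
Unshelve. all: by end_near. Qed.

End rates.
End enumeration.

(** Exponential bounds with exponents arbitrarily close to [g] on either side pin down the limit,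
    since the constants disappear after division by [t]. The lower bounds also make [E t] positive,
    so that [lne] is a real logarithm. *)
Lemma exponential_rate_limit (R : realType) (E : R -> R) (g : R) :
  (forall lam, lam < g -> exists2 c, 0 < c & forall t, 0 <= t -> c * expR (lam * t) <= E t) ->
  (forall lam, g < lam -> exists2 C, 0 < C & forall t, 0 <= t -> E t <= C * expR (lam * t)) ->
  ((t^-1)%:E * lne (E t)%:E)%E @[t --> +oo%R] --> g%:E.
Proof.
move=> lower upper.
have g1 : g - 1 < g by lra.
have E0 t : 0 <= t -> 0 < E t.
  move=> t0; have [c c0 /(_ t t0)] := lower (g - 1) g1.
  by apply: lt_le_trans; rewrite mulr_gt0 ?expR_gt0.
suff H : ln (E t) / t @[t --> +oo%R] --> g.
  apply: (@cvg_trans _ ((ln (E t) / t)%:E @[t --> +oo%R])).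
    apply: near_eq_cvg; near=> t.
    have t0 : 0 < t by near: t; exact: nbhs_pinfty_gt.
    by rewrite /lne leNgt (E0 t (ltW t0)) /= -EFinM mulrC.
  by apply/fine_cvgP; split; [exact: nearW|exact: H].
apply/cvgrPdist_le => e e0.
have e2 : 0 < e / 2 by rewrite divr_gt0.
have gm : g - e / 2 < g by lra.
have gp : g < g + e / 2 by lra.
have [c c0 lo] := lower (g - e / 2) gm.
have [C C0 up] := upper (g + e / 2) gp.
near=> t.
have t0 : 0 < t by near: t; exact: nbhs_pinfty_gt.
have tc : `|ln c| <= e / 2 * t.
  rewrite -ler_pdivrMl//; near: t; exact: nbhs_pinfty_ge.
have tC : `|ln C| <= e / 2 * t.
  rewrite -ler_pdivrMl//; near: t; exact: nbhs_pinfty_ge.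
have l1 : ln c + (g - e / 2) * t <= ln (E t).
  rewrite -[X in _ + X]expRK -lnM ?posrE ?expR_gt0//.
  by rewrite ler_ln ?posrE ?mulr_gt0 ?expR_gt0 ?E0 ?(ltW t0)// lo// ltW.
have u1 : ln (E t) <= ln C + (g + e / 2) * t.
  rewrite -[X in _ + X]expRK -lnM ?posrE ?expR_gt0//.
  by rewrite ler_ln ?posrE ?mulr_gt0 ?expR_gt0 ?E0 ?(ltW t0)// up// ltW.
have := ler_norm (- ln c); rewrite normrN => nc; have nC := ler_norm (ln C).
have l2 : g - e <= ln (E t) / t by rewrite ler_pdivlMr//; lra.
have u2 : ln (E t) / t <= g + e by rewrite ler_pdivrMr//; lra.
by rewrite ler_distlC l2.
Unshelve. all: by end_near. Qed.

Section solution.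
Context {R : realType} {d : nat}.
Variables (e : nat -> lattice d) (e' : lattice d -> nat).
Hypotheses (eK : cancel e e') (e'K : cancel e' e).
Variables (a : lattice d -> lattice d -> R) (ha : transition_rates a).
Variables (omega : lattice d -> R) (homega : reference_weight a omega).

Let om i := omega (e i).
Let a' i j := a (e i) (e j).

Lemma enum_weight : [/\ forall j, 0 < om j, nsummable om &
  exists K, forall j, nsum (fun i => om i * a' i j) <= K * om j].
Proof.
have w0 i : 0 <= omega i by exact/ltW/(weight_gt0 homega).
split=> [j||]; first exact: (weight_gt0 homega).
  exact: (enum_nsummable eK e'K w0 (weight_summable homega)).1.
have [K HK] := weight_rates homega; exists K => j.
have f0 i : 0 <= omega i * a i (e j) by rewrite mulr_ge0// (rates_ge0 ha).
have [|_ E] := enum_nsummable eK e'K f0; first exact: le_lt_trans (HK (e j)) (ltry _).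
by rewrite -lee_fin -E; exact: HK.
Qed.

Lemma enum_path (z : R -> lattice d -> R) : continuous_path_in omega z ->
  good_path om (fun s j => z s (e j)) /\ forall s j, 0 <= s -> 0 <= z s (e j).
Proof.
move=> hz; have w0 i : 0 <= omega i by exact/ltW/(weight_gt0 homega).
have z0 s j : 0 <= s -> 0 <= z s j by move=> /hz[[+ _] _]; exact.
have sz s : 0 <= s -> wsummable om (fun j => z s (e j)).
  move=> s0; have [[_ zoo] _] := hz s s0.
  have f0 j : 0 <= z s j * omega j by rewrite mulr_ge0 ?z0.
  have [sf _] := enum_nsummable eK e'K f0 zoo.
  by apply: nsummable_le sf _ => j; rewrite /om ger0_norm ?mulr_ge0// ger0_norm ?z0.
split=> [|s j]; last exact: z0.
split=> // s s0 eps eps0; have [_ cz] := hz s s0.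
have om0 : forall j, 0 < om j by move=> j; exact: (weight_gt0 homega).
have lt0 : (0 < eps%:E)%E by rewrite lte_fin.
have /nbhs_ballP[dl dl0 H] := cz _ (open_ereal_lt' lt0).
exists dl => // s' s'0 ss'; have /= := H s' ss' s'0.
have f0 j : 0 <= `|z s' j - z s j| * omega j by rewrite mulr_ge0.
move=> lte; have [|_ E] := enum_nsummable eK e'K f0; first exact: lt_trans lte (ltry _).
by move: lte; rewrite E lte_fin /wnorm; under eq_nsum do rewrite distrC.
Qed.

Lemma enum_migration f j : wsummable om (fun n => f (e n)) ->
  migration a f (e j) = mig a' (fun n => f (e n)) j.
Proof.
move=> sf; have [om0 som [K omK]] := enum_weight.
have hs := enum_stochastic eK e'K (rates_ge0 ha) (rates_sum1 ha).
have s1 := mig_summable hs om0 som omK j sf.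
have s2 := nsummableZ (f (e j)) (sm_summable hs j).
have E n : a (e j) (e n) * (f (e n) - f (e j)) = a' j n * f (e n) - f (e j) * a' j n.
  by rewrite /a'; ring.
rewrite /migration (enum_lattice_sum eK e'K); last first.
  by rewrite (_ : (fun n => _) = fun n => a' j n * f (e n) - f (e j) * a' j n);
    [exact: nsummableB|apply/funext => n; exact: E].
by rewrite (eq_nsum E) nsumB// nsumZ ?(sm_summable hs)// (sm_sum hs) mulr1.
Qed.

Variables (p : R -> lattice d -> lattice d -> R) (hp : transition_probabilities a p).
Variables (kappa rho : R) (hkappa : 0 < kappa) (hrho : -1 <= rho <= 1).
Context (disp : measure_display) (T : measurableType disp) (P : probability T R).
Variables (u v : R -> lattice d -> T -> R).
Hypothesis huv : sbm_solution P a omega kappa rho u v.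
Hypothesis hinit : {ae P, forall w, forall i, u 0 i w = 1 /\ v 0 i w = 1}.

Let p' t i j := p t (e i) (e j).
Let x (b : bool) s j := if b then u s (e j) else v s (e j).

Lemma solution_second_moments : exists f, [/\ profile om f,
  forall t i, 0 <= t -> f t i = kappa * (1 + rho * spread p' f t i) &
  forall b t i, 0 <= t -> ('E_P[fun w => (x b t i w ^+ 2)%R] = (1 + spread p' f t i)%:E)%E].
Proof.
have [om0 som [K omK]] := enum_weight.
have hs := enum_semigroup eK e'K ha hp.
have [F [W [hF hW aW cW [eqU eqV]]]] := huv.
have ax b j : adapted F (fun s => x b s j) by case: b; have [] := aW (e j).
have mx b s j : 0 <= s -> measurable_fun setT (x b s j).
  by move=> s0; exact: (adapted_measurable hF (ax b j) s0).
have good : {ae P, forall w b, [/\ good_path om (fun s j => x b s j w),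
      forall s j, 0 <= s -> 0 <= x b s j w & forall j, x b 0 j w = 1]}.
  apply: filterS2 cW hinit => w [cu cv] h1 b.
  have [gu u0] := enum_path cu; have [gv v0] := enum_path cv.
  by case: b; split=> // j; have [] := h1 (e j).
have [y hy yx] := regular_version som mx good.
pose r (b b' : bool) := if b == b' then 1 else rho.
have hB b j : brownian_motion P F (W b (e j)) by exact: (noise_brownian hW).
have hr b b' j j' : bracket_rate P F (W b (e j)) (W b' (e j')) (if j == j' then r b b' else 0).
  by have := noise_brackets hW b b' (e j) (e j'); rewrite (inj_eq (can_inj eK)).
have r1 b : r b b = 1 by rewrite /r eqxx.
have r_le1 b b' : `|r b b'| <= 1.
  by rewrite /r; case: eqP => _; rewrite ?normr1// ler_norml.
have eqx b j : exists M, ito_integral P F (fun s => intensity x kappa s j) (W b (e j)) M /\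
    {ae P, forall w t, 0 <= t -> x b t j w = x b 0 j w +
      \int[lebesgue_measure]_(s in `]0, t]) mig a' (fun l => x b s l w) j + M t w}.
  (* Dropping the end point 0 does not change the drift integral, and [migration] becomes [mig]
     because the path is summable at each time. *)
  have mE (z : R -> lattice d -> T -> R) w t : continuous_path_in omega (fun s i => z s i w) ->
      0 <= t -> \int[lebesgue_measure]_(s in `[0, t]) migration a (fun j => z s j w) (e j) =
      \int[lebesgue_measure]_(s in `]0, t]) mig a' (fun l => z s (e l) w) j.
    move=> cz t0; have [gz _] := enum_path cz.
    have gm := mig_path (enum_stochastic eK e'K (rates_ge0 ha) (rates_sum1 ha)) om0 som omK gz.
    have im : Rintegrable lebesgue_measure `]0, t] (fun s => mig a' (fun l => z s (e l) w) j).
      by apply: path_integrable => //; exact: (good_path_site om0 gm).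
    rewrite (Rintegral_itv_obnd_cbnd im); apply: Rintegral_eq => // s; rewrite /= in_itv/= => /andP[s0 _].
    by apply: enum_migration; exact: (gp_summable gz s0).
  case: b.
    have [M [HM EM]] := eqU (e j); exists M; split; first exact: HM.
    by apply: filterS2 EM cW => w EM [cu _] t t0; rewrite /x EM// mE.
  have [M [HM EM]] := eqV (e j); exists M; split.
    (* In the equation of [v] the two factors under the root are exchanged. *)
    rewrite (_ : (fun s => intensity x kappa s j) =
      fun s w => Num.sqrt (kappa * v s (e j) w * u s (e j) w)); first exact: HM.
    by apply/funext => s; apply/funext => w; rewrite /intensity mulrAC.
  by apply: filterS2 EM cW => w EM [_ cv] t t0; rewrite /x EM// mE.
have [M HM] : exists M : bool -> nat -> R -> T -> R, forall b j,
    ito_integral P F (fun s => intensity x kappa s j) (W b (e j)) (M b j) /\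
    {ae P, forall w t, 0 <= t -> x b t j w = x b 0 j w +
      \int[lebesgue_measure]_(s in `]0, t]) mig a' (fun l => x b s l w) j + M b j t w}.
  have [M1 H1] := choice (eqx true); have [M2 H2] := choice (eqx false).
  by exists (fun b => if b then M1 else M2) => -[].
have itoM b j := (HM b j).1; have eqM b j := (HM b j).2.
have SM := @second_moments _ _ _ P _ hF _ _ hs _ _ om0 som omK _ ax _ hy yx _ hkappa
  _ _ hB hr r1 r_le1 _ itoM eqM.
exists (product_moment P y kappa); split.
- split=> [s j s0|t j|t]; first exact: (@product_moment_ge0 _ _ _ P _ _ hy _ hkappa s j s0).
    have [t0|t0] := leP t 0; last first.
      exact: (@product_moment_measurable _ _ _ P _ hF _ _ hs _ _ om0 som omK _ ax _ hy yx _ hkappa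
        _ _ hB hr r1 _ itoM eqM t j t0).
    rewrite set_itv_ge ?bnd_simp -?leNgt//; exact: measurable_fun_set0.
  have t1 : 0 < Num.max t 1 by rewrite lt_max ltr01 orbT.
  have [C HC] := @product_moment_sum _ _ _ P _ hF _ _ hs _ _ om0 som omK _ ax _ hy yx _ hkappa
    _ _ hB hr r1 _ itoM eqM _ t1.
  by exists C => s /andP[s0 st]; apply: HC; rewrite s0 le_max st.
- by move=> t i t0; have [_ _] := SM t i t0.
(* The moments were computed for the regular version [y]; those of [x] agree because the two
   coincide almost surely. *)
- move=> b t i t0; have [sy Ey _] := SM t i t0; rewrite unlock -(Ey b) EFin_Rintegral//; last by case: (sy b).
  apply: ae_eq_integral => //.
  + by apply/measurable_EFinP; apply: measurable_funX; exact: mx.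
  + by apply/measurable_EFinP; apply: measurable_funX; exact: (rf_measurable hy b i t0).
  + by apply: filterS yx => w E _ /=; rewrite E.
Qed.

End solution.

Unset Implicit Arguments.

Theorem theorem2p1 (R : realType) (d : nat) (hd : (0 < d)%N)
    (a : lattice d -> lattice d -> R) (ha : transition_rates a)
    (omega : lattice d -> R) (homega : reference_weight a omega)
    (kappa rho : R) (hkappa : 0 < kappa) (hrho : -1 <= rho <= 1)
    (p : R -> lattice d -> lattice d -> R)
    (hp : transition_probabilities a p)
    (disp : measure_display) (T : measurableType disp) (P : probability T R)
    (u v : R -> lattice d -> T -> R)
    (huv : sbm_solution P a omega kappa rho u v)
    (hinit : {ae P, forall w, forall i, u 0 i w = 1 /\ v 0 i w = 1}) :
  [/\ exists gamma, second_lyapunov_exponent P u v gamma,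
      intermittent P u v <-> ((kappa * rho)%:E > (green p)^-1)%E &
      rho <= 0 -> ~ intermittent P u v].
Proof.
have [e [e' [eK e'K]]] := lattice_enumeration hd.
have [om0 som [K omK]] := enum_weight eK e'K ha homega.
have hs := enum_semigroup eK e'K ha hp.
have rho1 : rho <= 1 by case/andP: hrho.
have [f [hf fE Ef]] :=
  solution_second_moments eK e'K ha homega hp hkappa hrho huv hinit.
have [g [g0 lower upper gpos]] :=
  second_moment_rate hs (enum_transitive eK e'K ha) om0 som omK hkappa rho1 hf fE.
have lyap : second_lyapunov_exponent P u v g.
  have H i : ((t^-1)%:E * lne (1 + spread (fun t i j => p t (e i) (e j)) f t i)%:E)%E
      @[t --> +oo%R] --> g%:E.
    apply: exponential_rate_limit => lam.
      by move=> /lower[c c0 Hc]; exists c => // t t0; exact: Hc.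
    by move=> /upper[C C0 HC]; exists C => // t t0; exact: HC.
  move=> k; rewrite -(e'K k); split; apply: cvg_trans (H (e' k)); apply: near_eq_cvg;
    near=> t; have t0 : 0 <= t by near: t; exact: nbhs_pinfty_ge.
    by rewrite -(Ef true).
  by rewrite -(Ef false).
have green_pos : intermittent P u v <-> ((kappa * rho)%:E > (green p)^-1)%E.
  rewrite (green_laplace eK e'K ha hp) -gpos; split=> [[g' [lyap' g'0]]|gp]; last by exists g.
  (* Limits in the extended reals are unique, so any exponent witnessing intermittency equals the
     constructed rate. *)
  have E : g'%:E = g%:E :> \bar R.
    have [c1 _] := lyap' 0; have [c2 _] := lyap 0.
    exact: (cvg_unique (@ereal_hausdorff R) c1 c2).
  by case: E g'0 => ->.
split=> //; first by exists g.
move=> rho0 /green_pos; rewrite (green_laplace eK e'K ha hp) => -[t t0].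
apply/negP; rewrite -leNgt; apply: (@le_trans _ _ 0) => //.
by rewrite -mulrA pmulr_rle0// mulr_le0_ge0// laplace_ge0.
Unshelve. all: by end_near. Qed.
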